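(* The equivalence group $G^\sim_0$ of the class of equations ${\rm DE}_0(\mathcal L)$ is isomorphic to the equivalence group $G^\sim$ of the class of equations $\mathcal L$: $u_t=Au_{xx}+Bu_x+Cu$. The canonical isomorphism is established by extending each transformation from $G^\sim$, with $\tilde t=T(t)$, $\tilde x=X(t,x)$, $\tilde u=U^1(t,x)u$, to the variable $\eta$ by the formula $$\tilde\eta=\frac{U^1}{X_x}\eta+\frac{U^1_x}{X_x}u.$$
   Context: All considerations are local. The class of equations considered consists of all $\mathcal L$: $u_t-A(t,x)u_{xx}-B(t,x)u_x-C(t,x)u=0$ with analytic arbitrary elements $A,B,C$, $A\ne0$. With each $\mathcal L$ one associates the equation ${\rm DE}_0(\mathcal L)$ for a function $\eta=\eta(t,x,u)$ of three independent variables (the determining equation for reduction operators $\partial_x+\eta\partial_u$ of $\mathcal L$): $$\eta_t=A(\eta_{xx}+2\eta\eta_{xu}+\eta^2\eta_{uu})+A_x(\eta_x+\eta\eta_u)+(B\eta)_x+C(\eta-u\eta_u)+C_xu.$$ The equivalence group of a class of differential equations is the group of point transformations of the independent and dependent variables (together with the induced action on the arbitrary elements $A,B,C$) that can be applied to every equation of the class and map it to an equation of the same class. The equivalence group $G^\sim$ of the class of equations $\mathcal L$ is known to consist of the transformations $\tilde t=T(t)$, $\tilde x=X(t,x)$, $\tilde u=U^1(t,x)u$ with $T_tX_xU^1\neq0$ and $$\tilde A=\frac{X_x^2}{T_t}A,\quad \tilde B=\frac{X_x}{T_t}\Bigl(B-2\frac{U^1_x}{U^1}A\Bigr)-\frac{X_t-AX_{xx}}{T_t},\quad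 \tilde C=-\frac{U^1}{T_t}L\frac1{U^1},\qquad L=\partial_t-A\partial_{xx}-B\partial_x-C.$$ *)

(* Defs.v *)
From HB Require Import structures.
From mathcomp Require Import all_boot all_order all_algebra.
From mathcomp Require Import all_classical all_reals all_analysis.

Set Implicit Arguments.
Unset Strict Implicit.
Unset Printing Implicit Defensive.

Import Order.TTheory GRing.Theory Num.Theory.
Import numFieldNormedType.Exports.

Local Open Scope classical_set_scope.
Local Open Scope ring_scope.

Section Analytic.
Variables (R : realType) (n : nat).
Implicit Types (f : 'rV[R]_n -> R) (a h : 'rV[R]_n) (c : {ffun 'I_n -> nat} -> R).

(* The sum of the terms of total degree k of the power series with
   coefficients c, each term being passed through g (id or the norm). *)
Definition graded_part (g : R -> R) c h (k : nat) : R :=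
  \sum_(m : {ffun 'I_n -> 'I_k.+1} | (\sum_i m i == k)%N)
    g (c [ffun i => nat_of_ord (m i)] * \prod_i h 0 i ^+ m i).

(* Real-analyticity: f is, on a neighbourhood of a, the sum of an absolutely
   convergent power series in the n variables. *)
Definition analytic_at f a : Prop :=
  exists c, exists2 r : R, 0 < r &
    forall h, `|h| < r ->
      cvgn (series (graded_part Num.norm c h)) /\
      series (graded_part id c h) @ \oo --> f (a + h).

Definition pd (i : 'I_n) f : 'rV[R]_n -> R :=
  fun z => 'D_(delta_mx 0 i) f z.

End Analytic.

Definition analytic_map_at (R : realType) (m n : nat)
    (F : 'rV[R]_m -> 'rV[R]_n) (a : 'rV[R]_m) : Prop :=
  forall j : 'I_n, analytic_at (fun p => F p 0 j) a.

(* A point of 'rV_(n + 1) consists of n independent variables, followed by the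
   value of the dependent variable. *)
Section Coordinates.
Variables (R : realType) (n : nat).

Definition pt (z : 'rV[R]_n) (y : R) : 'rV[R]_(n + 1) := row_mx z y%:M.
Definition base (p : 'rV[R]_(n + 1)) : 'rV[R]_n := lsubmx p.
Definition fib (p : 'rV[R]_(n + 1)) : R := (rsubmx p : 'rV[R]_1) 0 0.

End Coordinates.

Section PointTransformations.
Variable R : realType.

(* All considerations being local, a transformation is partially defined, and
   comes with its inverse.  The values of fwd outside dom and of bwd outside
   cod are irrelevant. *)
Record ptrans (m : nat) := PTrans {
  dom : set 'rV[R]_m;
  cod : set 'rV[R]_m;
  fwd : 'rV[R]_m -> 'rV[R]_m;
  bwd : 'rV[R]_m -> 'rV[R]_m }.

Definition point_transformation m (F : ptrans m) : Prop :=
  [/\ open (dom F) /\ open (cod F),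
      forall p, dom F p -> cod F (fwd F p) /\ bwd F (fwd F p) = p,
      forall p, cod F p -> dom F (bwd F p) /\ fwd F (bwd F p) = p,
      forall p, dom F p -> analytic_map_at (fwd F) p
    & forall p, cod F p -> analytic_map_at (bwd F) p].

Definition pt_id m (D : set 'rV[R]_m) : ptrans m := PTrans D D id id.

Definition pt_inv m (F : ptrans m) : ptrans m :=
  PTrans (cod F) (dom F) (bwd F) (fwd F).

Definition pt_comp m (F2 F1 : ptrans m) : ptrans m :=
  PTrans (dom F1 `&` fwd F1 @^-1` dom F2) (cod F2 `&` bwd F2 @^-1` cod F1)
         (fwd F2 \o fwd F1) (bwd F1 \o bwd F2).

Definition pt_eq m (F1 F2 : ptrans m) : Prop :=
  dom F1 = dom F2 /\ forall p, dom F1 p -> fwd F1 p = fwd F2 p.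

Definition germ_eq m (p : 'rV[R]_m) (F1 F2 : ptrans m) : Prop :=
  [/\ dom F1 p, dom F2 p & \forall q \near p, fwd F1 q = fwd F2 q].

(* The local counterpart of a group of transformations.  The last clause
   covers both restrictions to open subsets and gluings. *)
Definition pseudogroup m (G : set (ptrans m)) : Prop :=
  [/\ G `<=` @point_transformation m,
      forall D, open D -> G (pt_id D),
      forall F1 F2, G F1 -> G F2 -> G (pt_comp F2 F1),
      forall F, G F -> G (pt_inv F)
    & forall F, point_transformation F ->
        (forall p, dom F p -> exists2 F', G F' & germ_eq p F F') -> G F].

(* A relation [ext] that extends each transformation of the variables p,
   belonging to the pseudogroup G, to one additional variable, and that induces
   an isomorphism of G onto G0:
   - ext F is defined for each F in G, and is unique;
   - ext F covers F, and its domain is the cylinder over the domain of F;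
   - for each q, the germ of F at base q |-> the germ of ext F at q is well
     defined, injective, and onto the germs at q of the elements of G0;
   - ext preserves identities, compositions and inverses. *)
Definition isomorphism_by_extension m
    (G : set (ptrans m)) (G0 : set (ptrans (m + 1)))
    (ext : ptrans m -> ptrans (m + 1) -> Prop) : Prop :=
  [/\ [/\ forall F, G F -> exists2 F0, G0 F0 & ext F F0,
          forall F F0 F0', G F -> G0 F0 -> G0 F0' ->
            ext F F0 -> ext F F0' -> pt_eq F0 F0'
        & forall F F0, G F -> G0 F0 -> ext F F0 ->
            dom F0 = @base R m @^-1` dom F /\
            forall q, dom F0 q -> base (fwd F0 q) = fwd F (base q)],
      [/\ forall F F' F0 F0', G F -> G F' -> G0 F0 -> G0 F0' ->
            ext F F0 -> ext F' F0' ->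
            forall q, germ_eq (base q) F F' <-> germ_eq q F0 F0'
        & forall F0 q, G0 F0 -> dom F0 q ->
            exists F F0', [/\ G F, G0 F0', ext F F0' & germ_eq q F0 F0']]
    & [/\ forall D, open D -> ext (pt_id D) (pt_id (@base R m @^-1` D)),
          forall F1 F2 F01 F02, G F1 -> G F2 -> G0 F01 -> G0 F02 ->
            ext F1 F01 -> ext F2 F02 -> ext (pt_comp F2 F1) (pt_comp F02 F01)
        & forall F F0, G F -> G0 F0 -> ext F F0 -> ext (pt_inv F) (pt_inv F0)]].

End PointTransformations.

Section EquivalenceGroup.
Variable R : realType.

(* The arbitrary elements, as functions of (t, x). *)
Record coeffs := Coeffs {
  cA : 'rV[R]_2 -> R;
  cB : 'rV[R]_2 -> R;
  cC : 'rV[R]_2 -> R }.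

Definition admissible (th : coeffs) (z : 'rV[R]_2) : Prop :=
  [/\ analytic_at (cA th) z, analytic_at (cB th) z, analytic_at (cC th) z
    & cA th z != 0].

(* A scalar differential equation: [E f z] means that f satisfies it at z. *)
Definition diff_eq n := ('rV[R]_n -> R) -> 'rV[R]_n -> Prop.

(* F maps the equation E to the equation E' over the point p: the change of
   variables F, prolonged to the derivatives, identifies the jets over p
   satisfying E with the jets over F p satisfying E'.  The jets are represented
   by functions f and g whose graphs correspond to each other under F; f and g
   need not be solutions elsewhere than at the point considered. *)
Definition maps_equation n (F : ptrans R (n + 1)) (E E' : diff_eq n)
    (p : 'rV[R]_(n + 1)) : Prop :=
  forall f g : 'rV[R]_n -> R,
    analytic_at f (base p) -> analytic_at g (base (fwd F p)) ->
    f (base p) = fib p ->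
    (\forall z \near base p,
       let q := fwd F (pt z (f z)) in fib q = g (base q)) ->
    (E f (base p) <-> E' g (base (fwd F p))).

(* The equivalence group of the class of equations E th, where th runs through
   the admissible arbitrary elements, and tx extracts (t, x) from the
   independent variables: the point transformations that (locally) map each
   equation of the class to some equation of the same class. *)
Definition equivalence_group n (tx : 'rV[R]_n -> 'rV[R]_2)
    (E : coeffs -> diff_eq n) : set (ptrans R (n + 1)) :=
  [set F | point_transformation F /\
    forall p th, dom F p -> admissible th (tx (base p)) ->
      exists2 th', admissible th' (tx (base (fwd F p))) &
        \forall q \near p, maps_equation F (E th) (E th') q].

Definition it : 'I_2 := ord0.
Definition ix : 'I_2 := ord_max.

Definition eqL (th : coeffs) : diff_eq 2 := fun u z =>
  pd it u z = cA th z * pd ix (pd ix u) z + cB th z * pd ix u z + cC th z * u z.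

Definition jt : 'I_(2 + 1) := lshift 1 it.
Definition jx : 'I_(2 + 1) := lshift 1 ix.
Definition ju : 'I_(2 + 1) := rshift 2 ord0.

(* The unknown function eta depends on w = (t, x, u). *)
Definition eqDE0 (th : coeffs) : diff_eq (2 + 1) := fun eta w =>
  let z := base w in
  let u := fib w in
  pd jt eta w =
    cA th z * (pd jx (pd jx eta) w + 2 * eta w * pd jx (pd ju eta) w
               + eta w ^+ 2 * pd ju (pd ju eta) w)
  + pd ix (cA th) z * (pd jx eta w + eta w * pd ju eta w)
  + pd jx (fun w' => cB th (base w') * eta w') w
  + cC th z * (eta w - u * pd ju eta w)
  + pd ix (cC th) z * u.

Definition Gequiv : set (ptrans R (2 + 1)) := equivalence_group id eqL.

Definition Gequiv0 : set (ptrans R (2 + 1 + 1)) :=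
  equivalence_group (@base R 2) eqDE0.

Definition point2 (a b : R) : 'rV[R]_2 := \row_(i < 2) (if i == it then a else b).

(* F0 is the extension to eta of F : t~ = T(t), x~ = X(t,x), u~ = U(t,x) u,
   given by eta~ = (U / X_x) eta + (U_x / X_x) u.  The functions T, X and U are
   only required to exist locally. *)
Definition canonical_extension (F : ptrans R (2 + 1)) (F0 : ptrans R (2 + 1 + 1))
    : Prop :=
  dom F0 = @base R (2 + 1) @^-1` dom F /\
  forall p, dom F p ->
    exists (T : R -> R) (X U : 'rV[R]_2 -> R),
      [/\ analytic_at (fun z : 'rV[R]_2 => T (z 0 it)) (base p),
          analytic_at X (base p), analytic_at U (base p)
        & \forall q \near p,
            let z : 'rV[R]_2 := base q in
            let u := fib q in
            [/\ derive1 T (z 0 it) * pd ix X z * U z != 0,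
                fwd F q = pt (point2 (T (z 0 it)) (X z)) (U z * u)
              & forall eta, fwd F0 (pt q eta) =
                  pt (fwd F q)
                     (U z / pd ix X z * eta + pd ix U z / pd ix X z * u)]].

(* The extended transformation acts on the arbitrary elements (A, B, C) in the
   same way as the initial one. *)
Definition same_induced_action (F : ptrans R (2 + 1)) (F0 : ptrans R (2 + 1 + 1))
    : Prop :=
  forall (q : 'rV[R]_(2 + 1 + 1)) (th th' : coeffs),
    dom F0 q -> admissible th (base (base q)) ->
    admissible th' (base (base (fwd F0 q))) ->
    (\forall p \near base q, maps_equation F (eqL th) (eqL th') p) <->
    (\forall q' \near q, maps_equation F0 (eqDE0 th) (eqDE0 th') q').

End EquivalenceGroup.

(* Main.v *)
(* A transformation F that maps equations of the class to equations of the class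
   acts on 2-jets of functions that satisfy them at one point only.  Both L and
   DE_0 are of evolution type, with a single characteristic direction in their
   principal symbol: d_x for L, d_x + eta d_u for DE_0.  Since F preserves it,
   the time is transformed by t~ = T(t), the last variable does not occur in the
   other components, and, for DE_0, eta~ = (V_x + eta V_u) / X_x where u~ = V.
   In the case of DE_0, (X_x + eta X_u)^2 = A~ T_t implies X_u = 0.  The lower order
   terms, compared for the equations u_t = u_xx + c u with c = 0 and c = 1 only,
   yield V = U(t, x) u.

   Conversely, put zeta = A (eta_x + eta eta_u) + B eta + C u.  The equation DE_0
   means that the vector fields d_x + eta d_u and d_t + zeta d_u commute, a
   condition transported by any transformation of the above form when (A, B, C)
   are changed by the formulas that are valid for L.  Locally, the elements of both
   pseudogroups are thus the triples (T, X, U), with the same composition and the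
   same action on the arbitrary elements. *)
Require Import Defs.
From HB Require Import structures.
From mathcomp Require Import all_boot all_order all_algebra.
From mathcomp Require Import all_classical all_reals all_analysis.
From mathcomp Require Import ring lra.

Set Implicit Arguments.
Unset Strict Implicit.
Unset Printing Implicit Defensive.

Import Order.TTheory GRing.Theory Num.Theory.
Import numFieldNormedType.Exports.

Local Open Scope classical_set_scope.
Local Open Scope ring_scope.

(** * Power series and majorants *)

(** Analyticity means convergent power series, so the tools are built on series: [maj r f M] bounds
    a weighted l1 norm for which the functions on a polydisc form a Banach algebra; composition,
    inverses and implicit functions are obtained there. Implicit functions enter because
    [maps_equation] speaks of pairs of functions with corresponding graphs: to use it on a jet of f,
    the image of the graph of f must be the graph of an analytic g. At the start this image may fail
    to be transversal to the fibers, so gradients of f are chosen outside an exceptional set; the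
    relations obtained are affine or quadratic in a free slope, and a few admissible slopes suffice.
    The images of the two heat equations are unknown. Comparing the two relations eliminates what c
    does not affect and leaves u V_u = kappa V with kappa constant along the u-axis; V being affine
    there, two points give kappa = 1. Conversely, to read the coefficients off an equation, points
    with u nonzero are used, as C u vanishes at u = 0, and for DE_0 the function A is identified on
    a neighborhood before B, as eta_x has coefficient A_x + B. *)

Section MultiIndices.
Variable n : nat.
Local Notation mi := {ffun 'I_n -> nat}.
Implicit Types (m : mi) (i : 'I_n).

Definition mdeg m : nat := (\sum_i m i)%N.

Definition layer (k : nat) : seq mi :=
  [seq ([ffun i => nat_of_ord (d i)] : mi) | d : {ffun 'I_n -> 'I_k.+1} <-
    enum [pred d : {ffun 'I_n -> 'I_k.+1} | (\sum_i d i == k)%N]].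

Lemma mem_layer k m : (m \in layer k) = (mdeg m == k).
Proof.
apply/mapP/eqP => [[d]|<-].
  by rewrite mem_enum => /eqP km ->; rewrite -[RHS]km; apply: eq_bigr => i _; rewrite ffunE.
have le_deg j : (m j < (mdeg m).+1)%N by rewrite ltnS /mdeg (bigD1 j)//= leq_addr.
exists ([ffun i => Ordinal (le_deg i)] : {ffun 'I_n -> 'I_(mdeg m).+1}).
  by rewrite mem_enum; apply/eqP; apply: eq_bigr => i _; rewrite ffunE.
by apply/ffunP => i; rewrite !ffunE.
Qed.

Lemma layer_uniq k : uniq (layer k).
Proof.
rewrite /layer map_inj_uniq ?enum_uniq// => m1 m2 /ffunP e.
by apply/ffunP => i; apply: val_inj; have := e i; rewrite !ffunE.
Qed.

(** Multi-indices of degree less than N, listed degree by degree: sums over [box n N] are then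
    exactly the partial sums by total degree that [analytic_at] uses. *)
Fixpoint box (N : nat) : seq mi := if N is k.+1 then box k ++ layer k else [::].

Lemma mem_box N m : (m \in box N) = (mdeg m < N)%N.
Proof.
elim: N => //= N IH; rewrite mem_cat IH mem_layer ltnS [RHS]leq_eqVlt.
by rewrite orbC.
Qed.

Lemma box_uniq N : uniq (box N).
Proof.
elim: N => //= N IH; rewrite cat_uniq IH layer_uniq andbT /=.
apply/hasPn => m; rewrite mem_layer mem_box => /eqP ->.
by rewrite ltnn.
Qed.

Definition minc i m : mi := [ffun j => m j + (j == i)]%N.
(** The subtraction is truncated: [mdec i m] is m itself when m i = 0, whence the case distinctions
    on m i below. *)
Definition mdec i m : mi := [ffun j => m j - (j == i)]%N.

Lemma mincK i : cancel (minc i) (mdec i).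
Proof. by move=> m; apply/ffunP => j; rewrite !ffunE addnK. Qed.

Lemma mdecK i m : m i != 0%N -> minc i (mdec i m) = m.
Proof.
move=> mi0; apply/ffunP => j; rewrite !ffunE.
by case: eqP => [->|]; rewrite /= ?subn0 ?addn0// subnK// lt0n.
Qed.

Lemma mdeg_inc i m : mdeg (minc i m) = (mdeg m).+1.
Proof.
rewrite /mdeg; under eq_bigr do rewrite ffunE.
rewrite big_split/= [X in (_ + X)%N](bigD1 i)//= eqxx.
by rewrite [X in (_ + (_ + X))%N]big1 ?addn1// => j /negbTE ->.
Qed.

End MultiIndices.

Section Monomials.
Variables (R : realType) (n : nat).
Local Notation mi := {ffun 'I_n -> nat}.
Implicit Types (h : 'rV[R]_n) (c : mi -> R).

Definition mono h (m : mi) : R := \prod_i h 0 i ^+ m i.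

Lemma graded_part_layer (g : R -> R) c h k :
  graded_part g c h k = \sum_(m <- layer n k) g (c m * mono h m).
Proof.
rewrite /graded_part /layer big_map [RHS]big_enum_cond /=.
apply: eq_big => [d|d _]; first by rewrite inE andbT.
by congr (g (_ * _)); apply: eq_bigr => i _; rewrite ffunE.
Qed.

Lemma series_graded_part (g : R -> R) c h N :
  series (graded_part g c h) N = \sum_(m <- box n N) g (c m * mono h m).
Proof.
rewrite /series/=; elim: N => [|N IH]; first by rewrite big_geq ?big_nil.
by rewrite big_nat_recr//= IH big_cat/= graded_part_layer.
Qed.

Lemma mono_inc h i m : mono h (minc i m) = h 0 i * mono h m.
Proof.
rewrite /mono (bigD1 i)//= [in RHS](bigD1 i)//= ffunE eqxx addn1 exprS mulrA.
congr (_ * _); apply: eq_bigr => j /negbTE ji.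
by rewrite ffunE ji addn0.
Qed.

Lemma le_coord_norm h i : `|h 0 i| <= `|h|.
Proof.
rewrite [leRHS]/Num.norm /= mx_normrE; apply/bigmax_geP; right => /=.
by exists (0, i).
Qed.

Lemma norm_rV_le h (r : R) : 0 <= r -> (forall i, `|h 0 i| <= r) -> `|h| <= r.
Proof.
move=> r0 hr; rewrite [leLHS]/Num.norm /= mx_normrE; apply/bigmax_leP.
by split=> // -[j i] _ /=; rewrite ord1.
Qed.

Lemma mono_le h (r : R) m : `|h| <= r -> `|mono h m| <= r ^+ mdeg m.
Proof.
move=> hr; rewrite /mono normr_prod /mdeg expr_sum.
apply: ler_prod => i _; rewrite normr_ge0/= normrX.
by apply: lerXn2r; rewrite ?nnegrE// ?(le_trans _ hr)// le_coord_norm.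
Qed.

End Monomials.

(** * Weighted l1 norms of power series *)

Section Majorants.
Variable R : realType.

(** A bound M for the sum of |c_m| r^|m|, uniform in the partial sums. The expansion holds on the
    closed polydisc, the norm being the maximum of the coordinates, so that functions of norm at
    most r can be substituted for the variables, boundary included. *)
Definition maj n (r : R) (f : 'rV[R]_n -> R) (M : R) : Prop :=
  exists c : {ffun 'I_n -> nat} -> R,
    (forall N, \sum_(m <- box n N) `|c m| * r ^+ mdeg m <= M) /\
    (forall h, `|h| <= r ->
       (fun N => \sum_(m <- box n N) c m * mono h m) @ \oo --> f h).

Section Fixed.
Variable n : nat.
Implicit Types (f g : 'rV[R]_n -> R) (h : 'rV[R]_n) (r M : R).

Lemma maj_ge0 r f M : maj r f M -> 0 <= M.
Proof. by case=> c [/(_ 0%N)]; rewrite /= big_nil. Qed.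

Lemma maj_ext r f g M : (forall h, `|h| <= r -> f h = g h) ->
  maj r f M -> maj r g M.
Proof. by move=> fg [c [? cf]]; exists c; split=> // h hr; rewrite -fg//; exact: cf. Qed.

Lemma maj_le r f M M' : M <= M' -> maj r f M -> maj r f M'.
Proof. by move=> MM' [c [cM cf]]; exists c; split=> // N; exact: le_trans MM'. Qed.

Lemma maj_bound r f M h : `|h| <= r -> maj r f M -> `|f h| <= M.
Proof.
move=> hr [c [cM /(_ _ hr) cf]].
apply: (cvgr_to_le (cvg_norm cf)); apply: nearW => N.
apply: le_trans (ler_norm_sum _ _ _) _; apply: le_trans (cM N).
by apply: ler_sum => m _; rewrite normrM ler_wpM2l// mono_le.
Qed.

Lemma maj_scale r f M a : maj r f M -> maj r (fun h => a * f h) (`|a| * M).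
Proof.
move=> [c [cM cf]]; exists (fun m => a * c m); split=> [N|h hr].
  under eq_bigr do rewrite normrM -mulrA.
  by rewrite -mulr_sumr ler_wpM2l.
under eq_fun do under eq_bigr do rewrite -mulrA.
under eq_fun do rewrite -mulr_sumr.
by apply: cvgM; [exact: cvg_cst|exact: cf].
Qed.

Lemma maj_add r f g M M' : maj r f M -> maj r g M' ->
  maj r (fun h => f h + g h) (M + M').
Proof.
move=> [c [cM cf]] [d [dM df]] .
have [r0|r0] := leP 0 r; last first.
  (* For r < 0 the polydisc is empty, so the series of f alone serves; the triangle inequality would
     fail with negative weights. *)
  exists c; split=> [N|h hr]; last first.
    by have := le_lt_trans hr r0; rewrite normr_lt0.
  by rewrite (le_trans (cM N))// lerDl (le_trans _ (dM 0%N))//= big_nil.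
exists (fun m => c m + d m); split=> [N|h hr].
  apply: le_trans (lerD (cM N) (dM N)); rewrite -big_split/=.
  by apply: ler_sum => m _; rewrite -mulrDl ler_wpM2r ?exprn_ge0// ler_normD.
under eq_fun do under eq_bigr do rewrite mulrDl.
under eq_fun do rewrite big_split/=.
by apply: cvgD; [exact: cf|exact: df].
Qed.

Lemma maj0 r : @maj n r (fun=> 0) 0.
Proof.
exists (fun=> 0); split=> [N|h hr].
  by rewrite big1// => m _; rewrite normr0 mul0r.
under eq_fun do under eq_bigr do rewrite mul0r.
under eq_fun do rewrite big1//; exact: cvg_cst.
Qed.

Lemma maj_sum (I : Type) (s : seq I) (f : I -> 'rV[R]_n -> R) (M : I -> R) r :
  (forall i, maj r (f i) (M i)) ->
  maj r (fun h => \sum_(i <- s) f i h) (\sum_(i <- s) M i).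
Proof.
move=> fM; elim: s => [|i s IH].
  by under eq_fun do rewrite big_nil; rewrite big_nil; exact: maj0.
by under eq_fun do rewrite big_cons; rewrite big_cons; exact: maj_add.
Qed.

Lemma maj1 r : @maj n r (fun=> 1) 1.
Proof.
pose z : {ffun 'I_n -> nat} := [ffun=> 0%N].
have zdeg : mdeg z = 0%N by rewrite /mdeg big1// => i _; rewrite ffunE.
have mz h : mono h z = 1 by rewrite /mono big1// => i _; rewrite ffunE.
have sum1 (u : {ffun 'I_n -> nat} -> R) N :
    \sum_(m <- box n N) (m == z)%:R * u m = (0 < N)%:R * u z.
  case: (ltnP 0 N) => N0; last by
    move: N0; rewrite leqn0 => /eqP ->; rewrite big_nil mul0r.
  rewrite (bigD1_seq z) ?mem_box ?zdeg ?box_uniq//= eqxx big1 ?addr0//.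
  by move=> m /negbTE ->; rewrite mul0r.
exists (fun m => (m == z)%:R); split=> [N|h hr].
  under eq_bigr do rewrite normr_nat.
  by rewrite sum1 zdeg mulr1; case: (0 < N)%N.
rewrite -[X in _ --> X](_ : 1%:R * mono h z = 1); last by rewrite mz mulr1.
under eq_fun do rewrite sum1; apply: cvgM; last exact: cvg_cst.
apply/cvgrPdist_lt => e e0; near=> N.
rewrite (_ : (0 < N)%N = true) ?subrr ?normr0//.
by near: N; exists 1%N.
Unshelve. all: by end_near. Qed.

Lemma maj_cst r a : @maj n r (fun=> a) `|a|.
Proof.
rewrite -[X in maj _ _ X]mulr1; apply: maj_ext (maj_scale a (maj1 r)) => h _.
by rewrite mulr1.
Qed.

(** The map [mdec i] is a bijection from the m in [box n N.+1] with m i nonzero onto [box n N];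
    multiplying a series by h_i reindexes its coefficients in this way. *)
Lemma sum_box_shift i (u : {ffun 'I_n -> nat} -> R) N :
  \sum_(m <- box n N.+1) (if m i == 0%N then 0 else u (mdec i m)) =
  \sum_(m <- box n N) u m.
Proof.
transitivity (\sum_(m <- box n N.+1 | m i != 0%N) u (mdec i m)).
  by rewrite [RHS]big_mkcond; apply: eq_bigr => m _; case: (m i == _).
rewrite -big_filter -(big_map (mdec i) xpredT u); apply: perm_big.
apply: uniq_perm; rewrite ?box_uniq//.
  rewrite map_inj_in_uniq ?filter_uniq ?box_uniq// => m m'.
  rewrite !mem_filter => /andP[mi0 _] /andP[mi0' _] e.
  by rewrite -(mdecK mi0) -(mdecK mi0') e.
move=> m; rewrite mem_box; apply/mapP/idP => [[d]|mN].
  rewrite mem_filter mem_box => /andP[di0 dN] ->.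
  by rewrite -ltnS -(mdeg_inc i) mdecK.
exists (minc i m); last by rewrite mincK.
by rewrite mem_filter mem_box mdeg_inc ltnS mN !ffunE eqxx addn1.
Qed.

Lemma maj_coord r f M i : 0 <= r -> maj r f M ->
  maj r (fun h => h 0 i * f h) (r * M).
Proof.
move=> r0 [c [cM cf]].
exists (fun m : {ffun 'I_n -> nat} => if m i == 0%N then 0 else c (mdec i m)); split=> [N|h hr].
  case: N => [|N]; first by rewrite /= big_nil mulr_ge0// (maj_ge0 (ex_intro _ _ (conj cM cf))).
  have -> : \sum_(m <- box n N.+1) `|if m i == 0%N then 0 else c (mdec i m)| *
     r ^+ mdeg m = \sum_(m <- box n N) r * (`|c m| * r ^+ mdeg m).
    rewrite -[RHS](sum_box_shift i); apply: eq_bigr => m _.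
    case: eqP => [_|/eqP mi0]; first by rewrite normr0 mul0r.
    by rewrite -{2}(mdecK mi0) mdeg_inc exprS mulrCA.
  by rewrite -mulr_sumr ler_wpM2l.
rewrite -cvg_shiftS.
rewrite (_ : [sequence \sum_(m <- box n N.+1) _]_N = fun N => h 0 i * \sum_(m <- box n N) c m * mono h m).
  by apply: cvgM; [exact: cvg_cst|exact: cf].
apply/funext => N; rewrite mulr_sumr -[RHS](sum_box_shift i); apply: eq_bigr => m _.
case: eqP => [_|/eqP mi0]; first by rewrite mul0r.
by rewrite -{2}(mdecK mi0) mono_inc mulrCA.
Qed.

End Fixed.
End Majorants.

Section MajorantSeries.
Variable R : realType.

Lemma cvg_sum_seq (I : Type) (s : seq I) (u : I -> R^nat) (l : I -> R) :
  (forall i, u i @ \oo --> l i) ->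
  (fun N => \sum_(i <- s) u i N) @ \oo --> \sum_(i <- s) l i.
Proof.
move=> ul; elim: s => [|i s IH].
  under eq_fun do rewrite big_nil; rewrite big_nil; exact: cvg_cst.
by under eq_fun do rewrite big_cons; rewrite big_cons; apply: cvgD; [exact: ul|].
Qed.

Lemma dominated_series_tail (u v : R^nat) (L l : R) :
  (forall j, `|u j| <= v j) -> series v @ \oo --> L ->
  series u @ \oo --> l -> forall J, `|l - series u J| <= L - series v J.
Proof.
move=> uv vL ul J.
have vJ N : `|series u (N + J)%N - series u J| <= series v (N + J)%N - series v J.
  rewrite !sub_series_geq ?leq_addl//.
  by apply: le_trans (ler_norm_sum _ _ _) _; apply: ler_sum => j _; exact: uv.
have cl : (fun N => `|series u (N + J)%N - series u J|) @ \oo --> `|l - series u J|.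
  by apply: cvg_norm; apply: cvgB; [rewrite cvg_shiftn|exact: cvg_cst].
apply: (ler_cvg_to cl); last by apply: nearW => N; exact: vJ.
by apply: cvgB; [rewrite cvg_shiftn|exact: cvg_cst].
Qed.

Lemma nonneg_series_bounded (v : R^nat) (M : R) :
  (forall j, 0 <= v j) -> (forall J, series v J <= M) ->
  exists2 L, L <= M & series v @ \oo --> L.
Proof.
move=> v0 vM; have cv : cvgn (series v).
  apply: nondecreasing_is_cvgn.
    by apply: nondecreasing_series => j _ _; exact: v0.
  by exists M => _ [J _ <-].
exists (limn (series v)) => //.
by apply: limr_le => //; exact: nearW.
Qed.

(** Completeness of the weighted l1 norm. The series is summed coefficient by coefficient; its tails
    are controlled, uniformly in the box of multi-indices, by the tail of the dominating series v.
    The sums over j and over m are then exchanged by splitting the error into three parts. *)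
Lemma maj_series n (r : R) (f : nat -> 'rV[R]_n -> R) (v : R^nat) (M : R) :
  0 < r -> (forall j, maj r (f j) (v j)) -> (forall J, series v J <= M) ->
  exists F, maj r F M /\
    forall h, `|h| <= r -> series (fun j => f j h) @ \oo --> F h.
Proof.
move=> r0 fv vM.
have v0 j : 0 <= v j by exact: maj_ge0 (fv j).
have [L LM cL] := nonneg_series_bounded v0 vM.
have cvl (u : R^nat) : (forall j, `|u j| <= v j) -> cvgn (series u).
  move=> uv; apply: normed_cvg; apply: (@series_le_cvg _ _ v) => [j|//|//|].
    exact: normr_ge0.
  by apply/cvg_ex; exists L.
have [c Hc] := choice fv.
have cb j m : `|c j m| * r ^+ mdeg m <= v j.
  apply: le_trans ((Hc j).1 (mdeg m).+1).
  rewrite (bigD1_seq m) ?mem_box ?box_uniq//= lerDl.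
  by apply: sumr_ge0 => k _; rewrite mulr_ge0// exprn_ge0// ltW.
have cC m : cvgn (series (fun j => c j m)).
  pose w := fun j => v j / r ^+ mdeg m.
  apply: normed_cvg; apply: (@series_le_cvg _ _ w) => [j|j|j|].
  - exact: normr_ge0.
  - by rewrite divr_ge0// exprn_ge0// ltW.
  - by rewrite ler_pdivlMr ?exprn_gt0//; exact: cb.
  - rewrite (_ : w = r ^- mdeg m *: v); last first.
      by apply/funext => j; rewrite /w mulrC.
    by apply: is_cvg_seriesZ; apply/cvg_ex; exists L.
pose C m := limn (series (fun j => c j m)).
have tail N J : \sum_(m <- box n N) `|C m - series (fun j => c j m) J| * r ^+ mdeg m
    <= L - series v J.
  pose u J' := \sum_(m <- box n N)
    `|series (fun j => c j m) (J' + J)%N - series (fun j => c j m) J| * r ^+ mdeg m.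
  have cu : u @ \oo --> \sum_(m <- box n N)
      `|C m - series (fun j => c j m) J| * r ^+ mdeg m.
    apply: cvg_sum_seq => m; apply: cvgM; last exact: cvg_cst.
    apply: cvg_norm; apply: cvgB; last exact: cvg_cst.
    by rewrite cvg_shiftn; exact: cC.
  apply: (cvgr_to_le cu); apply: nearW => J'.
  apply: (@le_trans _ _ (series v (J' + J)%N - series v J)); last first.
    rewrite lerB//; apply: (cvgr_to_ge cL); near=> K.
    apply: nondecreasing_series => //; near: K; exact: nbhs_infty_ge.
  rewrite sub_series_geq ?leq_addl// /u.
  apply: (@le_trans _ _ (\sum_(m <- box n N) \sum_(J <= j < J' + J)
      (`|c j m| * r ^+ mdeg m))).
    apply: ler_sum => m _; rewrite -mulr_suml ler_wpM2r ?exprn_ge0 ?(ltW r0)//.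
    by rewrite sub_series_geq ?leq_addl//; exact: ler_norm_sum.
  by rewrite exchange_big/=; apply: ler_sum => j _; exact: (Hc j).1.
pose F h := limn (series (fun j => f j h)).
have cF h : `|h| <= r -> series (fun j => f j h) @ \oo --> F h.
  by move=> hr; apply: cvl => j; exact: maj_bound (fv j).
exists F; split=> //; exists C; split=> [N|h hr].
  apply: le_trans LM; have := tail N 0%N; rewrite [in X in _ - X]/series/= big_geq// subr0.
  apply: le_trans; apply: ler_sum => m _.
  by rewrite /series/= big_geq// subr0.
apply/cvgrPdist_le => e e0.
have e30 : 0 < e / 3 by rewrite divr_gt0.
have /cvgrPdist_le/(_ _ e30)[J _ /(_ J (leqnn J))/= LJ] := cL.
have {}LJ : L - series v J <= e / 3 by rewrite (le_trans _ LJ)// ler_norm.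
have cJ : (fun N => \sum_(m <- box n N) series (fun j => c j m) J * mono h m) @ \oo -->
    series (fun j => f j h) J.
  rewrite (_ : (fun N => _) = fun N =>
      \sum_(0 <= j < J) \sum_(m <- box n N) c j m * mono h m); last first.
    apply/funext => N; rewrite exchange_big/=; apply: eq_bigr => m _.
    by rewrite mulr_suml.
  by apply: cvg_sum_seq => j; exact: (Hc j).2.
have /cvgrPdist_le/(_ _ e30) := cJ; apply: filterS => N hN.
have FJ : `|F h - series (fun j => f j h) J| <= e / 3.
  apply: le_trans LJ; apply: (dominated_series_tail _ cL (cF _ hr)) => j.
  exact: maj_bound (fv j).
have CJ : `|\sum_(m <- box n N) series (fun j => c j m) J * mono h m -
     \sum_(m <- box n N) C m * mono h m| <= e / 3.
  apply: le_trans LJ; apply: le_trans (tail N J); rewrite -sumrB.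
  apply: le_trans (ler_norm_sum _ _ _) _; apply: ler_sum => m _.
  by rewrite -mulrBl normrM distrC ler_wpM2l// mono_le.
set a := F h in FJ *; set b := series _ _ in FJ hN; set d := \sum_(m <- _) _ in hN CJ.
set g := \sum_(m <- _) _ in CJ *.
rewrite (_ : a - g = (a - b) + (b - d) + (d - g)); last by ring.
rewrite (le_trans (ler_normD _ _))// (le_trans (lerD (ler_normD _ _) (lexx _)))//.
by rewrite (le_trans (lerD (lerD FJ hN) CJ))//; lra.
Unshelve. all: by end_near. Qed.

End MajorantSeries.

(** * Products, compositions and division by a coordinate *)

Section MajorantCalculus.
Variable R : realType.

Lemma box_series n (u : {ffun 'I_n -> nat} -> R) N :
  \sum_(m <- box n N) u m = series (fun k => \sum_(m <- layer n k) u m) N.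
Proof.
rewrite /series/=; elim: N => [|N IH]; first by rewrite big_nil big_geq.
by rewrite big_nat_recr//= -IH big_cat.
Qed.

(** Each monomial is replaced by a function [phi m] of norm [a m]. Products, compositions and
    division by a coordinate are all instances, for different choices of [phi]. *)
Lemma maj_subst n p (c : {ffun 'I_n -> nat} -> R) (r M : R)
    (phi : {ffun 'I_n -> nat} -> 'rV[R]_p -> R) (a : {ffun 'I_n -> nat} -> R) :
  0 < r -> (forall m, maj r (phi m) (a m)) ->
  (forall N, \sum_(m <- box n N) `|c m| * a m <= M) ->
  exists F, maj r F M /\ forall h, `|h| <= r ->
    (fun N => \sum_(m <- box n N) c m * phi m h) @ \oo --> F h.
Proof.
move=> r0 phia cM.
have [|J|F [FM cF]] := @maj_series _ p r
  (fun k h => \sum_(m <- layer n k) c m * phi m h)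
  (fun k => \sum_(m <- layer n k) `|c m| * a m) M r0.
- by move=> k; apply: maj_sum => m; exact: maj_scale.
- by rewrite -box_series.
exists F; split=> // h hr; under eq_fun do rewrite box_series; exact: cF.
Qed.

(** Only f is expanded, instead of forming a Cauchy product: each product of a monomial by g is
    bounded by induction on the degree, one coordinate at a time, and [maj_subst] sums them. *)
Lemma maj_mul n (r : R) (f g : 'rV[R]_n -> R) (M M' : R) : 0 < r ->
  maj r f M -> maj r g M' -> maj r (fun h => f h * g h) (M * M').
Proof.
move=> r0 [c [cM cf]] gM.
have majm m : maj r (fun h => mono h m * g h) (r ^+ mdeg m * M').
  have [k] := ubnP (mdeg m); elim: k m => // k IH m; rewrite ltnS => mk.
  have [m0|[i mi0]] : (mdeg m = 0%N) \/ (exists i, m i != 0%N).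
    have [|] := eqVneq (mdeg m) 0%N; [by left|].
    rewrite sum_nat_eq0 negb_forall => /existsP[i]; rewrite implyTb.
    by right; exists i.
    have e h : mono h m = 1.
      rewrite /mono big1// => i _; move/eqP: m0; rewrite sum_nat_eq0.
      by move=> /forallP/(_ i)/eqP ->; rewrite expr0.
    by rewrite m0 mul1r; apply: maj_ext gM => h _; rewrite e mul1r.
  rewrite -(mdecK mi0) mdeg_inc exprS -mulrA.
  apply: (@maj_ext _ _ _ (fun h => h 0 i * (mono h (mdec i m) * g h))).
    by move=> h _; rewrite mono_inc mulrA.
  apply: maj_coord (ltW r0) (IH _ _); apply: leq_trans mk.
  by rewrite -{2}(mdecK mi0) mdeg_inc.
have [|F [FM cF]] := @maj_subst n n c r (M * M') _ _ r0 majm.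
  move=> N; under eq_bigr do rewrite mulrA.
  by rewrite -mulr_suml ler_wpM2r// (maj_ge0 gM).
apply: maj_ext FM => h hr; have {}cF := cF _ hr.
have cfg : (fun N => \sum_(m <- box n N) c m * (mono h m * g h)) @ \oo --> f h * g h.
  under eq_fun do under eq_bigr do rewrite mulrA.
  under eq_fun do rewrite -mulr_suml.
  by apply: cvgM; [exact: cf|exact: cvg_cst].
exact: cvg_unique cF cfg.
Qed.

Lemma maj_prod n (I : Type) (s : seq I) (f : I -> 'rV[R]_n -> R) (M : I -> R) r :
  0 < r -> (forall i, maj r (f i) (M i)) ->
  maj r (fun h => \prod_(i <- s) f i h) (\prod_(i <- s) M i).
Proof.
move=> r0 fM; elim: s => [|i s IH].
  by under eq_fun do rewrite big_nil; rewrite big_nil; exact: maj1.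
by under eq_fun do rewrite big_cons; rewrite big_cons; exact: maj_mul.
Qed.

Lemma maj_exp n (f : 'rV[R]_n -> R) (M r : R) k :
  0 < r -> maj r f M -> maj r (fun h => f h ^+ k) (M ^+ k).
Proof.
move=> r0 fM; elim: k => [|k IH].
  by under eq_fun do rewrite expr0; rewrite expr0; exact: maj1.
by under eq_fun do rewrite exprS; rewrite exprS; exact: maj_mul.
Qed.

Lemma maj_coordinate n (r : R) (i : 'I_n) : 0 <= r -> maj r (fun h => h 0 i) r.
Proof.
move=> r0; rewrite -[X in maj _ _ X]mulr1.
by apply: maj_ext (maj_coord i r0 (maj1 n r)) => h _; rewrite mulr1.
Qed.

Lemma maj_monomial n p (m : {ffun 'I_n -> nat}) (r s : R)
    (G : 'I_n -> 'rV[R]_p -> R) : 0 < r -> (forall i, maj r (G i) s) ->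
  maj r (fun h => mono (\row_i G i h) m) (s ^+ mdeg m).
Proof.
move=> r0 Gs; rewrite /mdeg expr_sum.
apply: (@maj_ext _ _ _ (fun h => \prod_i G i h ^+ m i)).
  by move=> h _; apply: eq_bigr => i _; rewrite mxE.
by apply: maj_prod => // i; exact: maj_exp.
Qed.

Lemma maj_comp n p (f : 'rV[R]_n -> R) (G : 'I_n -> 'rV[R]_p -> R) (M r s : R) :
  0 < r -> 0 <= s -> maj s f M -> (forall i, maj r (G i) s) ->
  maj r (fun h => f (\row_i G i h)) M.
Proof.
move=> r0 s0 [c [cM cf]] Gs.
have [F [FM cF]] := maj_subst r0 (fun m => maj_monomial m r0 Gs) cM.
apply: maj_ext FM => h hr; apply: cvg_unique (cF _ hr) _ => //.
apply: cf; apply: norm_rV_le => // i.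
by rewrite mxE; exact: maj_bound (Gs i).
Qed.

Lemma mono0 n (m : {ffun 'I_n -> nat}) : mono (0 : 'rV[R]_n) m = (mdeg m == 0%N)%:R.
Proof.
have [m0|] := eqVneq (mdeg m) 0%N.
  rewrite /mono big1// => i _; move/eqP: m0; rewrite sum_nat_eq0.
  by move=> /forallP/(_ i)/eqP ->; rewrite expr0.
rewrite sum_nat_eq0 negb_forall => /existsP[i]; rewrite implyTb => mi.
by rewrite /mono (bigD1 i)//= mxE expr0n (negbTE mi) mul0r.
Qed.

Lemma maj_shrink n (r s : R) (f : 'rV[R]_n -> R) M : 0 < s -> s <= r ->
  maj r f M -> maj s f M.
Proof.
move=> s0 sr fM.
have r0 : 0 <= r by rewrite (le_trans (ltW s0)).
have := @maj_comp n n f (fun i (h : 'rV[R]_n) => h 0 i) M s r s0 r0 fM.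
have e (h : 'rV[R]_n) : \row_i h 0 i = h by apply/rowP => i; rewrite mxE.
move=> fs; have := fs (fun i => maj_le sr (@maj_coordinate n s i (ltW s0))).
by apply: maj_ext => h _; rewrite e.
Qed.

(** As f vanishes at 0, every term has degree at least 1, and shrinking the radius from r to s gains
    a factor s / r. *)
Lemma maj_scaling n (r s : R) (f : 'rV[R]_n -> R) M : 0 < s -> s <= r ->
  f 0 = 0 -> maj r f M -> maj s f (M / r * s).
Proof.
move=> s0 sr f0 [c [cM cf]].
have r0 : 0 < r := lt_le_trans s0 sr.
have c0 m : mdeg m = 0%N -> c m = 0.
  move=> m0; have c0 := cf 0; rewrite normr0 f0 in c0.
  have {}c0 := c0 (ltW r0).
  apply: (cvg_unique _ _ c0) => //.
  apply: cvg_near_cst; near=> N.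
  rewrite (bigD1_seq m) ?box_uniq//= ?mem_box ?m0//; last first.
    by near: N; exists 1%N.
  rewrite mono0 m0 mulr1 big1 ?addr0// => d dm.
  rewrite mono0; case: eqP => [d0|]; rewrite ?mulr0//; exfalso.
  move/negP: dm; apply; apply/eqP/ffunP => i.
  move/eqP: m0; rewrite sum_nat_eq0 => /forallP/(_ i)/eqP ->.
  by move/eqP: d0; rewrite sum_nat_eq0 => /forallP/(_ i)/eqP ->.
exists c; split=> [N|h hs]; last by apply: cf; exact: le_trans hs sr.
rewrite mulrAC ler_pdivlMr// mulr_suml.
apply: (@le_trans _ _ (\sum_(m <- box n N) s * (`|c m| * r ^+ mdeg m))).
  apply: ler_sum => m _.
  have [/c0 ->|] := eqVneq (mdeg m) 0%N; first by rewrite normr0 !mul0r !mulr0.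
  case: (mdeg m) => // k _; rewrite [leRHS]mulrCA -mulrA ler_wpM2l//.
  rewrite !exprS -mulrA ler_pM2l// mulrC ler_pM2l//.
  by apply: lerXn2r => //; rewrite nnegrE ltW.
by rewrite -mulr_sumr mulrC ler_wpM2r// ltW.
Unshelve. all: by end_near. Qed.

Definition zero_coord n (i : 'I_n) (h : 'rV[R]_n) : 'rV[R]_n :=
  \row_j (if j == i then 0 else h 0 j).

(** Hadamard's lemma for series: the terms that contain h_i are divided by h_i, which lowers their
    degree by one and costs a factor 1 / r; the remaining ones form the restriction to h_i = 0. *)
Lemma maj_hadamard n (r : R) (f : 'rV[R]_n -> R) M i : 0 < r -> maj r f M ->
  exists F, maj r F (M / r) /\
    forall h, `|h| <= r -> f h = f (zero_coord i h) + h 0 i * F h.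
Proof.
move=> r0 [c [cM cf]].
pose phi (m : {ffun 'I_n -> nat}) h := if m i == 0%N then 0 else mono h (mdec i m) : R.
pose a (m : {ffun 'I_n -> nat}) := if m i == 0%N then 0 else r ^+ mdeg m / r.
have phia m : maj r (phi m) (a m).
  rewrite /phi /a; case: eqP => [_|/eqP mi0]; first exact: maj0.
  have -> : r ^+ mdeg m / r = r ^+ mdeg (mdec i m).
    by rewrite -{1}(mdecK mi0) mdeg_inc exprSr mulfK// gt_eqF.
  apply: (maj_ext _ (maj_monomial (mdec i m) r0 (fun j => @maj_coordinate n r j (ltW r0)))).
  by move=> h _; congr mono; apply/rowP => j; rewrite mxE.
have [|F [FM cF]] := @maj_subst n n c r (M / r) phi a r0 phia.
  move=> N; rewrite ler_pdivlMr// mulr_suml; apply: le_trans (cM N).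
  apply: ler_sum => m _; rewrite /a -mulrA ler_wpM2l//.
  case: ifP => _; first by rewrite mul0r exprn_ge0// ltW.
  by rewrite divfK// gt_eqF.
exists F; split=> // h hr.
have hz : `|zero_coord i h| <= r.
  apply: norm_rV_le => [|j]; first exact: ltW.
  rewrite mxE; case: ifP => _; first by rewrite normr0 ltW.
  exact: le_trans (le_coord_norm _ _) hr.
apply/eqP; rewrite addrC -subr_eq; apply/eqP.
have c1 : (fun N => \sum_(m <- box n N) c m * mono h m -
    \sum_(m <- box n N) c m * mono (zero_coord i h) m) @ \oo -->
    f h - f (zero_coord i h) by apply: cvgB; exact: cf.
have c2 : (fun N => h 0 i * \sum_(m <- box n N) c m * phi m h) @ \oo --> h 0 i * F h.
  by apply: cvgM; [exact: cvg_cst|exact: cF].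
suff e : (fun N => \sum_(m <- box n N) c m * mono h m -
    \sum_(m <- box n N) c m * mono (zero_coord i h) m) =
    fun N => h 0 i * \sum_(m <- box n N) c m * phi m h.
  by rewrite e in c1; exact: cvg_unique c1 c2.
apply/funext => N /=; rewrite -sumrB mulr_sumr; apply: eq_bigr => m _.
rewrite -mulrBr mulrCA; congr (_ * _); rewrite /phi.
case: eqP => [m0|/eqP m0].
  rewrite mulr0 -[RHS](subrr (mono h m)); congr (_ - _).
  by apply: eq_bigr => j _; rewrite mxE; case: eqP => [->|//]; rewrite m0 !expr0.
rewrite -{1 2}(mdecK m0) !mono_inc mxE eqxx mul0r subr0//.
Qed.

End MajorantCalculus.

(** * Analytic functions *)

Section AnalyticFunctions.
Variable R : realType.

Lemma analytic_atP n (f : 'rV[R]_n -> R) a :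
  analytic_at f a <-> exists r M, 0 < r /\ maj r (fun h => f (a + h)) M.
Proof.
split=> [[c [r r0 cf]]|[r [M [r0 [c [cM cf]]]]]].
  (* At the point with all coordinates equal to s, the normed series is the sum of the |c_m| s^|m|;
     half the radius keeps this point inside the ball of convergence. *)
  pose s := r / 2; have s0 : 0 < s by rewrite divr_gt0.
  have sr : s < r by rewrite ltr_pdivrMr// ltr_pMr// ltr1n.
  pose e : 'rV[R]_n := const_mx s.
  have es : `|e| <= s by apply: norm_rV_le (ltW s0) _ => i; rewrite mxE gtr0_norm.
  have [ce _] := cf e (le_lt_trans es sr).
  exists s, (limn (series (graded_part Num.norm c e))); split=> //.
  exists c; split=> [N|h hs].
    have -> : \sum_(m <- box n N) `|c m| * s ^+ mdeg m =
        series (graded_part Num.norm c e) N.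
      rewrite series_graded_part; apply: eq_bigr => m _.
      rewrite normrM; congr (_ * _); rewrite /mono normr_prod /mdeg expr_sum.
      by apply: eq_bigr => i _; rewrite mxE normrX gtr0_norm.
    apply: nondecreasing_cvgn_le => //; apply: nondecreasing_series => k _ _.
    by rewrite graded_part_layer; apply: sumr_ge0.
  have [_] := cf h (le_lt_trans hs sr).
  rewrite (_ : series _ = fun N => \sum_(m <- box n N) c m * mono h m)//.
  by apply/funext => N; rewrite series_graded_part.
exists c, r => // h /ltW hr; split; last first.
  rewrite (_ : series _ = fun N => \sum_(m <- box n N) c m * mono h m); first exact: cf.
  by apply/funext => N; rewrite series_graded_part.
apply: nondecreasing_is_cvgn.
  apply: nondecreasing_series => k _ _.
  by rewrite graded_part_layer; apply: sumr_ge0.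
exists M => _ [N _ <-]; rewrite series_graded_part; apply: le_trans (cM N).
by apply: ler_sum => m _; rewrite normrM ler_wpM2l// mono_le.
Qed.

(** A series that vanishes at the center has arbitrarily small norm on small polydiscs;
    compositions, inverses and the fixed point argument rest on this. Using M + 1 avoids a division
    by zero. *)
Lemma maj_small n (f : 'rV[R]_n -> R) (r M s : R) : 0 < r -> maj r f M ->
  f 0 = 0 -> 0 < s -> exists2 r', 0 < r' <= r & forall t, 0 < t <= r' -> maj t f s.
Proof.
move=> r0 fM f0 s0.
have M0 := maj_ge0 fM; have M1 : 0 < M + 1 by rewrite ltr_wpDl.
exists (Num.min r (s * r / (M + 1))).
  by rewrite lt_min r0 ge_min lexx !divr_gt0 ?mulr_gt0.
move=> t /andP[t0]; rewrite le_min => /andP[tr ts].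
apply: maj_le (maj_scaling t0 tr f0 fM).
rewrite mulrAC ler_pdivrMr//; move: ts; rewrite ler_pdivlMr// => ts.
by apply: le_trans ts; rewrite mulrC ler_wpM2l ?(ltW t0)// lerDl.
Qed.

(** Recentering at h is the substitution k -> h + k, whose components have norm at most |h_i| + (r -
    |h|) <= r on the polydisc of radius r - |h|. *)
Lemma maj_analytic n (r M : R) (f : 'rV[R]_n -> R) h :
  `|h| < r -> maj r f M -> analytic_at f h.
Proof.
move=> hr fM; apply/analytic_atP.
exists (r - `|h|), M; split; first by rewrite subr_gt0.
have d0 : 0 < r - `|h| by rewrite subr_gt0.
have r0 : 0 < r := le_lt_trans (normr_ge0 _) hr.
have := @maj_comp R n n f (fun i (k : 'rV[R]_n) => h 0 i + k 0 i) M (r - `|h|) r d0 (ltW r0) fM.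
move=> H; apply: (maj_ext _ (H _)) => [k _|i].
  by congr f; apply/rowP => i; rewrite !mxE.
have := maj_add (maj_cst n (r - `|h|) (h 0 i)) (maj_coordinate i (ltW d0)).
by apply: maj_le; rewrite addrCA gerDl subr_le0 le_coord_norm.
Qed.

Lemma analytic_near n (f : 'rV[R]_n -> R) a :
  analytic_at f a -> \forall z \near a, analytic_at f z.
Proof.
move=> /analytic_atP[r [M [r0 fM]]]; apply/nbhs_ballP; exists r => // z.
rewrite -ball_normE/= distrC => zr; apply/analytic_atP.
have /analytic_atP[s [N [s0 sN]]] := maj_analytic zr fM.
by exists s, N; split=> //; apply: maj_ext sN => h _; rewrite addrA [a + _]addrC subrK.
Qed.

Lemma analytic_ext n (f g : 'rV[R]_n -> R) a :
  (\forall z \near a, f z = g z) -> analytic_at f a -> analytic_at g a.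
Proof.
move=> /nbhs_ballP[e/= e0 fg] /analytic_atP[r [M [r0 fM]]]; apply/analytic_atP.
have t0 : 0 < Num.min r (e / 2) by rewrite lt_min r0 divr_gt0.
exists (Num.min r (e / 2)), M; split=> //.
apply: maj_ext (maj_shrink t0 _ fM); last by rewrite ge_min lexx.
move=> h; rewrite le_min => /andP[_ he]; apply: fg.
rewrite -ball_normE/= opprD addNKr normrN (le_lt_trans he)//.
by rewrite ltr_pdivrMr// ltr_pMr// ltr1n.
Qed.

Lemma analytic_cst n (c : R) (a : 'rV[R]_n) : analytic_at (fun=> c) a.
Proof. by apply/analytic_atP; exists 1, `|c|; split=> //; exact: maj_cst. Qed.

Lemma analytic_coord n i (a : 'rV[R]_n) : analytic_at (fun z => z 0 i) a.
Proof.
apply/analytic_atP; exists 1, (`|a 0 i| + 1); split=> //.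
apply: (maj_ext _ (maj_add (maj_cst n 1 (a 0 i)) (maj_coordinate i ler01))).
by move=> h _; rewrite mxE.
Qed.

Lemma analytic_common n (f g : 'rV[R]_n -> R) a : analytic_at f a -> analytic_at g a ->
  exists r M N, [/\ 0 < r, maj r (fun h => f (a + h)) M & maj r (fun h => g (a + h)) N].
Proof.
move=> /analytic_atP[r [M [r0 fM]]] /analytic_atP[s [N [s0 gN]]].
have t0 : 0 < Num.min r s by rewrite lt_min r0.
exists (Num.min r s), M, N; split=> //.
  by apply: maj_shrink fM => //; rewrite ge_min lexx.
by apply: maj_shrink gN => //; rewrite ge_min lexx orbT.
Qed.

Lemma analytic_add n (f g : 'rV[R]_n -> R) a : analytic_at f a -> analytic_at g a ->
  analytic_at (fun z => f z + g z) a.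
Proof.
move=> fa ga; have [r [M [N [r0 fM gN]]]] := analytic_common fa ga.
by apply/analytic_atP; exists r, (M + N); split=> //; exact: maj_add.
Qed.

Lemma analytic_mul n (f g : 'rV[R]_n -> R) a : analytic_at f a -> analytic_at g a ->
  analytic_at (fun z => f z * g z) a.
Proof.
move=> fa ga; have [r [M [N [r0 fM gN]]]] := analytic_common fa ga.
by apply/analytic_atP; exists r, (M * N); split=> //; exact: maj_mul.
Qed.

Lemma analytic_opp n (f : 'rV[R]_n -> R) a :
  analytic_at f a -> analytic_at (fun z => - f z) a.
Proof.
move=> fa; under eq_fun do rewrite -mulN1r.
exact: analytic_mul (analytic_cst (- 1) a) fa.
Qed.

Lemma analytic_sub n (f g : 'rV[R]_n -> R) a : analytic_at f a -> analytic_at g a ->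
  analytic_at (fun z => f z - g z) a.
Proof. by move=> fa ga; apply: analytic_add => //; exact: analytic_opp. Qed.

Lemma analytic_exp n (f : 'rV[R]_n -> R) a k :
  analytic_at f a -> analytic_at (fun z => f z ^+ k) a.
Proof.
move=> fa; elim: k => [|k IH]; first exact: analytic_cst.
by under eq_fun do rewrite exprS; exact: analytic_mul.
Qed.

Lemma common_radius (I : finType) (P : I -> R -> Prop) :
  (forall i, exists2 r, 0 < r & forall t, 0 < t <= r -> P i t) ->
  exists2 r, 0 < r & forall i, P i r.
Proof.
move=> H; have {H}/choice[rho rhoP] : forall i, exists r, 0 < r /\
    forall t, 0 < t <= r -> P i t by move=> i; have [r r0 rP] := H i; exists r.
pose r := \big[Num.min/1]_(i in I) rho i.
have r0 : 0 < r.
  by apply/bigmin_gtP; split=> // i _; exact: (rhoP i).1.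
exists r => // i; apply: (rhoP i).2; rewrite r0/=.
by apply/bigmin_leP; right; exists i.
Qed.

(** The increments of the components of G vanish at the center, so on a common small polydisc they
    have norm at most the radius s on which f is expanded. *)
Lemma analytic_comp n p (f : 'rV[R]_n -> R) (G : 'rV[R]_p -> 'rV[R]_n) a :
  analytic_at f (G a) -> (forall i, analytic_at (fun z => G z 0 i) a) ->
  analytic_at (fun z => f (G z)) a.
Proof.
move=> /analytic_atP[s [M [s0 fM]]] Ga.
pose g i (h : 'rV[R]_p) := G (a + h) 0 i - G a 0 i.
have [i|r r0 gr] := @common_radius 'I_n (fun i r => maj r (g i) s).
  have /analytic_atP[t [N [t0 tN]]] := analytic_sub (Ga i) (analytic_cst (G a 0 i) a).
  have [|r' /andP[r'0 _] r'P] := maj_small t0 tN _ s0.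
    by rewrite addr0 subrr.
  by exists r'.
apply/analytic_atP; exists r, M; split=> //.
apply: maj_ext (maj_comp r0 (ltW s0) fM gr) => h _; congr f.
by apply/rowP => i; rewrite !mxE addrC subrK.
Qed.

Lemma analytic_bound n (f : 'rV[R]_n -> R) a (e : R) : analytic_at f a -> 0 < e ->
  \forall z \near a, `|f z - f a| <= e.
Proof.
move=> fa e0.
have /analytic_atP[t [N [t0 tN]]] := analytic_sub fa (analytic_cst (f a) a).
have [|r' /andP[r'0 _] r'P] := maj_small t0 tN _ e0; first by rewrite addr0 subrr.
apply/nbhs_ballP; exists r' => // z; rewrite -ball_normE/= distrC => /ltW zr.
have rr : 0 < r' <= r' by rewrite r'0 lexx.
by have := maj_bound zr (r'P _ rr); rewrite [a + _]addrC subrK.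
Qed.

Lemma analytic_continuous n (f : 'rV[R]_n -> R) a :
  analytic_at f a -> {for a, continuous f}.
Proof.
move=> fa; suff : forall e, 0 < e -> \forall z \near a, `|f a - f z| <= e.
  by move/(@cvgrPdist_le _ _ _ (nbhs a)).
move=> e e0; near=> z; rewrite distrC; near: z.
exact: analytic_bound fa e0.
Unshelve. all: by end_near. Qed.

(** Geometric series in g = 1 - f / f(a), whose norm is at most 1/2 near a. *)
Lemma analytic_inv n (f : 'rV[R]_n -> R) a :
  analytic_at f a -> f a != 0 -> analytic_at (fun z => (f z)^-1) a.
Proof.
move=> fa fa0.
pose g z := 1 - (f a)^-1 * f z.
have ga : analytic_at g a.
  by apply: analytic_sub; [exact: analytic_cst|apply: analytic_mul => //; exact: analytic_cst].
have /analytic_atP[t [N [t0 tN]]] := ga.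
have half0 : 0 < 2^-1 :> R by rewrite invr_gt0.
have [|r /andP[r0 _] rP] := maj_small t0 tN _ half0.
  by rewrite addr0 /g mulVf// subrr.
have {}rP : maj r (fun h => g (a + h)) 2^-1 by apply: rP; rewrite r0 lexx.
have [J|F [FM cF]] := @maj_series _ _ r (fun k h => g (a + h) ^+ k) (fun k => 2^-1 ^+ k) 2 r0
  (fun k => maj_exp k r0 rP).
  have -> : series (fun k => 2^-1 ^+ k : R) J = 2 - 2 * 2^-1 ^+ J.
    rewrite /series/=; elim: J => [|J IH]; first by rewrite big_geq// expr0 mulr1 subrr.
    by rewrite big_nat_recr//= IH exprS; field.
  by rewrite gerBl mulr_ge0// exprn_ge0// ltW.
apply/analytic_atP; exists r, (`|(f a)^-1| * 2); split=> //.
apply: maj_ext (maj_scale (f a)^-1 FM) => h hr.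
have gh : `|g (a + h)| < 1.
  by rewrite (le_lt_trans (maj_bound hr rP))// invf_lt1// ltr1n.
have := @cvg_geometric_series R 1 _ gh; rewrite mul1r => cg.
have -> : F h = (1 - g (a + h))^-1.
  apply: cvg_unique (cF _ hr) _ => //; apply: cvg_trans cg.
  by rewrite (_ : geometric _ _ = fun k => g (a + h) ^+ k)//; apply/funext => k; rewrite /geometric/= mul1r.
rewrite /g subKr invfM invrK mulKf//.
Qed.

End AnalyticFunctions.

(** * Directional derivatives *)

Section AnalyticDerivatives.
Variable R : realType.

Lemma pt_le n (z : 'rV[R]_n) (y r : R) : `|z| <= r -> `|y| <= r -> `|pt z y| <= r.
Proof.
move=> zr yr; apply: norm_rV_le; first exact: le_trans zr.
move=> i; rewrite /pt; case: (split_ordP i) => j ->.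
  by rewrite row_mxEl (le_trans (le_coord_norm _ _)).
by rewrite row_mxEr mxE ord1 eqxx mulr1n.
Qed.

Lemma base_pt n (z : 'rV[R]_n) (y : R) : base (pt z y) = z.
Proof. by rewrite /base /pt row_mxKl. Qed.

Lemma fib_pt n (z : 'rV[R]_n) (y : R) : fib (pt z y) = y.
Proof. by rewrite /fib /pt row_mxKr mxE eqxx mulr1n. Qed.

Lemma pt_base_fib n (p : 'rV[R]_(n + 1)) : pt (base p) (fib p) = p.
Proof.
rewrite /pt /base -[RHS]hsubmxK; congr row_mx; apply/rowP => i.
by rewrite !mxE !ord1 eqxx mulr1n /fib !mxE.
Qed.

Lemma pt_inj n (z z' : 'rV[R]_n) y y' : pt z y = pt z' y' -> z = z' /\ y = y'.
Proof.
move=> e; split; first by rewrite -(base_pt z y) e base_pt.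
by rewrite -(fib_pt z y) e fib_pt.
Qed.

Lemma ptD n (z z' : 'rV[R]_n) y y' : pt (z + z') (y + y') = pt z y + pt z' y'.
Proof. by rewrite /pt add_row_mx raddfD. Qed.

Lemma ptB n (z z' : 'rV[R]_n) y y' : pt (z - z') (y - y') = pt z y - pt z' y'.
Proof. by rewrite /pt opp_row_mx add_row_mx raddfB. Qed.

Lemma ptZ n (z : 'rV[R]_n) y a : pt (a *: z) (a * y) = a *: pt z y.
Proof. by rewrite /pt scale_row_mx scale_scalar_mx. Qed.

Lemma pt0 n : pt 0 0 = 0 :> 'rV[R]_(n + 1).
Proof. by rewrite /pt raddf0 row_mx0. Qed.

Lemma baseE n (p : 'rV[R]_(n + 1)) i : base p 0 i = p 0 (lshift 1 i).
Proof. by rewrite /base mxE. Qed.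

Lemma fibE n (p : 'rV[R]_(n + 1)) : fib p = p 0 (rshift n ord0).
Proof. by rewrite /fib mxE. Qed.

Lemma ptl n (z : 'rV[R]_n) y i : pt z y 0 (lshift 1 i) = z 0 i.
Proof. by rewrite -baseE base_pt. Qed.

Lemma ptr n (z : 'rV[R]_n) y : pt z y 0 (rshift n ord0) = y.
Proof. by rewrite -fibE fib_pt. Qed.

Lemma rV_split n (P : 'I_(n + 1) -> Prop) :
  (forall i, P (lshift 1 i)) -> P (rshift n ord0) -> forall i, P i.
Proof. by move=> Pl Pr i; case: (split_ordP i) => j ->//; rewrite ord1. Qed.

Lemma zero_last n (z : 'rV[R]_n) (y : R) : zero_coord (rshift n ord0) (pt z y) = pt z 0.
Proof.
apply/rowP; apply: rV_split => [i|]; rewrite mxE.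
  by rewrite eq_lrshift !ptl.
by rewrite eqxx ptr.
Qed.

Lemma hadamard_last n (r M : R) (f : 'rV[R]_(n + 1) -> R) : 0 < r -> maj r f M ->
  exists F, maj r F (M / r) /\ forall z y, `|z| <= r -> `|y| <= r ->
    f (pt z y) = f (pt z 0) + y * F (pt z y).
Proof.
move=> r0 fM; have [F [FM fF]] := maj_hadamard (rshift n ord0) r0 fM.
exists F; split=> // z y zr yr.
by rewrite fF ?pt_le// zero_last ptr.
Qed.

Lemma analytic_fib n (w : 'rV[R]_(n + 1)) : analytic_at (@fib R n) w.
Proof.
rewrite (_ : @fib R n = fun w => w 0 (rshift n ord0)); first exact: analytic_coord.
by apply/funext => p; rewrite fibE.
Qed.

Lemma analytic_base n (f : 'rV[R]_n -> R) (w : 'rV[R]_(n + 1)) :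
  analytic_at f (base w) -> analytic_at (fun w => f (base w)) w.
Proof.
move=> fa; apply: analytic_comp fa _ => i.
under eq_fun do rewrite baseE; exact: analytic_coord.
Qed.

Lemma analytic_pt n p (Z : 'rV[R]_p -> 'rV[R]_n) (Y : 'rV[R]_p -> R) a :
  analytic_map_at Z a -> analytic_at Y a -> analytic_map_at (fun z => pt (Z z) (Y z)) a.
Proof.
move=> Za Ya; apply: rV_split => [i|].
  by under eq_fun do rewrite ptl; exact: Za.
by under eq_fun do rewrite ptr.
Qed.

(** Hadamard's lemma is applied to f(a + h + e v) in the extra variable e: the quotient at e = 0 is
    the derivative along v, and it is analytic in h. Existence and analyticity of the derivative
    come out together. *)
Lemma analytic_line_quotient n (f : 'rV[R]_n -> R) a v : analytic_at f a ->
  exists r D, [/\ 0 < r, forall h, `|h| < r -> analytic_at D (a + h) &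
   forall h, `|h| < r -> is_derive (a + h) v f (D (a + h))].
Proof.
move=> fa.
have ga : analytic_at (fun p : 'rV[R]_(n + 1) => f (a + (base p + fib p *: v))) 0.
  apply: (@analytic_comp _ _ _ f (fun p => a + (base p + fib p *: v))).
    by rewrite -(pt0 n) base_pt fib_pt scale0r !addr0.
  move=> i; under eq_fun do rewrite !mxE.
  apply: analytic_add; first exact: analytic_cst.
  apply: analytic_add; first exact: analytic_coord.
  apply: analytic_mul; last exact: analytic_cst.
  exact: analytic_fib.
have /analytic_atP[r [M [r0 gM]]] := ga.
have [F [FM gF]] := hadamard_last r0 gM.
have Fan h : `|h| < r -> analytic_at F (pt h 0).
  move=> hr; apply: maj_analytic FM; apply: le_lt_trans hr; apply: pt_le => //.
  by rewrite normr0.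
exists r, (fun z => F (pt (z - a) 0)); split=> // h hr.
  apply: (@analytic_comp _ _ _ F (fun z => pt (z - a) 0)).
    by rewrite [a + h]addrC addrK; exact: Fan.
  apply: rV_split => [i|].
    under eq_fun do rewrite ptl !mxE.
    by apply: analytic_sub; [exact: analytic_coord|exact: analytic_cst].
  by under eq_fun do rewrite ptr; exact: analytic_cst.
have Fh := Fan _ hr.
have cF : (fun e : R => F (pt h e)) @ 0 --> F (pt h 0).
  have cpt : (fun e : R => pt h e) @ 0 --> pt h 0.
    apply/cvgrPdist_le => e e0; near=> x.
    rewrite -ptB; apply: pt_le; first by rewrite subrr normr0 ltW.
    by near: x; apply: cvgr_dist_le.
  exact: (cvg_comp _ _ cpt (analytic_continuous Fh)).
have cD : (fun e : R => e^-1 *: (f (e *: v + (a + h)) - f (a + h))) @ 0^' --> F (pt h 0).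
  have {}cF : (fun e : R => F (pt h e)) @ 0^' --> F (pt h 0).
    exact: cvg_within_filter.
  apply: cvg_trans cF; apply: near_eq_cvg; near=> e.
  have e0 : e != 0 by near: e; exact: nbhs_dnbhs_neq.
  have er : `|e| <= r by near: e; exact: dnbhs0_le.
  have := gF h e (ltW hr) er.
  rewrite !add0r !base_pt !fib_pt scale0r addr0 [a + (h + _)]addrA [_ + e *: v]addrC => ->.
  by rewrite addrC addKr /GRing.scale/= mulKf.
have e : a + h - a = h by rewrite [a + h]addrC addrK.
by apply: DeriveDef; rewrite ?e; [apply: cvgP cD|apply: cvg_lim cD].
Unshelve. all: by end_near. Qed.

End AnalyticDerivatives.

(** * Calculus from Taylor expansions with analytic remainders *)

Section DerivativeCalculus.
Variable R : realType.

Lemma analytic_is_derive n (f : 'rV[R]_n -> R) a v :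
  analytic_at f a -> is_derive a v f ('D_v f a).
Proof.
move=> /(analytic_line_quotient v)[r [D [r0 _ /(_ 0)]]].
rewrite normr0 addr0 => /(_ r0) fD; apply: DeriveDef => //.
Qed.

Lemma analytic_derivable n (f : 'rV[R]_n -> R) a v :
  analytic_at f a -> derivable f a v.
Proof. by move=> /(analytic_is_derive v) ?; exact: ex_derive. Qed.

Lemma near_ball0 n (P : 'rV[R]_n -> Prop) a r : 0 < r ->
  (forall h, `|h| < r -> P (a + h)) -> \forall z \near a, P z.
Proof.
move=> r0 hP; apply/nbhs_ballP; exists r => // z; rewrite -ball_normE/= distrC => zr.
by rewrite -(subrK a z) addrC; exact: hP.
Qed.

Lemma analytic_derive n (f : 'rV[R]_n -> R) a v :
  analytic_at f a -> analytic_at ('D_v f) a.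
Proof.
move=> /(analytic_line_quotient v)[r [D [r0 Da fD]]].
apply: (@analytic_ext _ _ D); last by rewrite -[a]addr0; apply: Da; rewrite normr0.
apply: (near_ball0 r0) => h hr; have := fD h hr => H.
by rewrite derive_val.
Qed.

Definition trunc_coord n (k : nat) (h : 'rV[R]_n) : 'rV[R]_n :=
  \row_j (if (j < k)%N then h 0 j else 0).

Lemma norm_trunc_coord n k (h : 'rV[R]_n) r : 0 <= r -> `|h| <= r -> `|trunc_coord k h| <= r.
Proof.
move=> r0 hr; apply: norm_rV_le => // i; rewrite mxE.
case: ifP => _; last by rewrite normr0.
exact: le_trans (le_coord_norm _ _) hr.
Qed.

Lemma maj_hadamard_all n (r M : R) (f : 'rV[R]_n -> R) : 0 < r -> maj r f M ->
  exists F : 'I_n -> 'rV[R]_n -> R, (forall k, maj r (F k) (M / r)) /\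
    forall h, `|h| <= r -> f h = f 0 + \sum_k h 0 k * F k h.
Proof.
move=> r0 fM.
have /choice[G GP] : forall k : 'I_n, exists F, maj r F (M / r) /\
    forall h, `|h| <= r -> f h = f (zero_coord k h) + h 0 k * F h.
  by move=> k; exact: maj_hadamard.
exists (fun k h => G k (trunc_coord k.+1 h)); split=> [k|h hr].
  apply: (@maj_comp R n n (G k) (fun j h => if (j < k.+1)%N then h 0 j else 0)
    (M / r) r r r0 (ltW r0) (GP k).1) => j.
  case: (j < k.+1)%N; first exact: maj_coordinate (ltW r0).
  exact: maj_le (ltW r0) (maj0 _ _).
have e0 : trunc_coord 0 h = 0 by apply/rowP => j; rewrite !mxE ltn0.
have en : trunc_coord n h = h by apply/rowP => j; rewrite !mxE ltn_ord.
apply/eqP; rewrite addrC -subr_eq -e0 -{1}en; apply/eqP.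
rewrite -(telescope_sumr (fun k => f (trunc_coord k h)))// big_mkord.
apply: eq_bigr => k _.
rewrite ((GP k).2 (trunc_coord k.+1 h)); last exact: norm_trunc_coord (ltW r0) hr.
have -> : zero_coord k (trunc_coord k.+1 h) = trunc_coord k h.
  apply/rowP => j; rewrite !mxE; case: eqP => [->|/eqP jk]; first by rewrite ltnn.
  have {}jk : ((j : nat) == k) = false by apply/negbTE.
  by rewrite ltnS leq_eqVlt jk.
by rewrite addrC addKr mxE ltnSn.
Qed.

(** Plays the part of differentiability: the chain rule and the symmetry of second derivatives are
    read off this expansion. *)
Lemma analytic_taylor1 n (f : 'rV[R]_n -> R) a : analytic_at f a ->
  exists F : 'I_n -> 'rV[R]_n -> R, (forall k, analytic_at (F k) a) /\
    \forall z \near a, f z = f a + \sum_k (z 0 k - a 0 k) * F k z.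
Proof.
move=> /analytic_atP[r [M [r0 fM]]].
have [F [FM fF]] := maj_hadamard_all r0 fM.
exists (fun k z => F k (z - a)); split=> [k|].
  apply: (@analytic_comp _ _ _ (F k) (fun z => z - a)).
    by rewrite subrr; apply: maj_analytic (FM k); rewrite normr0.
  move=> i; under eq_fun do rewrite !mxE.
  by apply: analytic_sub; [exact: analytic_coord|exact: analytic_cst].
apply: (near_ball0 r0) => h hr; rewrite fF ?(ltW hr)// addr0; congr (_ + _).
by apply: eq_bigr => k _; rewrite mxE addrAC subrr add0r [a + h]addrC addrK.
Qed.

Lemma line_cvg n (a v : 'rV[R]_n) : (fun e : R => e *: v + a) @ 0 --> a.
Proof.
rewrite -[X in _ --> X]add0r -[X in _ --> X + a](scale0r v).
by apply: cvgD; [apply: cvgZr_tmp; exact: cvg_id|exact: cvg_cst].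
Qed.

Lemma rV_cvg n T (F : set_system T) (FF : Filter F) (G : T -> 'rV[R]_n) (l : 'rV[R]_n) :
  (forall i, (fun x => G x 0 i) @ F --> (l 0 i : R)) -> G @ F --> l.
Proof.
move=> Gl; apply/cvgrPdist_le => e e0; near=> x.
apply: norm_rV_le (ltW e0) _ => i; rewrite !mxE; move: i; near: x.
by apply: filter_forall => i; have /cvgrPdist_le/(_ _ e0) := Gl i.
Unshelve. all: by end_near. Qed.

Lemma analytic_map_continuous n p (G : 'rV[R]_p -> 'rV[R]_n) a :
  analytic_map_at G a -> G @ a --> G a.
Proof. by move=> Ga; apply: (@rV_cvg _ _ (nbhs a)) => i; exact: analytic_continuous (Ga i). Qed.

Lemma derive_coord n (a v : 'rV[R]_n) k : 'D_v (fun z : 'rV[R]_n => z 0 k) a = v 0 k.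
Proof.
apply: cvg_lim => //; apply: cvg_near_cst; near=> e => /=.
have e0 : e != 0 by near: e; exact: nbhs_dnbhs_neq.
by rewrite !mxE addrK /GRing.scale/= mulKf.
Unshelve. all: by end_near. Qed.

Lemma derive_comp_taylor n p (g : 'rV[R]_n -> R) (F : 'I_n -> 'rV[R]_n -> R)
    (G : 'rV[R]_p -> 'rV[R]_n) a v :
  (forall k, analytic_at (F k) (G a)) ->
  (\forall z \near G a, g z = g (G a) + \sum_k (z 0 k - G a 0 k) * F k z) ->
  analytic_map_at G a ->
  'D_v (fun z => g (G z)) a = \sum_k F k (G a) * 'D_v (fun z => G z 0 k) a.
Proof.
move=> Fan gF Ga; apply: cvg_lim => //.
have cl : (fun e : R => e *: v + a) @ 0^' --> a.
  by apply: cvg_within_filter; exact: line_cvg.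
have cG : (fun e : R => G (e *: v + a)) @ 0^' --> G a.
  exact: cvg_comp cl (analytic_map_continuous Ga).
have {}gF : \forall e \near (0 : R)^', g (G (e *: v + a)) =
    g (G a) + \sum_k (G (e *: v + a) 0 k - G a 0 k) * F k (G (e *: v + a)).
  exact: cG gF.
have c : (fun e : R => \sum_k F k (G (e *: v + a)) *
    (e^-1 *: (G (e *: v + a) 0 k - G a 0 k))) @ 0^' -->
    \sum_k F k (G a) * 'D_v (fun z => G z 0 k) a.
  apply: cvg_big => [|k _]; first exact: add_continuous.
  apply: cvgM; first exact: cvg_comp cG (analytic_continuous (Fan k)).
  exact: analytic_derivable (Ga k).
apply: cvg_trans c; apply: near_eq_cvg; near=> e => /=.
rewrite (near gF e)// [g (G a) + _]addrC addrK scaler_sumr; apply: eq_bigr => k _.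
by rewrite /GRing.scale/=; ring.
Unshelve. all: by end_near. Qed.

Lemma analytic_map_id n (a : 'rV[R]_n) : analytic_map_at (fun z => z) a.
Proof. by move=> i; exact: analytic_coord. Qed.

(** The values at G(a) of the Taylor coefficients F k are the partial derivatives of g, as the
    expansion applied to the identity map shows. *)
Lemma derive_chain n p (g : 'rV[R]_n -> R) (G : 'rV[R]_p -> 'rV[R]_n) a v :
  analytic_at g (G a) -> analytic_map_at G a ->
  'D_v (fun z => g (G z)) a =
  \sum_k pd k g (G a) * 'D_v (fun z => G z 0 k) a.
Proof.
move=> ga Ga; have [F [Fan gF]] := analytic_taylor1 ga.
rewrite (derive_comp_taylor v Fan gF Ga); apply: eq_bigr => k _; congr (_ * _).
rewrite /pd (@derive_comp_taylor _ _ g F (fun z => z))//; last exact: analytic_map_id.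
rewrite (bigD1 k)//= derive_coord mxE !eqxx mulr1 big1 ?addr0// => j jk.
by rewrite derive_coord mxE eqxx (negbTE jk) mulr0.
Qed.

Lemma derive_dir n (g : 'rV[R]_n -> R) a v : analytic_at g a ->
  'D_v g a = \sum_k v 0 k * pd k g a.
Proof.
move=> ga; rewrite (@derive_chain _ _ g (fun z => z))//; last exact: analytic_map_id.
by apply: eq_bigr => k _; rewrite derive_coord mulrC.
Qed.

(** Analyticity travels with the value of the derivative, so that the rules below compose without
    side conditions and build the derivative of a compound expression together with its proof. *)
Definition hasD n (v : 'rV[R]_n) f a d := analytic_at f a /\ 'D_v f a = d.

Lemma hasD_derive n v (f : 'rV[R]_n -> R) a : analytic_at f a -> hasD v f a ('D_v f a).
Proof. by []. Qed.

Lemma hasD_near n v (f g : 'rV[R]_n -> R) a d : (\forall z \near a, f z = g z) ->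
  hasD v f a d -> hasD v g a d.
Proof.
move=> fg [fa fd]; split; first exact: analytic_ext fg fa.
by rewrite -(near_eq_derive v fg).
Qed.

Lemma hasD_eq n v (f : 'rV[R]_n -> R) a d e : hasD v f a d -> d = e -> hasD v f a e.
Proof. by move=> ? <-. Qed.

Lemma hasD_cst n v c (a : 'rV[R]_n) : hasD v (fun=> c) a 0.
Proof. by split; [exact: analytic_cst|exact: derive_cst]. Qed.

Lemma hasD_coord n v i (a : 'rV[R]_n) : hasD v (fun z => z 0 i) a (v 0 i).
Proof. by split; [exact: analytic_coord|exact: derive_coord]. Qed.

Lemma hasD_add n v (f g : 'rV[R]_n -> R) a d e : hasD v f a d -> hasD v g a e ->
  hasD v (fun z => f z + g z) a (d + e).
Proof.
move=> [fa <-] [ga <-]; split; first exact: analytic_add.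
by apply: deriveD; exact: analytic_derivable.
Qed.

Lemma hasD_mul n v (f g : 'rV[R]_n -> R) a d e : hasD v f a d -> hasD v g a e ->
  hasD v (fun z => f z * g z) a (d * g a + f a * e).
Proof.
move=> [fa <-] [ga <-]; split; first exact: analytic_mul.
have -> : 'D_v (fun z => f z * g z) a = f a *: 'D_v g a + g a *: 'D_v f a.
  by apply: deriveM; exact: analytic_derivable.
by rewrite /GRing.scale/= addrC mulrC.
Qed.

Lemma hasD_opp n v (f : 'rV[R]_n -> R) a d : hasD v f a d ->
  hasD v (fun z => - f z) a (- d).
Proof.
move=> [fa <-]; split; first exact: analytic_opp.
by apply: deriveN; exact: analytic_derivable.
Qed.

Lemma hasD_sub n v (f g : 'rV[R]_n -> R) a d e : hasD v f a d -> hasD v g a e ->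
  hasD v (fun z => f z - g z) a (d - e).
Proof. by move=> fd gd; apply: hasD_add => //; exact: hasD_opp. Qed.

Lemma hasD_inv n v (f : 'rV[R]_n -> R) a d : f a != 0 -> hasD v f a d ->
  hasD v (fun z => (f z)^-1) a (- d / f a ^+ 2).
Proof.
move=> fa0 [fa <-]; split; first exact: analytic_inv.
have -> : 'D_v (fun z => (f z)^-1) a = - f a ^- 2 *: 'D_v f a.
  by apply: deriveV => //; exact: analytic_derivable.
by rewrite /GRing.scale/= mulNr mulNr mulrC.
Qed.

Lemma hasD_exp n v (f : 'rV[R]_n -> R) a d k : hasD v f a d ->
  hasD v (fun z => f z ^+ k.+1) a (k.+1%:R * f a ^+ k * d).
Proof.
move=> fd; elim: k => [|k IH]; first by rewrite expr0 !mul1r; under eq_fun do rewrite expr1.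
under eq_fun do rewrite exprS; apply: hasD_eq (hasD_mul fd IH) _.
by rewrite -[in RHS]natr1 !exprS; ring.
Qed.

Lemma hasD_sum n v (I : Type) (s : seq I) (f : I -> 'rV[R]_n -> R) a d :
  (forall i, hasD v (f i) a (d i)) ->
  hasD v (fun z => \sum_(i <- s) f i z) a (\sum_(i <- s) d i).
Proof.
move=> fd; elim: s => [|i s IH].
  by under eq_fun do rewrite big_nil; rewrite big_nil; exact: hasD_cst.
by under eq_fun do rewrite big_cons; rewrite big_cons; exact: hasD_add.
Qed.

(** Expanding f twice gives a quadratic expression with analytic coefficients, whose second
    derivative at a along u and u' is visibly symmetric. *)
Lemma analytic_deriveC n (f : 'rV[R]_n -> R) a v w : analytic_at f a ->
  'D_w ('D_v f) a = 'D_v ('D_w f) a.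
Proof.
move=> fa; have [F [Fan fF]] := analytic_taylor1 fa.
have /choice[G GP] : forall k, exists G : 'I_n -> 'rV[R]_n -> R,
    (forall l, analytic_at (G l) a) /\
    \forall z \near a, F k z = F k a + \sum_l (z 0 l - a 0 l) * G l z.
  by move=> k; exact: analytic_taylor1.
suff main u u' : 'D_u ('D_u' f) a =
    \sum_k (u' 0 k * (\sum_l u 0 l * G k l a) + u 0 k * (\sum_l u' 0 l * G k l a)).
  by rewrite !main; apply: eq_bigr => k _; rewrite addrC.
pose g (z : 'rV[R]_n) := f a + \sum_k (z 0 k - a 0 k) * (F k a + \sum_l (z 0 l - a 0 l) * G k l z).
have fg : \forall z \near a, f z = g z.
  have Gn : \forall z \near a, forall k, F k z = F k a + \sum_l (z 0 l - a 0 l) * G k l z.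
    apply: (@filter_forall _ _ (fun k z => F k z = F k a +
      \sum_l (z 0 l - a 0 l) * G k l z) (nbhs a)) => k.
    exact: (GP k).2.
  near=> z; rewrite (near fF z)// /g; congr (_ + _); apply: eq_bigr => k _.
  by congr (_ * _); move: k; near: z.
pose dg (z : 'rV[R]_n) := \sum_k (u' 0 k * (F k a + \sum_l (z 0 l - a 0 l) * G k l z) +
   (z 0 k - a 0 k) * \sum_l (u' 0 l * G k l z + (z 0 l - a 0 l) * 'D_u' (G k l) z)).
have Gz : \forall z \near a, forall k l, analytic_at (G k l) z.
  apply: (@filter_forall _ _ (fun k z => forall l, analytic_at (G k l) z) (nbhs a)) => k.
  apply: (@filter_forall _ _ (fun l z => analytic_at (G k l) z) (nbhs a)) => l.
  exact: analytic_near ((GP k).1 l).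
have D1 z : (forall k l, analytic_at (G k l) z) -> 'D_u' g z = dg z.
  move=> Gzz; suff : hasD u' g z (0 + dg z) by case=> _ ->; rewrite add0r.
  apply: hasD_add; first exact: hasD_cst.
  apply: hasD_sum => k; apply: hasD_eq.
    apply: hasD_mul.
      apply: hasD_sub; [exact: hasD_coord|exact: hasD_cst].
    apply: hasD_add; first exact: hasD_cst.
    apply: hasD_sum => l; apply: hasD_mul; last exact: hasD_derive.
    apply: hasD_sub; [exact: hasD_coord|exact: hasD_cst].
  rewrite subr0 add0r; congr (_ + _ * _); apply: eq_bigr => l _.
  by rewrite subr0.
have D2 : \forall z \near a, 'D_u' f z = dg z.
  have fgz : \forall z \near a, \forall y \near z, f y = g y by exact: (@near_join _ a).
  near=> z; rewrite -D1; last by near: z.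
  by apply: near_eq_derive; near: z.
rewrite (near_eq_derive u D2).
suff : hasD u dg a (\sum_k (u' 0 k * (\sum_l u 0 l * G k l a) + u 0 k * (\sum_l u' 0 l * G k l a))).
  by case.
apply: hasD_sum => k; apply: hasD_eq.
  apply: hasD_add; apply: hasD_mul.
  - exact: hasD_cst.
  - apply: hasD_add; first exact: hasD_cst.
    apply: hasD_sum => l; apply: hasD_mul; last exact: hasD_derive ((GP k).1 l).
    apply: hasD_sub; [exact: hasD_coord|exact: hasD_cst].
  - apply: hasD_sub; [exact: hasD_coord|exact: hasD_cst].
  - apply: hasD_sum => l; apply: hasD_add; apply: hasD_mul.
    + exact: hasD_cst.
    + exact: hasD_derive ((GP k).1 l).
    + apply: hasD_sub; [exact: hasD_coord|exact: hasD_cst].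
    + exact: hasD_derive (analytic_derive _ ((GP k).1 l)).
rewrite !mul0r !add0r subrr mul0r !addr0; congr (_ * _ + _ * _).
- by apply: eq_bigr => l _; rewrite !subr0 subrr mul0r addr0.
- by rewrite subr0.
- by apply: eq_bigr => l _; rewrite subrr mul0r addr0.
Unshelve. all: by end_near. Qed.

End DerivativeCalculus.

(** * The implicit function theorem *)

Section ImplicitFunction.
Variable R : realType.

Lemma maj_comp_pt n p (f : 'rV[R]_(n + 1) -> R) (Z : 'I_n -> 'rV[R]_p -> R) Y (M r s : R) :
  0 < r -> 0 <= s -> maj s f M -> (forall i, maj r (Z i) s) -> maj r Y s ->
  maj r (fun h => f (pt (\row_i Z i h) (Y h))) M.
Proof.
move=> r0 s0 fM Zs Ys.
pose G (i : 'I_(n + 1)) h : R := pt (\row_i Z i h) (Y h) 0 i.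
apply: (maj_ext _ (@maj_comp R _ p f G M r s r0 s0 fM _)) => [h _|].
  by congr f; apply/rowP => i; rewrite mxE.
apply: rV_split => [i|].
  by apply: maj_ext (Zs i) => h _; rewrite /G ptl mxE.
by apply: maj_ext Ys => h _; rewrite /G ptr.
Qed.

(* Newton's scheme g_(j+1) = phi (., g_j) converges in the algebra of the power
   series that converge absolutely on a small polydisc: the difference
   quotient Phi of phi in its last variable vanishes at the origin, so that it
   has norm at most 1/2 on a smaller polydisc. *)
Lemma fixed_point_majorant n (phi : 'rV[R]_(n + 1) -> R)
    (Phi : 'rV[R]_(n + 1 + 1) -> R) (r rho : R) :
  0 < r -> r <= rho -> maj rho Phi 2^-1 ->
  (forall z y e, `|z| <= rho -> `|y| <= rho -> `|e| <= rho ->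
     phi (pt z (y + e)) = phi (pt z y) + e * Phi (pt (pt z y) e)) ->
  maj r (fun z => phi (pt z 0)) (rho / 4) ->
  exists2 g, maj r g (rho / 2) & forall z, `|z| <= r ->
     phi (pt z (g z)) = g z /\
     forall y, `|y| <= rho / 2 -> phi (pt z y) = y -> y = g z.
Proof.
move=> r0 rrho PhiM phiE phi0; have rho0 : 0 < rho := lt_le_trans r0 rrho.
pose gs := fix gs j := if j is k.+1 then (fun z => phi (pt z (gs k z))) else (fun=> 0 : R).
pose d j z := gs j.+1 z - gs j z.
(* The sum of these terms is rho / 2: the iterates stay within rho / 2 and the steps within rho, so
   that the arguments of Phi remain in its polydisc. *)
pose v j : R := rho / 4 * 2^-1 ^+ j.
have vJ J : series v J = rho / 2 - rho / 2 * 2^-1 ^+ J.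
  rewrite /series/=; elim: J => [|J IH]; first by rewrite big_geq// expr0 mulr1 subrr.
  by rewrite big_nat_recr//= IH /v exprS; field.
have vJ' J : series v J <= rho / 2.
  by rewrite vJ gerBl mulr_ge0 ?exprn_ge0 ?divr_ge0 ?invr_ge0// ltW.
have v4 j : v j <= rho.
  rewrite /v -[leRHS]mulr1 ler_pM ?exprn_ge0 ?divr_ge0 ?invr_ge0 ?(ltW rho0)//.
    by rewrite ler_pdivrMr// ler_pMr// ler1n.
  by apply: exprn_ile1; rewrite ?invr_ge0// invf_le1// ler1n.
have half : rho / 2 <= rho by rewrite ler_pdivrMr// ler_pMr// ler1n.
have step j : maj r (gs j) (series v j) /\ maj r (d j) (v j).
  elim: j => [|j [gj dj]].
    split; first by rewrite /series/= big_geq//; exact: maj0.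
    by rewrite /v expr0 mulr1; apply: maj_ext phi0 => z _; rewrite /d/= subr0.
  have gj1 : maj r (gs j.+1) (series v j.+1).
    rewrite /series/= big_nat_recr//=; apply: maj_ext (maj_add gj dj) => z _.
    by rewrite /d addrC subrK.
  split=> //.
  have zr i : maj r (fun z : 'rV[R]_n => z 0 i) rho.
    exact: maj_le rrho (maj_coordinate _ (ltW r0)).
  have PhiG : maj r (fun z => Phi (pt (\row_i pt z (gs j z) 0 i) (d j z))) 2^-1.
    apply: (@maj_comp_pt _ _ Phi (fun i z => pt z (gs j z) 0 i) (d j) 2^-1 r rho
      r0 (ltW rho0) PhiM).
      apply: rV_split => [i|].
        by under eq_fun do rewrite ptl; exact: zr.
      under eq_fun do rewrite ptr; apply: maj_le gj; exact: le_trans (vJ' _) half.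
    exact: maj_le (v4 _) dj.
  have := maj_mul r0 dj PhiG.
  have -> : v j * 2^-1 = v j.+1 by rewrite /v exprSr mulrA.
  apply: maj_ext => z zr'.
  have -> : \row_i pt z (gs j z) 0 i = pt z (gs j z) by apply/rowP => i; rewrite mxE.
  have -> : d j.+1 z = phi (pt z (gs j z + d j z)) - phi (pt z (gs j z)).
    by rewrite /d/= addrCA subrr addr0.
  rewrite phiE; first by rewrite addrC addKr.
  - exact: le_trans zr' rrho.
  - by apply: le_trans (maj_bound zr' gj) _; exact: le_trans (vJ' _) half.
  - by apply: le_trans (maj_bound zr' dj) _; exact: v4.
have [g [gM cg]] := maj_series r0 (fun j => (step j).2) vJ'.
have seriesd z J : series (fun j => d j z) J = gs J z.
  by rewrite /series/= telescope_sumr// subr0.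
exists g => // z zr; have {}cg : (fun j => gs j z) @ \oo --> g z.
  have := cg z zr; rewrite (_ : series _ = fun j => gs j z)//.
  by apply/funext => J; rewrite seriesd.
have gz : `|g z| <= rho / 2 := maj_bound zr gM.
have contr y y' : `|y| <= rho / 2 -> `|y'| <= rho / 2 ->
    `|phi (pt z y) - phi (pt z y')| <= 2^-1 * `|y - y'|.
  move=> yr y'r.
  have yy' : `|y - y'| <= rho.
    by rewrite (le_trans (ler_normB _ _))// (le_trans (lerD yr y'r))// -splitr.
  have zrho := le_trans zr rrho; have y'rho := le_trans y'r half.
  have -> : phi (pt z y) = phi (pt z y') + (y - y') * Phi (pt (pt z y') (y - y')).
    by rewrite -phiE// addrC subrK.
  rewrite addrC addKr normrM mulrC ler_wpM2r//; apply: maj_bound PhiM.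
  by apply: pt_le => //; exact: pt_le.
have fix_g : phi (pt z (g z)) = g z.
  have c1 : (fun j => gs j.+1 z) @ \oo --> g z by move: cg; rewrite -cvg_shiftS.
  apply: (cvg_unique _ _ c1) => //.
  apply/cvgrPdist_le => e e0; move/cvgrPdist_le: cg => /(_ _ e0) [J _ HJ].
  exists J => // j /HJ/= gj; apply: le_trans (contr _ _ gz _) _.
    by apply: le_trans (maj_bound zr (step j).1) _; exact: vJ'.
  by rewrite -[leRHS]mul1r ler_pM// invf_le1// ler1n.
split=> // y yr yfix; apply/eqP; rewrite -subr_eq0 -normr_le0.
have := contr _ _ yr gz; rewrite yfix fix_g => H.
have : `|y - g z| - 2^-1 * `|y - g z| <= 0 by rewrite subr_le0.
have -> : `|y - g z| - 2^-1 * `|y - g z| = 2^-1 * `|y - g z| by field.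
by rewrite pmulr_rle0// invr_gt0.
Qed.

Lemma pt0_delta n (e : R) : pt 0 e = e *: (delta_mx 0 (rshift n ord0) : 'rV_(n + 1)).
Proof.
apply/rowP; apply: rV_split => [i|]; rewrite ?ptl ?ptr !mxE.
  by rewrite eq_lrshift andbF mulr0.
by rewrite !eqxx mulr1.
Qed.

Lemma baseD n (p q : 'rV[R]_(n + 1)) : base (p + q) = base p + base q.
Proof. by apply/rowP => i; rewrite !mxE. Qed.

Lemma fibD n (p q : 'rV[R]_(n + 1)) : fib (p + q) = fib p + fib q.
Proof. by rewrite !fibE mxE. Qed.

Lemma norm_base n (p : 'rV[R]_(n + 1)) : `|base p| <= `|p|.
Proof. by apply: norm_rV_le => // i; rewrite baseE le_coord_norm. Qed.

Lemma norm_fib n (p : 'rV[R]_(n + 1)) : `|fib p| <= `|p|.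
Proof. by rewrite fibE le_coord_norm. Qed.

Lemma analytic_cvg_line n (f : 'rV[R]_n -> R) a v : analytic_at f a ->
  (fun e : R => f (e *: v + a)) @ 0^' --> f a.
Proof.
move=> fa; apply: cvg_within_filter.
have cl := @line_cvg R n a v.
exact: cvg_comp cl (analytic_continuous fa).
Qed.

(** The zeros of K over z are the fixed points of y -> y - K / k, where k is the derivative of K
    along the fiber, frozen at p: Newton's method with constant slope. The last clause is local
    uniqueness. *)
Theorem implicit_function n (K : 'rV[R]_(n + 1) -> R) p :
  analytic_at K p -> K p = 0 -> pd (rshift n ord0) K p != 0 ->
  exists g, [/\ analytic_at g (base p), g (base p) = fib p,
    \forall z \near base p, K (pt z (g z)) = 0
    & \forall q \near p, K q = 0 -> fib q = g (base q)].
Proof.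
move=> Kp Kp0; set k := pd _ K p => k0.
pose phi q := fib q - k^-1 * K (p + q).
have aK q : analytic_at K (p + q) -> analytic_at (fun q => K (p + q)) q.
  move=> Kq; apply: (@analytic_comp _ _ _ K (fun q => p + q)) Kq _ => i.
  under eq_fun do rewrite mxE.
  by apply: analytic_add; [exact: analytic_cst|exact: analytic_coord].
have phia : analytic_at phi 0.
  apply: analytic_sub; first exact: analytic_fib.
  by apply: analytic_mul; [exact: analytic_cst|apply: aK; rewrite addr0].
have phi00 : phi 0 = 0.
  by rewrite /phi addr0 Kp0 mulr0 subr0 -pt0 fib_pt.
(* The extra variable of psi is the increment of y; Hadamard's lemma in this variable yields the
   difference quotient Phi. *)
pose psi (w : 'rV[R]_(n + 1 + 1)) := phi (pt (base (base w)) (fib (base w) + fib w)).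
have psia : analytic_at psi 0.
  apply: (@analytic_comp _ _ _ phi (fun w => pt (base (base w)) (fib (base w) + fib w))).
    by rewrite -!pt0 !base_pt !fib_pt addr0 pt0.
  apply: analytic_pt => [i|].
    under eq_fun do rewrite !baseE; exact: analytic_coord.
  apply: analytic_add; last exact: analytic_fib.
  by apply: analytic_base; exact: analytic_fib.
have /analytic_atP[s [M [s0 psiM]]] := psia.
have {}psiM : maj s psi M by apply: maj_ext psiM => h _; rewrite add0r.
have [Phi [PhiM psiE]] := hadamard_last s0 psiM.
have psipt z y e : psi (pt (pt z y) e) = phi (pt z (y + e)).
  by rewrite /psi !base_pt !fib_pt.
(* At the origin the quotient is the derivative of phi along the fiber, that is 1 - k / k. *)
have Phi0 : Phi 0 = 0.
  have Phi_an : analytic_at Phi 0 by apply: maj_analytic PhiM; rewrite normr0.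
  have c1 : (fun e => Phi (e *: delta_mx 0 (rshift (n + 1) ord0) + 0)) @ (0 : R)^' --> Phi 0.
    exact: analytic_cvg_line.
  have c2 : (fun e : R => 1 - k^-1 * (e^-1 *: (K (e *: delta_mx 0 (rshift n ord0) + p) - K p)))
      @ 0^' --> 1 - k^-1 * k.
    apply: cvgB; first exact: cvg_cst.
    by apply: cvgM; [exact: cvg_cst|exact: analytic_derivable].
  have e12 : \forall e \near (0 : R)^',
      1 - k^-1 * (e^-1 *: (K (e *: delta_mx 0 (rshift n ord0) + p) - K p)) =
      Phi (e *: delta_mx 0 (rshift (n + 1) ord0) + 0).
    near=> e.
    have e0 : e != 0 by near: e; exact: nbhs_dnbhs_neq.
    have es : `|e| <= s by near: e; exact: dnbhs0_le.
    rewrite addr0 -!pt0_delta Kp0 subr0.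
    have := psiE (pt 0 0) e; rewrite !psipt addr0 add0r !pt0 normr0 (ltW s0) phi00 add0r.
    move=> /(_ isT es); rewrite /phi fib_pt => H.
    apply: (mulfI e0); rewrite -H /GRing.scale/= [p + _]addrC; field.
    by rewrite e0 k0.
  have {}c2 : (fun e => Phi (e *: delta_mx 0 (rshift (n + 1) ord0) + 0)) @ (0 : R)^' -->
    1 - k^-1 * k by apply: cvg_trans c2; exact: near_eq_cvg.
  have := cvg_unique _ c1 c2; rewrite mulVf// subrr => ->//.
have half0 : 0 < 2^-1 :> R by rewrite invr_gt0.
have [rho /andP[rho0 rhos] /(_ rho)] := maj_small s0 PhiM Phi0 half0.
rewrite rho0 lexx => /(_ isT) {}PhiM.
have phiza : analytic_at (fun z => phi (pt z 0)) (0 : 'rV[R]_n).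
  apply: (@analytic_comp _ _ _ phi (fun z => pt z 0)); first by rewrite pt0.
  by apply: analytic_pt; [exact: analytic_map_id|exact: analytic_cst].
have /analytic_atP[t [N [t0 tN]]] := phiza.
have rho40 : 0 < rho / 4 by rewrite divr_gt0.
have [|r1 /andP[r10 _] r1P] := maj_small t0 tN _ rho40; first by rewrite addr0 pt0.
pose r := Num.min r1 rho.
have r0 : 0 < r by rewrite lt_min r10.
have rr1 : 0 < r <= r1 by rewrite r0 ge_min lexx.
have rrho : r <= rho by rewrite ge_min lexx orbT.
have phir : maj r (fun z => phi (pt z 0)) (rho / 4).
  by apply: maj_ext (r1P _ rr1) => h _; rewrite add0r.
have [z y e zr yr er|//|g gM gP] := @fixed_point_majorant n phi Phi r rho r0 rrho PhiM.
  rewrite -!psipt psiE ?psipt ?addr0//; last exact: le_trans er rhos.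
  by apply: pt_le; [exact: le_trans zr rhos|exact: le_trans yr rhos].
pose G z := fib p + g (z - base p).
have ppt z y : p + pt (z - base p) y = pt z (fib p + y).
  rewrite -{1}(pt_base_fib p) -ptD; congr pt; by rewrite addrC subrK.
exists G; split.
- apply: analytic_add; first exact: analytic_cst.
  apply: (@analytic_comp _ _ _ g (fun z => z - base p)).
    by rewrite subrr; apply: maj_analytic gM; rewrite normr0.
  move=> i; under eq_fun do rewrite !mxE.
  by apply: analytic_sub; [exact: analytic_coord|exact: analytic_cst].
- have [|_ /(_ 0)] := gP 0; first by rewrite normr0 ltW.
  rewrite normr0 pt0 phi00 divr_ge0 ?(ltW rho0)// => /(_ isT erefl) g0.
  by rewrite /G subrr -g0 addr0.
- apply: (near_ball0 r0) => h /ltW hr; have [gh _] := gP h hr.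
  rewrite /G -ppt [base p + h]addrC addrK; move: gh; rewrite /phi fib_pt.
  move=> /eqP; rewrite -subr_eq0 addrAC subrr add0r oppr_eq0 mulf_eq0 invr_eq0 (negbTE k0).
  by move/eqP.
- have m0 : 0 < Num.min r (rho / 2) by rewrite lt_min r0 divr_gt0.
  apply: (near_ball0 m0) => h; rewrite lt_min => /andP[/ltW hr /ltW hrho] Kq.
  have [_ /(_ (fib h))] := gP (base h) (le_trans (norm_base h) hr).
  rewrite (le_trans (norm_fib h) hrho) pt_base_fib /phi Kq mulr0 subr0 => /(_ isT erefl) gh.
  by rewrite /G baseD fibD [base p + _]addrC addrK gh.
Unshelve. all: by end_near. Qed.

Lemma ball_segment n (a z z' : 'rV[R]_n) e s : 0 <= s <= 1 ->
  ball a e z -> ball a e z' -> ball a e (s *: (z' - z) + z).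
Proof.
move=> /andP[s0 s1]; rewrite -!ball_normE/= => az az'.
rewrite (_ : a - _ = (1 - s) *: (a - z) + s *: (a - z')); last first.
  by apply/rowP => i; rewrite !mxE; ring.
apply: le_lt_trans (ler_normD _ _) _; rewrite !normrZ (ger0_norm s0) ger0_norm ?subr_ge0//.
have [<-|sn0] := eqVneq 0 s; first by rewrite subr0 mul1r mul0r addr0.
have sp : 0 < s by rewrite lt_neqAle sn0.
rewrite [ltRHS](_ : e = (1 - s) * e + s * e); last by ring.
by rewrite ler_ltD ?ltr_pM2l// ler_wpM2l ?subr_ge0// ltW.
Qed.

(** Two points of the ball that differ only in the coordinates of I are joined by a segment inside
    the ball, along which the derivative of f vanishes. *)
Lemma pd0_const n (f : 'rV[R]_n -> R) (a : 'rV[R]_n) (e : R) (I : pred 'I_n) :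
  (forall z, ball a e z -> analytic_at f z) ->
  (forall z i, ball a e z -> I i -> pd i f z = 0) ->
  forall z z', ball a e z -> ball a e z' -> (forall i, ~~ I i -> z 0 i = z' 0 i) ->
  f z = f z'.
Proof.
move=> fa f0 z z' az az' zz'.
pose w := z' - z; pose phi (s : R) := f (s *: w + z).
have dphi (s : R) : 0 <= s <= 1 -> is_derive s 1 phi 0.
  move=> s01; have bs := ball_segment s01 az az'.
  have Dw : 'D_w f (s *: w + z) = 0.
    rewrite derive_dir; last exact: fa.
    rewrite big1// => i _; case: (boolP (I i)) => Ii; first by rewrite f0 ?mulr0.
    by rewrite !mxE (zz' i Ii) subrr mul0r.
  have e1 : (fun h : R => h^-1 *: (phi (h *: 1 + s) - phi s)) =
     (fun h : R => h^-1 *: (f (h *: w + (s *: w + z)) - f (s *: w + z))).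
    by apply/funext => h; rewrite /phi addrA -scalerDl /GRing.scale/= mulr1.
  have cf : derivable f (s *: w + z) w by apply: analytic_derivable; exact: fa.
  apply: DeriveDef; first by rewrite /derivable/= e1.
  by rewrite /derive/= e1.
have [x||c _] := @MVT_segment R phi (fun=> 0) 0 1 ler01.
- rewrite in_itv/= => /andP[x0 x1]; apply: dphi; by rewrite !ltW.
- apply: derivable_within_continuous => x; rewrite in_itv/= => xi.
  by have ? := dphi x xi; exact: ex_derive.
by rewrite mul0r /phi scale0r scale1r add0r /w subrK => /eqP; rewrite subr_eq0 => /eqP.
Qed.

End ImplicitFunction.

(** * Jets of transformed graphs *)

Section Jacobians.
Variable R : realType.

Definition jac m n (G : 'rV[R]_m -> 'rV[R]_n) a v : 'rV[R]_n :=
  \row_k 'D_v (fun z => G z 0 k) a.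

Lemma analytic_pd n i (f : 'rV[R]_n -> R) a : analytic_at f a -> analytic_at (pd i f) a.
Proof. exact: analytic_derive. Qed.

Lemma derive_comp m n (g : 'rV[R]_n -> R) (G : 'rV[R]_m -> 'rV[R]_n) a v :
  analytic_at g (G a) -> analytic_map_at G a ->
  'D_v (fun z => g (G z)) a = 'D_(jac G a v) g (G a).
Proof.
move=> ga Ga; rewrite derive_chain// derive_dir//.
by apply: eq_bigr => k _; rewrite mxE mulrC.
Qed.

Lemma deriveDdir n (f : 'rV[R]_n -> R) a u v : analytic_at f a ->
  'D_(u + v) f a = 'D_u f a + 'D_v f a.
Proof.
move=> fa; rewrite !derive_dir// -big_split/=.
by apply: eq_bigr => k _; rewrite mxE mulrDl.
Qed.

Lemma deriveZdir n (f : 'rV[R]_n -> R) a (s : R) v : analytic_at f a ->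
  'D_(s *: v) f a = s * 'D_v f a.
Proof.
move=> fa; rewrite !derive_dir// mulr_sumr.
by apply: eq_bigr => k _; rewrite mxE mulrA.
Qed.

Lemma derive2Zdir n (f : 'rV[R]_n -> R) a (s : R) v : analytic_at f a ->
  'D_(s *: v) ('D_(s *: v) f) a = s ^+ 2 * 'D_v ('D_v f) a.
Proof.
move=> fa; rewrite deriveZdir; last exact: analytic_derive.
rewrite expr2 -mulrA; congr (_ * _).
have e : \forall z \near a, 'D_(s *: v) f z = s * 'D_v f z.
  by near=> z; apply: deriveZdir; near: z; exact: analytic_near.
rewrite (near_eq_derive v e).
suff : hasD v (fun z => s * 'D_v f z) a (0 * 'D_v f a + s * 'D_v ('D_v f) a).
  by case=> _ ->; rewrite mul0r add0r.
by apply: hasD_mul; [exact: hasD_cst|apply: hasD_derive; exact: analytic_derive].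
Unshelve. all: by end_near. Qed.

Lemma jacD m n (G : 'rV[R]_m -> 'rV[R]_n) a u v : analytic_map_at G a ->
  jac G a (u + v) = jac G a u + jac G a v.
Proof. by move=> Ga; apply/rowP => k; rewrite !mxE deriveDdir. Qed.

Lemma jacZ m n (G : 'rV[R]_m -> 'rV[R]_n) a (s : R) v : analytic_map_at G a ->
  jac G a (s *: v) = s *: jac G a v.
Proof. by move=> Ga; apply/rowP => k; rewrite !mxE deriveZdir. Qed.

Lemma jac_comp m n p (H : 'rV[R]_n -> 'rV[R]_p) (G : 'rV[R]_m -> 'rV[R]_n) a v :
  analytic_map_at H (G a) -> analytic_map_at G a ->
  jac (fun z => H (G z)) a v = jac H (G a) (jac G a v).
Proof.
move=> HGa Ga; apply/rowP => k; rewrite !mxE.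
exact: (derive_comp _ (HGa k) Ga).
Qed.

Lemma jac_id n (a v : 'rV[R]_n) : jac (fun z => z) a v = v.
Proof. by apply/rowP => k; rewrite mxE derive_coord. Qed.

Lemma jac_near m n (G H : 'rV[R]_m -> 'rV[R]_n) a v :
  (\forall z \near a, G z = H z) -> jac G a v = jac H a v.
Proof.
move=> GH; apply/rowP => k; rewrite !mxE; apply: near_eq_derive.
by near=> z; rewrite (near GH z).
Unshelve. all: by end_near. Qed.

Lemma analytic_map_comp m n p (H : 'rV[R]_n -> 'rV[R]_p) (G : 'rV[R]_m -> 'rV[R]_n) a :
  analytic_map_at H (G a) -> analytic_map_at G a ->
  analytic_map_at (fun z => H (G z)) a.
Proof. by move=> HGa Ga k; exact: (analytic_comp (HGa k) Ga). Qed.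

Lemma analytic_map_near m n (G H : 'rV[R]_m -> 'rV[R]_n) a :
  (\forall z \near a, G z = H z) -> analytic_map_at G a -> analytic_map_at H a.
Proof.
move=> GH Ga k; apply: analytic_ext (Ga k).
by near=> z; rewrite (near GH z).
Unshelve. all: by end_near. Qed.

Lemma analytic_map_base n (w : 'rV[R]_(n + 1)) : analytic_map_at (@base R n) w.
Proof. by move=> i; under eq_fun do rewrite baseE; exact: analytic_coord. Qed.

Lemma jac_pt m n (Z : 'rV[R]_m -> 'rV[R]_n) Y a v :
  jac (fun z => pt (Z z) (Y z)) a v = pt (jac Z a v) ('D_v Y a).
Proof.
apply/rowP; apply: rV_split => [i|]; rewrite mxE ?ptl ?ptr ?mxE.
  by under eq_fun do rewrite ptl.
by under eq_fun do rewrite ptr.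
Qed.

Lemma jac_base m n (G : 'rV[R]_m -> 'rV[R]_(n + 1)) a v :
  jac (fun z => base (G z)) a v = base (jac G a v).
Proof.
apply/rowP => i; rewrite baseE !mxE.
by under eq_fun do rewrite baseE.
Qed.

Lemma derive_fib m n (G : 'rV[R]_m -> 'rV[R]_(n + 1)) a v :
  'D_v (fun z => fib (G z)) a = fib (jac G a v).
Proof. by rewrite fibE mxE; under eq_fun do rewrite fibE. Qed.

Lemma derive2_comp m n (g : 'rV[R]_n -> R) (G : 'rV[R]_m -> 'rV[R]_n) a v :
  analytic_at g (G a) -> analytic_map_at G a ->
  'D_v ('D_v (fun z => g (G z))) a =
  'D_(jac G a v) ('D_(jac G a v) g) (G a) +
  \sum_k pd k g (G a) * 'D_v ('D_v (fun z => G z 0 k)) a.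
Proof.
move=> ga Ga; set c := jac G a v.
have cG : \forall z \near a, analytic_at g (G z).
  exact: (analytic_map_continuous Ga) (analytic_near ga).
have Gn : \forall z \near a, analytic_map_at G z.
  by apply: (@filter_forall _ _ (fun i z => analytic_at (fun z => G z 0 i) z) (nbhs a))
    => i; exact: analytic_near (Ga i).
have e1 : \forall z \near a, 'D_v (fun z => g (G z)) z =
    \sum_k pd k g (G z) * 'D_v (fun z => G z 0 k) z.
  by near=> z; apply: derive_chain; near: z.
rewrite (near_eq_derive v e1).
have : hasD v (fun z => \sum_k pd k g (G z) * 'D_v (fun z => G z 0 k) z) a
  (\sum_k ('D_c (pd k g) (G a) * c 0 k + pd k g (G a) * 'D_v ('D_v (fun z => G z 0 k)) a)).
  apply: hasD_sum => k; apply: hasD_eq.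
    apply: hasD_mul; last by apply: hasD_derive; apply: analytic_derive; exact: Ga.
    by apply: hasD_derive; apply: (@analytic_comp _ _ _ (pd k g) G) => //; exact: analytic_pd.
  have -> : 'D_v (fun z => pd k g (G z)) a = 'D_c (pd k g) (G a).
    by apply: derive_comp => //; exact: analytic_pd.
  by rewrite [c 0 k]mxE.
case=> _ ->; rewrite big_split/=; congr (_ + _).
have e2 : \forall z \near G a, 'D_c g z = \sum_k c 0 k * pd k g z.
  by near=> z; apply: derive_dir; near: z; exact: analytic_near.
rewrite (near_eq_derive c e2).
suff : hasD c (fun z => \sum_k c 0 k * pd k g z) (G a)
    (\sum_k (0 * pd k g (G a) + c 0 k * 'D_c (pd k g) (G a))).
  by case=> _ ->; apply: eq_bigr => k _; rewrite mul0r add0r mulrC.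
apply: hasD_sum => k; apply: hasD_mul; first exact: hasD_cst.
by apply: hasD_derive; exact: analytic_pd.
Unshelve. all: by end_near. Qed.

End Jacobians.

Section PointTransformationCalculus.
Variables (R : realType) (m : nat).
Implicit Types (F : ptrans R m).

Lemma point_transformation_inv F : point_transformation F -> point_transformation (pt_inv F).
Proof. by case=> -[oD oC] dF cF aF aG; split. Qed.

Lemma fwdK_near F q : point_transformation F -> dom F q ->
  \forall p \near q, dom F p /\ bwd F (fwd F p) = p.
Proof.
move=> [[oD _] dF _ _ _] Fq; near=> p.
have Fp : dom F p by near: p; exact: open_nbhs_nbhs.
by split=> //; exact: (dF p Fp).2.
Unshelve. all: by end_near. Qed.

Lemma bwd_jacK F q v : point_transformation F -> dom F q ->
  jac (bwd F) (fwd F q) (jac (fwd F) q v) = v.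
Proof.
move=> PF Fq; have [_ dF _ aF aG] := PF.
rewrite -jac_comp; [|by apply: aG; exact: (dF _ Fq).1|exact: aF].
rewrite -[RHS](jac_id q v); apply: jac_near.
by near=> p; have [] := near (fwdK_near PF Fq) p.
Unshelve. all: by end_near. Qed.

Lemma fwd_jacK F q v : point_transformation F -> dom F q ->
  jac (fwd F) q (jac (bwd F) (fwd F q) v) = v.
Proof.
move=> PF Fq; have [_ dF _ _ _] := PF; have [Cq qK] := dF _ Fq.
by have := bwd_jacK v (point_transformation_inv PF) Cq; rewrite /= qK.
Qed.

End PointTransformationCalculus.


(** * Images of graphs and their derivatives *)

Section GraphTransform.
Variables (R : realType) (n : nat).
Implicit Types (F : ptrans R (n + 1)) (f g : 'rV[R]_n -> R).

Definition vert : 'rV[R]_(n + 1) := pt 0 1.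

Lemma vertE : vert = delta_mx 0 (rshift n ord0).
Proof. by rewrite /vert pt0_delta scale1r. Qed.

(* The image of the graph of f under F is transversal to the fibers. *)
Definition graph_transversal F q f :=
  fib (jac (bwd F) (fwd F q) vert) - 'D_(base (jac (bwd F) (fwd F q) vert)) f (base q) != 0.

(** The image of the graph of f is the zero set of K = (y - f) o F^-1. The derivative of K along the
    fiber is the transversality factor, so the implicit function theorem presents this image as a
    graph. The two final clauses say that F and its inverse carry each graph into the other. *)
Lemma graph_transform F q f : point_transformation F -> dom F q ->
  analytic_at f (base q) -> f (base q) = fib q -> graph_transversal F q f ->
  exists g, [/\ analytic_at g (base (fwd F q)), g (base (fwd F q)) = fib (fwd F q),
    \forall z \near base q, let p := fwd F (pt z (f z)) in fib p = g (base p)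
    & \forall z \near base (fwd F q), cod F (pt z (g z)) /\
        let p := bwd F (pt z (g z)) in fib p = f (base p)].
Proof.
move=> PF Fq fa fq tr.
have [[oD oC] dF cF aF aG] := PF; have [Cq qK] := dF _ Fq.
have aGq := aG _ Cq.
pose K p := fib (bwd F p) - f (base (bwd F p)).
have fGa : analytic_at (fun p => f (base (bwd F p))) (fwd F q).
  apply: (@analytic_comp _ _ _ f (fun p => base (bwd F p))); first by rewrite qK.
  by move=> i; under eq_fun do rewrite baseE; exact: aGq.
have yGa : analytic_at (fun p => fib (bwd F p)) (fwd F q).
  by under eq_fun do rewrite fibE; exact: aGq.
have Ka : analytic_at K (fwd F q) by apply: analytic_sub.
have K0 : K (fwd F q) = 0 by rewrite /K qK fq subrr.
have pK : pd (rshift n ord0) K (fwd F q) != 0.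
  rewrite /pd -vertE; have [_ ->] := hasD_sub (hasD_derive vert yGa) (hasD_derive vert fGa).
  rewrite derive_fib.
  have -> : 'D_vert (fun p => f (base (bwd F p))) (fwd F q) =
      'D_(base (jac (bwd F) (fwd F q) vert)) f (base (bwd F (fwd F q))).
    rewrite -jac_base; apply: derive_comp; first by rewrite qK.
    by move=> i; under eq_fun do rewrite baseE; exact: aGq.
  by rewrite qK.
have [g [ga gq gK gU]] := implicit_function Ka K0 pK.
exists g; split=> //.
  have cl : (fun z => pt z (f z)) @ base q --> q.
    rewrite -{2}(pt_base_fib q) -fq; apply: analytic_map_continuous.
    by apply: analytic_pt => //; exact: analytic_map_id.
  have cF1 : fwd F @ q --> fwd F q by apply: analytic_map_continuous; exact: aF.
  have cc : (fun z => fwd F (pt z (f z))) @ base q --> fwd F q by exact: cvg_comp cl cF1.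
  have N1 : \forall z \near base q, dom F (pt z (f z)).
    by apply: cl; exact: open_nbhs_nbhs.
  have N2 : \forall z \near base q, K (fwd F (pt z (f z))) = 0 ->
      fib (fwd F (pt z (f z))) = g (base (fwd F (pt z (f z)))) by exact: (cc _ gU).
  near=> z; apply: (near N2 z) => //.
  rewrite /K (dF _ _).2; last by near: z.
  by rewrite base_pt fib_pt subrr.
have cg : (fun z => pt z (g z)) @ base (fwd F q) --> fwd F q.
  rewrite -{2}(pt_base_fib (fwd F q)) -gq; apply: analytic_map_continuous.
  by apply: analytic_pt => //; exact: analytic_map_id.
have N3 : \forall z \near base (fwd F q), cod F (pt z (g z)).
  by apply: cg; exact: open_nbhs_nbhs.
near=> z; split; first by near: z.
apply/eqP; rewrite -subr_eq0; apply/eqP; rewrite -/(K (pt z (g z))).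
by near: z.
Unshelve. all: by end_near. Qed.

Lemma graph_jac F q f v : point_transformation F -> dom F q ->
  analytic_at f (base q) -> f (base q) = fib q ->
  jac (fun z => fwd F (pt z (f z))) (base q) v = jac (fwd F) q (pt v ('D_v f (base q))).
Proof.
move=> PF Fq fa fq; have [_ _ _ aF _] := PF.
rewrite (@jac_comp _ _ _ _ (fwd F) (fun z => pt z (f z))).
- by rewrite jac_pt jac_id fq pt_base_fib.
- by rewrite fq pt_base_fib; exact: aF.
- by apply: analytic_pt => //; exact: analytic_map_id.
Qed.

(** F^-1 parametrizes the graph of f by the base of g, so every vector tangent to the graph of g is
    the image of one tangent to the graph of f. This gives access to directions prescribed on the
    side of g, such as e'. *)
Lemma graph_jac_onto F q f g c : point_transformation F -> dom F q ->
  analytic_at f (base q) -> f (base q) = fib q ->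
  analytic_at g (base (fwd F q)) -> g (base (fwd F q)) = fib (fwd F q) ->
  (\forall z \near base (fwd F q), cod F (pt z (g z)) /\
        let p := bwd F (pt z (g z)) in fib p = f (base p)) ->
  exists v, jac (fwd F) q (pt v ('D_v f (base q))) = pt c ('D_c g (base (fwd F q))).
Proof.
move=> PF Fq fa fq ga gq gn.
have PG := point_transformation_inv PF.
have [[oD oC] dF cF aF aG] := PF; have [Cq qK] := dF _ Fq.
pose zeta z := base (bwd F (pt z (g z))).
have gpt : pt (base (fwd F q)) (g (base (fwd F q))) = fwd F q by rewrite gq pt_base_fib.
have zetaq : zeta (base (fwd F q)) = base q by rewrite /zeta gpt qK.
have pta : analytic_map_at (fun z => pt z (g z)) (base (fwd F q)).
  by apply: analytic_pt => //; exact: analytic_map_id.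
have zetaa : analytic_map_at zeta (base (fwd F q)).
  apply: (analytic_map_comp (H := fun p => base (bwd F p)) _ pta); rewrite gpt.
  by apply: (analytic_map_comp (H := @base R n)); [exact: analytic_map_base|exact: aG].
exists (jac zeta (base (fwd F q)) c).
rewrite -graph_jac//.
rewrite -{1}zetaq -(@jac_comp _ _ _ _ (fun z => fwd F (pt z (f z))) zeta)//; last first.
  rewrite zetaq; apply: (analytic_map_comp (H := fwd F)).
    by rewrite fq pt_base_fib; exact: aF.
  by apply: analytic_pt => //; exact: analytic_map_id.
transitivity (jac (fun z => pt z (g z)) (base (fwd F q)) c); last by rewrite jac_pt jac_id.
apply: jac_near.
near=> z.
have [Cz zf] : cod F (pt z (g z)) /\ fib (bwd F (pt z (g z))) = f (base (bwd F (pt z (g z)))).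
  by near: z.
rewrite /zeta -zf pt_base_fib; exact: (cF _ Cz).2.
Unshelve. all: by end_near. Qed.

Lemma graph_first_order F q f g v : point_transformation F -> dom F q ->
  analytic_at f (base q) -> f (base q) = fib q ->
  analytic_at g (base (fwd F q)) ->
  (\forall z \near base q, let p := fwd F (pt z (f z)) in fib p = g (base p)) ->
  let u := jac (fwd F) q (pt v ('D_v f (base q))) in
  'D_(base u) g (base (fwd F q)) = fib u.
Proof.
move=> PF Fq fa fq ga fg u.
have [[oD oC] dF cF aF aG] := PF.
have pta : analytic_map_at (fun z => fwd F (pt z (f z))) (base q).
  apply: (analytic_map_comp (H := fwd F)).
    by rewrite fq pt_base_fib; exact: aF.
  by apply: analytic_pt => //; exact: analytic_map_id.
have e : 'D_v (fun z => fib (fwd F (pt z (f z)))) (base q) =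
  'D_v (fun z => g (base (fwd F (pt z (f z))))) (base q) by exact: near_eq_derive.
rewrite (derive_fib (fun z => fwd F (pt z (f z)))) graph_jac// -/u in e.
have ptq : pt (base q) (f (base q)) = q by rewrite fq pt_base_fib.
rewrite e; have -> : 'D_v (fun z => g (base (fwd F (pt z (f z))))) (base q) =
    'D_(jac (fun z => base (fwd F (pt z (f z)))) (base q) v) g (base (fwd F q)).
  rewrite -{2}ptq; apply: derive_comp; first by rewrite ptq.
  by apply: (analytic_map_comp (H := @base R n)); [exact: analytic_map_base|].
by rewrite (jac_base (fun z => fwd F (pt z (f z)))) graph_jac.
Qed.

(** The relation y~ = g(z~) differentiated twice along the graph of f: [Q i] is the second
    derivative of the component i of F along this graph, and the second derivative of f enters it
    only through the image of the vertical vector. *)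
Lemma graph_second_order F q f g v : point_transformation F -> dom F q ->
  analytic_at f (base q) -> f (base q) = fib q ->
  analytic_at g (base (fwd F q)) ->
  (\forall z \near base q, let p := fwd F (pt z (f z)) in fib p = g (base p)) ->
  let w := pt v ('D_v f (base q)) in let c := base (jac (fwd F) q w) in
  let Q i := 'D_w ('D_w (fun p => fwd F p 0 i)) q +
    jac (fwd F) q vert 0 i * 'D_v ('D_v f) (base q) in
  'D_c ('D_c g) (base (fwd F q)) +
   \sum_(k < n) pd k g (base (fwd F q)) * Q (lshift 1 k) = Q (rshift n ord0).
Proof.
move=> PF Fq fa fq ga fg w c Q.
have [[oD oC] dF cF aF aG] := PF.
have pfa : analytic_map_at (fun z => pt z (f z)) (base q).
  by apply: analytic_pt => //; exact: analytic_map_id.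
have ptq : pt (base q) (f (base q)) = q by rewrite fq pt_base_fib.
have pta : analytic_map_at (fun z => fwd F (pt z (f z))) (base q).
  by apply: (analytic_map_comp (H := fwd F)); rewrite ?ptq//; exact: aF.
have QE i : 'D_v ('D_v (fun z => fwd F (pt z (f z)) 0 i)) (base q) = Q i.
  rewrite (@derive2_comp _ _ _ (fun p => fwd F p 0 i) (fun z => pt z (f z)))//; last first.
    by rewrite ptq; exact: aF.
  rewrite jac_pt jac_id ptq -/w /Q; congr (_ + _).
  have D2l k : 'D_v ('D_v (fun z => pt z (f z) 0 (lshift 1 k))) (base q) = 0.
    have -> : (fun z => pt z (f z) 0 (lshift 1 k)) = (fun z => z 0 k).
      by apply/funext => y; rewrite ptl.
    have -> : 'D_v (fun z : 'rV[R]_n => z 0 k) = cst (v 0 k).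
      by apply/funext => z; rewrite derive_coord.
    by rewrite derive_cst.
  have D2r : 'D_v ('D_v (fun z => pt z (f z) 0 (rshift n ord0))) (base q) =
      'D_v ('D_v f) (base q).
    have -> // : (fun z => pt z (f z) 0 (rshift n ord0)) = f.
    by apply/funext => y; rewrite ptr.
  rewrite big_split_ord/= big1 ?add0r => [|k _]; last by rewrite D2l mulr0.
  by rewrite big_ord1 D2r vertE mxE.
rewrite -QE.
have fg' : \forall z \near base q, \forall z \near z,
   let p := fwd F (pt z (f z)) in fib p = g (base p) by exact: near_join.
have -> : 'D_v ('D_v (fun z => fwd F (pt z (f z)) 0 (rshift n ord0))) (base q) =
    'D_v ('D_v (fun z => g (base (fwd F (pt z (f z)))))) (base q).
  apply: near_eq_derive; near=> z; apply: near_eq_derive.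
  by near=> y; rewrite -fibE; near: y; near: z.
rewrite (@derive2_comp _ _ _ g (fun z => base (fwd F (pt z (f z))))).
- rewrite jac_base graph_jac// ptq; congr (_ + _); apply: eq_bigr => k _; congr (_ * _).
  rewrite -QE.
  have -> // : (fun z => fwd F (pt z (f z)) 0 (lshift 1 k)) =
    (fun z => base (fwd F (pt z (f z))) 0 k) by apply/funext => z; rewrite baseE.
- by rewrite ptq.
- by apply: (analytic_map_comp (H := @base R n)); [exact: analytic_map_base|].
Unshelve. all: by end_near. Qed.

End GraphTransform.

(** * Principal symbols *)

Section Symbols.
Variables (R : realType) (n : nat).
Implicit Types (F : ptrans R (n + 1)) (f g : 'rV[R]_n -> R) (E : diff_eq R n).

Definition dot (a b : 'rV[R]_n) : R := \sum_i a 0 i * b 0 i.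

Lemma dotDl a b c : dot (a + b) c = dot a c + dot b c.
Proof. by rewrite /dot -big_split/=; apply: eq_bigr => i _; rewrite mxE mulrDl. Qed.

Lemma dotZl s a c : dot (s *: a) c = s * dot a c.
Proof. by rewrite /dot mulr_sumr; apply: eq_bigr => i _; rewrite mxE mulrA. Qed.

Lemma dot_delta i c : dot (delta_mx 0 i) c = c 0 i.
Proof.
rewrite /dot (bigD1 i)//= mxE !eqxx mul1r big1 ?addr0// => j ji.
by rewrite mxE eqxx (negbTE ji) mul0r.
Qed.

Lemma dotC a b : dot a b = dot b a.
Proof. by apply: eq_bigr => i _; rewrite mulrC. Qed.

Definition affine (z a : 'rV[R]_n) (y : 'rV[R]_n) : R := \sum_i a 0 i * (y 0 i - z 0 i).

Lemma affine_hasD z a v y : hasD v (affine z a) y (dot a v).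
Proof.
apply: hasD_eq.
  apply: hasD_sum => i; apply: hasD_mul; first exact: hasD_cst.
  by apply: hasD_sub; [exact: hasD_coord|exact: hasD_cst].
by apply: eq_bigr => i _; rewrite mul0r add0r subr0.
Qed.

Lemma affine0 z a : affine z a z = 0.
Proof. by rewrite /affine big1// => i _; rewrite subrr mulr0. Qed.

(** The value at z is kept, the gradient there increases by b and the Hessian by 2 a (x) a: a way to
    move among the jets that satisfy a given equation. *)
Definition perturb f z (b a : 'rV[R]_n) (y : 'rV[R]_n) : R :=
  f y + (affine z b y + affine z a y * affine z a y).

Lemma perturb_hasD f z b a v y : analytic_at f y ->
  hasD v (perturb f z b a) y ('D_v f y + (dot b v + (2 * dot a v * affine z a y))).
Proof.
move=> fy; apply: hasD_eq.
  apply: hasD_add; first exact: hasD_derive.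
  by apply: hasD_add; [exact: affine_hasD|apply: hasD_mul; exact: affine_hasD].
by ring.
Qed.

Lemma perturb_analytic f z b a y : analytic_at f y -> analytic_at (perturb f z b a) y.
Proof. by move=> fy; exact: (perturb_hasD z b a 0 fy).1. Qed.

Lemma perturbE f z b a : perturb f z b a z = f z.
Proof. by rewrite /perturb !affine0 mul0r !addr0. Qed.

Lemma perturb_D f z b a v : analytic_at f z ->
  'D_v (perturb f z b a) z = 'D_v f z + dot b v.
Proof. by move=> fz; rewrite (perturb_hasD z b a v fz).2 affine0 mulr0 addr0. Qed.

Lemma perturb_D2 f z b a v : analytic_at f z ->
  'D_v ('D_v (perturb f z b a)) z = 'D_v ('D_v f) z + 2 * dot a v ^+ 2.
Proof.
move=> fz.
have e : \forall y \near z, 'D_v (perturb f z b a) y =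
    'D_v f y + (dot b v + (2 * dot a v * affine z a y)).
  near=> y; have fy : analytic_at f y by near: y; exact: analytic_near.
  by rewrite (perturb_hasD z b a v fy).2.
rewrite (near_eq_derive v e).
have [_ ->] : hasD v (fun y => 'D_v f y + (dot b v + (2 * dot a v * affine z a y))) z
    ('D_v ('D_v f) z + (0 + (0 * affine z a z + 2 * dot a v * dot a v))).
  apply: hasD_add; first by apply: hasD_derive; exact: analytic_derive.
  apply: hasD_add; first exact: hasD_cst.
  by apply: hasD_mul; [exact: hasD_cst|exact: affine_hasD].
by ring.
Unshelve. all: by end_near. Qed.

(* Over (z, y), the equation E is quasi-linear: it reads
   f_t = A * Hess f (e, e) + (terms depending on the other first derivatives). *)
Definition evolution_symbol E z (y : R) t A e : Prop :=
  forall f f', analytic_at f z -> analytic_at f' z -> f z = y -> f' z = y ->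
    (forall i, i != t -> pd i f' z = pd i f z) -> E f z ->
    (E f' z <-> pd t f' z - pd t f z = A * ('D_e ('D_e f') z - 'D_e ('D_e f) z)).

(** The 1-jet of a function satisfying E at the point is free, since second derivatives can be
    adjusted; gradients can thus be chosen generically. *)
Definition solvable E z (y : R) : Prop := forall om : 'rV[R]_n,
  exists f, [/\ analytic_at f z, f z = y, forall i, pd i f z = om 0 i & E f z].

Variables (F : ptrans R (n + 1)) (q : 'rV[R]_(n + 1)) (E E' : diff_eq R n).
Hypotheses (PF : point_transformation F) (Fq : dom F q) (FE : maps_equation F E E' q).
Variables (t x : 'I_n) (A A' : R) (e e' : 'rV[R]_n).
Hypotheses (A0 : A != 0) (A'0 : A' != 0) (tx : t != x).
Hypotheses (et : e 0 t = 0) (ex : e 0 x = 1) (e't : e' 0 t = 0) (e'x : e' 0 x = 1).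
Hypothesis symE : evolution_symbol E (base q) (fib q) t A e.
Hypothesis symE' : evolution_symbol E' (base (fwd F q)) (fib (fwd F q)) t A' e'.
Hypothesis solvE : solvable E (base q) (fib q).

Let d := jac (fwd F) q (vert R n).
Let w := jac (bwd F) (fwd F q) (vert R n).

Let aF : analytic_map_at (fwd F) q.
Proof. by have [_ _ _ aF _] := PF; exact: aF. Qed.

Lemma jac_dot f v : analytic_at f (base q) ->
  'D_v f (base q) = dot (\row_i pd i f (base q)) v.
Proof. by move=> fa; rewrite derive_dir//; apply: eq_bigr => i _; rewrite mxE mulrC. Qed.

Lemma jac_inj u v : jac (fwd F) q u = jac (fwd F) q v -> u = v.
Proof. by move=> uv; rewrite -(bwd_jacK u PF Fq) uv bwd_jacK. Qed.

Lemma vert_pt v s : pt v s = pt v 0 + s *: vert R n.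
Proof. by rewrite -ptZ scaler0 mulr1 -ptD addr0 add0r. Qed.

Lemma base_jac_pt v s : base (jac (fwd F) q (pt v s)) =
  base (jac (fwd F) q (pt v 0)) + s *: base d.
Proof. by rewrite vert_pt jacD// jacZ// baseD; congr (_ + _); apply/rowP => i; rewrite !mxE. Qed.

Section Pair.
Variables (f g : 'rV[R]_n -> R).
Hypotheses (fa : analytic_at f (base q)) (fq : f (base q) = fib q).
Hypotheses (ga : analytic_at g (base (fwd F q))) (gq : g (base (fwd F q)) = fib (fwd F q)).
Hypothesis fg : \forall z \near base q, let p := fwd F (pt z (f z)) in fib p = g (base p).
Hypothesis gf : \forall z \near base (fwd F q), cod F (pt z (g z)) /\
        let p := bwd F (pt z (g z)) in fib p = f (base p).

(** Otherwise the image of the vertical vector would be tangent to the graph of g, and the vertical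
    vector itself tangent to the graph of f. *)
Lemma fiber_factor_neq0 : fib d - 'D_(base d) g (base (fwd F q)) != 0.
Proof.
apply/negP => /eqP/eqP; rewrite subr_eq0 => /eqP dg.
have [v] := graph_jac_onto (base d) PF Fq fa fq ga gq gf.
rewrite -dg pt_base_fib => /jac_inj/pt_inj[-> /eqP].
by rewrite derive0 eq_sym oner_eq0.
Qed.

End Pair.

Definition hessF v s i := 'D_(pt v s) ('D_(pt v s) (fun p => fwd F p 0 i)) q.

Lemma subr0_eq' (a b : R) : a = b -> a - b = 0.
Proof. by move=> ->; rewrite subrr. Qed.

Lemma variation_algebra (P dk p p' : 'I_n -> R) (Py dy H H' D D' : R) :
  H + \sum_k p k * (P k + dk k * D) = Py + dy * D ->
  H' + \sum_k p' k * (P k + dk k * D') = Py + dy * D' ->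
  (forall k, p' k = p k \/ (P k = 0 /\ dk k = 0)) ->
  H' - H = (dy - \sum_k dk k * p k) * (D' - D).
Proof.
move=> e1 e2 pk.
have e3 : \sum_k p' k * (P k + dk k * D') =
    \sum_k p k * (P k + dk k * D) + (\sum_k dk k * p k) * (D' - D).
  rewrite mulr_suml -big_split/=; apply: eq_bigr => k _.
  by case: (pk k) => [->|[-> ->]]; ring.
move: e2; rewrite e3 => e2.
by rewrite mulrBl; lra.
Qed.

(** Two functions with the same value and the same derivative along v are compared: in the
    second-order relation everything cancels but the second derivatives. The alternative in the last
    hypothesis lets the time derivative of g vary when the time component of F contributes nothing
    to the second order along v. *)
Lemma hessian_variation f g f' g' v s :
  analytic_at f (base q) -> f (base q) = fib q -> analytic_at g (base (fwd F q)) ->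
  analytic_at f' (base q) -> f' (base q) = fib q -> analytic_at g' (base (fwd F q)) ->
  (\forall z \near base q, let p := fwd F (pt z (f z)) in fib p = g (base p)) ->
  (\forall z \near base q, let p := fwd F (pt z (f' z)) in fib p = g' (base p)) ->
  'D_v f (base q) = s -> 'D_v f' (base q) = s ->
  (forall k, pd k g' (base (fwd F q)) = pd k g (base (fwd F q)) \/
     (hessF v s (lshift 1 k) = 0 /\ d 0 (lshift 1 k) = 0)) ->
  let c := base (jac (fwd F) q (pt v s)) in
  'D_c ('D_c g') (base (fwd F q)) - 'D_c ('D_c g) (base (fwd F q)) =
  (fib d - 'D_(base d) g (base (fwd F q))) *
  ('D_v ('D_v f') (base q) - 'D_v ('D_v f) (base q)).
Proof.
move=> fa fq ga f'a f'q g'a fg fg' Df Df' pk c.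
have := graph_second_order v PF Fq fa fq ga fg; rewrite Df => e1.
have := graph_second_order v PF Fq f'a f'q g'a fg'; rewrite Df' => e2.
rewrite (derive_dir (base d) ga) fibE.
have -> : \sum_k base d 0 k * pd k g (base (fwd F q)) =
  \sum_k d 0 (lshift 1 k) * pd k g (base (fwd F q)).
  by apply: eq_bigr => k _; rewrite baseE.
exact: (variation_algebra e1 e2 pk).
Qed.

(** Let v be the base part of the vector tangent to the graph of f that F sends over e'. A covector
    that vanishes on e also vanishes on v, for its square can be added to f without leaving the
    equations; hence v is a multiple of e. *)
Lemma symbol_direction (om : 'rV[R]_n) : fib w - dot om (base w) != 0 ->
  exists2 m, m != 0 & base (jac (fwd F) q (pt e (dot om e))) = m *: e'.
Proof.
move=> trom.
have [f [fa fq fom fE]] := solvE om.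
have Df v : 'D_v f (base q) = dot om v.
  by rewrite jac_dot//; apply: eq_bigr => i _; rewrite mxE fom.
have trf : graph_transversal F q f by rewrite /graph_transversal Df.
have [g [ga gq fg gf]] := graph_transform PF Fq fa fq trf.
have [v] := graph_jac_onto e' PF Fq fa fq ga gq gf.
rewrite Df => vE.
have av0 a : dot a e = 0 -> dot a v = 0.
  move=> ae; pose f' := perturb f (base q) 0 a.
  have f'a : analytic_at f' (base q) by exact: perturb_analytic.
  have f'q : f' (base q) = fib q by rewrite /f' perturbE.
  have Df' u : 'D_u f' (base q) = dot om u.
    by rewrite perturb_D// Df /dot [X in _ + X]big1 ?addr0// => i _; rewrite mxE mul0r.
  have trf' : graph_transversal F q f' by rewrite /graph_transversal Df'.
  have [g' [g'a g'q fg' gf']] := graph_transform PF Fq f'a f'q trf'.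
  have Eg : E' g (base (fwd F q)) by apply/(FE fa ga fq fg).
  have Ef' : E f' (base q).
    apply/(symE fa f'a fq f'q _ fE); first by move=> i _; rewrite /pd Df Df'.
    by rewrite /pd Df Df' subrr perturb_D2// ae expr0n mulr0 addr0 subrr mulr0.
  have Eg' : E' g' (base (fwd F q)) by apply/(FE f'a g'a f'q fg').
  (* f and f' have the same gradient, hence so have g and g'; the equation E' then leaves no freedom
     to the second derivative along e'. *)
  have Dg c : 'D_c g' (base (fwd F q)) = 'D_c g (base (fwd F q)).
    have [u uE] := graph_jac_onto c PF Fq fa fq ga gq gf.
    have /= := graph_first_order u PF Fq f'a f'q g'a fg'.
    by rewrite Df' -Df uE base_pt fib_pt.
  have D2g : 'D_e' ('D_e' g') (base (fwd F q)) = 'D_e' ('D_e' g) (base (fwd F q)).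
    have /iffLR := symE' ga g'a gq g'q (fun i _ => Dg _) Eg.
    move=> /(_ Eg'); rewrite [X in X - _](Dg _) subrr => /esym/eqP.
    by rewrite mulf_eq0 (negbTE A'0) subr_eq0 => /eqP.
  have vs : 'D_v f (base q) = dot om v by [].
  have vs' : 'D_v f' (base q) = dot om v by [].
  have H := hessian_variation fa fq ga f'a f'q g'a fg fg' vs vs' (fun k => or_introl (Dg _)).
  rewrite /= vE base_pt in H.
  have L0 := subr0_eq' D2g.
  have RD : 'D_v ('D_v f') (base q) - 'D_v ('D_v f) (base q) = 2 * dot a v ^+ 2.
    by apply/eqP; rewrite subr_eq addrC; apply/eqP; exact: perturb_D2.
  have := etrans (esym L0) (etrans H (congr1 ( *%R _) RD)).
  move=> /esym/eqP; rewrite mulf_eq0 (negbTE (fiber_factor_neq0 fa fq ga gq gf)).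
  by rewrite mulf_eq0 pnatr_eq0/= expf_eq0/= => /eqP.
have vx : v = v 0 x *: e.
  apply/rowP => j; rewrite mxE.
  have := av0 (delta_mx 0 j - e 0 j *: delta_mx 0 x).
  rewrite -scaleNr !dotDl !dotZl !dot_delta ex mulr1 subrr => /(_ erefl) /eqP.
  by rewrite mulNr subr_eq0 => /eqP ->; rewrite mulrC.
have := congr1 (@base R n) vE; rewrite base_pt {1 2}vx dotC dotZl dotC ptZ jacZ//.
have -> : base (v 0 x *: jac (fwd F) q (pt e (dot om e))) =
    v 0 x *: base (jac (fwd F) q (pt e (dot om e))) by apply/rowP => i; rewrite !mxE.
move=> vE'.
have vx0 : v 0 x != 0.
  apply/eqP => vx0; move/rowP: vE' => /(_ x); rewrite vx0 scale0r mxE e'x => /eqP.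
  by rewrite eq_sym oner_eq0.
exists (v 0 x)^-1; first by rewrite invr_eq0.
by rewrite -vE' scalerA mulVf// scale1r.
Qed.

Lemma bwd_vert_neq0 : w != 0.
Proof.
apply/eqP => w0; have := fwd_jacK (vert R n) PF Fq; rewrite -/w w0.
rewrite -(scale0r (0 : 'rV[R]_(n + 1))) jacZ// scale0r -pt0.
by move=> /pt_inj[_ /eqP]; rewrite eq_sym oner_eq0.
Qed.

(** The slope s along e is prescribed, and transversality excludes at most one value of it. A
    multiple of the x-covector is enough when w has an x-component or a vertical component;
    otherwise another nonzero component j of w is used. *)
Lemma generic_covector : exists s0, forall s, s != s0 ->
  exists2 om, dot om e = s & fib w - dot om (base w) != 0.
Proof.
have dx s v : dot (s *: delta_mx 0 x) v = s * v 0 x by rewrite dotZl dot_delta.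
have [wx|wx] := eqVneq (base w 0 x) 0; last first.
  exists (fib w / base w 0 x) => s s0; exists (s *: delta_mx 0 x).
    by rewrite dx ex mulr1.
  rewrite dx subr_eq0; apply: contraNneq s0 => ->.
  by rewrite mulfK.
have [wy|wy] := eqVneq (fib w) 0; last first.
  exists 0 => s _; exists (s *: delta_mx 0 x); first by rewrite dx ex mulr1.
  by rewrite dx wx mulr0 subr0.
have [j wj] : exists j, base w 0 j != 0.
  apply/existsP; apply: contraNT bwd_vert_neq0; rewrite negb_exists => /forallP w0.
  suff bw : base w = 0 by rewrite -(pt_base_fib w) bw wy pt0.
  by apply/rowP => i; rewrite [RHS]mxE; move: (w0 i); rewrite negbK => /eqP.
exists 0 => s _; exists (delta_mx 0 j + (s - e 0 j) *: delta_mx 0 x).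
  by rewrite dotDl dot_delta dx ex mulr1 addrC subrK.
by rewrite dotDl dot_delta dx wx mulr0 addr0 wy sub0r oppr_eq0.
Qed.

Lemma neq_exists (s : seq R) : exists a, a \notin s.
Proof.
set S := \sum_(b <- s) `|b|; have S0 : 0 <= S by exact: sumr_ge0.
exists (1 + S); apply/negP => abs.
have : `|1 + S| <= S by rewrite [leRHS](big_rem _ abs)/= lerDl sumr_ge0.
by rewrite ger0_norm ?addr_ge0// gerDr leNgt ltr01.
Qed.

(* Adding to f the square of a linear form that vanishes on e does not affect
   the equation at z, hence the Hessian of g does not change along e' either:
   the characteristic directions of the two equations correspond. *)
Theorem symbol_contact : exists m0 m1,
  base (jac (fwd F) q (pt e 0)) = m0 *: e' /\ base d = m1 *: e'.
Proof.
have [s0 s0P] := generic_covector.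
(* The image of the lift of e with slope s is affine in s: two admissible slopes determine its
   constant term and the image of the vertical vector. *)
have [a a0] := neq_exists [:: s0].
have [b] := neq_exists [:: s0; a].
rewrite !inE negb_or => /andP[b0 ba]; rewrite inE in a0.
have [om ome omw] := s0P _ a0; have [om' om'e om'w] := s0P _ b0.
have [m _ e2] := symbol_direction omw; have [m' _ e1] := symbol_direction om'w.
rewrite ome base_jac_pt in e2; rewrite om'e base_jac_pt in e1.
have ba0 : b - a != 0 by rewrite subr_eq0.
have dE : base d = ((b - a)^-1 * (m' - m)) *: e'.
  have : (b - a) *: base d = (m' - m) *: e'.
    by rewrite !scalerBl -e1 -e2 opprD addrACA subrr add0r.
  by move/(congr1 (fun u => (b - a)^-1 *: u)); rewrite !scalerA mulVf// scale1r.
exists (m - a * ((b - a)^-1 * (m' - m))), ((b - a)^-1 * (m' - m)); split=> //.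
by rewrite scalerBl -scalerA -dE -e2 addrK.
Qed.

Hypothesis Ft : \forall p \near q, forall i, i != lshift 1 t ->
  pd i (fun p => fwd F p 0 (lshift 1 t)) p = 0.

Let T' := pd (lshift 1 t) (fun p => fwd F p 0 (lshift 1 t)) q.

Lemma time_D u : \forall p \near q,
  'D_u (fun p => fwd F p 0 (lshift 1 t)) p =
  u 0 (lshift 1 t) * pd (lshift 1 t) (fun p => fwd F p 0 (lshift 1 t)) p.
Proof.
have an : \forall p \near q, analytic_at (fun p => fwd F p 0 (lshift 1 t)) p.
  exact: analytic_near (aF _).
near=> p; rewrite derive_dir; last by near: p.
rewrite (bigD1 (lshift 1 t))//= big1 ?addr0// => i it.
have -> : pd i (fun p => fwd F p 0 (lshift 1 t)) p = 0; last by rewrite mulr0.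
by move: i it; near: p.
Unshelve. all: by end_near. Qed.

Lemma time_jac u : jac (fwd F) q u 0 (lshift 1 t) = u 0 (lshift 1 t) * T'.
Proof. by rewrite mxE; exact: nbhs_singleton (time_D u). Qed.

Lemma time_jac_bwd u :
  jac (bwd F) (fwd F q) u 0 (lshift 1 t) * T' = u 0 (lshift 1 t).
Proof. by rewrite -time_jac fwd_jacK. Qed.

Lemma time_factor_neq0 : T' != 0.
Proof.
apply/eqP => T0; have := time_jac_bwd (delta_mx 0 (lshift 1 t)).
by rewrite T0 mulr0 mxE !eqxx => /eqP; rewrite eq_sym oner_eq0.
Qed.

Lemma time_hessF (v : 'rV[R]_n) s : v 0 t = 0 -> hessF v s (lshift 1 t) = 0.
Proof.
move=> vt; rewrite /hessF.
have e0 : \forall p \near q, 'D_(pt v s) (fun p => fwd F p 0 (lshift 1 t)) p = (fun=> 0) p.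
  have H := time_D (pt v s); near=> p.
  have -> : 'D_(pt v s) (fun p => fwd F p 0 (lshift 1 t)) p = pt v s 0 (lshift 1 t) *
    pd (lshift 1 t) (fun p => fwd F p 0 (lshift 1 t)) p by near: p.
  by rewrite ptl vt mul0r.
have -> := near_eq_derive (pt v s) e0.
exact: derive_cst.
Unshelve. all: by end_near. Qed.

(** f is perturbed so that f_t increases by 2 A and the second derivative along e by 2, which keeps
    it a solution at the point. For g, the time derivative then changes by 2 A lam / T' and the
    second derivative along e' by 2 lam / m^2; the equation E' relates the two changes. *)
Lemma symbol_speed (om : 'rV[R]_n) m : fib w - dot om (base w) != 0 -> m != 0 ->
  base (jac (fwd F) q (pt e (dot om e))) = m *: e' -> A * m ^+ 2 = A' * T'.
Proof.
move=> trom m0 mE.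
have [f [fa fq fom fE]] := solvE om.
have Df v : 'D_v f (base q) = dot om v.
  by rewrite jac_dot//; apply: eq_bigr => i _; rewrite mxE fom.
have trf : graph_transversal F q f by rewrite /graph_transversal Df.
have [g [ga gq fg gf]] := graph_transform PF Fq fa fq trf.
pose bt : 'rV[R]_n := (2 * A) *: delta_mx 0 t.
have btE v : dot bt v = 2 * A * v 0 t by rewrite dotZl dot_delta.
have ddx v : dot (delta_mx 0 x) v = v 0 x by exact: dot_delta.
pose f' := perturb f (base q) bt (delta_mx 0 x).
have f'a : analytic_at f' (base q) by exact: perturb_analytic.
have f'q : f' (base q) = fib q by rewrite /f' perturbE.
have Df' v : 'D_v f' (base q) = dot om v + 2 * A * v 0 t by rewrite perturb_D// Df btE.
have D2f' v : 'D_v ('D_v f') (base q) - 'D_v ('D_v f) (base q) = 2 * v 0 x ^+ 2.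
  by apply/eqP; rewrite subr_eq addrC -ddx; apply/eqP; exact: perturb_D2.
(* The time component of F depends on t only, so w has no t-component and changing f_t does not
   affect transversality. *)
have wt : base w 0 t = 0.
  have := time_jac_bwd (vert R n); rewrite -/w -baseE [in RHS]/vert ptl.
  rewrite (_ : (0 : 'rV[R]_n) 0 t = 0); last by rewrite mxE.
  move=> /eqP; by rewrite mulf_eq0 (negbTE time_factor_neq0) orbF => /eqP.
have trf' : graph_transversal F q f' by rewrite /graph_transversal Df' wt mulr0 addr0.
have [g' [g'a g'q fg' gf']] := graph_transform PF Fq f'a f'q trf'.
have Eg : E' g (base (fwd F q)) by apply/(FE fa ga fq fg).
have dE i : (delta_mx 0 i : 'rV[R]_n) 0 t = (t == i)%:R by rewrite mxE eqxx.
have pf' : pd t f' (base q) - pd t f (base q) = 2 * A.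
  have -> : pd t f (base q) = dot om (delta_mx 0 t) := Df _.
  have -> : pd t f' (base q) = dot om (delta_mx 0 t) + 2 * A * (delta_mx 0 t : 'rV[R]_n) 0 t := Df' _.
  by rewrite dE eqxx mulr1 addrC addKr.
have Ef' : E f' (base q).
  apply/(symE fa f'a fq f'q _ fE); last by rewrite pf' D2f' ex expr1n mulr1 mulrC.
  move=> i it.
  have -> : pd i f (base q) = dot om (delta_mx 0 i) := Df _.
  have -> : pd i f' (base q) = dot om (delta_mx 0 i) + 2 * A * (delta_mx 0 i : 'rV[R]_n) 0 t := Df' _.
  by rewrite dE eq_sym (negbTE it) mulr0 addr0.
have Eg' : E' g' (base (fwd F q)) by apply/(FE f'a g'a f'q fg').
have dt : d 0 (lshift 1 t) = 0 by rewrite time_jac /vert ptl mxE mul0r.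
have onto c : exists v, jac (fwd F) q (pt v (dot om v)) = pt c ('D_c g (base (fwd F q))) /\
    v 0 t * T' = c 0 t.
  have [v] := graph_jac_onto c PF Fq fa fq ga gq gf; rewrite Df => vE; exists v; split=> //.
  by rewrite -[v 0 t](ptl v (dot om v)) -time_jac vE ptl.
have Dg (c : 'rV[R]_n) : c 0 t = 0 -> 'D_c g' (base (fwd F q)) = 'D_c g (base (fwd F q)).
  move=> ct; have [v [vE /eqP]] := onto c.
  rewrite ct mulf_eq0 (negbTE time_factor_neq0) orbF => /eqP vt.
  have := graph_first_order v PF Fq f'a f'q g'a fg'.
  by rewrite Df' vt mulr0 addr0 vE /= base_pt fib_pt.
set lam := fib d - 'D_(base d) g (base (fwd F q)).
have lam0 : lam != 0 := fiber_factor_neq0 fa fq ga gq gf.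
have Dgt : (pd t g' (base (fwd F q)) - pd t g (base (fwd F q))) * T' = 2 * A * lam.
  have [v [vE vt]] := onto (delta_mx 0 t); rewrite dE eqxx in vt.
  have := graph_first_order v PF Fq f'a f'q g'a fg'.
  rewrite Df'; have -> : pt v (dot om v + 2 * A * v 0 t) =
      pt v (dot om v) + (2 * A * v 0 t) *: vert R n.
    by rewrite [LHS]vert_pt [pt v (dot om v)]vert_pt scalerDl addrA.
  rewrite jacD// jacZ// vE -/d /= baseD base_pt fibD fib_pt.
  have -> : base ((2 * A * v 0 t) *: d) = (2 * A * v 0 t) *: base d.
    by apply/rowP => i; rewrite !mxE.
  have -> : fib ((2 * A * v 0 t) *: d) = (2 * A * v 0 t) * fib d by rewrite !fibE mxE.
  rewrite deriveDdir// deriveZdir// (Dg (base d)); last by rewrite baseE.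
  rewrite -[X in X + _ = _]/(pd t g' (base (fwd F q))).
  rewrite -[X in _ = X + _]/(pd t g (base (fwd F q))).
  rewrite /lam; set a := pd t g' _; set b := pd t g _; set l := 'D_(base d) g _; set y := fib d.
  move=> H; have -> : a - b = 2 * A * v 0 t * (y - l) by lra.
  have -> : 2 * A * v 0 t * (y - l) * T' = 2 * A * (y - l) * (v 0 t * T') by ring.
  by rewrite vt mulr1.
have D2g : m ^+ 2 * ('D_e' ('D_e' g') (base (fwd F q)) - 'D_e' ('D_e' g) (base (fwd F q))) =
    lam * 2.
  have vs : 'D_e f (base q) = dot om e by [].
  have vs' : 'D_e f' (base q) = dot om e by rewrite Df' et mulr0 addr0.
  have H := hessian_variation fa fq ga f'a f'q g'a fg fg' vs vs'.
  rewrite /= mE in H.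
  have L : 'D_(m *: e') ('D_(m *: e') g') (base (fwd F q)) -
      'D_(m *: e') ('D_(m *: e') g) (base (fwd F q)) = _ :=
    congr2 (fun a b => a - b) (derive2Zdir m e' g'a) (derive2Zdir m e' ga).
  apply: (etrans (mulrBr _ _ _)); apply: (etrans (esym L)); apply: (etrans (H _)).
    move=> k; have [->|kt] := eqVneq k t; first by right; split=> //; exact: time_hessF.
    by left; apply: Dg; rewrite dE eq_sym (negbTE kt).
  apply: (congr1 ( *%R lam)); apply: (etrans (D2f' e)).
  by rewrite ex expr1n mulr1.
have Dgi i : i != t -> pd i g' (base (fwd F q)) = pd i g (base (fwd F q)).
  by move=> it; apply: Dg; rewrite dE eq_sym (negbTE it).
have H := (symE' ga g'a gq g'q Dgi Eg).1 Eg'.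
rewrite H in Dgt; move: Dgt D2g.
set X := _ - _ => H1 H2; apply: (mulIf lam0); rewrite -[LHS]mulrA.
apply: (@mulfI _ 2); first by rewrite pnatr_eq0.
have -> : 2 * (A * (m ^+ 2 * lam)) = m ^+ 2 * (2 * A * lam) by ring.
rewrite -H1; have -> : m ^+ 2 * (A' * X * T') = A' * T' * (m ^+ 2 * X) by ring.
by rewrite H2; ring.
Qed.

(** By [symbol_speed], (m0 + s m1)^2 is the same number for all slopes s but one. Three slopes force
    m1 = 0, so that F sends the vertical vector to a vertical one. *)
Theorem symbol_projectable : exists m0,
  [/\ base (jac (fwd F) q (pt e 0)) = m0 *: e', base d = 0, m0 != 0, T' != 0
    & A * m0 ^+ 2 = A' * T'].
Proof.
have [m0 [m1 [e0 e1]]] := symbol_contact.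
have [s0 s0P] := generic_covector.
have mE (om : 'rV[R]_n) : fib w - dot om (base w) != 0 ->
    m0 + dot om e * m1 != 0 /\ A * (m0 + dot om e * m1) ^+ 2 = A' * T'.
  move=> omw; have [m mn0 mE] := symbol_direction omw.
  have {}mm : m0 + dot om e * m1 = m.
    move: mE; rewrite base_jac_pt e0 e1 scalerA -scalerDl => /rowP/(_ x).
    by rewrite !mxE e'x !mulr1.
  by rewrite mm; split=> //; exact: symbol_speed omw mn0 mE.
have [a a0] := neq_exists [:: s0].
have [b] := neq_exists [:: s0; a].
have [c] := neq_exists [:: s0; a; b].
rewrite !inE !negb_or => /and3P[c0 ca cb] /andP[b0 ba]; rewrite inE in a0.
have [om1 o1 /mE] := s0P _ a0; have [om2 o2 /mE] := s0P _ b0.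
have [om3 o3 /mE] := s0P _ c0; rewrite o1 o2 o3 => -[_ e3] [_ e2] [ma e1'].
have sq s : A * (m0 + s * m1) ^+ 2 = A' * T' -> (m0 + s * m1) ^+ 2 = A' * T' / A.
  by move=> <-; rewrite mulrAC divff// mul1r.
have diff u v : u != v -> (m0 + u * m1) ^+ 2 = A' * T' / A ->
    (m0 + v * m1) ^+ 2 = A' * T' / A -> m1 * (2 * m0 + (u + v) * m1) = 0.
  move=> uv eu ev; apply: (@mulfI _ (u - v)); first by rewrite subr_eq0.
  rewrite mulr0; rewrite -ev in eu; move/eqP: eu; rewrite -subr_eq0 => /eqP <-; ring.
have d1 := diff b a ba (sq _ e2) (sq _ e1').
have d2 := diff c a ca (sq _ e3) (sq _ e1').
have m10 : m1 = 0.
  have : (c - b) * m1 ^+ 2 = 0.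
    have -> : (c - b) * m1 ^+ 2 = m1 * (2 * m0 + (c + a) * m1) - m1 * (2 * m0 + (b + a) * m1).
      by ring.
    by rewrite d1 d2 subrr.
  by move/eqP; rewrite mulf_eq0 subr_eq0 (negbTE cb) expf_eq0/= => /eqP.
rewrite m10 mulr0 addr0 in ma e1'.
by exists m0; split=> //; [rewrite e1 m10 scale0r|exact: time_factor_neq0].
Qed.

End Symbols.

(** * Transformations of the equations L *)

Section Equations.
Variable R : realType.
Local Notation it := Defs.it.

Lemma I2P (k : 'I_2) : k = it \/ k = ix.
Proof. by case: k => [[|[|//]] kk]; [left|right]; exact: val_inj. Qed.

Lemma sum_I2 (G : 'I_2 -> R) : \sum_i G i = G it + G ix.
Proof. by rewrite big_ord_recl big_ord1; congr (_ + G _); apply: val_inj. Qed.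

Lemma sum_I3 (G : 'I_(2 + 1) -> R) : \sum_i G i = G jt + G jx + G ju.
Proof.
by rewrite big_split_ord/= sum_I2 big_ord1; congr (_ + G _).
Qed.

Lemma delta_lshift n (i : 'I_n) : delta_mx 0 (lshift 1 i) = pt (delta_mx 0 i) 0 :> 'rV[R]_(n + 1).
Proof.
apply/rowP; apply: rV_split => [j|]; rewrite ?ptl ?ptr !mxE ?eq_lshift//.
by rewrite eq_rlshift andbF.
Qed.

Lemma deriveC_pd n (f : 'rV[R]_n -> R) a i j : analytic_at f a ->
  pd i (pd j f) a = pd j (pd i f) a.
Proof. exact: analytic_deriveC. Qed.

Lemma derive2_pair n (f : 'rV[R]_n -> R) a u v (s : R) : analytic_at f a ->
  'D_(u + s *: v) ('D_(u + s *: v) f) a =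
  'D_u ('D_u f) a + 2 * s * 'D_u ('D_v f) a + s ^+ 2 * 'D_v ('D_v f) a.
Proof.
move=> fa.
have e : \forall z \near a, 'D_(u + s *: v) f z = 'D_u f z + s * 'D_v f z.
  near=> z; have fz : analytic_at f z by near: z; exact: analytic_near.
  by rewrite deriveDdir// deriveZdir.
rewrite (near_eq_derive (u + s *: v) e).
have H w : hasD w (fun z => 'D_u f z + s * 'D_v f z) a
    ('D_w ('D_u f) a + (0 * 'D_v f a + s * 'D_w ('D_v f) a)).
  apply: hasD_add; first by apply: hasD_derive; exact: analytic_derive.
  by apply: hasD_mul; [exact: hasD_cst|apply: hasD_derive; exact: analytic_derive].
rewrite deriveDdir; last exact: (H 0).1.
rewrite deriveZdir; last exact: (H 0).1.
rewrite (H u).2 (H v).2 (analytic_deriveC u v fa).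
generalize ('D_u ('D_u f) a) ('D_u ('D_v f) a) ('D_v ('D_v f) a) ('D_v f a) => b c d e'.
by ring.
Unshelve. all: by end_near. Qed.

(** A representative of a prescribed 2-jet at z: value y, gradient om, Hessian 2 k a (x) a. *)
Definition quadratic n (z : 'rV[R]_n) (y : R) om (k : R) a (z' : 'rV[R]_n) : R :=
  y + (affine z om z' + k * (affine z a z' * affine z a z')).

Lemma quadratic_hasD n (z : 'rV[R]_n) y om k a v z' :
  hasD v (quadratic z y om k a) z' (dot om v + 2 * k * dot a v * affine z a z').
Proof.
apply: hasD_eq.
  apply: hasD_add; first exact: hasD_cst.
  apply: hasD_add; first exact: affine_hasD.
  by apply: hasD_mul; [exact: hasD_cst|apply: hasD_mul; exact: affine_hasD].
by cbv beta; ring.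
Qed.

Lemma quadratic_D n (z : 'rV[R]_n) y om k a v : 'D_v (quadratic z y om k a) z = dot om v.
Proof. by rewrite (quadratic_hasD z y om k a v z).2 affine0 mulr0 addr0. Qed.

Lemma quadratic_D2 n (z : 'rV[R]_n) y om k a u v :
  'D_u ('D_v (quadratic z y om k a)) z = 2 * k * dot a v * dot a u.
Proof.
have -> : 'D_v (quadratic z y om k a) = fun z' => dot om v + 2 * k * dot a v * affine z a z'.
  by apply/funext => z'; exact: (quadratic_hasD z y om k a v z').2.
have [_ ->] : hasD u (fun z' => dot om v + 2 * k * dot a v * affine z a z') z
    (0 + (0 * affine z a z + 2 * k * dot a v * dot a u)).
  apply: hasD_add; first exact: hasD_cst.
  by apply: hasD_mul; [exact: hasD_cst|exact: affine_hasD].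
by rewrite mul0r !add0r.
Qed.

Lemma quadraticE n (z : 'rV[R]_n) y om k a : quadratic z y om k a z = y.
Proof. by rewrite /quadratic !affine0 !mulr0 !addr0. Qed.

Lemma quadratic_analytic n (z : 'rV[R]_n) y om k a z' : analytic_at (quadratic z y om k a) z'.
Proof. exact: (quadratic_hasD z y om k a 0 z').1. Qed.

Lemma eq_sub_iff (p q r s : R) : q - r = s -> (p = q <-> p - r = s).
Proof. by move=> <-; split=> [->//|/addIr]. Qed.

Lemma eqL_symbol (th : coeffs R) z y : evolution_symbol (eqL th) z y it (cA th z) (delta_mx 0 ix).
Proof.
move=> f f' fa f'a fy f'y pf; rewrite /eqL => Ef.
have -> : pd ix f' z = pd ix f z by apply: pf.
rewrite f'y -fy Ef mulrBr.
change ('D_(delta_mx 0 ix) ('D_(delta_mx 0 ix) f') z) with (pd ix (pd ix f') z).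
change ('D_(delta_mx 0 ix) ('D_(delta_mx 0 ix) f) z) with (pd ix (pd ix f) z).
generalize (pd it f' z) (pd ix (pd ix f') z) (pd ix (pd ix f) z) (pd ix f z) => a b c d.
by apply: eq_sub_iff; ring.
Qed.

Lemma eqL_solvable (th : coeffs R) z y : cA th z != 0 -> solvable (eqL th) z y.
Proof.
move=> A0 om.
(* The Hessian is concentrated in the x-direction, and the equation is solved for u_xx = 2 k, A
   being nonzero. *)
pose k := (om 0 it - cB th z * om 0 ix - cC th z * y) / (2 * cA th z).
exists (quadratic z y om k (delta_mx 0 ix)).
have pE i : pd i (quadratic z y om k (delta_mx 0 ix)) z = om 0 i.
  by rewrite /pd quadratic_D dotC dot_delta.
split; [exact: quadratic_analytic|exact: quadraticE|exact: pE|].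
have e1 : dot (delta_mx 0 ix : 'rV[R]_2) (delta_mx 0 ix) = 1.
  by rewrite dot_delta mxE !eqxx.
have pp : pd ix (pd ix (quadratic z y om k (delta_mx 0 ix))) z = 2 * k.
  by rewrite /pd quadratic_D2 e1 !mulr1.
by rewrite /eqL !pE quadraticE pp /k; field.
Qed.

Definition char_dir (y : R) : 'rV[R]_(2 + 1) := delta_mx 0 jx + y *: delta_mx 0 ju.

Lemma char_dirE y i : char_dir y 0 i = (i == jx)%:R + y * (i == ju)%:R.
Proof. by rewrite !mxE !eqxx. Qed.

Lemma char_hess (f : 'rV[R]_(2 + 1) -> R) w y : analytic_at f w ->
  'D_(char_dir y) ('D_(char_dir y) f) w =
  pd jx (pd jx f) w + 2 * y * pd jx (pd ju f) w + y ^+ 2 * pd ju (pd ju f) w.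
Proof. exact: derive2_pair. Qed.

Lemma base_analytic_B (B : 'rV[R]_2 -> R) (f : 'rV[R]_(2 + 1) -> R) w :
  analytic_at B (base w) -> analytic_at f w ->
  pd jx (fun w' => B (base w') * f w') w = pd ix B (base w) * f w + B (base w) * pd jx f w.
Proof.
move=> Ba fa.
have Bb : hasD (delta_mx 0 jx) (fun w' => B (base w')) w (pd ix B (base w)).
  split; first exact: analytic_base.
  have -> : 'D_(delta_mx 0 jx) (fun w' => B (base w')) w =
      'D_(jac (@base R 2) w (delta_mx 0 jx)) B (base w).
    by apply: derive_comp => //; exact: analytic_map_base.
  congr ('D_ _ _ _); rewrite (jac_base (fun z => z)) jac_id.
  by rewrite /jx delta_lshift base_pt.
exact: (hasD_mul Bb (hasD_derive (delta_mx 0 jx) fa)).2.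
Qed.

Lemma eqDE0_symbol (th : coeffs R) w y : analytic_at (cB th) (base w) ->
  evolution_symbol (eqDE0 th) w y jt (cA th (base w)) (char_dir y).
Proof.
move=> Ba f f' fa f'a fy f'y pf; rewrite /eqDE0 => Ef.
have px : pd jx f' w = pd jx f w by apply: pf.
have pu : pd ju f' w = pd ju f w by apply: pf.
have hf := char_hess y fa; have hf' := char_hess y f'a.
rewrite (congr2 (fun a b => cA th (base w) * (a - b)) hf' hf).
have bf := base_analytic_B Ba fa; have bf' := base_analytic_B Ba f'a.
move: Ef; rewrite bf bf' px pu fy f'y.
generalize (pd jt f' w) (pd jt f w) (pd jx (pd jx f') w) (pd jx (pd ju f') w)
  (pd ju (pd ju f') w) (pd jx (pd jx f) w) (pd jx (pd ju f) w) (pd ju (pd ju f) w)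
  (pd jx f w) (pd ju f w) (pd ix (cA th) (base w)) (pd ix (cB th) (base w))
  (pd ix (cC th) (base w)) => a b c1 c2 c3 d1 d2 d3 g1 g2 g3 g4 g5 ->.
by apply: eq_sub_iff; ring.
Qed.

Lemma eqDE0_solvable (th : coeffs R) w y : analytic_at (cB th) (base w) -> cA th (base w) != 0 ->
  solvable (eqDE0 th) w y.
Proof.
move=> Ba A0 om.
pose k := (om 0 jt - (pd ix (cA th) (base w) * (om 0 jx + y * om 0 ju)
  + (pd ix (cB th) (base w) * y + cB th (base w) * om 0 jx)
  + cC th (base w) * (y - fib w * om 0 ju)
  + pd ix (cC th) (base w) * fib w)) / (2 * cA th (base w)).
exists (quadratic w y om k (delta_mx 0 jx)).
have pE i : pd i (quadratic w y om k (delta_mx 0 jx)) w = om 0 i.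
  by rewrite /pd quadratic_D dotC dot_delta.
split; [exact: quadratic_analytic|exact: quadraticE|exact: pE|].
rewrite /eqDE0 base_analytic_B//; last exact: quadratic_analytic.
rewrite !pE quadraticE.
have pp i j : pd i (pd j (quadratic w y om k (delta_mx 0 jx))) w =
   2 * k * (j == jx)%:R * (i == jx)%:R.
  rewrite /pd quadratic_D2 !dot_delta !mxE !eqxx.
  by rewrite ![jx == _]eq_sym.
rewrite !pp !eqxx /= /k; field.
by [].
Qed.

End Equations.

(** * Prolongation to jets for the equations L *)

Section LinearEquationJets.
Variable R : realType.
Local Notation it := Defs.it.

Definition coordF m (F : ptrans R m) k (p : 'rV[R]_m) : R := fwd F p 0 k.

Lemma coordF_analytic m (F : ptrans R m) k q : point_transformation F -> dom F q ->
  analytic_at (coordF F k) q.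
Proof. by move=> [_ _ _ aF _] Fq; exact: aF. Qed.

Lemma pd_near0 n (f : 'rV[R]_n -> R) a i :
  (\forall z \near a, f z = 0) -> pd i f a = 0.
Proof.
move=> f0; have e : \forall z \near a, f z = cst 0 z by [].
by apply: (etrans (near_eq_derive _ e)); exact: derive_cst.
Qed.

Lemma pt_dir3 (v : 'rV[R]_2) s (f : 'rV[R]_(2 + 1) -> R) q : analytic_at f q ->
  'D_(pt v s) f q = v 0 it * pd jt f q + v 0 ix * pd jx f q + s * pd ju f q.
Proof. by move=> fa; rewrite derive_dir// sum_I3 !ptl ptr. Qed.

Lemma dir2 (g : 'rV[R]_2 -> R) z v : analytic_at g z ->
  'D_v g z = v 0 it * pd it g z + v 0 ix * pd ix g z.
Proof. by move=> ga; rewrite derive_dir// sum_I2. Qed.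

Lemma hess_x3 s (f : 'rV[R]_(2 + 1) -> R) q : analytic_at f q ->
  'D_(pt (delta_mx 0 ix) s) ('D_(pt (delta_mx 0 ix) s) f) q =
  pd jx (pd jx f) q + 2 * s * pd jx (pd ju f) q + s ^+ 2 * pd ju (pd ju f) q.
Proof.
move=> fa; have -> : pt (delta_mx 0 ix) s = delta_mx 0 jx + s *: delta_mx 0 ju.
  by rewrite vert_pt vertE /jx delta_lshift.
exact: derive2_pair.
Qed.

Definition projectable2 (F : ptrans R (2 + 1)) (q : 'rV[R]_(2 + 1)) := \forall p \near q,
  [/\ pd jx (coordF F jt) p = 0, pd ju (coordF F jt) p = 0 & pd ju (coordF F jx) p = 0].

Lemma second_order_cleanup (h gt gx Xxx s d r : R) :
  h + (gt * (0 + 2 * s * 0 + s ^+ 2 * 0 + 0 * d) +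
       gx * (Xxx + 2 * s * 0 + s ^+ 2 * 0 + 0 * d)) = r -> h + gx * Xxx = r.
Proof. by move=> <-; ring. Qed.

(** Prolongation formulas for t~ = T, x~ = X(t, x), u~ = V(t, x, u), kept polynomial instead of
    being solved for the derivatives of g. Since T depends on neither x nor u, only g_t, g_x and
    g_xx occur, as in the equation. *)
Lemma L_jets F q f g : point_transformation F -> dom F q -> projectable2 F q ->
  analytic_at f (base q) -> f (base q) = fib q -> analytic_at g (base (fwd F q)) ->
  (\forall z \near base q, let p := fwd F (pt z (f z)) in fib p = g (base p)) ->
  let z' := base (fwd F q) in let V := coordF F ju in let X := coordF F jx in
  [/\ pd jx X q * pd ix g z' = pd jx V q + pd ix f (base q) * pd ju V q,
      pd jt (coordF F jt) q * pd it g z' + pd jt X q * pd ix g z' =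
        pd jt V q + pd it f (base q) * pd ju V q
    & pd jx X q ^+ 2 * pd ix (pd ix g) z' + pd ix g z' * pd jx (pd jx X) q =
        pd jx (pd jx V) q + 2 * pd ix f (base q) * pd jx (pd ju V) q +
        pd ix f (base q) ^+ 2 * pd ju (pd ju V) q +
        pd ju V q * pd ix (pd ix f) (base q)].
Proof.
move=> PF Fq pr fa fq ga fg z' V X.
have an k : analytic_at (coordF F k) q by exact: coordF_analytic.
have [Tx Tu Xu] := nbhs_singleton pr.
have Tx' : \forall p \near q, pd jx (coordF F jt) p = 0 by apply: filterS pr => p [].
have Tu' : \forall p \near q, pd ju (coordF F jt) p = 0 by apply: filterS pr => p [].
have Xu' : \forall p \near q, pd ju (coordF F jx) p = 0 by apply: filterS pr => p [].
have cF v s k : jac (fwd F) q (pt v s) 0 k = v 0 it * pd jt (coordF F k) q +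
   v 0 ix * pd jx (coordF F k) q + s * pd ju (coordF F k) q.
  by rewrite mxE; exact: (pt_dir3 v s (an k)).
have first v := graph_first_order v PF Fq fa fq ga fg.
have dE (i j : 'I_2) : (delta_mx 0 i : 'rV[R]_2) 0 j = (j == i)%:R by rewrite mxE eqxx.
have Jt v s : base (jac (fwd F) q (pt v s)) 0 it = v 0 it * pd jt (coordF F jt) q.
  rewrite baseE; apply: (etrans (cF v s jt)).
  by rewrite Tx Tu !mulr0 !addr0.
have Jx v s : base (jac (fwd F) q (pt v s)) 0 ix = v 0 it * pd jt X q + v 0 ix * pd jx X q.
  rewrite baseE; apply: (etrans (cF v s jx)).
  by rewrite Xu mulr0 addr0.
have Ju v s : fib (jac (fwd F) q (pt v s)) = v 0 it * pd jt V q + v 0 ix * pd jx V q + s * pd ju V q.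
  by rewrite fibE; exact: (cF v s ju).
have first' (v : 'rV[R]_2) : v 0 it * pd jt (coordF F jt) q * pd it g z' +
    (v 0 it * pd jt X q + v 0 ix * pd jx X q) * pd ix g z' =
    v 0 it * pd jt V q + v 0 ix * pd jx V q + 'D_v f (base q) * pd ju V q.
  have := first v; rewrite /= Ju => <-.
  by rewrite (dir2 _ ga) Jt Jx.
split.
- have := first' (delta_mx 0 ix); rewrite !dE /=.
  by rewrite !mul0r !add0r !mul1r.
- have := first' (delta_mx 0 it); rewrite !dE /=.
  by rewrite !mul0r !addr0 !mul1r.
have := graph_second_order (delta_mx 0 ix) PF Fq fa fq ga fg.
set s := 'D_(delta_mx 0 ix) f (base q); set w := pt _ s => /=.
have hessE k : 'D_w ('D_w (fun p => fwd F p 0 k)) q =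
   pd jx (pd jx (coordF F k)) q + 2 * s * pd jx (pd ju (coordF F k)) q +
   s ^+ 2 * pd ju (pd ju (coordF F k)) q by apply: hess_x3; exact: an.
have vertF k : jac (fwd F) q (vert R 2) 0 k = pd ju (coordF F k) q.
  have z0 i : (0 : 'rV[R]_2) 0 i = 0 by rewrite mxE.
  by rewrite /vert cF !z0 !mul0r !add0r mul1r.
have baseJ : base (jac (fwd F) q w) = pd jx X q *: delta_mx 0 ix.
  apply/rowP => k; have [->|->] := I2P k.
  - by rewrite Jt !dE !mxE/= mul0r mulr0.
  - by rewrite Jx !dE !mxE/= mul0r add0r mul1r mulr1.
rewrite baseJ (derive2Zdir _ _ ga) sum_I2.
have -> : lshift 1 it = jt by [].
have -> : lshift 1 ix = jx by [].
have -> : rshift 2 ord0 = ju by [].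
rewrite !hessE !vertF.
rewrite (pd_near0 jx Tx') (pd_near0 jx Tu') (pd_near0 ju Tu') (pd_near0 jx Xu') (pd_near0 ju Xu').
rewrite Tu Xu; exact: second_order_cleanup.
Qed.

End LinearEquationJets.

Section LinearEquationProlongation.
Variable R : realType.
Local Notation it := Defs.it.

(* The equations u_t = u_xx + c u suffice to determine the transformations. *)
Definition heat (c : R) : coeffs R := Coeffs (fun=> 1) (fun=> 0) (fun=> c).

Lemma heat_admissible c z : admissible (heat c) z.
Proof. by split; try exact: analytic_cst; rewrite /= oner_eq0. Qed.

Lemma jac_vert m (F : ptrans R (m + 1)) q k : jac (fwd F) q (vert R m) 0 k =
  pd (rshift m ord0) (coordF F k) q.
Proof. by rewrite mxE vertE. Qed.

Lemma jac_lshift m (F : ptrans R (m + 1)) q i k :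
  jac (fwd F) q (pt (delta_mx 0 i) 0) 0 k = pd (lshift 1 i) (coordF F k) q.
Proof. by rewrite mxE -delta_lshift. Qed.

(** Once F preserves the vertical direction, so does its inverse, and every graph is transversal:
    gradients no longer have to avoid an exceptional set. *)
Lemma fiber_bwd m (F : ptrans R (m + 1)) q : point_transformation F -> dom F q ->
  base (jac (fwd F) q (vert R m)) = 0 ->
  pd (rshift m ord0) (coordF F (rshift m ord0)) q != 0 /\
  jac (bwd F) (fwd F q) (vert R m) =
    (pd (rshift m ord0) (coordF F (rshift m ord0)) q)^-1 *: vert R m.
Proof.
move=> PF Fq b0; set k := pd _ _ q.
have dE : jac (fwd F) q (vert R m) = k *: vert R m.
  rewrite -[LHS]pt_base_fib b0 fibE jac_vert -/k /vert.
  by rewrite -ptZ scaler0 mulr1.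
have aG : analytic_map_at (bwd F) (fwd F q).
  by have [_ dF _ _ aG] := PF; apply: aG; exact: (dF _ Fq).1.
have GE : k *: jac (bwd F) (fwd F q) (vert R m) = vert R m.
  by rewrite -jacZ// -dE; exact: bwd_jacK.
have k0 : k != 0.
  apply/eqP => k0; move: GE; rewrite k0 scale0r -pt0 => /pt_inj[_ /eqP].
  by rewrite eq_sym oner_eq0.
split=> //; apply: (scalerI k0).
by rewrite GE scalerA divff// scale1r.
Qed.

Lemma L_contact F q c th' : point_transformation F -> dom F q ->
  maps_equation F (eqL (heat c)) (eqL th') q -> cA th' (base (fwd F q)) != 0 ->
  pd jx (coordF F jt) q = 0 /\ pd ju (coordF F jt) q = 0.
Proof.
move=> PF Fq FE A'0.
have dx : (delta_mx 0 ix : 'rV[R]_2) 0 ix = 1 by rewrite mxE.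
have sv : solvable (eqL (heat c)) (base q) (fib q).
  by apply: eqL_solvable; exact: oner_neq0.
have [m0 [m1 [e0 e1]]] := symbol_contact PF Fq FE A'0 dx dx (@eqL_symbol _ _ _ _)
  (@eqL_symbol _ _ _ _) sv.
have dt m : (m *: (delta_mx 0 ix : 'rV[R]_2)) 0 it = 0 by rewrite !mxE mulr0.
have e0t := congr1 (fun v : 'rV[R]_2 => v 0 it) e0.
have e1t := congr1 (fun v : 'rV[R]_2 => v 0 it) e1.
rewrite /= dt baseE in e0t; rewrite /= dt baseE in e1t.
split; first by rewrite -e0t; exact: esym (jac_lshift _ _ _ _).
by rewrite -e1t; exact: esym (jac_vert _ _ _).
Qed.

Lemma time_indep2 (F : ptrans R (2 + 1)) (q : 'rV[R]_(2 + 1)) :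
  (\forall p \near q, pd jx (coordF F jt) p = 0 /\ pd ju (coordF F jt) p = 0) ->
  \forall p \near q, forall i, i != lshift 1 it -> pd i (fun p => fwd F p 0 (lshift 1 it)) p = 0.
Proof.
apply: filterS => p [Tx Tu]; apply: rV_split => [i|_]; last exact: Tu.
have [->|->] := I2P i; last by [].
by move=> /negP[]; apply/eqP.
Qed.

Lemma L_projectable F q c th' : point_transformation F -> dom F q ->
  maps_equation F (eqL (heat c)) (eqL th') q -> cA th' (base (fwd F q)) != 0 ->
  (\forall p \near q, pd jx (coordF F jt) p = 0 /\ pd ju (coordF F jt) p = 0) ->
  [/\ pd ju (coordF F jx) q = 0, pd jt (coordF F jt) q != 0,
      pd jx (coordF F jx) q != 0, pd ju (coordF F ju) q != 0
    & pd jx (coordF F jx) q ^+ 2 = cA th' (base (fwd F q)) * pd jt (coordF F jt) q].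
Proof.
move=> PF Fq FE A'0 /time_indep2 Ft.
have dx : (delta_mx 0 ix : 'rV[R]_2) 0 ix = 1 by rewrite mxE.
have dt : (delta_mx 0 ix : 'rV[R]_2) 0 it = 0 by rewrite mxE.
have sv : solvable (eqL (heat c)) (base q) (fib q).
  by apply: eqL_solvable; exact: oner_neq0.
have [m0 [e0 e1 m00 T0 AA]] := symbol_projectable PF Fq FE (oner_neq0 _) A'0 dt dx dx
  (@eqL_symbol _ _ _ _) (@eqL_symbol _ _ _ _) sv Ft.
have [Vu _] := fiber_bwd PF Fq e1.
have dxm m : (m *: (delta_mx 0 ix : 'rV[R]_2)) 0 ix = m by rewrite mxE dx mulr1.
have e0x := congr1 (fun v : 'rV[R]_2 => v 0 ix) e0.
have e1x := congr1 (fun v : 'rV[R]_2 => v 0 ix) e1.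
have z0 : (0 : 'rV[R]_2) 0 ix = 0 by rewrite mxE.
rewrite /= dxm baseE in e0x; rewrite /= z0 baseE in e1x.
have Xm : pd jx (coordF F jx) q = m0 by rewrite -e0x; exact: esym (jac_lshift _ _ _ _).
split; [|exact: T0|by rewrite Xm|exact: Vu|by rewrite Xm -AA mul1r].
by rewrite -e1x; exact: esym (jac_vert _ _ _).
Qed.

(* Comparing the terms in f_x^2, in f_x and without f_x in the image of
   u_t = u_xx + c u under a projectable transformation. *)
Lemma L_fiber_linear F q th0 th1 : point_transformation F -> dom F q ->
  projectable2 F q ->
  maps_equation F (eqL (heat 0)) (eqL th0) q ->
  maps_equation F (eqL (heat 1)) (eqL th1) q ->
  (forall th, th = th0 \/ th = th1 ->
    pd jx (coordF F jx) q ^+ 2 = cA th (base (fwd F q)) * pd jt (coordF F jt) q) ->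
  pd jt (coordF F jt) q != 0 -> pd jx (coordF F jx) q != 0 -> pd ju (coordF F ju) q != 0 ->
  base (jac (fwd F) q (vert R 2)) = 0 ->
  pd ju (pd ju (coordF F ju)) q = 0 /\
  fib q * pd ju (coordF F ju) q = pd jt (coordF F jt) q *
    (cC th1 (base (fwd F q)) - cC th0 (base (fwd F q))) * coordF F ju q.
Proof.
move=> PF Fq pr FE0 FE1 AA T0 Xx0 Vu0 bv.
pose T := pd jt (coordF F jt) q; pose Xx := pd jx (coordF F jx) q.
pose Vu := pd ju (coordF F ju) q.
suff [Vt [Xt [Vx [Vxx [Vxu [Xxx P]]]]]] : exists Vt Xt Vx Vxx Vxu Xxx : R,
    forall c th s, (c = 0 /\ th = th0) \/ (c = 1 /\ th = th1) ->
    Vt + c * fib q * Vu - Xt * ((Vx + s * Vu) / Xx) =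
    Vxx + 2 * s * Vxu + s ^+ 2 * pd ju (pd ju (coordF F ju)) q - (Vx + s * Vu) / Xx * Xxx +
    T * cB th (base (fwd F q)) * ((Vx + s * Vu) / Xx) +
    T * cC th (base (fwd F q)) * coordF F ju q.
  have c0 s := P 0 th0 s (or_introl (conj erefl erefl)).
  have c1 s := P 1 th1 s (or_intror (conj erefl erefl)).
  (* The slopes 0, 1 and -1 isolate V_uu by a second difference; the slopes 0 and 1 then give T b0 =
     T b1, after which c = 0 and c = 1 are compared at slope 0. *)
  move: (c0 0) (c0 1) (c0 (-1)) (c1 0) (c1 1); rewrite -/T -/Vu.
  move: T0 Xx0 Vu0; rewrite -/T -/Xx -/Vu; clear P c0 c1 AA.
  generalize T Xx Vu (pd ju (pd ju (coordF F ju)) q) (coordF F ju q) (fib q)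
    (cB th0 (base (fwd F q))) (cB th1 (base (fwd F q)))
    (cC th0 (base (fwd F q))) (cC th1 (base (fwd F q))) => {}T {}Xx {}Vu w v u b0 b1 k0 k1.
  move=> T0 Xx0 Vu0 e00 e01 e0m e10 e11.
  have w0 : w = 0.
    have : 2 * w = 0 by move: e00 e01 e0m; set a := Vu / Xx; rewrite !mulrDl; lra.
    by move/eqP; rewrite mulf_eq0 pnatr_eq0/= => /eqP.
  split=> //.
  have bb : T * b0 = T * b1.
    apply: (@mulIf _ (Vu / Xx)); first by rewrite mulf_neq0// invr_eq0.
    move: e00 e01 e10 e11; rewrite w0 !mulrDl; lra.
  move: e00 e10; rewrite bb; lra.
pose X := coordF F jx; pose V := coordF F ju.
exists (pd jt V q), (pd jt X q), (pd jx V q), (pd jx (pd jx V) q), (pd jx (pd ju V) q),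
  (pd jx (pd jx X) q) => c th s cth.
have FE : maps_equation F (eqL (heat c)) (eqL th) q by case: cth => -[-> ->].
have {}AA : Xx ^+ 2 = cA th (base (fwd F q)) * T.
  by apply: AA; case: cth => -[_ ->]; [left|right].
(* For zero second derivatives, u_t = u_xx + c u only prescribes f_t = c u; the slope f_x = s stays
   free. *)
pose om : 'rV[R]_2 := (c * fib q) *: delta_mx 0 it + s *: delta_mx 0 ix.
have omt : om 0 it = c * fib q by rewrite !mxE/= mulr1 mulr0 addr0.
have omx : om 0 ix = s by rewrite !mxE/= mulr1 mulr0 add0r.
pose f := quadratic (base q) (fib q) om 0 (delta_mx 0 ix).
have fa : analytic_at f (base q) by exact: quadratic_analytic.
have fq : f (base q) = fib q by exact: quadraticE.
have pf i : pd i f (base q) = om 0 i by rewrite /pd quadratic_D dotC dot_delta.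
have ft : pd it f (base q) = c * fib q by rewrite pf omt.
have fx : pd ix f (base q) = s by rewrite pf omx.
have fxx : pd ix (pd ix f) (base q) = 0 by rewrite /pd quadratic_D2 mulr0 !mul0r.
have fE : eqL (heat c) f (base q).
  by rewrite /eqL ft fx fxx fq /= mulr0 mul0r !add0r.
have [k0 wE] := fiber_bwd PF Fq bv.
have trf : graph_transversal F q f.
  rewrite /graph_transversal wE.
  have -> : base ((pd (rshift 2 ord0) (coordF F (rshift 2 ord0)) q)^-1 *: vert R 2) = 0.
    by rewrite /vert -ptZ base_pt scaler0.
  by rewrite derive0 subr0 /vert -ptZ fib_pt mulr1 invr_neq0.
have [g [ga gq fg _]] := graph_transform PF Fq fa fq trf.
have gE : eqL th g (base (fwd F q)) by apply/(FE f g fa ga fq fg).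
have [] := L_jets PF Fq pr fa fq ga fg.
move: gE; rewrite /eqL gq ft fx fxx -/X -/V -/Xx -/T -/Vu fibE -[fwd F q 0 _]/(V q).
move: AA Xx0; rewrite -/Xx.
generalize (cA th (base (fwd F q))) (cB th (base (fwd F q))) (cC th (base (fwd F q)))
  (pd it g (base (fwd F q))) (pd ix g (base (fwd F q))) (pd ix (pd ix g) (base (fwd F q)))
  Xx T Vu (V q) (pd jt V q) (pd jt X q) (pd jx V q) (pd jx (pd jx V) q) (pd jx (pd ju V) q)
  (pd jx (pd jx X) q) (pd ju (pd ju V) q) (fib q).
move=> a b k gt gx gxx X1 T1 V1 v vt xt vx vxx vxu xxx vuu u AA X10 -> J1 J2 J3.
have -> : (vx + s * V1) / X1 = gx by rewrite -J1 mulrC mulKf.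
have -> : vt + c * u * V1 - xt * gx = T1 * (a * gxx + b * gx + k * v) by rewrite -J2; ring.
have -> : vxx + 2 * s * vxu + s ^+ 2 * vuu - gx * xxx = X1 ^+ 2 * gxx.
  by move: J3; rewrite mulr0 addr0 => <-; ring.
by rewrite AA; ring.
Qed.

End LinearEquationProlongation.

(** * Linearity in the last variable for the equations L *)

Section FiberLinearity.
Variable R : realType.
Local Notation it := Defs.it.

Lemma near_exists_ball n (P : 'rV[R]_n -> Prop) a : (\forall z \near a, P z) ->
  exists2 e, 0 < e & forall z, ball a e z -> P z.
Proof. by move=> /nbhs_ballP[e /= e0 H]; exists e. Qed.

Lemma ball_nbhs n (P : 'rV[R]_n -> Prop) a e w : ball a e w ->
  (forall z, ball a e z -> P z) -> \forall z \near w, P z.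
Proof.
move=> aw aP; apply: (@filterS _ (nbhs w) _ (ball a e)) => [//|].
by apply: open_nbhs_nbhs; split=> //; exact: ball_open.
Qed.

Lemma pd0_fiber n (f : 'rV[R]_(n + 1) -> R) a e :
  (forall w, ball a e w -> analytic_at f w) ->
  (forall w, ball a e w -> pd (rshift n ord0) f w = 0) ->
  forall w w', ball a e w -> ball a e w' -> base w = base w' -> f w = f w'.
Proof.
move=> fa f0 w w' aw aw' ww'.
apply: (@pd0_const _ _ f a e (fun i => i == rshift n ord0)) => // [z i az /eqP ->|].
  exact: f0.
apply: rV_split => [i _|]; last by rewrite eqxx.
by rewrite -!baseE ww'.
Qed.

Lemma ball_fiber n (a : 'rV[R]_(n + 1)) e w : ball a e w ->
  exists2 y, y != fib w & ball a e (pt (base w) y).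
Proof.
rewrite -!ball_normE/= => aw; pose d := (e - `|a - w|) / 2.
have d0 : 0 < d by rewrite divr_gt0// subr_gt0.
exists (fib w + d).
  by rewrite -subr_eq0 addrC addKr gt_eqF.
have -> : a - pt (base w) (fib w + d) = (a - w) - pt 0 d.
  rewrite -addrA -opprD; congr (a - _).
  by rewrite -[in RHS](pt_base_fib w) -ptD addr0.
apply: le_lt_trans (ler_normB _ _) _.
have : `|pt 0 d : 'rV[R]_(n + 1)| <= d by apply: pt_le; [rewrite normr0 ltW|rewrite gtr0_norm].
move=> H; apply: (@le_lt_trans _ _ (`|a - w| + d)); first by rewrite lerD2l.
by rewrite -ltrBrDl /d ltr_pdivrMr// ltr_pMr ?subr_gt0// ltr1n.
Qed.

(* V is affine on each fiber, and proportional there to its linear part. *)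
Lemma linear_fiber n (V kappa : 'rV[R]_(n + 1) -> R) a e (u := rshift n ord0) :
  (forall w, ball a e w -> analytic_at V w) ->
  (forall w, ball a e w -> pd u (pd u V) w = 0) ->
  (forall w, ball a e w -> pd u V w != 0) ->
  (forall w w', ball a e w -> ball a e w' -> base w = base w' -> kappa w = kappa w') ->
  (forall w, ball a e w -> fib w * pd u V w = kappa w * V w) ->
  forall w, ball a e w -> V w = fib w * pd u V w.
Proof.
move=> Va Vuu Vu0 kk kV w aw.
have Vua z : ball a e z -> analytic_at (pd u V) z by move=> /Va; exact: analytic_pd.
have hW z : ball a e z -> hasD (delta_mx 0 u) (fun z => V z - fib z * pd u V z) z 0.
  move=> az; apply: hasD_eq.
    apply: hasD_sub; first exact: hasD_derive (Va _ az).
    apply: hasD_mul; last exact: hasD_derive (Vua _ az).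
    by apply: hasD_derive; exact: analytic_fib.
  have -> : 'D_(delta_mx 0 u) (@fib R n) z = 1.
    have -> : @fib R n = (fun z => z 0 u) by apply/funext => y; rewrite fibE.
    by rewrite derive_coord mxE !eqxx.
  have -> : 'D_(delta_mx 0 u) (pd u V) z = 0 := Vuu _ az.
  by rewrite mul1r mulr0 addr0 subrr.
have [y yw ay] := ball_fiber aw.
set w' := pt (base w) y in ay.
have bw : base w = base w' by rewrite base_pt.
have e1 : pd u V w = pd u V w' by exact: (pd0_fiber Vua Vuu).
have e2 : V w - fib w * pd u V w = V w' - fib w' * pd u V w'.
  apply: (@pd0_fiber _ (fun z => V z - fib z * pd u V z) a e) => // z az.
    exact: (hW z az).1.
  exact: (hW z az).2.
have fw' : fib w' = y by exact: fib_pt.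
move: (kV _ aw) (kV _ ay) (Vu0 _ aw) e2; rewrite -e1 (kk _ _ ay aw (esym bw)) fw'.
generalize (pd u V w) (V w) (V w') (kappa w) (fib w) yw => U v v' k s ys e3 e4 U0 e5.
(* Subtracting the relations at the two points of the fiber gives (y - s) U = k (y - s) U. *)
have k1 : k = 1.
  apply: (@mulIf _ (U * (y - s))); first by rewrite mulf_neq0// subr_eq0.
  have : v' - v = (y - s) * U by lra.
  move=> e6; have : (y - s) * U = k * (v' - v) by rewrite mulrBr -e3 -e4; ring.
  by rewrite e6 => e7; rewrite mul1r -[RHS]mulrC e7; ring.
by rewrite e3 k1 mul1r.
Qed.

End FiberLinearity.

Section LinearEquationStructure.
Variable R : realType.
Local Notation it := Defs.it.

Definition fibered2 (F : ptrans R (2 + 1)) p e := forall q, ball p e q ->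
  [/\ dom F q, [/\ pd jx (coordF F jt) q = 0, pd ju (coordF F jt) q = 0 & pd ju (coordF F jx) q = 0],
      pd jt (coordF F jt) q != 0 /\ pd jx (coordF F jx) q != 0,
      pd ju (coordF F ju) q != 0
    & coordF F ju q = fib q * pd ju (coordF F ju) q /\ pd ju (pd ju (coordF F ju)) q = 0].

Lemma admissible_near (th : coeffs R) z : admissible th z -> \forall y \near z, admissible th y.
Proof.
move=> [Aa Ba Ca A0].
have A0n : \forall y \near z, cA th y != 0.
  exact: (analytic_continuous Aa) (open_nbhs_nbhs (conj (@open_neq _ _) A0)).
by near=> y; split; near: y => //; exact: analytic_near.
Unshelve. all: by end_near. Qed.

Lemma fwd_cvg m (F : ptrans R m) q : point_transformation F -> dom F q -> fwd F @ q --> fwd F q.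
Proof. by move=> [_ _ _ aF _] Fq; apply: analytic_map_continuous; exact: aF. Qed.

Lemma base_cvg n (q : 'rV[R]_(n + 1)) : @base R n @ q --> base q.
Proof. by apply: analytic_map_continuous; exact: analytic_map_base. Qed.

Lemma dom_near m (F : ptrans R m) q : point_transformation F -> dom F q ->
  \forall p \near q, dom F p.
Proof. by move=> [[oD _] _ _ _ _] Fq; exact: open_nbhs_nbhs. Qed.

Lemma fiber_pd n (f : 'rV[R]_(n + 1) -> R) a e i :
  (forall w, ball a e w -> analytic_at f w) ->
  (forall w, ball a e w -> pd (rshift n ord0) f w = 0) ->
  forall w, ball a e w -> pd (rshift n ord0) (pd i f) w = 0.
Proof.
move=> fa f0 w aw; apply: (etrans (deriveC_pd _ i (fa w aw))).
by apply: pd_near0; exact: ball_nbhs aw f0.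
Qed.

Section Ball.
Variables (F : ptrans R (2 + 1)) (th0 th1 : coeffs R) (p : 'rV[R]_(2 + 1)) (e : R).
Hypothesis PF : point_transformation F.
Hypothesis hyp : forall q, ball p e q ->
  [/\ dom F q, admissible th0 (base (fwd F q)), admissible th1 (base (fwd F q)),
      maps_equation F (eqL (heat 0)) (eqL th0) q & maps_equation F (eqL (heat 1)) (eqL th1) q].
Let T := coordF F jt.
Let X := coordF F jx.
Let V := coordF F ju.

(** [L_projectable] requires T_x = T_u = 0 around the point and not only at it; the contact
    condition is therefore established at all points of the ball beforehand. *)
Lemma L_first_order_facts q : ball p e q ->
  [/\ [/\ pd jx T q = 0, pd ju T q = 0 & pd ju X q = 0],
      pd jt T q != 0 /\ pd jx X q != 0, pd ju V q != 0
    & pd jx X q ^+ 2 = cA th0 (base (fwd F q)) * pd jt T q /\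
      pd jx X q ^+ 2 = cA th1 (base (fwd F q)) * pd jt T q].
Proof.
have hT q' : ball p e q' -> pd jx T q' = 0 /\ pd ju T q' = 0.
  by move=> /hyp[Fq [_ _ _ A0] _ FE _]; exact: L_contact PF Fq FE A0.
move=> pq; have [Fq [_ _ _ A0] [_ _ _ A1] FE0 FE1] := hyp pq; have [Tx Tu] := hT q pq.
have nT := ball_nbhs pq hT.
have [Xu T0 X0 V0 AA0] := L_projectable PF Fq FE0 A0 nT.
by have [_ _ _ _ AA1] := L_projectable PF Fq FE1 A1 nT.
Qed.

Lemma L_second_order_facts q : ball p e q -> pd ju (pd ju V) q = 0 /\
  fib q * pd ju V q = pd jt T q * (cC th1 (base (fwd F q)) - cC th0 (base (fwd F q))) * V q.
Proof.
move=> pq; have [Fq _ _ FE0 FE1] := hyp pq.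
have [[_ Tu Xu] [T0 X0] V0 [AA0 AA1]] := L_first_order_facts pq.
apply: (L_fiber_linear PF Fq _ FE0 FE1 _ T0 X0 V0).
- by apply: ball_nbhs pq _ => w /L_first_order_facts[].
- by move=> th [|] ->.
by apply/rowP => k; rewrite baseE jac_vert mxE; have [->|->] := I2P k.
Qed.

(** Here kappa = T_t (C1 - C0), with C0 and C1 taken at the image point: it is constant on the
    fibers because T and X do not depend on u. *)
Lemma L_zeroth_order_facts q : ball p e q -> V q = fib q * pd ju V q.
Proof.
move=> pq; have an k w : ball p e w -> analytic_at (coordF F k) w.
  by move=> /hyp[Fw _ _ _ _]; exact: coordF_analytic.
have Tu w : ball p e w -> pd ju T w = 0 by move=> /L_first_order_facts[[]].
have Xu w : ball p e w -> pd ju X w = 0 by move=> /L_first_order_facts[[]].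
have Vuu w : ball p e w -> pd ju (pd ju V) w = 0 by move=> /L_second_order_facts[].
have Vu w : ball p e w -> pd ju V w != 0 by move=> /L_first_order_facts[].
have Ta w : ball p e w -> analytic_at (pd jt T) w by move=> pw; apply: analytic_pd; exact: an.
apply: (linear_fiber (an ju) Vuu Vu
  (kappa := fun w => pd jt T w * (cC th1 (base (fwd F w)) - cC th0 (base (fwd F w))))) => //.
  move=> w w' pw pw' ww'.
  have -> : base (fwd F w) = base (fwd F w').
    apply/rowP => k; rewrite !baseE; have [->|->] := I2P k.
      exact: (pd0_fiber (an jt) Tu pw pw' ww').
    exact: (pd0_fiber (an jx) Xu pw pw' ww').
  have -> : pd jt T w = pd jt T w' := pd0_fiber Ta (@fiber_pd _ T p e jt (an jt) Tu) pw pw' ww'.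
  by [].
by move=> w /L_second_order_facts[].
Qed.

End Ball.

Theorem L_structure (F : ptrans R (2 + 1)) p : Gequiv F -> dom F p ->
  exists2 e, 0 < e & fibered2 F p e.
Proof.
move=> [PF HF] Fp.
have [th0 ad0 FE0] := HF p (heat 0) Fp (heat_admissible _ _).
have [th1 ad1 FE1] := HF p (heat 1) Fp (heat_admissible _ _).
have bF : (fun q => base (fwd F q)) @ p --> base (fwd F p).
  by apply: cvg_comp (fwd_cvg PF Fp) (@base_cvg _ _).
have nD := dom_near PF Fp.
have adn0 : \forall q \near p, admissible th0 (base (fwd F q)) by exact: (bF _ (admissible_near ad0)).
have adn1 : \forall q \near p, admissible th1 (base (fwd F q)) by exact: (bF _ (admissible_near ad1)).
have /near_exists_ball[e e0 hyp] : \forall q \near p,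
  [/\ dom F q, admissible th0 (base (fwd F q)), admissible th1 (base (fwd F q)),
      maps_equation F (eqL (heat 0)) (eqL th0) q & maps_equation F (eqL (heat 1)) (eqL th1) q].
  by near=> q; split; near: q.
exists e => // q pq; have [Fq _ _ _ _] := hyp q pq.
have [T TX V0 _] := L_first_order_facts PF hyp pq.
have [Vuu _] := L_second_order_facts PF hyp pq.
by split=> //; split=> //; exact: (L_zeroth_order_facts PF hyp).
Unshelve. all: by end_near. Qed.

End LinearEquationStructure.

(** * Transformations of the equations DE_0 *)

Section DE0Jets.
Variable R : realType.

Definition kt : 'I_(2 + 1 + 1) := lshift 1 jt.
Definition kx : 'I_(2 + 1 + 1) := lshift 1 jx.
Definition ku : 'I_(2 + 1 + 1) := lshift 1 ju.
Definition ke : 'I_(2 + 1 + 1) := rshift (2 + 1) ord0.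

Lemma sum_I4 (G : 'I_(2 + 1 + 1) -> R) : \sum_i G i = G kt + G kx + G ku + G ke.
Proof. by rewrite big_split_ord/= sum_I3 big_ord1; congr (_ + G _). Qed.

Lemma pt_dir4 (v : 'rV[R]_(2 + 1)) s (f : 'rV[R]_(2 + 1 + 1) -> R) q : analytic_at f q ->
  'D_(pt v s) f q = v 0 jt * pd kt f q + v 0 jx * pd kx f q + v 0 ju * pd ku f q + s * pd ke f q.
Proof. by move=> fa; rewrite derive_dir// sum_I4 !ptl ptr. Qed.

Lemma dir3 (g : 'rV[R]_(2 + 1) -> R) z v : analytic_at g z ->
  'D_v g z = v 0 jt * pd jt g z + v 0 jx * pd jx g z + v 0 ju * pd ju g z.
Proof. by move=> ga; rewrite derive_dir// sum_I3. Qed.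

Lemma delta3E (i j : 'I_(2 + 1)) : (delta_mx 0 i : 'rV[R]_(2 + 1)) 0 j = (j == i)%:R.
Proof. by rewrite mxE eqxx. Qed.

Lemma char_dir_t (y : R) : char_dir y 0 jt = 0.
Proof. by rewrite char_dirE /= mulr0 addr0. Qed.

Lemma char_dir_x (y : R) : char_dir y 0 jx = 1.
Proof. by rewrite char_dirE /= mulr0 addr0. Qed.

Lemma char_dir_u (y : R) : char_dir y 0 ju = y.
Proof. by rewrite char_dirE /= mulr1 add0r. Qed.

Lemma I3P (k : 'I_(2 + 1)) : [\/ k = jt, k = jx | k = ju].
Proof.
case: k => [[|[|[|//]]] kk].
- by apply: Or31; exact: val_inj.
- by apply: Or32; exact: val_inj.
- by apply: Or33; exact: val_inj.
Qed.

Lemma pt_char (y s : R) : pt (char_dir y) s =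
  delta_mx 0 kx + y *: delta_mx 0 ku + s *: delta_mx 0 ke.
Proof.
rewrite vert_pt vertE; congr (_ + _).
by rewrite /kx /ku (delta_lshift R jx) (delta_lshift R ju) -ptZ -ptD mulr0 addr0.
Qed.

Lemma hess_char4 y s (f : 'rV[R]_(2 + 1 + 1) -> R) q : analytic_at f q ->
  'D_(pt (char_dir y) s) ('D_(pt (char_dir y) s) f) q =
  pd kx (pd kx f) q + 2 * y * pd kx (pd ku f) q + y ^+ 2 * pd ku (pd ku f) q
  + 2 * s * (pd kx (pd ke f) q + y * pd ku (pd ke f) q) + s ^+ 2 * pd ke (pd ke f) q.
Proof.
move=> fa; rewrite pt_char.
apply: (etrans (derive2_pair _ _ _ fa)); congr (_ + _ * _ + _).
  exact: derive2_pair.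
have fe : analytic_at (pd ke f) q by exact: analytic_pd.
apply: (etrans (deriveDdir _ _ fe)); congr (_ + _).
exact: deriveZdir.
Qed.

Definition projectable3 (F : ptrans R (2 + 1 + 1)) (q : 'rV[R]_(2 + 1 + 1)) :=
  \forall p \near q,
  [/\ [/\ pd kx (coordF F kt) p = 0, pd ku (coordF F kt) p = 0 & pd ke (coordF F kt) p = 0],
      pd ku (coordF F kx) p = 0 /\ pd ke (coordF F kx) p = 0, pd ke (coordF F ku) p = 0
    & coordF F ke p * pd kx (coordF F kx) p =
      pd kx (coordF F ku) p + fib p * pd ku (coordF F ku) p].

Lemma second_order_cleanup3 (h gt gx gu Xxx Vee y s d r
    txx txu tuu txe tue tee xxu xuu xxe xue xee vxe vue vee : R) :
  txx = 0 -> txu = 0 -> tuu = 0 -> txe = 0 -> tue = 0 -> tee = 0 -> xxu = 0 ->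
  xuu = 0 -> xxe = 0 -> xue = 0 -> xee = 0 -> vxe = 0 -> vue = 0 -> vee = 0 ->
  h + (gt * (txx + 2 * y * txu + y ^+ 2 * tuu + 2 * s * (txe + y * tue) + s ^+ 2 * tee + 0 * d) +
       gx * (Xxx + 2 * y * xxu + y ^+ 2 * xuu + 2 * s * (xxe + y * xue) + s ^+ 2 * xee + 0 * d) +
       gu * (Vee + 2 * s * (vxe + y * vue) + s ^+ 2 * vee + 0 * d)) = r ->
  h + gx * Xxx + gu * Vee = r.
Proof. by do 14 move=> ->; move=> <-; ring. Qed.

Lemma first_order_cleanup (a b c t1 t2 t3 x1 x2 u1 u2 u3 h1 h2 h3 r h : R) :
  a * t1 * t2 + (a * x1 + b * x2) * t3 + (a * u1 + b * u2 + c * u3) * h =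
  a * h1 + b * h2 + c * h3 + r ->
  [/\ a = 0 -> b = 0 -> c = 1 -> u3 * h = h3 + r,
      a = 0 -> b = 1 -> c = 0 -> x2 * t3 + u2 * h = h2 + r
    & a = 1 -> b = 0 -> c = 0 -> t1 * t2 + x1 * t3 + u1 * h = h1 + r].
Proof.
move=> E; split=> ea eb ec; move: E; rewrite ea eb ec !(mul0r, mul1r, add0r, addr0)//.
Qed.

(** Prolongation formulas along the characteristic direction. By the contact condition, F carries
    the lift of d_x + y d_u to X_x (d_x + H d_u) in the base, so that the second derivatives of g
    appear only in the combination that DE_0 contains. *)
Lemma DE0_jets F q f g : point_transformation F -> dom F q -> projectable3 F q ->
  analytic_at f (base q) -> f (base q) = fib q -> analytic_at g (base (fwd F q)) ->
  (\forall z \near base q, let p := fwd F (pt z (f z)) in fib p = g (base p)) ->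
  let z' := base (fwd F q) in let V := coordF F ku in let X := coordF F kx in
  let H := coordF F ke in let y := fib q in
  let s := pd jx f (base q) + y * pd ju f (base q) in
  [/\ pd ku V q * pd ju g z' = pd ku H q + pd ju f (base q) * pd ke H q,
      pd kx X q * pd jx g z' + pd kx V q * pd ju g z' =
        pd kx H q + pd jx f (base q) * pd ke H q,
      pd kt (coordF F kt) q * pd jt g z' + pd kt X q * pd jx g z' + pd kt V q * pd ju g z' =
        pd kt H q + pd jt f (base q) * pd ke H q
    & pd kx X q ^+ 2 * (pd jx (pd jx g) z' + 2 * H q * pd jx (pd ju g) z' +
         H q ^+ 2 * pd ju (pd ju g) z') + pd jx g z' * pd kx (pd kx X) q +
       pd ju g z' * (pd kx (pd kx V) q + 2 * y * pd kx (pd ku V) q + y ^+ 2 * pd ku (pd ku V) q) =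
      pd kx (pd kx H) q + 2 * y * pd kx (pd ku H) q + y ^+ 2 * pd ku (pd ku H) q
      + 2 * s * (pd kx (pd ke H) q + y * pd ku (pd ke H) q) + s ^+ 2 * pd ke (pd ke H) q
      + pd ke H q * (pd jx (pd jx f) (base q) + 2 * y * pd jx (pd ju f) (base q) +
         y ^+ 2 * pd ju (pd ju f) (base q))].
Proof.
move=> PF Fq pr fa fq ga fg z' V X H y s.
have an k : analytic_at (coordF F k) q by exact: coordF_analytic.
have [[Tx Tu Te] [Xu Xe] Ve HE] := nbhs_singleton pr.
have n0 (P : 'rV[R]_(2 + 1 + 1) -> R) : (forall p, 
  [/\ [/\ pd kx (coordF F kt) p = 0, pd ku (coordF F kt) p = 0 & pd ke (coordF F kt) p = 0],
      pd ku (coordF F kx) p = 0 /\ pd ke (coordF F kx) p = 0, pd ke (coordF F ku) p = 0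
    & coordF F ke p * pd kx (coordF F kx) p =
      pd kx (coordF F ku) p + fib p * pd ku (coordF F ku) p] -> P p = 0) ->
    forall i, pd i P q = 0.
  by move=> Pp i; apply: pd_near0; apply: filterS pr => p /Pp.
have cF v r k : jac (fwd F) q (pt v r) 0 k = v 0 jt * pd kt (coordF F k) q +
   v 0 jx * pd kx (coordF F k) q + v 0 ju * pd ku (coordF F k) q + r * pd ke (coordF F k) q.
  by rewrite mxE; exact: (pt_dir4 v r (an k)).
have Jt v r : base (jac (fwd F) q (pt v r)) 0 jt = v 0 jt * pd kt (coordF F kt) q.
  rewrite baseE; apply: (etrans (cF v r kt)).
  by rewrite Tx Tu Te !mulr0 !addr0.
have Jx v r : base (jac (fwd F) q (pt v r)) 0 jx = v 0 jt * pd kt X q + v 0 jx * pd kx X q.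
  rewrite baseE; apply: (etrans (cF v r kx)).
  by rewrite Xu Xe !mulr0 !addr0.
have Ju v r : base (jac (fwd F) q (pt v r)) 0 ju = v 0 jt * pd kt V q + v 0 jx * pd kx V q +
    v 0 ju * pd ku V q.
  rewrite baseE; apply: (etrans (cF v r ku)).
  by rewrite Ve mulr0 addr0.
have Je v r : fib (jac (fwd F) q (pt v r)) = v 0 jt * pd kt H q + v 0 jx * pd kx H q +
    v 0 ju * pd ku H q + r * pd ke H q.
  by rewrite fibE; exact: (cF v r ke).
have first' (v : 'rV[R]_(2 + 1)) : v 0 jt * pd kt (coordF F kt) q * pd jt g z' +
    (v 0 jt * pd kt X q + v 0 jx * pd kx X q) * pd jx g z' +
    (v 0 jt * pd kt V q + v 0 jx * pd kx V q + v 0 ju * pd ku V q) * pd ju g z' =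
    v 0 jt * pd kt H q + v 0 jx * pd kx H q + v 0 ju * pd ku H q + 'D_v f (base q) * pd ke H q.
  have := graph_first_order v PF Fq fa fq ga fg; rewrite /= Je => <-.
  by rewrite (dir3 _ ga) Jt Jx Ju.

split.
- have [+ _ _] := first_order_cleanup (first' (delta_mx 0 ju)); apply.
  + by rewrite delta3E.
  + by rewrite delta3E.
  + by rewrite delta3E.
- have [_ + _] := first_order_cleanup (first' (delta_mx 0 jx)); apply.
  + by rewrite delta3E.
  + by rewrite delta3E.
  + by rewrite delta3E.
- have [_ _] := first_order_cleanup (first' (delta_mx 0 jt)); apply.
  + by rewrite delta3E.
  + by rewrite delta3E.
  + by rewrite delta3E.
have := graph_second_order (char_dir y) PF Fq fa fq ga fg.
have -> : 'D_(char_dir y) f (base q) = s.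
  by rewrite (dir3 _ fa) char_dir_t char_dir_x char_dir_u mul0r add0r mul1r.
set w := pt _ s => /=.
have hessE k : 'D_w ('D_w (fun p => fwd F p 0 k)) q =
  pd kx (pd kx (coordF F k)) q + 2 * y * pd kx (pd ku (coordF F k)) q
  + y ^+ 2 * pd ku (pd ku (coordF F k)) q
  + 2 * s * (pd kx (pd ke (coordF F k)) q + y * pd ku (pd ke (coordF F k)) q)
  + s ^+ 2 * pd ke (pd ke (coordF F k)) q by apply: hess_char4; exact: an.
have vertF k : jac (fwd F) q (vert R (2 + 1)) 0 k = pd ke (coordF F k) q.
  exact: jac_vert.
have baseJ : base (jac (fwd F) q w) = pd kx X q *: char_dir (H q).
  apply/rowP => k; rewrite [RHS]mxE; case: (I3P k) => ->.
  - by rewrite Jt !char_dir_t mul0r mulr0.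
  - by rewrite Jx !char_dir_t !char_dir_x mul0r add0r mul1r mulr1.
  - by rewrite Ju char_dir_t char_dir_x !char_dir_u mul0r add0r mul1r [RHS]mulrC HE.
rewrite baseJ (derive2Zdir _ _ ga) sum_I3.
rewrite (char_hess (H q) ga) (char_hess y fa).
have -> : lshift 1 jt = kt by [].
have -> : lshift 1 jx = kx by [].
have -> : lshift 1 ju = ku by [].
have -> : rshift (2 + 1) ord0 = ke by [].
rewrite !hessE !vertF Te Xe Ve.
have nTx := n0 (pd kx (coordF F kt)) (fun p H => let: And4 (And3 a _ _) _ _ _ := H in a).
have nTu := n0 (pd ku (coordF F kt)) (fun p H => let: And4 (And3 _ a _) _ _ _ := H in a).
have nTe := n0 (pd ke (coordF F kt)) (fun p H => let: And4 (And3 _ _ a) _ _ _ := H in a).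
have nXu := n0 (pd ku (coordF F kx)) (fun p H => let: And4 _ (conj a _) _ _ := H in a).
have nXe := n0 (pd ke (coordF F kx)) (fun p H => let: And4 _ (conj _ a) _ _ := H in a).
have nVe := n0 (pd ke (coordF F ku)) (fun p H => let: And4 _ _ a _ := H in a).
exact: (second_order_cleanup3 (nTx kx) (nTu kx) (nTu ku) (nTe kx) (nTe ku) (nTe ke)
  (nXu kx) (nXu ku) (nXe kx) (nXe ku) (nXe ke) (nVe kx) (nVe ku) (nVe ke)).
Qed.

End DE0Jets.

Section DE0Prolongation.
Variable R : realType.

Lemma hasD_div n v (f g : 'rV[R]_n -> R) a d e : g a != 0 ->
  hasD v f a d -> hasD v g a e ->
  hasD v (fun z => f z / g z) a ((d * g a - f a * e) / g a ^+ 2).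
Proof.
move=> ga fd gd; apply: hasD_eq (hasD_mul fd (hasD_inv ga gd)) _.
by field.
Qed.

(** The images of d_x + y d_u and of d_eta have base parts that are multiples of d_x + H d_u. Their
    t-components vanish, their x-components are the multipliers, and these are substituted in the
    u-components. *)
Lemma DE0_contact (F : ptrans R (2 + 1 + 1)) q (c : R) th' : point_transformation F -> dom F q ->
  maps_equation F (eqDE0 (heat c)) (eqDE0 th') q -> admissible th' (base (base (fwd F q))) ->
  [/\ pd kx (coordF F kt) q + fib q * pd ku (coordF F kt) q = 0,
      pd ke (coordF F kt) q = 0,
      pd ke (coordF F ku) q = coordF F ke q * pd ke (coordF F kx) q
    & pd kx (coordF F ku) q + fib q * pd ku (coordF F ku) q =
      coordF F ke q * (pd kx (coordF F kx) q + fib q * pd ku (coordF F kx) q)].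
Proof.
move=> PF Fq FE [A'a B'a C'a A'0].
have Ba : analytic_at (cB (heat c)) (base (base q)) by exact: analytic_cst.
have sv : solvable (eqDE0 (heat c)) (base q) (fib q).
  by apply: eqDE0_solvable => //; exact: oner_neq0.
have [m0 [m1 [e0 e1]]] := symbol_contact PF Fq FE A'0 (char_dir_x _) (char_dir_x _)
  (@eqDE0_symbol _ _ _ (fib q) Ba) (@eqDE0_symbol _ _ _ (fib (fwd F q)) B'a) sv.
have HE : fib (fwd F q) = coordF F ke q by rewrite fibE.
have an k : analytic_at (coordF F k) q by exact: coordF_analytic.
have J0 k : base (jac (fwd F) q (pt (char_dir (fib q)) 0)) 0 k =
    pd kx (coordF F (lshift 1 k)) q + fib q * pd ku (coordF F (lshift 1 k)) q.
  rewrite baseE mxE; apply: (etrans (pt_dir4 _ _ (an (lshift 1 k)))).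
  by rewrite char_dir_t char_dir_x char_dir_u mul0r add0r mul1r mul0r addr0.
have J1 k : base (jac (fwd F) q (vert R (2 + 1))) 0 k = pd ke (coordF F (lshift 1 k)) q.
  by rewrite baseE; exact: jac_vert.
have E0 k : pd kx (coordF F (lshift 1 k)) q + fib q * pd ku (coordF F (lshift 1 k)) q =
    m0 * char_dir (fib (fwd F q)) 0 k by rewrite -J0 e0 mxE.
have E1 k : pd ke (coordF F (lshift 1 k)) q = m1 * char_dir (fib (fwd F q)) 0 k.
  by rewrite -J1 e1 mxE.
have := E0 jx; rewrite char_dir_x mulr1 => m0E.
have := E1 jx; rewrite char_dir_x mulr1 => m1E.
split.
- by apply: (etrans (E0 jt)); rewrite char_dir_t mulr0.
- by apply: (etrans (E1 jt)); rewrite char_dir_t mulr0.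
- by apply: (etrans (E1 ju)); rewrite char_dir_u HE -m1E mulrC.
- by apply: (etrans (E0 ju)); rewrite char_dir_u HE -m0E mulrC.
Qed.

Lemma DE0_projectable (F : ptrans R (2 + 1 + 1)) q (c : R) th' : point_transformation F -> dom F q ->
  maps_equation F (eqDE0 (heat c)) (eqDE0 th') q -> admissible th' (base (base (fwd F q))) ->
  (\forall p \near q, [/\ pd kx (coordF F kt) p = 0, pd ku (coordF F kt) p = 0 &
    pd ke (coordF F kt) p = 0]) ->
  [/\ pd ke (coordF F kx) q = 0, pd ke (coordF F ku) q = 0,
      pd kt (coordF F kt) q != 0 /\ pd ke (coordF F ke) q != 0,
      pd kx (coordF F kx) q + fib q * pd ku (coordF F kx) q != 0
    & (pd kx (coordF F kx) q + fib q * pd ku (coordF F kx) q) ^+ 2 =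
      cA th' (base (base (fwd F q))) * pd kt (coordF F kt) q].
Proof.
move=> PF Fq FE [A'a B'a C'a A'0] nT.
have Ba : analytic_at (cB (heat c)) (base (base q)) by exact: analytic_cst.
have sv : solvable (eqDE0 (heat c)) (base q) (fib q).
  by apply: eqDE0_solvable => //; exact: oner_neq0.
have Ft : \forall p \near q, forall i, i != lshift 1 jt ->
    pd i (fun p => fwd F p 0 (lshift 1 jt)) p = 0.
  apply: filterS nT => p [Tx Tu Te]; apply: rV_split => [i|_]; last exact: Te.
  by case: (I3P i) => ->; [move=> /negP[]; apply/eqP| |].
have [m0 [e0 e1 m00 T0 AA]] := symbol_projectable PF Fq FE (oner_neq0 _) A'0
  (char_dir_t _) (char_dir_x _) (char_dir_x _)
  (@eqDE0_symbol _ _ _ (fib q) Ba) (@eqDE0_symbol _ _ _ (fib (fwd F q)) B'a) sv Ft.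
have an k : analytic_at (coordF F k) q by exact: coordF_analytic.
have J0 k : base (jac (fwd F) q (pt (char_dir (fib q)) 0)) 0 k =
    pd kx (coordF F (lshift 1 k)) q + fib q * pd ku (coordF F (lshift 1 k)) q.
  rewrite baseE mxE; apply: (etrans (pt_dir4 _ _ (an (lshift 1 k)))).
  by rewrite char_dir_t char_dir_x char_dir_u mul0r add0r mul1r mul0r addr0.
have J1 k : pd ke (coordF F (lshift 1 k)) q = 0.
  have <- : base (jac (fwd F) q (vert R (2 + 1))) 0 k = pd ke (coordF F (lshift 1 k)) q.
    by rewrite baseE; exact: jac_vert.
  by rewrite e1 mxE.
have m0E : pd kx (coordF F kx) q + fib q * pd ku (coordF F kx) q = m0.
  by apply: (etrans (esym (J0 jx))); rewrite e0 mxE char_dir_x mulr1.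
have [He _] := fiber_bwd PF Fq e1.
split; [exact: (J1 jx)|exact: (J1 ju)|by split|by rewrite m0E|].
by rewrite m0E -AA mul1r.
Qed.

(** DE_0 for g, after elimination of the derivatives of g by means of [DE0_jets]. The slopes a = f_x
    and r = f_u stay free, so that the relation is an identity in a and r. *)
Lemma DE0_relation (F : ptrans R (2 + 1 + 1)) q (c : R) th' (a r : R) : point_transformation F -> dom F q ->
  projectable3 F q -> maps_equation F (eqDE0 (heat c)) (eqDE0 th') q ->
  admissible th' (base (base (fwd F q))) ->
  let T := pd kt (coordF F kt) q in let X := coordF F kx in let V := coordF F ku in
  let H := coordF F ke in let y := fib q in let s := a + y * r in
  let z' := base (base (fwd F q)) in
  let gu := (pd ku H q + r * pd ke H q) / pd ku V q in
  let gx := (pd kx H q + a * pd ke H q - pd kx V q * gu) / pd kx X q in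
  pd kx X q ^+ 2 = cA th' z' * T -> pd kx X q != 0 -> pd ku V q != 0 ->
  pd kt H q + c * (y - fib (base q) * r) * pd ke H q - pd kt X q * gx - pd kt V q * gu =
  pd kx (pd kx H) q + 2 * y * pd kx (pd ku H) q + y ^+ 2 * pd ku (pd ku H) q
      + 2 * s * (pd kx (pd ke H) q + y * pd ku (pd ke H) q) + s ^+ 2 * pd ke (pd ke H) q
  - gx * pd kx (pd kx X) q -
  gu * (pd kx (pd kx V) q + 2 * y * pd kx (pd ku V) q + y ^+ 2 * pd ku (pd ku V) q) +
  T * (pd ix (cA th') z' * (gx + H q * gu) + (pd ix (cB th') z' * H q + cB th' z' * gx) +
       cC th' z' * (H q - V q * gu) + pd ix (cC th') z' * V q).
Proof.
move=> PF Fq pr FE [A'a B'a C'a A'0] T X V H y s z' gu gx AA Xx0 Vu0.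
(* For zero second derivatives, DE_0 of [heat c] reduces to f_t = c (f - u f_u), which fixes the
   t-component. *)
pose om : 'rV[R]_(2 + 1) := (c * (y - fib (base q) * r)) *: delta_mx 0 jt +
  a *: delta_mx 0 jx + r *: delta_mx 0 ju.
have omE k : om 0 k = c * (y - fib (base q) * r) * (k == jt)%:R + a * (k == jx)%:R + r * (k == ju)%:R.
  by rewrite !mxE eqxx.
pose f := quadratic (base q) y om 0 (delta_mx 0 jx).
have fa : analytic_at f (base q) by exact: quadratic_analytic.
have fq : f (base q) = fib q by exact: quadraticE.
have pf i : pd i f (base q) = om 0 i by rewrite /pd quadratic_D dotC dot_delta.
have ft : pd jt f (base q) = c * (y - fib (base q) * r).
  by rewrite pf omE /= mulr1 !mulr0 !addr0.
have fx : pd jx f (base q) = a by rewrite pf omE /= mulr1 !mulr0 add0r addr0.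
have fu : pd ju f (base q) = r by rewrite pf omE /= mulr1 !mulr0 !add0r.
have ff i j : pd i (pd j f) (base q) = 0 by rewrite /pd quadratic_D2 mulr0 !mul0r.
have p0 (k : R) : pd ix (cst k) (base (base q)) = 0 by exact: derive_cst.
have fE : eqDE0 (heat c) f (base q).
  have Ba : analytic_at (cB (heat c)) (base (base q)) by exact: analytic_cst.
  rewrite /eqDE0 (base_analytic_B Ba fa) ft fx fu !ff fq /= !p0.
  rewrite !(mulr0, mul0r, addr0, add0r).
  by [].
have [[_ _ Te] [_ Xe] Ve HE] := nbhs_singleton pr.
have bv : base (jac (fwd F) q (vert R (2 + 1))) = 0.
  apply/rowP => k; rewrite baseE jac_vert [RHS]mxE.
  by case: (I3P k) => ->.
have [k0 wE] := fiber_bwd PF Fq bv.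
have trf : graph_transversal F q f.
  rewrite /graph_transversal wE.
  have -> : base ((pd (rshift (2 + 1) ord0) (coordF F (rshift (2 + 1) ord0)) q)^-1 *: vert R (2 + 1)) = 0.
    by rewrite /vert -ptZ base_pt scaler0.
  by rewrite derive0 subr0 /vert -ptZ fib_pt mulr1 invr_neq0.
have [g [ga gq fg _]] := graph_transform PF Fq fa fq trf.
have gE : eqDE0 th' g (base (fwd F q)) by apply/(FE f g fa ga fq fg).
have [] := DE0_jets PF Fq pr fa fq ga fg.
have Hq : fib (fwd F q) = H q by rewrite fibE.
have Vq : fib (base (fwd F q)) = V q by rewrite fibE baseE.
move: gE; rewrite /eqDE0 (base_analytic_B B'a ga) gq Hq Vq !ff ft fx fu -/X -/V -/H -/T -/y -/s.
move: AA Xx0 Vu0; rewrite /gx /gu -/T -/z'.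
generalize (cA th' z') (cB th' z') (cC th' z') (pd ix (cA th') z') (pd ix (cB th') z')
  (pd ix (cC th') z') (pd jt g (base (fwd F q))) (pd jx g (base (fwd F q)))
  (pd ju g (base (fwd F q))) (pd jx (pd jx g) (base (fwd F q)))
  (pd jx (pd ju g) (base (fwd F q))) (pd ju (pd ju g) (base (fwd F q)))
  T (V q) (H q) (pd kt H q) (pd kx H q) (pd ku H q) (pd ke H q) (pd kt V q) (pd kx V q)
  (pd ku V q) (pd kt X q) (pd kx X q) (pd kx (pd kx X) q).
generalize (pd kx (pd kx V) q + 2 * y * pd kx (pd ku V) q + y ^+ 2 * pd ku (pd ku V) q).
generalize (pd kx (pd kx H) q + 2 * y * pd kx (pd ku H) q + y ^+ 2 * pd ku (pd ku H) q
      + 2 * s * (pd kx (pd ke H) q + y * pd ku (pd ke H) q) + s ^+ 2 * pd ke (pd ke H) q).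
move=> Hw Vee A B C Ax Bx Cx gt gx' gu' gxx gxu guu T1 V1 H1 Ht Hx Hu He Vt Vx Vu Xt Xx Xxx.
move=> AA Xx0 Vu0 gE J1 J2 J3 J4.
have -> : (Hu + r * He) / Vu = gu' by rewrite -J1 mulrC mulKf.
have -> : (Hx + a * He - Vx * gu') / Xx = gx'.
  by rewrite -J2 addrK mulrC mulKf.
have -> : Ht + c * (y - fib (base q) * r) * He - Xt * gx' - Vt * gu' = T1 * gt.
  by rewrite -J3; ring.
rewrite gE.
have -> : Hw = Xx ^+ 2 * (gxx + 2 * H1 * gxu + H1 ^+ 2 * guu) + gx' * Xxx + gu' * Vee.
  by rewrite J4 !mulr0 !addr0; ring.
by rewrite AA; ring.
Qed.

End DE0Prolongation.

(** * Consequences of the relation for DE_0 *)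

Section DE0Coefficients.
Variable R : realType.

Lemma relation_coefficients (Ht He Xt Vt Hw Hm Xxx Vee T H V u y e f d gx0 gu0 c Ax Bx C Cx B : R) :
  (forall a r, Ht + c * (y - u * r) * He - Xt * (gx0 + a * e - r * f) - Vt * (gu0 + r * d) =
    Hw + 2 * (a + y * r) * Hm - (gx0 + a * e - r * f) * Xxx - (gu0 + r * d) * Vee +
    T * (Ax * ((gx0 + a * e - r * f) + H * (gu0 + r * d)) +
      (Bx * H + B * (gx0 + a * e - r * f)) + C * (H - V * (gu0 + r * d)) + Cx * V)) ->
  - Xt * e = 2 * Hm - e * Xxx + T * (Ax + B) * e /\
  - c * u * He + Xt * f - Vt * d = 2 * y * Hm + f * Xxx - d * Vee +
    T * (Ax * (- f + H * d) - B * f - C * V * d).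
Proof.
move=> P; move: (P 0 0) (P 1 0) (P 0 1).
rewrite !(mul0r, mulr0, mul1r, mulr1, addr0, add0r, subr0) => e0 e1 e2.
split.
  apply: (@addrI _ (Ht + c * y * He - Xt * gx0 - Vt * gu0)).
  transitivity (Ht + c * y * He - Xt * (gx0 + e) - Vt * gu0); first by ring.
  by rewrite e1 e0; ring.
apply: (@addrI _ (Ht + c * y * He - Xt * gx0 - Vt * gu0)).
transitivity (Ht + c * (y - u) * He - Xt * (gx0 - f) - Vt * (gu0 + d)); first by ring.
by rewrite e2 e0; ring.
Qed.

(** With H_eta_eta = 0 the relation is affine in a and r. The conclusions are the coefficients of a,
    multiplied by X_x^2, and of r, multiplied by X_x. *)
Lemma relation_algebra (T H V u y c Ax Bx C Cx B Ht Hx Hu He Hw Hm Hee Vt Vx Vu Vee Vxu Vuu Xt Xx Xxx : R) :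
  Xx != 0 -> Vu != 0 -> He = Vu / Xx -> Hee = 0 ->
  Hm = (Vxu + y * Vuu) / Xx - Vu * Xxx / Xx ^+ 2 ->
  (forall a r, let s := a + y * r in
    let gu := (Hu + r * He) / Vu in let gx := (Hx + a * He - Vx * gu) / Xx in
    Ht + c * (y - u * r) * He - Xt * gx - Vt * gu =
    Hw + 2 * s * Hm + s ^+ 2 * Hee - gx * Xxx - gu * Vee +
    T * (Ax * (gx + H * gu) + (Bx * H + B * gx) + C * (H - V * gu) + Cx * V)) ->
  let f := Vx / Xx ^+ 2 in
  - Xt * Vu = 2 * Xx * (Vxu + y * Vuu) - 3 * Vu * Xxx + T * (Ax + B) * Vu /\
  - c * u * Vu + (Xt * f - Vt / Xx - (2 * y * Hm + f * Xxx - Vee / Xx)) * Xx =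
    T * (Ax * H - C * V) - T * (Ax + B) * f * Xx.
Proof.
move=> Xx0 Vu0 -> -> -> rel; cbv zeta in rel.
set Hm' := (Vxu + y * Vuu) / Xx - Vu * Xxx / Xx ^+ 2 in rel *.
pose e := Vu / Xx ^+ 2; pose d := Xx^-1; pose f := Vx / Xx ^+ 2.
have dE r : (Hu + r * (Vu / Xx)) / Vu = Hu / Vu + r * d by rewrite /d; field; rewrite Xx0 Vu0.
have gxE a r : (Hx + a * (Vu / Xx) - Vx * ((Hu + r * (Vu / Xx)) / Vu)) / Xx =
    (Hx - Vx * (Hu / Vu)) / Xx + a * e - r * f.
  by rewrite /e /f; field; rewrite Xx0 Vu0.
have := @relation_coefficients Ht (Vu / Xx) Xt Vt Hw Hm' Xxx Vee T H V u y e f d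
    ((Hx - Vx * (Hu / Vu)) / Xx) (Hu / Vu) c Ax Bx C Cx B.
case=> [a r|Ea Er].
  by rewrite -gxE -dE; have := rel a r; rewrite mulr0 addr0.
split.
  have : - Xt * e * Xx ^+ 2 = (2 * Hm' - e * Xxx + T * (Ax + B) * e) * Xx ^+ 2 by rewrite Ea.
  have -> : - Xt * e * Xx ^+ 2 = - Xt * Vu by rewrite /e; field.
  by move=> ->; rewrite /e /Hm'; field.
rewrite -/f.
have -> : - c * u * Vu + (Xt * f - Vt / Xx - (2 * y * Hm' + f * Xxx - Vee / Xx)) * Xx =
   (- c * u * (Vu / Xx) + Xt * f - Vt * d - (2 * y * Hm' + f * Xxx - d * Vee)) * Xx.
  by rewrite /d; field.
by rewrite Er /d; field.
Qed.

(** K stands for T (A_x + B). The coefficient of a does not involve c, so both heat equations yield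
    the same K; the coefficients of r then differ only through c, C and A_x. *)
Lemma coefficients_difference (K0 K1 V Vu Z f H Xx u T Ax0 Ax1 C0 C1 E : R) : Vu != 0 ->
  E + K0 * Vu = E + K1 * Vu ->
  - 0 * u * Vu + Z = T * (Ax0 * H - C0 * V) - K0 * f * Xx ->
  - 1 * u * Vu + Z = T * (Ax1 * H - C1 * V) - K1 * f * Xx ->
  u * Vu = T * (C1 - C0) * V - T * (Ax1 - Ax0) * H.
Proof.
move=> Vu0 /addrI /(mulIf Vu0) <- e0 e1.
have -> : u * Vu = (- 0 * u * Vu + Z) - (- 1 * u * Vu + Z) by ring.
by rewrite e0 e1; ring.
Qed.

Lemma DE0_coefficients (F : ptrans R (2 + 1 + 1)) q th0 th1 : point_transformation F -> dom F q ->
  projectable3 F q ->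
  maps_equation F (eqDE0 (heat 0)) (eqDE0 th0) q -> maps_equation F (eqDE0 (heat 1)) (eqDE0 th1) q ->
  let T := pd kt (coordF F kt) q in let X := coordF F kx in let V := coordF F ku in
  let H := coordF F ke in let y := fib q in
  let z' := base (base (fwd F q)) in
  (admissible th0 z' /\ pd kx X q ^+ 2 = cA th0 z' * T) ->
  (admissible th1 z' /\ pd kx X q ^+ 2 = cA th1 z' * T) -> pd kx X q != 0 -> pd ku V q != 0 ->
  pd ke H q = pd ku V q / pd kx X q -> pd ke (pd ke H) q = 0 ->
  pd kx (pd ke H) q + y * pd ku (pd ke H) q = (pd kx (pd ku V) q + y * pd ku (pd ku V) q) / pd kx X q
    - pd ku V q * pd kx (pd kx X) q / pd kx X q ^+ 2 ->
  - pd kt X q * pd ku V q = 2 * pd kx X q * (pd kx (pd ku V) q + y * pd ku (pd ku V) q)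
    - 3 * pd ku V q * pd kx (pd kx X) q + T * (pd ix (cA th0) z' + cB th0 z') * pd ku V q /\
  fib (base q) * pd ku V q =
    T * (cC th1 z' - cC th0 z') * V q - T * (pd ix (cA th1) z' - pd ix (cA th0) z') * H q.
Proof.
move=> PF Fq pr FE0 FE1 T X V H y z' [ad0 AA0] [ad1 AA1] Xx0 Vu0 HeE HeeE HmE.
have [E1 E3] := relation_algebra Xx0 Vu0 HeE HeeE HmE
  (fun a r => DE0_relation a r PF Fq pr FE0 ad0 AA0 Xx0 Vu0).
have [E1' E3'] := relation_algebra Xx0 Vu0 HeE HeeE HmE
  (fun a r => DE0_relation a r PF Fq pr FE1 ad1 AA1 Xx0 Vu0).
split=> //.
exact: (coefficients_difference Vu0 (etrans (esym E1) E1') E3 E3').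
Qed.

Definition fibered3 (F : ptrans R (2 + 1 + 1)) p e := forall q, ball p e q ->
  [/\ dom F q,
      [/\ pd kx (coordF F kt) q = 0, pd ku (coordF F kt) q = 0 & pd ke (coordF F kt) q = 0],
      [/\ pd ku (coordF F kx) q = 0, pd ke (coordF F kx) q = 0 & pd ke (coordF F ku) q = 0],
      [/\ pd kt (coordF F kt) q != 0, pd kx (coordF F kx) q != 0 & pd ku (coordF F ku) q != 0]
    & [/\ coordF F ke q * pd kx (coordF F kx) q =
            pd kx (coordF F ku) q + fib q * pd ku (coordF F ku) q,
          pd ku (pd ku (coordF F ku)) q = 0
        & coordF F ku q = fib (base q) * pd ku (coordF F ku) q]].

Lemma time_algebra (Tx Tu xe ue y : R) : xe = 0 -> ue = 0 -> Tx + y * Tu = 0 ->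
  xe + (1 * Tu + y * ue) = 0 -> Tx = 0 /\ Tu = 0.
Proof.
move=> -> -> e; rewrite add0r mul1r mulr0 addr0 => Tu0; split=> //.
by move: e; rewrite Tu0 mulr0 addr0.
Qed.

(** T does not depend on eta: differentiating T_x + eta T_u = 0 with respect to eta leaves T_u =
    0. *)
Lemma DE0_time (F : ptrans R (2 + 1 + 1)) q : point_transformation F -> dom F q ->
  (\forall p \near q, pd kx (coordF F kt) p + fib p * pd ku (coordF F kt) p = 0 /\
     pd ke (coordF F kt) p = 0) ->
  pd kx (coordF F kt) q = 0 /\ pd ku (coordF F kt) q = 0.
Proof.
move=> PF Fq nT; have an := coordF_analytic kt PF Fq.
have [e1 e2] := nbhs_singleton nT.
have ne2 : \forall p \near q, pd ke (coordF F kt) p = 0 by apply: filterS nT => p [].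
have ne1 : \forall p \near q, pd kx (coordF F kt) p + fib p * pd ku (coordF F kt) p = 0.
  by apply: filterS nT => p [].
have xe : pd ke (pd kx (coordF F kt)) q = 0.
  by apply: (etrans (deriveC_pd ke kx an)); exact: pd_near0.
have ue : pd ke (pd ku (coordF F kt)) q = 0.
  by apply: (etrans (deriveC_pd ke ku an)); exact: pd_near0.
have := pd_near0 ke ne1.
have fe : hasD (delta_mx 0 ke) (@fib R (2 + 1)) q 1.
  split; first exact: analytic_fib.
  have -> : @fib R (2 + 1) = (fun z => z 0 ke) by apply/funext => y; rewrite fibE.
  by rewrite derive_coord mxE !eqxx.
have [_ H] := hasD_add (hasD_derive (delta_mx 0 ke) (analytic_pd kx an))
  (hasD_mul fe (hasD_derive (delta_mx 0 ke) (analytic_pd ku an))).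
move/(etrans (esym H)); exact: time_algebra xe ue e1.
Qed.

Lemma space_algebra (A T Xx Xu y : R) : Xx + y * Xu != 0 ->
  2%:R * (Xx + y * Xu) ^+ 1 * (0 + (1 * Xu + y * 0)) = 0 * T + A * 0 -> Xu = 0.
Proof.
move=> X0; rewrite mul0r mulr0 addr0 add0r mul1r mulr0 addr0 expr1 => /eqP.
by rewrite mulf_eq0 mulf_eq0 pnatr_eq0 (negbTE X0)/= => /eqP.
Qed.

(** In (X_x + eta X_u)^2 = A~ T_t the right-hand side does not depend on eta, since neither T nor X
    does; the eta-derivative reads 2 (X_x + eta X_u) X_u = 0. *)
Lemma DE0_space (F : ptrans R (2 + 1 + 1)) q th : point_transformation F -> dom F q ->
  admissible th (base (base (fwd F q))) ->
  (\forall p \near q, [/\ pd ke (coordF F kt) p = 0, pd ke (coordF F kx) p = 0,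
    pd ke (coordF F ku) p = 0 & (pd kx (coordF F kx) p + fib p * pd ku (coordF F kx) p) ^+ 2 =
      cA th (base (base (fwd F p))) * pd kt (coordF F kt) p]) ->
  pd kx (coordF F kx) q + fib q * pd ku (coordF F kx) q != 0 ->
  pd ku (coordF F kx) q = 0.
Proof.
move=> PF Fq [A'a _ _ _] nn X0.
have anX := coordF_analytic kx PF Fq; have anT := coordF_analytic kt PF Fq.
have [Te Xe Ve _] := nbhs_singleton nn.
have nTe : \forall p \near q, pd ke (coordF F kt) p = 0 by apply: filterS nn => p [].
have nXe : \forall p \near q, pd ke (coordF F kx) p = 0 by apply: filterS nn => p [].
have nAA : \forall p \near q, (pd kx (coordF F kx) p + fib p * pd ku (coordF F kx) p) ^+ 2 =
      cA th (base (base (fwd F p))) * pd kt (coordF F kt) p by apply: filterS nn => p [].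
have com k i : analytic_at (coordF F k) q -> (\forall p \near q, pd ke (coordF F k) p = 0) ->
    hasD (delta_mx 0 ke) (pd i (coordF F k)) q 0.
  move=> an n0; split; first exact: analytic_pd.
  by apply: (etrans (deriveC_pd ke i an)); exact: pd_near0.
have fe : hasD (delta_mx 0 ke) (@fib R (2 + 1)) q 1.
  split; first exact: analytic_fib.
  have -> : @fib R (2 + 1) = (fun z => z 0 ke) by apply/funext => y; rewrite fibE.
  by rewrite derive_coord mxE !eqxx.
have dA : hasD (delta_mx 0 ke) (fun p => cA th (base (base (fwd F p)))) q 0.
  have am : analytic_map_at (fun p => base (base (fwd F p))) q.
    apply: (analytic_map_comp (H := fun p => base (base p))).
      by apply: (analytic_map_comp (H := @base R 2)); exact: analytic_map_base.
    by have [_ _ _ aF _] := PF; exact: aF.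
  split; first exact: (@analytic_comp _ _ _ _ (fun p => base (base (fwd F p))) q A'a am).
  apply: (etrans (@derive_comp _ _ _ _ (fun p => base (base (fwd F p))) q _ A'a am)).
  have -> : jac (fun p => base (base (fwd F p))) q (delta_mx 0 ke) = 0; last exact: derive0.
  rewrite (jac_base (fun p => base (fwd F p))) jac_base.
  apply/rowP => k; rewrite baseE baseE -vertE jac_vert [RHS]mxE.
  by have [->|->] := I2P k; [exact: Te|exact: Xe].
have [_ L] := hasD_exp 1 (hasD_add (com kx kx anX nXe) (hasD_mul fe (com kx ku anX nXe))).
have [_ Rr] := hasD_mul dA (com kt kt anT nTe).
have E : 'D_(delta_mx 0 ke) (fun p => (pd kx (coordF F kx) p + fib p * pd ku (coordF F kx) p) ^+ 2) q =
  'D_(delta_mx 0 ke) (fun p => cA th (base (base (fwd F p))) * pd kt (coordF F kt) p) q.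
  exact: near_eq_derive.
have := etrans (esym L) (etrans E Rr).
exact: space_algebra X0.
Qed.

End DE0Coefficients.

Section DE0EtaComponent.
Variable R : realType.

Lemma analytic_slice n (f : 'rV[R]_(n + 1) -> R) w y : analytic_at f (pt w y) ->
  analytic_at (fun w' => f (pt w' y)) w.
Proof.
move=> fa; apply: (@analytic_comp _ _ _ f (fun w' : 'rV[R]_n => pt w' y) w fa).
by apply: analytic_pt; [exact: analytic_map_id|exact: analytic_cst].
Qed.

Lemma pd_slice n (f : 'rV[R]_(n + 1) -> R) w y i : analytic_at f (pt w y) ->
  pd i (fun w' => f (pt w' y)) w = pd (lshift 1 i) f (pt w y).
Proof.
move=> fa; apply: (etrans (@derive_comp _ _ _ f (fun w' : 'rV[R]_n => pt w' y) w _ fa _)).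
  by apply: analytic_pt; [exact: analytic_map_id|exact: analytic_cst].
have -> : jac (fun w' : 'rV[R]_n => pt w' y) w (delta_mx 0 i) = delta_mx 0 (lshift 1 i); last by [].
rewrite delta_lshift; apply: (etrans (jac_pt (fun w' : 'rV[R]_n => w') (fun=> y) w _)).
by rewrite jac_id derive_cst.
Qed.

Lemma ball_pt n (p : 'rV[R]_(n + 1)) e w : ball (base p) e w -> ball p e (pt w (fib p)).
Proof.
rewrite -!ball_normE/= -{2}(pt_base_fib p) -ptB subrr => pw.
by apply: le_lt_trans pw; apply: pt_le; rewrite // normr0.
Qed.

Lemma ball_base n (p : 'rV[R]_(n + 1)) e q : ball p e q -> ball (base p) e (base q).
Proof.
rewrite -!ball_normE/=; apply: le_lt_trans.
have -> : base p - base q = base (p - q) by apply/rowP => i; rewrite !mxE.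
exact: norm_base.
Qed.

Lemma fib_hasD n (q : 'rV[R]_(n + 1)) : hasD (delta_mx 0 (rshift n ord0)) (@fib R n) q 1.
Proof.
split; first exact: analytic_fib.
have -> : @fib R n = (fun z => z 0 (rshift n ord0)) by apply/funext => y; rewrite fibE.
by rewrite derive_coord mxE !eqxx.
Qed.

Lemma quotient_algebra0 (Vxe Vu y Vue Vx Xx Xxe : R) : Vxe = 0 -> Vue = 0 -> Xxe = 0 -> Xx != 0 ->
  ((Vxe + (1 * Vu + y * Vue)) * Xx - (Vx + y * Vu) * Xxe) / Xx ^+ 2 = Vu / Xx.
Proof. by move=> -> -> -> Xx0; field. Qed.

Lemma quotient_algebra1 (Vxu Vuu Vu Xx Xxx Xxu y : R) : Xx != 0 -> Xxu = 0 ->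
  (Vxu * Xx - Vu * Xxx) / Xx ^+ 2 + y * ((Vuu * Xx - Vu * Xxu) / Xx ^+ 2) =
  (Vxu + y * Vuu) / Xx - Vu * Xxx / Xx ^+ 2.
Proof. by move=> Xx0 ->; field. Qed.

(** The contact condition makes H the quotient (V_x + eta V_u) / X_x on the whole ball, where V and
    X do not depend on eta: H is affine in eta, and the formulas follow by differentiating the
    quotient. *)
Lemma DE0_eta_jets (F : ptrans R (2 + 1 + 1)) p e : point_transformation F ->
  let T := coordF F kt in let X := coordF F kx in let V := coordF F ku in
  let H := coordF F ke in
  (forall q, ball p e q -> [/\ dom F q, pd ku X q = 0, pd ke X q = 0, pd ke V q = 0 &
     pd kx X q != 0 /\ H q * pd kx X q = pd kx V q + fib q * pd ku V q]) ->
  forall q, ball p e q ->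
  [/\ pd ke H q = pd ku V q / pd kx X q, pd ke (pd ke H) q = 0 &
      pd kx (pd ke H) q + fib q * pd ku (pd ke H) q =
      (pd kx (pd ku V) q + fib q * pd ku (pd ku V) q) / pd kx X q
      - pd ku V q * pd kx (pd kx X) q / pd kx X q ^+ 2].
Proof.
move=> PF T X V H hyp.
have an k q : ball p e q -> analytic_at (coordF F k) q.
  by move=> /hyp[Fq _ _ _ _]; exact: coordF_analytic.
have Xe i q : ball p e q -> pd ke (pd i X) q = 0.
  by apply: fiber_pd => w pw; [exact: an|have [] := hyp w pw].
have Ve i q : ball p e q -> pd ke (pd i V) q = 0.
  by apply: fiber_pd => w pw; [exact: an|have [] := hyp w pw].
have Xx0 q : ball p e q -> pd kx X q != 0 by move=> /hyp[_ _ _ _ []].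
have HE q : ball p e q -> (pd kx V q + fib q * pd ku V q) / pd kx X q = H q.
  by move=> pq; have [_ _ _ _ [h <-]] := hyp q pq; rewrite mulfK.
have HeE q : ball p e q -> pd ku V q / pd kx X q = pd ke H q.
  move=> pq; have nE := ball_nbhs pq HE.
  have aX := analytic_pd kx (an kx q pq).
  have [_ D] := hasD_near nE (hasD_div (Xx0 q pq)
    (hasD_add (hasD_derive (delta_mx 0 ke) (analytic_pd kx (an ku q pq)))
      (hasD_mul (fib_hasD q) (hasD_derive (delta_mx 0 ke) (analytic_pd ku (an ku q pq)))))
    (hasD_derive (delta_mx 0 ke) aX)).
  apply: esym; apply: (etrans D).
  exact: (@quotient_algebra0 _ (pd ku V q) (fib q) _ (pd kx V q) _ _ (Ve kx q pq) (Ve ku q pq) (Xe kx q pq) (Xx0 q pq)).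
move=> q pq; split.
- by apply: esym; exact: HeE.
- have nE := ball_nbhs pq HeE.
  have [_ D] := hasD_near nE (hasD_div (Xx0 q pq)
    (hasD_derive (delta_mx 0 ke) (analytic_pd ku (an ku q pq)))
    (hasD_derive (delta_mx 0 ke) (analytic_pd kx (an kx q pq)))).
  apply: (etrans D).
  have z (a b c d : R) : a = 0 -> d = 0 -> (a * b - c * d) / b ^+ 2 = 0.
    by move=> -> ->; rewrite mul0r mulr0 subrr mul0r.
  exact: z (Ve ku q pq) (Xe kx q pq).
have D i : pd i (pd ke H) q =
    (pd i (pd ku V) q * pd kx X q - pd ku V q * pd i (pd kx X) q) / pd kx X q ^+ 2.
  have [_ D] := hasD_near (ball_nbhs pq HeE) (hasD_div (Xx0 q pq)
    (hasD_derive (delta_mx 0 i) (analytic_pd ku (an ku q pq)))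
    (hasD_derive (delta_mx 0 i) (analytic_pd kx (an kx q pq)))).
  exact: D.
have Xxu : pd ku (pd kx X) q = 0.
  apply: (etrans (deriveC_pd ku kx (an kx q pq))); apply: pd_near0.
  by apply: ball_nbhs pq _ => w /hyp[].
apply: (etrans (f_equal2 (fun a b => a + fib q * b) (D kx) (D ku))).
exact: (@quotient_algebra1 _ _ _ _ _ _ (fib q) (Xx0 q pq) Xxu).
Qed.

End DE0EtaComponent.

Section DE0Ball.
Variable R : realType.

(** In the coefficient of a, only y V_uu varies with eta; two values of eta give V_uu = 0. *)
Lemma DE0_compare (Xt Vu Xx Vxu y y' Vuu Xxx K : R) : Xx != 0 -> y != y' ->
  - Xt * Vu = 2 * Xx * (Vxu + y * Vuu) - 3 * Vu * Xxx + K ->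
  - Xt * Vu = 2 * Xx * (Vxu + y' * Vuu) - 3 * Vu * Xxx + K -> Vuu = 0.
Proof.
move=> Xx0 yy e e'; have : 2 * Xx * (y - y') * Vuu = 0.
  have -> : 2 * Xx * (y - y') * Vuu =
    (2 * Xx * (Vxu + y * Vuu) - 3 * Vu * Xxx + K) - (2 * Xx * (Vxu + y' * Vuu) - 3 * Vu * Xxx + K) by ring.
  by rewrite -e -e' subrr.
by move=> /eqP; rewrite !mulf_eq0 pnatr_eq0 (negbTE Xx0) subr_eq0 (negbTE yy)/= => /eqP.
Qed.

(** Along an eta-axis u V_u, S and T D are constant while H takes distinct values, which forces T D
    = 0. In the application D is the difference of the A_x of the two target equations. *)
Lemma DE0_compare_zeroth (u Vu Vx Xx T D H H' y y' S : R) : Vu != 0 -> Xx != 0 -> y != y' ->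
  H * Xx = Vx + y * Vu -> H' * Xx = Vx + y' * Vu ->
  u * Vu = S - T * D * H -> u * Vu = S - T * D * H' -> u * Vu = S.
Proof.
move=> Vu0 Xx0 yy e e' -> /addrI /oppr_inj h.
have : T * D * ((y - y') * Vu) = 0.
  have -> : T * D * ((y - y') * Vu) = (T * D * H - T * D * H') * Xx.
    have -> : (y - y') * Vu = (H - H') * Xx by rewrite [RHS]mulrBl e e'; ring.
    by ring.
  by rewrite h subrr mul0r.
move=> /eqP; rewrite mulf_eq0 [X in _ || X]mulf_eq0 subr_eq0 (negbTE yy) (negbTE Vu0) !orbF => /eqP ->.
by rewrite mul0r subr0.
Qed.

Lemma fwd_base2 (F : ptrans R (2 + 1 + 1)) w w' :
  coordF F kt w = coordF F kt w' -> coordF F kx w = coordF F kx w' ->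
  base (base (fwd F w)) = base (base (fwd F w')).
Proof.
move=> eT eX; apply/rowP => k; rewrite !baseE.
by have [->|->] := I2P k; [exact: eT|exact: eX].
Qed.

Section Ball.
Variables (F : ptrans R (2 + 1 + 1)) (th0 th1 : coeffs R) (p : 'rV[R]_(2 + 1 + 1)) (e : R).
Hypothesis PF : point_transformation F.
Hypothesis hyp : forall q, ball p e q ->
  [/\ dom F q, admissible th0 (base (base (fwd F q))), admissible th1 (base (base (fwd F q))),
      maps_equation F (eqDE0 (heat 0)) (eqDE0 th0) q
    & maps_equation F (eqDE0 (heat 1)) (eqDE0 th1) q].
Let T := coordF F kt.
Let X := coordF F kx.
Let V := coordF F ku.
Let H := coordF F ke.

(** The conditions come in stages, each of them needed on a neighborhood by the next one: contact,
    then T = T(t), then independence of eta, then X_u = 0. *)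
Lemma DE0_first_order_facts q : ball p e q ->
  [/\ [/\ pd kx T q = 0, pd ku T q = 0 & pd ke T q = 0],
      [/\ pd ku X q = 0, pd ke X q = 0 & pd ke V q = 0],
      [/\ pd kt T q != 0, pd kx X q != 0 & pd ke H q != 0],
      H q * pd kx X q = pd kx V q + fib q * pd ku V q
    & (admissible th0 (base (base (fwd F q))) /\
        pd kx X q ^+ 2 = cA th0 (base (base (fwd F q))) * pd kt T q) /\
      (admissible th1 (base (base (fwd F q))) /\
        pd kx X q ^+ 2 = cA th1 (base (base (fwd F q))) * pd kt T q)].
Proof.
have hC q' : ball p e q' ->
  [/\ pd kx T q' + fib q' * pd ku T q' = 0, pd ke T q' = 0,
      pd ke V q' = H q' * pd ke X q'
    & pd kx V q' + fib q' * pd ku V q' = H q' * (pd kx X q' + fib q' * pd ku X q')].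
  by move=> /hyp[Fq ad _ FE _]; exact: DE0_contact PF Fq FE ad.
have hT q' : ball p e q' -> [/\ pd kx T q' = 0, pd ku T q' = 0 & pd ke T q' = 0].
  move=> pq; have [Fq _ _ _ _] := hyp pq; have [_ Te _ _] := hC _ pq.
  have [] := @DE0_time _ F q' PF Fq; last by [].
  by apply: ball_nbhs pq _ => w /hC[].
have hP q' : ball p e q' -> [/\ pd ke X q' = 0, pd ke V q' = 0,
      pd kt T q' != 0 /\ pd ke H q' != 0,
      pd kx X q' + fib q' * pd ku X q' != 0
    & (pd kx X q' + fib q' * pd ku X q') ^+ 2 =
      cA th0 (base (base (fwd F q'))) * pd kt T q'].
  move=> pq; have [Fq ad _ FE _] := hyp pq.
  by apply: (DE0_projectable PF Fq FE ad); apply: ball_nbhs pq hT.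
have hP1 q' : ball p e q' -> (pd kx X q' + fib q' * pd ku X q') ^+ 2 =
      cA th1 (base (base (fwd F q'))) * pd kt T q'.
  move=> pq; have [Fq _ ad _ FE] := hyp pq.
  by have [] := DE0_projectable PF Fq FE ad (ball_nbhs pq hT).
move=> pq; have [Fq ad0 ad1 _ _] := hyp pq.
have [Xe Ve [T0 He0] X0 AA0] := hP q pq; have AA1 := hP1 q pq.
have Xu : pd ku X q = 0.
  apply: (DE0_space PF Fq ad0 _ X0); apply: ball_nbhs pq _ => w pw.
  by have [_ _ Te] := hT w pw; have [Xe' Ve' _ _ AA'] := hP w pw.
have Xx : pd kx X q + fib q * pd ku X q = pd kx X q by rewrite Xu mulr0 addr0.
have [_ _ _ HX] := hC q pq.
rewrite Xx in X0 AA0 AA1 HX.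
by split=> //; exact: hT.
Qed.

Lemma DE0_second_order_facts q : ball p e q -> pd ku V q != 0 /\
  (- pd kt X q * pd ku V q = 2 * pd kx X q * (pd kx (pd ku V) q + fib q * pd ku (pd ku V) q)
    - 3 * pd ku V q * pd kx (pd kx X) q + pd kt T q *
      (pd ix (cA th0) (base (base (fwd F q))) + cB th0 (base (base (fwd F q)))) * pd ku V q /\
  fib (base q) * pd ku V q =
    pd kt T q * (cC th1 (base (base (fwd F q))) - cC th0 (base (base (fwd F q)))) * V q -
    pd kt T q * (pd ix (cA th1) (base (base (fwd F q))) - pd ix (cA th0) (base (base (fwd F q)))) * H q).
Proof.
move=> pq; have [Fq _ _ FE0 FE1] := hyp pq.
have [] := @DE0_eta_jets _ F p e PF _ q pq.
  move=> w pw; have [Fw _ _ _ _] := hyp pw.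
  by have [_ [Xu Xe Ve] [_ Xx0 _] Hw _] := DE0_first_order_facts pw.
move=> HeE HeeE HmE.
have [_ _ [_ Xx0 He0] _ [A0 A1]] := DE0_first_order_facts pq.
have Vu0 : pd ku V q != 0.
  by move: He0; rewrite -/H HeE mulf_eq0 negb_or => /andP[].
split=> //; apply: (DE0_coefficients PF Fq _ FE0 FE1 A0 A1 Xx0 Vu0 HeE HeeE HmE).
apply: ball_nbhs pq _ => w pw.
by have [? [? ? ?] _ ? _] := DE0_first_order_facts pw.
Qed.

(* All the quantities but eta and the last component are constant along the
   eta-axis: the relations are compared at two points of it. *)
Lemma DE0_fiber_facts q : ball p e q -> pd ku (pd ku V) q = 0 /\
  fib (base q) * pd ku V q =
    pd kt T q * (cC th1 (base (base (fwd F q))) - cC th0 (base (base (fwd F q)))) * V q.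
Proof.
move=> pq; have [y yq pq'] := ball_fiber pq.
have [Vu0 [E1 E3]] := DE0_second_order_facts pq.
have [_ [E1' E3']] := DE0_second_order_facts pq'.
have [_ _ [_ Xx0 _] Hq _] := DE0_first_order_facts pq.
have [_ _ _ Hq' _] := DE0_first_order_facts pq'.
have bq : base q = base (pt (base q) y) by rewrite base_pt.
have an k w : ball p e w -> analytic_at (coordF F k) w.
  by move=> /hyp[Fw _ _ _ _]; exact: coordF_analytic.
have Te w : ball p e w -> pd ke T w = 0 by move=> /DE0_first_order_facts[[]].
have Xe w : ball p e w -> pd ke X w = 0 by move=> /DE0_first_order_facts[_ []].
have Ve w : ball p e w -> pd ke V w = 0 by move=> /DE0_first_order_facts[_ []].
have c0 f : (forall w, ball p e w -> analytic_at f w) -> (forall w, ball p e w -> pd ke f w = 0) ->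
    f (pt (base q) y) = f q.
  by move=> fa f0; apply: (pd0_fiber fa f0 pq' pq); rewrite -bq.
have c1 f i : (forall w, ball p e w -> analytic_at f w) -> (forall w, ball p e w -> pd ke f w = 0) ->
    pd i f (pt (base q) y) = pd i f q.
  move=> fa f0; by apply: (c0 (pd i f) _ (@fiber_pd R _ f p e i fa f0)) => w pw; exact: analytic_pd (fa w pw).
have c2 f i j : (forall w, ball p e w -> analytic_at f w) -> (forall w, ball p e w -> pd ke f w = 0) ->
    pd i (pd j f) (pt (base q) y) = pd i (pd j f) q.
  move=> fa f0; by apply: (c1 (pd j f) i _ (@fiber_pd R _ f p e j fa f0)) => w pw; exact: analytic_pd (fa w pw).
have zE : base (base (fwd F (pt (base q) y))) = base (base (fwd F q)).
  by apply: fwd_base2; apply: c0 => //; exact: an.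
move: E1' E3' Hq'.
rewrite zE (c1 X kt (an kx) Xe) (c1 V ku (an ku) Ve) (c1 X kx (an kx) Xe) (c2 V kx ku (an ku) Ve).
rewrite (c2 V ku ku (an ku) Ve) (c2 X kx kx (an kx) Xe) (c1 T kt (an kt) Te) -bq.
rewrite (c0 V (an ku) Ve) (c1 V kx (an ku) Ve) fib_pt => E1' E3' Hq'.
rewrite eq_sym in yq; split; first exact: (DE0_compare Xx0 yq E1 E1').
exact: (DE0_compare_zeroth Vu0 Xx0 yq Hq Hq' E3 E3').
Qed.

End Ball.
End DE0Ball.

Section DE0Structure.
Variable R : realType.

(** V does not depend on eta: freezing eta at its value at p turns V into a function of (t, x, u),
    to which [linear_fiber] applies as in the case of L. *)
Lemma DE0_fiber_linear (F : ptrans R (2 + 1 + 1)) th0 th1 p e : point_transformation F ->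
  (forall q, ball p e q ->
  [/\ dom F q, admissible th0 (base (base (fwd F q))), admissible th1 (base (base (fwd F q))),
      maps_equation F (eqDE0 (heat 0)) (eqDE0 th0) q
    & maps_equation F (eqDE0 (heat 1)) (eqDE0 th1) q]) ->
  forall q, ball p e q -> coordF F ku q = fib (base q) * pd ku (coordF F ku) q.
Proof.
move=> PF hyp; pose y0 := fib p.
have an k w : ball p e w -> analytic_at (coordF F k) w.
  by move=> /hyp[Fw _ _ _ _]; exact: coordF_analytic.
have an3 k w : ball (base p) e w -> analytic_at (coordF F k) (pt w y0).
  by move=> /ball_pt; exact: an.
have sl k i w : ball (base p) e w ->
    pd i (fun w' => coordF F k (pt w' y0)) w = pd (lshift 1 i) (coordF F k) (pt w y0).
  by move=> pw; apply: pd_slice; exact: an3.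
pose V w := coordF F ku (pt w y0).
pose kappa (w : 'rV[R]_(2 + 1)) := let q := pt w y0 in pd kt (coordF F kt) q *
    (cC th1 (base (base (fwd F q))) - cC th0 (base (base (fwd F q)))).
have Va w : ball (base p) e w -> analytic_at V w.
  by move=> pw; apply: (@analytic_slice _ _ _ w y0); exact: an3.
have VuE w : ball (base p) e w -> pd ju V w = pd ku (coordF F ku) (pt w y0) by exact: sl.
have VuuE w : ball (base p) e w -> pd ju (pd ju V) w = 0.
  move=> pw; have nE := ball_nbhs pw VuE.
  apply: (etrans (near_eq_derive _ nE)).
  apply: (etrans (pd_slice ju (analytic_pd ku (an3 ku w pw)))).
  by have [] := DE0_fiber_facts PF hyp (ball_pt pw).
have Vu0 w : ball (base p) e w -> pd ju V w != 0.
  by move=> pw; rewrite (VuE w pw); have [] := DE0_second_order_facts PF hyp (ball_pt pw).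
have T0 w : ball (base p) e w -> pd ju (fun w' => coordF F kt (pt w' y0)) w = 0.
  move=> pw; apply: (etrans (sl kt ju w pw)).
  by have [[]] := DE0_first_order_facts PF hyp (ball_pt pw).
have X0 w : ball (base p) e w -> pd ju (fun w' => coordF F kx (pt w' y0)) w = 0.
  move=> pw; apply: (etrans (sl kx ju w pw)).
  by have [_ []] := DE0_first_order_facts PF hyp (ball_pt pw).
have asl k w : ball (base p) e w -> analytic_at (fun w' => coordF F k (pt w' y0)) w.
  by move=> pw; apply: (@analytic_slice _ _ _ w y0); exact: an3.
have aTt w : ball (base p) e w -> analytic_at (pd jt (fun w' => coordF F kt (pt w' y0))) w.
  by move=> pw; apply: analytic_pd; exact: asl.
have Ttu := @fiber_pd _ _ _ (base p) e jt (asl kt) T0.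
have kc w w' : ball (base p) e w -> ball (base p) e w' -> base w = base w' -> kappa w = kappa w'.
  move=> pw pw' ww'; rewrite /kappa /=.
  rewrite (@fwd_base2 _ F (pt w y0) (pt w' y0)).
  - congr (_ * _).
    rewrite -(sl kt jt w pw) -(sl kt jt w' pw').
    exact: (pd0_fiber aTt Ttu pw pw' ww').
  - exact: (pd0_fiber (asl kt) T0 pw pw' ww').
  - exact: (pd0_fiber (asl kx) X0 pw pw' ww').
have kV w : ball (base p) e w -> fib w * pd ju V w = kappa w * V w.
  move=> pw; rewrite (VuE w pw).
  by have [_] := DE0_fiber_facts PF hyp (ball_pt pw); rewrite base_pt.
move=> q pq; have pb := ball_base pq.
have := linear_fiber Va VuuE Vu0 kc kV pb.
rewrite (VuE _ pb).
have Ve w : ball p e w -> pd ke (coordF F ku) w = 0.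
  by move=> /(DE0_first_order_facts PF hyp)[_ []].
have bq : base (pt (base q) y0) = base q by rewrite base_pt.
rewrite /V (pd0_fiber (an ku) Ve (ball_pt pb) pq bq) => ->.
congr (_ * _); apply: (pd0_fiber _ _ (ball_pt pb) pq bq) => w pw.
  by apply: analytic_pd; exact: an.
exact: (@fiber_pd _ _ _ p e ku (an ku) Ve w pw).
Qed.

Theorem DE0_structure (F : ptrans R (2 + 1 + 1)) p : Gequiv0 F -> dom F p ->
  exists2 e, 0 < e & fibered3 F p e.
Proof.
move=> [PF HF] Fp.
have [th0 ad0 FE0] := HF p (heat 0) Fp (heat_admissible _ _).
have [th1 ad1 FE1] := HF p (heat 1) Fp (heat_admissible _ _).
have bF : (fun q => base (base (fwd F q))) @ p --> base (base (fwd F p)).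
  by apply: cvg_comp (@base_cvg _ _ _); apply: cvg_comp (fwd_cvg PF Fp) (@base_cvg _ _ _).
have nD := dom_near PF Fp.
have adn0 : \forall q \near p, admissible th0 (base (base (fwd F q))) by exact: (bF _ (admissible_near ad0)).
have adn1 : \forall q \near p, admissible th1 (base (base (fwd F q))) by exact: (bF _ (admissible_near ad1)).
have /near_exists_ball[e e0 hyp] : \forall q \near p,
  [/\ dom F q, admissible th0 (base (base (fwd F q))), admissible th1 (base (base (fwd F q))),
      maps_equation F (eqDE0 (heat 0)) (eqDE0 th0) q
    & maps_equation F (eqDE0 (heat 1)) (eqDE0 th1) q].
  by near=> q; split; near: q.
exists e => // q pq; have [Fq _ _ _ _] := hyp q pq.
have [T [Xu Xe Ve] [T0 Xx0 _] HX _] := DE0_first_order_facts PF hyp pq.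
have [Vu0 _] := DE0_second_order_facts PF hyp pq.
have [Vuu _] := DE0_fiber_facts PF hyp pq.
by split=> //; split=> //; exact: (DE0_fiber_linear PF hyp).
Unshelve. all: by end_near. Qed.

End DE0Structure.

(** * Local forms of the transformations *)

Section Gauge.
Variable R : realType.

(* T is a function of t only; it is kept as a function of (t, x) with T_x = 0. *)
Record gauge := Gauge { gT : 'rV[R]_2 -> R; gX : 'rV[R]_2 -> R; gU : 'rV[R]_2 -> R }.

Definition gZ (g : gauge) z : 'rV[R]_2 := point2 (gT g z) (gX g z).

Definition gauge_at (g : gauge) z : Prop :=
  [/\ analytic_at (gT g) z, analytic_at (gX g) z, analytic_at (gU g) z,
      \forall y \near z, pd ix (gT g) y = 0
    & [/\ pd it (gT g) z != 0, pd ix (gX g) z != 0 & gU g z != 0]].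

Definition ext2 (g : gauge) (q : 'rV[R]_(2 + 1)) : 'rV[R]_(2 + 1) :=
  pt (gZ g (base q)) (gU g (base q) * fib q).

Definition gH (g : gauge) (q : 'rV[R]_(2 + 1)) (eta : R) : R :=
  gU g (base q) / pd ix (gX g) (base q) * eta +
  pd ix (gU g) (base q) / pd ix (gX g) (base q) * fib q.

Definition ext3 (g : gauge) (q : 'rV[R]_(2 + 1 + 1)) : 'rV[R]_(2 + 1 + 1) :=
  pt (ext2 g (base q)) (gH g (base q) (fib q)).

Lemma point2_t (a b : R) : point2 a b 0 it = a.
Proof. by rewrite mxE eqxx. Qed.

Lemma point2_x (a b : R) : point2 a b 0 ix = b.
Proof. by rewrite mxE. Qed.

Lemma point2E (z : 'rV[R]_2) : point2 (z 0 it) (z 0 ix) = z.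
Proof. by apply/rowP => k; have [->|->] := I2P k; rewrite ?point2_t ?point2_x. Qed.

Lemma analytic_point2 n (f g : 'rV[R]_n -> R) a : analytic_at f a -> analytic_at g a ->
  analytic_map_at (fun z => point2 (f z) (g z)) a.
Proof.
move=> fa ga k; have [->|->] := I2P k.
  by under eq_fun do rewrite point2_t.
by under eq_fun do rewrite point2_x.
Qed.

Lemma jac_point2 n (f g : 'rV[R]_n -> R) a v :
  jac (fun z => point2 (f z) (g z)) a v = point2 ('D_v f a) ('D_v g a).
Proof.
apply/rowP => k; rewrite mxE; have [->|->] := I2P k.
  by rewrite point2_t; under eq_fun do rewrite point2_t.
by rewrite point2_x; under eq_fun do rewrite point2_x.
Qed.

Lemma near_pd0 n (f : 'rV[R]_n -> R) a i : (\forall z \near a, pd i f z = 0) -> pd i f a = 0.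
Proof. exact: nbhs_singleton. Qed.

Lemma analytic_neq0_near n (f : 'rV[R]_n -> R) a : analytic_at f a -> f a != 0 ->
  \forall z \near a, f z != 0.
Proof.
move=> fa f0; have c := analytic_continuous fa.
by apply: (c [set x | x != 0]); apply: open_nbhs_nbhs; split=> //; exact: open_neq.
Qed.

Lemma gauge_near g z : gauge_at g z -> \forall y \near z, gauge_at g y.
Proof.
move=> [Ta Xa Ua Tx [T0 X0 U0]].
have nT0 := analytic_neq0_near (analytic_pd it Ta) T0.
have nX0 := analytic_neq0_near (analytic_pd ix Xa) X0.
have nU0 := analytic_neq0_near Ua U0.
have nTa := analytic_near Ta; have nXa := analytic_near Xa; have nUa := analytic_near Ua.
have nTx := near_join Tx.
by near=> y; split; [near: y|near: y|near: y|near: y|split; near: y].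
Unshelve. all: by end_near. Qed.

Lemma gZ_analytic g z : gauge_at g z -> analytic_map_at (gZ g) z.
Proof. by move=> [Ta Xa _ _ _]; exact: analytic_point2. Qed.

Lemma pull_D g z v (h : 'rV[R]_2 -> R) : gauge_at g z -> analytic_at h (gZ g z) ->
  'D_v (fun y => h (gZ g y)) z = 'D_v (gT g) z * pd it h (gZ g z) + 'D_v (gX g) z * pd ix h (gZ g z).
Proof.
move=> gz ha; apply: (etrans (derive_comp v ha (gZ_analytic gz))).
apply: (etrans (dir2 _ ha)).
by rewrite /gZ jac_point2 point2_t point2_x.
Qed.

Lemma pull_x g z (h : 'rV[R]_2 -> R) : gauge_at g z -> analytic_at h (gZ g z) ->
  pd ix (fun y => h (gZ g y)) z = pd ix (gX g) z * pd ix h (gZ g z).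
Proof.
move=> gz ha; apply: (etrans (pull_D _ gz ha)).
have [_ _ _ Tx _] := gz.
by rewrite -!/(pd _ _ _) (near_pd0 Tx) mul0r add0r.
Qed.

Lemma pull_t g z (h : 'rV[R]_2 -> R) : gauge_at g z -> analytic_at h (gZ g z) ->
  pd it (fun y => h (gZ g y)) z =
  pd it (gT g) z * pd it h (gZ g z) + pd it (gX g) z * pd ix h (gZ g z).
Proof. by move=> gz ha; exact: pull_D. Qed.

Lemma D_base n (h : 'rV[R]_n -> R) (w v : 'rV[R]_(n + 1)) : analytic_at h (base w) ->
  'D_v (fun y => h (base y)) w = 'D_(base v) h (base w).
Proof.
move=> ha; apply: (etrans (derive_comp v ha (analytic_map_base w))).
have -> : jac (@base R n) w v = base v; last by [].
by apply: (etrans (jac_base (fun y => y) w v)); rewrite jac_id.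
Qed.

Lemma hasD_base n (h : 'rV[R]_n -> R) (w v : 'rV[R]_(n + 1)) : analytic_at h (base w) ->
  hasD v (fun y => h (base y)) w ('D_(base v) h (base w)).
Proof.
move=> ha; split; last exact: D_base.
exact: (@analytic_comp _ _ _ h (@base R n) w ha (analytic_map_base w)).
Qed.

Lemma ext2_analytic g (w : 'rV[R]_(2 + 1)) : gauge_at g (base w) -> analytic_map_at (ext2 g) w.
Proof.
move=> gw; apply: analytic_pt.
  apply: (@analytic_map_comp _ _ _ _ (gZ g) (@base R 2)); [exact: gZ_analytic|exact: analytic_map_base].
have [_ _ Ua _ _] := gw.
by apply: analytic_mul; [have [] := hasD_base 0 Ua|exact: analytic_fib].
Qed.

Lemma pull3_D g (w v : 'rV[R]_(2 + 1)) (h : 'rV[R]_(2 + 1) -> R) :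
  gauge_at g (base w) -> analytic_at h (ext2 g w) ->
  'D_v (fun y => h (ext2 g y)) w =
  'D_(base v) (gT g) (base w) * pd jt h (ext2 g w) +
  'D_(base v) (gX g) (base w) * pd jx h (ext2 g w) +
  ('D_(base v) (gU g) (base w) * fib w + gU g (base w) * fib v) * pd ju h (ext2 g w).
Proof.
move=> gw ha; apply: (etrans (derive_comp v ha (ext2_analytic gw))).
have [Ta Xa Ua _ _] := gw.
have -> : jac (ext2 g) w v = pt (point2 ('D_(base v) (gT g) (base w)) ('D_(base v) (gX g) (base w)))
   ('D_(base v) (gU g) (base w) * fib w + gU g (base w) * fib v).
  apply: (etrans (jac_pt (fun y => gZ g (base y)) (fun y => gU g (base y) * fib y) w v)).
  have [_ ->] := hasD_mul (hasD_base v Ua) (hasD_derive v (analytic_fib w)).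
  rewrite derive_fib jac_id; congr pt.
  apply: (etrans (jac_point2 _ _ _ _)).
  by rewrite (D_base v Ta) (D_base v Xa).
by apply: (etrans (pt_dir3 _ _ ha)); rewrite point2_t point2_x.
Qed.

End Gauge.

Section GaugeGroup.
Variable R : realType.
Implicit Types g : gauge R.

Definition gid : gauge R := Gauge (fun z => z 0 it) (fun z => z 0 ix) (fun=> 1).

Definition gcomp (g2 g1 : gauge R) : gauge R :=
  Gauge (fun z => gT g2 (gZ g1 z)) (fun z => gX g2 (gZ g1 z)) (fun z => gU g2 (gZ g1 z) * gU g1 z).

Definition gauge_eq (g1 g2 : gauge R) (z : 'rV[R]_2) :=
  \forall y \near z, [/\ gT g1 y = gT g2 y, gX g1 y = gX g2 y & gU g1 y = gU g2 y].

Lemma delta2E (i j : 'I_2) : (delta_mx 0 i : 'rV[R]_2) 0 j = (j == i)%:R.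
Proof. by rewrite mxE eqxx. Qed.

Lemma pd_coord2 (i j : 'I_2) (z : 'rV[R]_2) : pd i (fun y : 'rV[R]_2 => y 0 j) z = (j == i)%:R.
Proof. by rewrite /pd derive_coord delta2E. Qed.

Lemma gid_at z : gauge_at gid z.
Proof.
split; [exact: analytic_coord|exact: analytic_coord|exact: analytic_cst| |].
  by near=> y; rewrite pd_coord2.
by split; rewrite ?pd_coord2 ?eqxx oner_eq0.
Unshelve. all: by end_near. Qed.

Lemma pd_cst n i (c : R) (z : 'rV[R]_n) : pd i (fun=> c) z = 0.
Proof. by rewrite /pd derive_cst. Qed.

Lemma gid_Z z : gZ gid z = z.
Proof. exact: point2E. Qed.

Lemma gid_ext2 q : ext2 gid q = q.
Proof. by rewrite /ext2 gid_Z mul1r pt_base_fib. Qed.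

Lemma gid_ext3 q : ext3 gid q = q.
Proof.
rewrite /ext3 gid_ext2 /gH (pd_cst ix 1 (base (base q))) pd_coord2 eqxx.
by rewrite mul0r mul0r addr0 divr1 mul1r pt_base_fib.
Qed.

Lemma gcomp_at g2 g1 z : gauge_at g1 z -> gauge_at g2 (gZ g1 z) -> gauge_at (gcomp g2 g1) z.
Proof.
move=> g1z g2z; have an h : analytic_at h (gZ g1 z) -> analytic_at (fun y => h (gZ g1 y)) z.
  by move=> ha; exact: (@analytic_comp _ _ _ h (gZ g1) z ha (gZ_analytic g1z)).
have [Ta Xa Ua Tx [T0 X0 U0]] := g2z; have [Ta1 Xa1 Ua1 Tx1 [T01 X01 U01]] := g1z.
split; [exact: an|exact: an|by apply: analytic_mul; [exact: an|]| |split].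
- have c : gZ g1 @ z --> gZ g1 z by exact: (analytic_map_continuous (gZ_analytic g1z)).
  have n2 : \forall y \near z, gauge_at g2 (gZ g1 y) by exact: (c _ (gauge_near g2z)).
  have n1 := gauge_near g1z.
  near=> y.
  have g1y : gauge_at g1 y by near: y.
  have [Ta' _ _ Tx' _] : gauge_at g2 (gZ g1 y) by near: y.
  by apply: (etrans (pull_x g1y Ta')); rewrite (near_pd0 Tx') mulr0.
- apply/eqP => e; have := etrans (esym (pull_t g1z Ta)) e.
  by rewrite (near_pd0 Tx) mulr0 addr0 => /eqP; rewrite mulf_eq0 (negbTE T01) (negbTE T0).
- apply/eqP => e; have := etrans (esym (pull_x g1z Xa)) e.
  by move/eqP; rewrite mulf_eq0 (negbTE X01) (negbTE X0).
- by rewrite mulf_neq0.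
Unshelve. all: by end_near. Qed.

Lemma gcomp_ext2 g2 g1 q : ext2 (gcomp g2 g1) q = ext2 g2 (ext2 g1 q).
Proof. by rewrite /ext2 base_pt fib_pt mulrA. Qed.

(** Compatibility of the formula for eta~ with composition amounts to the chain rule for X2 o Z1 and
    for the product (U2 o Z1) U1, differentiated in x. *)
Lemma gcomp_ext3 g2 g1 q : gauge_at g1 (base (base q)) -> gauge_at g2 (gZ g1 (base (base q))) ->
  ext3 (gcomp g2 g1) q = ext3 g2 (ext3 g1 q).
Proof.
move=> g1z g2z; have [_ Xa Ua _ [_ X0 _]] := g2z; have [_ _ Ua1 _ [_ X01 _]] := g1z.
rewrite /ext3 base_pt fib_pt gcomp_ext2; congr pt.
rewrite /gH; set z := base (base q) in g1z g2z Xa Ua X0 Ua1 X01 *.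
have -> : base (ext2 g1 (base q)) = gZ g1 z by rewrite base_pt.
have -> : fib (ext2 g1 (base q)) = gU g1 z * fib (base q) by rewrite fib_pt.
have -> : pd ix (gX (gcomp g2 g1)) z = pd ix (gX g1) z * pd ix (gX g2) (gZ g1 z).
  exact: pull_x.
have -> : pd ix (gU (gcomp g2 g1)) z =
    (pd ix (gX g1) z * pd ix (gU g2) (gZ g1 z)) * gU g1 z + gU g2 (gZ g1 z) * pd ix (gU g1) z.
  have hU : hasD (delta_mx 0 ix) (fun y => gU g2 (gZ g1 y)) z (pd ix (gX g1) z * pd ix (gU g2) (gZ g1 z)).
    split; last exact: pull_x.
    exact: (@analytic_comp _ _ _ (gU g2) (gZ g1) z Ua (gZ_analytic g1z)).
  by have [_ D] := hasD_mul hU (hasD_derive (delta_mx 0 ix) Ua1); exact: D.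
rewrite /=; move: X0 X01.
generalize (pd ix (gX g1) z) (pd ix (gX g2) (gZ g1 z)) (gU g2 (gZ g1 z)) (gU g1 z)
  (pd ix (gU g2) (gZ g1 z)) (pd ix (gU g1) z) (fib q) (fib (base q)).
by move=> a b c d e f h k b0 a0; field; rewrite a0 b0.
Qed.

Lemma gauge_eq_ext2 g1 g2 z : gauge_eq g1 g2 z ->
  \forall y \near z, forall u, ext2 g1 (pt y u) = ext2 g2 (pt y u).
Proof. by apply: filterS => y [e1 e2 e3] u; rewrite /ext2 base_pt fib_pt /gZ e1 e2 e3. Qed.

(** [ext3] involves X_x and U_x, so equality of the gauges is used on a neighborhood of each nearby
    point and not only at that point. *)
Lemma gauge_eq_ext3 g1 g2 z : gauge_eq g1 g2 z ->
  \forall y \near z, forall u eta, ext3 g1 (pt (pt y u) eta) = ext3 g2 (pt (pt y u) eta).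
Proof.
move=> ge; have ge' := near_join ge; have e2 := gauge_eq_ext2 ge.
near=> y => u eta.
have [_ _ e3] : [/\ gT g1 y = gT g2 y, gX g1 y = gX g2 y & gU g1 y = gU g2 y] by near: y.
have nX : \forall y' \near y, gX g1 y' = gX g2 y'.
  have h : \forall y' \near y, [/\ gT g1 y' = gT g2 y', gX g1 y' = gX g2 y' & gU g1 y' = gU g2 y'] by near: y.
  by near=> y'; have [] : [/\ gT g1 y' = gT g2 y', gX g1 y' = gX g2 y' & gU g1 y' = gU g2 y'] by near: y'.
have nU : \forall y' \near y, gU g1 y' = gU g2 y'.
  have h : \forall y' \near y, [/\ gT g1 y' = gT g2 y', gX g1 y' = gX g2 y' & gU g1 y' = gU g2 y'] by near: y.
  by near=> y'; have [] : [/\ gT g1 y' = gT g2 y', gX g1 y' = gX g2 y' & gU g1 y' = gU g2 y'] by near: y'.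
have Xx : pd ix (gX g1) y = pd ix (gX g2) y := near_eq_derive _ nX.
have Ux : pd ix (gU g1) y = pd ix (gU g2) y := near_eq_derive _ nU.
have e2y : forall u, ext2 g1 (pt y u) = ext2 g2 (pt y u) by near: y.
by rewrite /ext3 /gH !base_pt e2y e3 Xx Ux.
Unshelve. all: by end_near. Qed.

End GaugeGroup.

Section GaugeInverse.
Variable R : realType.
Implicit Types g : gauge R.

Lemma pull_point2 (h : 'rV[R]_2 -> R) n (f g : 'rV[R]_n -> R) a v :
  analytic_at f a -> analytic_at g a -> analytic_at h (point2 (f a) (g a)) ->
  'D_v (fun y => h (point2 (f y) (g y))) a =
  'D_v f a * pd it h (point2 (f a) (g a)) + 'D_v g a * pd ix h (point2 (f a) (g a)).
Proof.
move=> fa ga ha; apply: (etrans (@derive_comp _ _ _ h (fun y => point2 (f y) (g y)) a v ha _)).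
  exact: analytic_point2.
apply: (etrans (dir2 _ ha)).
by rewrite jac_point2 point2_t point2_x.
Qed.

Lemma near_pullback n p (P : 'rV[R]_p -> Prop) (W : 'rV[R]_n -> 'rV[R]_p) a :
  analytic_map_at W a -> (\forall z \near W a, P z) -> \forall y \near a, P (W y).
Proof. by move=> Wa nP; exact: (analytic_map_continuous Wa nP). Qed.

Lemma gauge_const g z : gauge_at g z -> exists2 e, 0 < e & forall y y', ball z e y -> ball z e y' ->
  y 0 it = y' 0 it -> gT g y = gT g y'.
Proof.
move=> gz; have /near_exists_ball[e e0 ge] := gauge_near gz.
exists e => // y y' zy zy' yy'.
apply: (@pd0_const _ _ (gT g) z e (pred1 ix) _ _ y y' zy zy').
- by move=> w /ge[].
- by move=> w i zw /= /eqP ->; have [_ _ _ Tx _] := ge w zw; exact: near_pd0 Tx.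
by move=> i; have [->|->] := I2P i; rewrite ?yy' /= ?eqxx.
Qed.

(* T(t) = t' is solved first, then X(t, x) = x'. *)
Lemma gauge_inverse g z : gauge_at g z -> exists g',
  [/\ gauge_at g' (gZ g z), gZ g' (gZ g z) = z, gauge_eq (gcomp g' g) (gid R) z
    & gauge_eq (gcomp g g') (gid R) (gZ g z)].
Proof.
move=> gz; have [Ta Xa Ua Tx [T0 X0 U0]] := gz.
have [e e0 gc] := gauge_const gz.
(* T is read on the line where x keeps its value at z, so that one unknown t remains. Since T is
   known to be independent of x only on a ball, the points used later are kept inside it. *)
pose K1 (q : 'rV[R]_(2 + 1)) := gT g (point2 (fib q) (z 0 ix)) - base q 0 it.
pose p1 := pt (gZ g z) (z 0 it).
have hb i (q : 'rV[R]_(2 + 1)) : hasD (delta_mx 0 ju) (fun q : 'rV[R]_(2 + 1) => base q 0 i) q 0.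
  apply: hasD_eq (hasD_base (delta_mx 0 ju) (@analytic_coord _ _ i (base q))) _.
  by rewrite derive_coord -[delta_mx 0 ju]vertE /vert base_pt mxE.
have p1E : point2 (fib p1) (z 0 ix) = z by rewrite fib_pt point2E.
have hK1 : hasD (delta_mx 0 ju) K1 p1 (pd it (gT g) z).
  have hT : hasD (delta_mx 0 ju) (fun q : 'rV[R]_(2 + 1) => gT g (point2 (fib q) (z 0 ix))) p1 (pd it (gT g) z).
    split.
      apply: (@analytic_comp _ _ _ (gT g) (fun q : 'rV[R]_(2 + 1) => point2 (fib q) (z 0 ix)) p1); first by rewrite p1E.
      by apply: analytic_point2; [exact: analytic_fib|exact: analytic_cst].
    apply: (etrans (@pull_point2 (gT g) _ (@fib R 2) (fun=> z 0 ix) p1 _ _ _ _)).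
    - exact: analytic_fib.
    - exact: analytic_cst.
    - by rewrite p1E.
    rewrite p1E derive_cst mul0r addr0.
    by have [_ ->] := fib_hasD p1; rewrite mul1r.
  by apply: hasD_eq (hasD_sub hT (hb it p1)) _; rewrite subr0.
have [] := @implicit_function _ _ K1 p1.
- by have [] := hK1.
- by rewrite /K1 p1E base_pt /gZ point2_t subrr.
- by have [_ D] := hK1; apply/eqP => E; move/eqP: (etrans (esym D) E); rewrite (negbTE T0).
rewrite base_pt fib_pt => s [sa sz sK1 sU1].
pose K2 (q : 'rV[R]_(2 + 1)) := gX g (point2 (s (base q)) (fib q)) - base q 0 ix.
pose p2 := pt (gZ g z) (z 0 ix).
have p2E : point2 (s (base p2)) (fib p2) = z by rewrite base_pt fib_pt sz point2E.
have hs : hasD (delta_mx 0 ju) (fun q : 'rV[R]_(2 + 1) => s (base q)) p2 0.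
  have sa2 : analytic_at s (base p2) by rewrite base_pt.
  have [a D] := hasD_base (delta_mx 0 ju) sa2.
  split=> //; apply: (etrans D).
  by rewrite -[delta_mx 0 ju]vertE /vert base_pt derive0.
have hK2 : hasD (delta_mx 0 ju) K2 p2 (pd ix (gX g) z).
  have hX : hasD (delta_mx 0 ju) (fun q : 'rV[R]_(2 + 1) => gX g (point2 (s (base q)) (fib q))) p2 (pd ix (gX g) z).
    have [sa2 sD] := hs.
    split.
      apply: (@analytic_comp _ _ _ (gX g) (fun q : 'rV[R]_(2 + 1) => point2 (s (base q)) (fib q)) p2); first by rewrite p2E.
      by apply: analytic_point2 => //; exact: analytic_fib.
    apply: (etrans (@pull_point2 (gX g) _ (fun q : 'rV[R]_(2 + 1) => s (base q)) (@fib R 2) p2 _ _ _ _)) => //.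
    - exact: analytic_fib.
    - by rewrite p2E.
    rewrite p2E sD mul0r add0r.
    by have [_ ->] := fib_hasD p2; rewrite mul1r.
  by apply: hasD_eq (hasD_sub hX (hb ix p2)) _; rewrite subr0.
have [] := @implicit_function _ _ K2 p2.
- by have [] := hK2.
- by rewrite /K2 p2E base_pt /gZ point2_x subrr.
- by have [_ D] := hK2; apply/eqP => E; move/eqP: (etrans (esym D) E); rewrite (negbTE X0).
rewrite base_pt fib_pt => r [ra rz rK2 rU2].
pose W (y : 'rV[R]_2) := point2 (s y) (r y).
have Wa : analytic_map_at W (gZ g z) by exact: analytic_point2.
have Wz : W (gZ g z) = z by rewrite /W sz rz point2E.
pose g' := Gauge s r (fun y => (gU g (W y))^-1).
have nW := near_pullback Wa.
have nzg : \forall y \near gZ g z, gauge_at g (W y) by apply: nW; rewrite Wz; exact: gauge_near.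
have bz : \forall y \near z, ball z e y by exact: nbhsx_ballx.
have nb1 : \forall y \near gZ g z, ball z e (W y) by apply: nW; rewrite Wz.
have nb2 : \forall y \near gZ g z, ball z e (point2 (s y) (z 0 ix)).
  apply: (@near_pullback _ _ (ball z e) (fun y => point2 (s y) (z 0 ix))).
    by apply: analytic_point2 => //; exact: analytic_cst.
  by rewrite sz point2E.
have nT : \forall y \near gZ g z, gT g (W y) = y 0 it.
  near=> y.
  have k : K1 (pt y (s y)) = 0 by near: y.
  move: k; rewrite /K1 fib_pt base_pt => /eqP; rewrite subr_eq0 => /eqP <-.
  by apply: gc; [near: y|near: y|rewrite !point2_t].
have nX : \forall y \near gZ g z, gX g (W y) = y 0 ix.
  near=> y.
  have k : K2 (pt y (r y)) = 0 by near: y.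
  by move: k; rewrite /K2 fib_pt base_pt => /eqP; rewrite subr_eq0 => /eqP.
have nT' := near_join nT.
(* Differentiating T o W = t along v, with T_x = 0, determines the derivatives of s. *)
have Dt (v y : 'rV[R]_2) : analytic_at s y -> analytic_at r y -> gauge_at g (W y) ->
   (\forall y' \near y, gT g (W y') = y' 0 it) -> v 0 it = 'D_v s y * pd it (gT g) (W y).
  move=> sy ry [Ty _ _ Tyx _] nTy.
  have := etrans (esym (near_eq_derive v nTy)) (@pull_point2 (gT g) _ s r y v sy ry Ty).
  by rewrite derive_coord (near_pd0 Tyx) mulr0 addr0.
have nsa := analytic_near sa; have nra := analytic_near ra.
exists g'; split => //.
- split=> //.
  + have UWa : analytic_at (fun y => gU g (W y)) (gZ g z).
      by apply: (@analytic_comp _ _ _ (gU g) W _ _ Wa); rewrite Wz.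
    by have := analytic_inv UWa; rewrite Wz => /(_ U0).
  + near=> y.
    have gWy : gauge_at g (W y) by near: y.
    have [_ _ _ _ [Ty0 _ _]] := gWy.
    have := Dt (delta_mx 0 ix) y _ _ gWy; rewrite delta2E => D.
    have : 0 = 'D_(delta_mx 0 ix) s y * pd it (gT g) (W y) by apply: D; near: y.
    by move/esym/eqP; rewrite mulf_eq0 (negbTE Ty0) orbF => /eqP.
  + have gWz : gauge_at g (W (gZ g z)) by rewrite Wz.
    have D (v : 'rV[R]_2) := Dt v _ sa ra gWz nT.
    have Dx : 'D_(delta_mx 0 ix) s (gZ g z) = 0.
      have := D (delta_mx 0 ix); rewrite delta2E Wz => /esym/eqP.
      by rewrite mulf_eq0 (negbTE T0) orbF => /eqP.
    split; last by rewrite /= Wz invr_neq0.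
    * apply/eqP => E; have := D (delta_mx 0 it); rewrite delta2E eqxx -/(pd it s _) E mul0r.
      by move/eqP; rewrite oner_eq0.
    * have Xz : analytic_at (gX g) (point2 (s (gZ g z)) (r (gZ g z))) by rewrite -/(W _) Wz.
      have := etrans (esym (near_eq_derive (delta_mx 0 ix) nX)) (pull_point2 _ sa ra Xz).
      rewrite derive_coord delta2E eqxx Dx mul0r add0r => E1; apply/eqP => E.
      by move: E1; rewrite -/(pd ix r _) E mul0r => /eqP; rewrite oner_eq0.
- have nZ := near_pullback (gZ_analytic gz).
  have n1 : \forall y \near z, s (gZ g y) = y 0 it.
    have an : analytic_map_at (fun y : 'rV[R]_2 => pt (gZ g y) (y 0 it)) z.
      by apply: analytic_pt; [exact: gZ_analytic|exact: analytic_coord].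
    have n1 := near_pullback an sU1.
    have an2 : analytic_map_at (fun y : 'rV[R]_2 => point2 (y 0 it) (z 0 ix)) z.
      by apply: analytic_point2; [exact: analytic_coord|exact: analytic_cst].
    have nb3 : \forall y \near z, ball z e (point2 ((y : 'rV[R]_2) 0 it) (z 0 ix)).
      by apply: (@near_pullback _ _ (ball z e) _ _ an2); rewrite point2E.
    near=> y.
    have : K1 (pt (gZ g y) (y 0 it)) = 0 -> fib (pt (gZ g y) (y 0 it)) = s (base (pt (gZ g y) (y 0 it))) by near: y.
    rewrite /K1 fib_pt base_pt => k; apply: esym; apply: k; rewrite /gZ point2_t.
    apply/eqP; rewrite subr_eq0; apply/eqP.
    by apply: gc; [near: y|near: y|rewrite point2_t].
  have an : analytic_map_at (fun y : 'rV[R]_2 => pt (gZ g y) (y 0 ix)) z.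
    by apply: analytic_pt; [exact: gZ_analytic|exact: analytic_coord].
  have n2 := near_pullback an rU2.
  have n3 := gauge_near gz.
  near=> y.
  have Es : s (gZ g y) = y 0 it by near: y.
  have Er : y 0 ix = r (gZ g y).
    have : K2 (pt (gZ g y) (y 0 ix)) = 0 -> fib (pt (gZ g y) (y 0 ix)) = r (base (pt (gZ g y) (y 0 ix))) by near: y.
    rewrite /K2 fib_pt base_pt; apply; rewrite Es point2E /gZ point2_x.
    by rewrite subrr.
  have [_ _ _ _ [_ _ Uy0]] : gauge_at g y by near: y.
  by split=> //=; rewrite /W Es -Er point2E mulVf.
near=> y.
have [_ _ _ _ [_ _ Uy0]] : gauge_at g (W y) by near: y.
split=> /=.
- by rewrite /gZ/=; near: y.
- by rewrite /gZ/=; near: y.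
by rewrite /gZ/= divff.
Unshelve. all: by end_near. Qed.

End GaugeInverse.

(** * Action on the arbitrary elements *)

Section GaugeLinear.
Variable R : realType.
Implicit Types g : gauge R.

(** The action of the equivalence group on (A, B, C), multiplied by T_t; the last formula is T_t C~
    = - U L(1/U) with the derivatives of 1/U expanded. *)
Definition gauge_rel g (th th' : coeffs R) (z : 'rV[R]_2) : Prop :=
  let Tt := pd it (gT g) z in let Xx := pd ix (gX g) z in
  let U := gU g z in let Ux := pd ix (gU g) z in
  [/\ Tt * cA th' (gZ g z) = Xx ^+ 2 * cA th z,
      Tt * cB th' (gZ g z) = Xx * (cB th z - 2 * Ux / U * cA th z) - pd it (gX g) z +
        cA th z * pd ix (pd ix (gX g)) z
    & Tt * cC th' (gZ g z) = cC th z + pd it (gU g) z / U +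
        cA th z * (2 * Ux ^+ 2 / U ^+ 2 - pd ix (pd ix (gU g)) z / U) - cB th z * Ux / U].

(** The defects of the two equations are proportional: T_t times the defect of h equals U times the
    defect of f. *)
Lemma L_transform_algebra (T A' B' C' A B C Xx Xt Xxx U Ut Ux Uxx h ht hx hxx f ft fx fxx : R) :
  T != 0 -> Xx != 0 -> U != 0 ->
  T * A' = Xx ^+ 2 * A -> T * B' = Xx * (B - 2 * Ux / U * A) - Xt + A * Xxx ->
  T * C' = C + Ut / U + A * (2 * Ux ^+ 2 / U ^+ 2 - Uxx / U) - B * Ux / U ->
  h = U * f -> T * ht + Xt * hx = Ut * f + U * ft -> Xx * hx = Ux * f + U * fx ->
  Xxx * hx + Xx * (Xx * hxx) = Uxx * f + Ux * fx + (Ux * fx + U * fxx) ->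
  (ft = A * fxx + B * fx + C * f <-> ht = A' * hxx + B' * hx + C' * h).
Proof.
move=> T0 Xx0 U0 eA eB eC -> et ex exx.
have hxE : hx = (Ux * f + U * fx) / Xx by rewrite -ex; field.
have E : T * (ht - (A' * hxx + B' * hx + C' * (U * f))) = U * (ft - (A * fxx + B * fx + C * f)).
  have -> : T * (ht - (A' * hxx + B' * hx + C' * (U * f))) =
    (T * ht + Xt * hx) - Xt * hx - ((T * A') * hxx + (T * B') * hx + (T * C') * (U * f)) by ring.
  rewrite et eA eB eC.
  have -> : Xx ^+ 2 * A * hxx = A * (Uxx * f + Ux * fx + (Ux * fx + U * fxx) - Xxx * hx).
    by rewrite -exx; ring.
  by rewrite hxE; field; rewrite U0 Xx0.
split=> e; apply/eqP; rewrite -subr_eq0.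
  by rewrite -(mulrI_eq0 _ (mulfI T0)) E e subrr mulr0.
by rewrite -(mulrI_eq0 _ (mulfI U0)) -E e subrr mulr0.
Qed.

Lemma L_transform g z th th' (f h : 'rV[R]_2 -> R) : gauge_at g z -> gauge_rel g th th' z ->
  analytic_at f z -> analytic_at h (gZ g z) ->
  (\forall y \near z, h (gZ g y) = gU g y * f y) ->
  (eqL th f z <-> eqL th' h (gZ g z)).
Proof.
move=> gz [eA eB eC] fa ha hf.
have [_ Xa Ua _ [T0 X0 U0]] := gz.
have dUf y v : analytic_at f y -> gauge_at g y ->
    hasD v (fun y => gU g y * f y) y ('D_v (gU g) y * f y + gU g y * 'D_v f y).
  by move=> fy [_ _ Uy _ _]; apply: hasD_mul; exact: hasD_derive.
have nga := gauge_near gz; have nfa := analytic_near fa; have nha := near_pullback (gZ_analytic gz) (analytic_near ha).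
have nhf := near_join hf.
have ex1 : \forall y \near z, pd ix (gX g) y * pd ix h (gZ g y) = pd ix (gU g) y * f y + gU g y * pd ix f y.
  near=> y.
  have gy : gauge_at g y by near: y.
  have fy : analytic_at f y by near: y.
  have hy : analytic_at h (gZ g y) by near: y.
  have ey : \forall y' \near y, h (gZ g y') = gU g y' * f y' by near: y.
  apply: (etrans (esym (pull_x gy hy))).
  apply: (etrans (near_eq_derive _ ey)).
  by have [_ D] := dUf y (delta_mx 0 ix) fy gy; exact: D.
have et : pd it (gT g) z * pd it h (gZ g z) + pd it (gX g) z * pd ix h (gZ g z) =
    pd it (gU g) z * f z + gU g z * pd it f z.
  apply: (etrans (esym (pull_t gz ha))).
  apply: (etrans (near_eq_derive _ hf)).
  by have [_ D] := dUf z (delta_mx 0 it) fa gz; exact: D.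
have exx : pd ix (pd ix (gX g)) z * pd ix h (gZ g z) +
    pd ix (gX g) z * (pd ix (gX g) z * pd ix (pd ix h) (gZ g z)) =
    pd ix (pd ix (gU g)) z * f z + pd ix (gU g) z * pd ix f z +
    (pd ix (gU g) z * pd ix f z + gU g z * pd ix (pd ix f) z).
  have pull : hasD (delta_mx 0 ix) (fun y => pd ix h (gZ g y)) z (pd ix (gX g) z * pd ix (pd ix h) (gZ g z)).
    split; last by apply: pull_x => //; exact: analytic_pd.
    exact: (@analytic_comp _ _ _ (pd ix h) (gZ g) z (analytic_pd ix ha) (gZ_analytic gz)).
  have [_ D1] := hasD_near ex1 (hasD_mul (hasD_derive (delta_mx 0 ix) (analytic_pd ix Xa)) pull).
  have [_ D2] := hasD_add (hasD_mul (hasD_derive (delta_mx 0 ix) (analytic_pd ix Ua)) (hasD_derive (delta_mx 0 ix) fa))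
    (hasD_mul (hasD_derive (delta_mx 0 ix) Ua) (hasD_derive (delta_mx 0 ix) (analytic_pd ix fa))).
  exact: etrans (esym D1) D2.
exact: (L_transform_algebra T0 X0 U0 eA eB eC (nbhs_singleton hf) et (nbhs_singleton ex1) exx).
Unshelve. all: by end_near. Qed.

End GaugeLinear.

Section GaugeDE0.
Variable R : realType.
Implicit Types g : gauge R.

Lemma hasD_base_t (k : 'rV[R]_2 -> R) (w : 'rV[R]_(2 + 1)) : analytic_at k (base w) ->
  hasD (delta_mx 0 jt) (fun v => k (base v)) w (pd it k (base w)).
Proof.
move=> ka; apply: hasD_eq (hasD_base _ ka) _.
by rewrite [delta_mx 0 jt]delta_lshift base_pt.
Qed.

Lemma hasD_base_x (k : 'rV[R]_2 -> R) (w : 'rV[R]_(2 + 1)) : analytic_at k (base w) ->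
  hasD (delta_mx 0 jx) (fun v => k (base v)) w (pd ix k (base w)).
Proof.
move=> ka; apply: hasD_eq (hasD_base _ ka) _.
by rewrite [delta_mx 0 jx]delta_lshift base_pt.
Qed.

Lemma hasD_base_u (k : 'rV[R]_2 -> R) (w : 'rV[R]_(2 + 1)) : analytic_at k (base w) ->
  hasD (delta_mx 0 ju) (fun v => k (base v)) w 0.
Proof.
move=> ka; apply: hasD_eq (hasD_base _ ka) _.
by rewrite -[delta_mx 0 ju]vertE /vert base_pt derive0.
Qed.

Lemma hasD_fib_t (w : 'rV[R]_(2 + 1)) : hasD (delta_mx 0 jt) (@fib R 2) w 0.
Proof.
split; first exact: analytic_fib.
by apply: (etrans (derive_fib (fun y => y) w _)); rewrite jac_id [delta_mx 0 jt]delta_lshift fib_pt.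
Qed.

Lemma hasD_fib_x (w : 'rV[R]_(2 + 1)) : hasD (delta_mx 0 jx) (@fib R 2) w 0.
Proof.
split; first exact: analytic_fib.
by apply: (etrans (derive_fib (fun y => y) w _)); rewrite jac_id [delta_mx 0 jx]delta_lshift fib_pt.
Qed.

Lemma hasD_fib_u (w : 'rV[R]_(2 + 1)) : hasD (delta_mx 0 ju) (@fib R 2) w 1.
Proof. exact: fib_hasD. Qed.

Lemma pull3_x g (w : 'rV[R]_(2 + 1)) (h : 'rV[R]_(2 + 1) -> R) :
  gauge_at g (base w) -> analytic_at h (ext2 g w) ->
  pd jx (fun y => h (ext2 g y)) w = pd ix (gX g) (base w) * pd jx h (ext2 g w) +
    pd ix (gU g) (base w) * fib w * pd ju h (ext2 g w).
Proof.
move=> gw ha; apply: (etrans (pull3_D _ gw ha)).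
have [_ _ _ Tx _] := gw.
rewrite [delta_mx 0 jx]delta_lshift base_pt fib_pt mulr0 addr0.
by rewrite -!/(pd _ _ _) (near_pd0 Tx) mul0r add0r.
Qed.

Lemma pull3_u g (w : 'rV[R]_(2 + 1)) (h : 'rV[R]_(2 + 1) -> R) :
  gauge_at g (base w) -> analytic_at h (ext2 g w) ->
  pd ju (fun y => h (ext2 g y)) w = gU g (base w) * pd ju h (ext2 g w).
Proof.
move=> gw ha; apply: (etrans (pull3_D _ gw ha)).
by rewrite -[delta_mx 0 ju]vertE /vert base_pt fib_pt !derive0 !mul0r !add0r mulr1.
Qed.

Lemma pull3_t g (w : 'rV[R]_(2 + 1)) (h : 'rV[R]_(2 + 1) -> R) :
  gauge_at g (base w) -> analytic_at h (ext2 g w) ->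
  pd jt (fun y => h (ext2 g y)) w = pd it (gT g) (base w) * pd jt h (ext2 g w) +
    pd it (gX g) (base w) * pd jx h (ext2 g w) +
    pd it (gU g) (base w) * fib w * pd ju h (ext2 g w).
Proof.
move=> gw ha; apply: (etrans (pull3_D _ gw ha)).
by rewrite [delta_mx 0 jt]delta_lshift base_pt fib_pt mulr0 addr0.
Qed.

(** The value of u_t that L prescribes for functions u with u_x = f, for which u_xx = f_x + f
    f_u. *)
Definition flow (th : coeffs R) (f : 'rV[R]_(2 + 1) -> R) (v : 'rV[R]_(2 + 1)) : R :=
  cA th (base v) * (pd jx f v + f v * pd ju f v) + cB th (base v) * f v + cC th (base v) * fib v.

(* The equation DE_0 expresses that the vector fields d_x + eta d_u and
   d_t + flow d_u commute. *)
Lemma eqDE0_commutation th f w : admissible th (base w) -> analytic_at f w ->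
  analytic_at (flow th f) w /\
  (eqDE0 th f w <-> pd jt f w + flow th f w * pd ju f w =
     pd jx (flow th f) w + f w * pd ju (flow th f) w).
Proof.
move=> [Aa Ba Ca _] fa.
have fxa := analytic_pd jx fa; have fua := analytic_pd ju fa.
pose dv (i : 'I_(2 + 1)) (a b c y : R) := a * (pd jx f w + f w * pd ju f w) +
  cA th (base w) * (pd i (pd jx f) w + (pd i f w * pd ju f w + f w * pd i (pd ju f) w)) +
  (b * f w + cB th (base w) * pd i f w) + (c * fib w + cC th (base w) * y).
have D i a b c y : hasD (delta_mx 0 i) (fun v => cA th (base v)) w a ->
    hasD (delta_mx 0 i) (fun v => cB th (base v)) w b ->
    hasD (delta_mx 0 i) (fun v => cC th (base v)) w c ->
    hasD (delta_mx 0 i) (@fib R 2) w y -> hasD (delta_mx 0 i) (flow th f) w (dv i a b c y).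
  move=> hA hB hC hy; apply: hasD_add; last exact: hasD_mul.
  apply: hasD_add; last exact: hasD_mul hB (hasD_derive _ fa).
  apply: hasD_mul hA _; apply: hasD_add (hasD_derive _ fxa) _.
  exact: hasD_mul (hasD_derive _ fa) (hasD_derive _ fua).
have [an Dx] := D _ _ _ _ _ (hasD_base_x Aa) (hasD_base_x Ba) (hasD_base_x Ca) (hasD_fib_x w).
have [_ Du] := D _ _ _ _ _ (hasD_base_u Aa) (hasD_base_u Ba) (hasD_base_u Ca) (hasD_fib_u w).
split=> //; rewrite -/(pd jx (flow th f) w) in Dx; rewrite -/(pd ju (flow th f) w) in Du.
rewrite Dx Du /dv /eqDE0 (base_analytic_B Ba fa) /flow.
rewrite (deriveC_pd ju jx fa).
generalize (pd jt f w) (pd jx f w) (pd ju f w) (pd jx (pd jx f) w) (pd jx (pd ju f) w)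
  (pd ju (pd ju f) w) (f w) (fib w) (cA th (base w)) (cB th (base w)) (cC th (base w))
  (pd ix (cA th) (base w)) (pd ix (cB th) (base w)) (pd ix (cC th) (base w)).
move=> ft fx fu fxx fxu fuu y u A B C Ax Bx Cx.
by split=> e; [rewrite e; ring|apply: (@addIr _ ((A * (fx + y * fu) + B * y + C * u) * fu)); rewrite e; ring].
Qed.

End GaugeDE0.

Section GaugeDE0Transform.
Variable R : realType.
Implicit Types g : gauge R.

Lemma flow_algebra (T A' B' C' A B C Xx Xt Xxx U Ut Ux Uxx u hx hu h G Gx Gu f fx fu : R) :
  T != 0 -> Xx != 0 -> U != 0 ->
  T * A' = Xx ^+ 2 * A -> T * B' = Xx * (B - 2 * Ux / U * A) - Xt + A * Xxx ->
  T * C' = C + Ut / U + A * (2 * Ux ^+ 2 / U ^+ 2 - Uxx / U) - B * Ux / U ->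
  h = G -> Xx * G = U * f + Ux * u ->
  Xx * hx + Ux * u * hu = Gx -> U * hu = Gu ->
  Xxx * G + Xx * Gx = Ux * f + U * fx + Uxx * u -> Xx * Gu = U * fu + Ux ->
  T * (A' * (hx + h * hu) + B' * h + C' * (U * u)) = Ut * u + U * (A * (fx + f * fu) + B * f + C * u) - Xt * G.
Proof.
move=> T0 Xx0 U0 eA eB eC -> GE ex eu Gxx Guu.
have QG : Xx * (Xx * (hx + G * hu)) = Ux * f + U * fx + Uxx * u + f * (U * fu + Ux) - Xxx * G.
  rewrite -Guu -Gxx -ex -eu.
  have -> : Xx * (Xx * (hx + G * hu)) = Xx * (Xx * hx) + (Xx * G) * (Xx * hu) by ring.
  by rewrite GE; ring.
have -> : T * (A' * (hx + G * hu) + B' * G + C' * (U * u)) =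
   (T * A') * (hx + G * hu) + (T * B') * G + (T * C') * (U * u) by ring.
rewrite eA eB eC.
have -> : Xx ^+ 2 * A * (hx + G * hu) = A * (Xx * (Xx * (hx + G * hu))) by ring.
rewrite QG.
have -> : G = (U * f + Ux * u) / Xx by rewrite -GE; field.
by field; rewrite U0 Xx0.
Qed.

(* F maps the field d_x + eta d_u to X_x times its analogue, and d_t + flow d_u
   to a combination of its analogue, with coefficient T_t, and of the former;
   the commutators thus agree up to a nonzero factor. *)
Lemma commutation_algebra (T Xx Xt Xxt U Ut Ux Utx u h ht hx hu zx zu z'
    f ft fu z zx0 zu0 G Gt Gx Gu : R) : T != 0 -> Xx != 0 -> U != 0 ->
  h = G -> Xx * G = U * f + Ux * u ->
  T * ht + Xt * hx + Ut * u * hu = Gt -> Xx * hx + Ux * u * hu = Gx -> U * hu = Gu ->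
  Xxt * G + Xx * Gt = Ut * f + U * ft + Utx * u ->
  T * z' = Ut * u + U * z - Xt * G ->
  T * (Xx * zx + Ux * u * zu) = Utx * u + (Ux * z + U * zx0) - (Xxt * G + Xt * Gx) ->
  T * (U * zu) = Ut + U * zu0 - Xt * Gu ->
  Xx * Gu = U * fu + Ux ->
  (ft + z * fu = zx0 + f * zu0 <-> ht + z' * hu = zx + h * zu).
Proof.
move=> T0 Xx0 U0 -> GE et ex eu Gtt ez ezx ezu Guu.
have E : Xx * T * ((ht + z' * hu) - (zx + G * zu)) = U * ((ft + z * fu) - (zx0 + f * zu0)).
  have -> : Xx * T * ((ht + z' * hu) - (zx + G * zu)) =
     Xx * ((T * ht + Xt * hx + Ut * u * hu) - Xt * hx - Ut * u * hu + (T * z') * hu) -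
     (T * (Xx * zx + Ux * u * zu) + T * zu * (Xx * G - Ux * u)) by ring.
  rewrite et ez ezx GE.
  have -> : T * zu * (U * f + Ux * u - Ux * u) = f * (T * (U * zu)) by ring.
  rewrite ezu -ex -eu.
  have -> : Xx * (Gt - Xt * hx - Ut * u * hu + (Ut * u + U * z - Xt * G) * hu) =
    (Xxt * G + Xx * Gt) - Xxt * G - Xt * (Xx * hx) + z * (Xx * (U * hu)) - Xt * hu * (Xx * G) by ring.
  rewrite Gtt GE eu Guu.
  by rewrite -eu; ring.
split=> e; apply/eqP; rewrite -subr_eq0.
  by rewrite -(mulrI_eq0 _ (mulfI (mulf_neq0 Xx0 T0))) E e subrr mulr0.
by rewrite -(mulrI_eq0 _ (mulfI U0)) -E e subrr mulr0.
Qed.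

Lemma collect_x (a p p' utx utx' xtx xtx' F T u Ut Ux z U zx G Xt Gx : R) :
  a = 0 -> p = p' -> utx = utx' -> xtx = xtx' ->
  a * F + T * p = utx * u + Ut * 0 + (Ux * z + U * zx) - (xtx * G + Xt * Gx) ->
  T * p' = utx' * u + (Ux * z + U * zx) - (xtx' * G + Xt * Gx).
Proof. by move=> -> <- <- <-; rewrite mul0r add0r mulr0 addr0. Qed.

Lemma collect_u (p p' F T u Ut z U zu G Xt Gu : R) : p = p' ->
  0 * F + T * p = 0 * u + Ut * 1 + (0 * z + U * zu) - (0 * G + Xt * Gu) ->
  T * p' = Ut + U * zu - Xt * Gu.
Proof. by move=> <-; rewrite !mul0r !add0r mulr1. Qed.

Section Point.
Variables (g : gauge R) (f h : 'rV[R]_(2 + 1) -> R).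
Let G v := h (ext2 g v).
Let eta_rel (v : 'rV[R]_(2 + 1)) := pd ix (gX g) (base v) * G v =
  gU g (base v) * f v + pd ix (gU g) (base v) * fib v.

Lemma G_jets v : gauge_at g (base v) -> analytic_at f v -> analytic_at h (ext2 g v) ->
  (\forall v \near v, eta_rel v) ->
  [/\ pd ix (pd ix (gX g)) (base v) * G v + pd ix (gX g) (base v) * pd jx G v =
       pd ix (gU g) (base v) * f v + gU g (base v) * pd jx f v + pd ix (pd ix (gU g)) (base v) * fib v,
      pd ix (gX g) (base v) * pd ju G v = gU g (base v) * pd ju f v + pd ix (gU g) (base v)
    & pd it (pd ix (gX g)) (base v) * G v + pd ix (gX g) (base v) * pd jt G v =
       pd it (gU g) (base v) * f v + gU g (base v) * pd jt f v + pd it (pd ix (gU g)) (base v) * fib v].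
Proof.
move=> gv fa ha nE; have [_ Xa Ua _ _] := gv.
have Xxa := analytic_pd ix Xa; have Uxa := analytic_pd ix Ua.
have Ga : analytic_at G v by exact: (@analytic_comp _ _ _ h (ext2 g) v ha (ext2_analytic gv)).
have D i a b c y : hasD (delta_mx 0 i) (fun v => pd ix (gX g) (base v)) v a ->
    hasD (delta_mx 0 i) (fun v => gU g (base v)) v b ->
    hasD (delta_mx 0 i) (fun v => pd ix (gU g) (base v)) v c ->
    hasD (delta_mx 0 i) (@fib R 2) v y ->
    a * G v + pd ix (gX g) (base v) * pd i G v =
    b * f v + gU g (base v) * pd i f v + (c * fib v + pd ix (gU g) (base v) * y).
  move=> hX hU hUx hy.
  have [_ D1] := hasD_near nE (hasD_mul hX (hasD_derive (delta_mx 0 i) Ga)).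
  have [_ D2] := hasD_add (hasD_mul hU (hasD_derive (delta_mx 0 i) fa)) (hasD_mul hUx hy).
  exact: etrans (esym D1) D2.
split.
- have := D _ _ _ _ _ (hasD_base_x Xxa) (hasD_base_x Ua) (hasD_base_x Uxa) (hasD_fib_x v).
  by rewrite mulr0 addr0.
- have := D _ _ _ _ _ (hasD_base_u Xxa) (hasD_base_u Ua) (hasD_base_u Uxa) (hasD_fib_u v).
  by rewrite mulr1 !mul0r !add0r.
have := D _ _ _ _ _ (hasD_base_t Xxa) (hasD_base_t Ua) (hasD_base_t Uxa) (hasD_fib_t v).
by rewrite mulr0 addr0.
Qed.

(** This is the u~-component of the image of d_t + flow d_u; the term in X_t is the share of the
    field d_x~ + h d_u~ in that image. *)
Lemma flow_transform th th' v : gauge_at g (base v) -> gauge_rel g th th' (base v) ->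
  analytic_at f v -> analytic_at h (ext2 g v) -> (\forall v \near v, eta_rel v) ->
  pd it (gT g) (base v) * flow th' h (ext2 g v) =
  pd it (gU g) (base v) * fib v + gU g (base v) * flow th f v - pd it (gX g) (base v) * G v.
Proof.
move=> gv [eA eB eC] fa ha nE; have [_ _ _ _ [T0 X0 U0]] := gv.
have [Gx Gu _] := G_jets gv fa ha nE.
have bE : base (ext2 g v) = gZ g (base v) by rewrite base_pt.
have fE : fib (ext2 g v) = gU g (base v) * fib v by rewrite fib_pt.
rewrite /flow bE fE.
exact: (flow_algebra T0 X0 U0 eA eB eC erefl (nbhs_singleton nE)
  (esym (pull3_x gv ha)) (esym (pull3_u gv ha)) Gx Gu).
Qed.

(** The rules for (A, B, C) are required on a neighborhood, whereas they are required at one point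
    for L, because the transformation law of the flow is differentiated. *)
Lemma DE0_transform th th' w : gauge_at g (base w) ->
  (\forall z \near base w, gauge_rel g th th' z) ->
  admissible th (base w) -> admissible th' (gZ g (base w)) ->
  analytic_at f w -> analytic_at h (ext2 g w) -> (\forall v \near w, eta_rel v) ->
  (eqDE0 th f w <-> eqDE0 th' h (ext2 g w)).
Proof.
move=> gw nrel ad ad' fa ha nE; have [Ta Xa Ua Tx [T0 X0 U0]] := gw.
have ad2 : admissible th' (base (ext2 g w)) by rewrite base_pt.
have [za zE] := eqDE0_commutation ad fa; have [za' zE'] := eqDE0_commutation ad2 ha.
rewrite zE zE'.
have [Gx Gu Gt] := G_jets gw fa ha nE.
have nflow : \forall v \near w, pd it (gT g) (base v) * flow th' h (ext2 g v) =
  pd it (gU g) (base v) * fib v + gU g (base v) * flow th f v - pd it (gX g) (base v) * G v.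
  have n1 : \forall v \near w, gauge_at g (base v) := near_pullback (analytic_map_base w) (gauge_near gw).
  have n2 : \forall v \near w, gauge_rel g th th' (base v) := near_pullback (analytic_map_base w) nrel.
  have n3 := analytic_near fa.
  have n4 := near_pullback (ext2_analytic gw) (analytic_near ha).
  have n5 := near_join nE.
  by near=> v; apply: flow_transform; near: v.
have Ga : analytic_at G w by exact: (@analytic_comp _ _ _ h (ext2 g) w ha (ext2_analytic gw)).
have za2 : analytic_at (fun v => flow th' h (ext2 g v)) w.
  exact: (@analytic_comp _ _ _ (flow th' h) (ext2 g) w za' (ext2_analytic gw)).
have Tta := analytic_pd it Ta; have Uta := analytic_pd it Ua; have Xta := analytic_pd it Xa.
have D i a b b' c y : hasD (delta_mx 0 i) (fun v => pd it (gT g) (base v)) w a ->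
    hasD (delta_mx 0 i) (fun v => pd it (gU g) (base v)) w b ->
    hasD (delta_mx 0 i) (fun v => gU g (base v)) w b' ->
    hasD (delta_mx 0 i) (fun v => pd it (gX g) (base v)) w c ->
    hasD (delta_mx 0 i) (@fib R 2) w y ->
    a * flow th' h (ext2 g w) + pd it (gT g) (base w) * pd i (fun v => flow th' h (ext2 g v)) w =
    b * fib w + pd it (gU g) (base w) * y + (b' * flow th f w + gU g (base w) * pd i (flow th f) w)
    - (c * G w + pd it (gX g) (base w) * pd i G w).
  move=> hT hU hU' hX hy.
  have [_ D1] := hasD_near nflow (hasD_mul hT (hasD_derive (delta_mx 0 i) za2)).
  have [_ D2] := hasD_sub (hasD_add (hasD_mul hU hy) (hasD_mul hU' (hasD_derive (delta_mx 0 i) za)))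
    (hasD_mul hX (hasD_derive (delta_mx 0 i) Ga)).
  exact: etrans (esym D1) D2.
have Txt : pd ix (pd it (gT g)) (base w) = 0.
  by apply: (etrans (deriveC_pd ix it Ta)); exact: pd_near0.
have Dx : pd it (gT g) (base w) * (pd ix (gX g) (base w) * pd jx (flow th' h) (ext2 g w) +
    pd ix (gU g) (base w) * fib w * pd ju (flow th' h) (ext2 g w)) =
    pd it (pd ix (gU g)) (base w) * fib w + (pd ix (gU g) (base w) * flow th f w +
     gU g (base w) * pd jx (flow th f) w)
    - (pd it (pd ix (gX g)) (base w) * G w + pd it (gX g) (base w) * pd jx G w).
  exact: (collect_x Txt (pull3_x gw za') (deriveC_pd ix it Ua) (deriveC_pd ix it Xa)
    (D _ _ _ _ _ _ (hasD_base_x Tta) (hasD_base_x Uta) (hasD_base_x Ua) (hasD_base_x Xta) (hasD_fib_x w))).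
have Du : pd it (gT g) (base w) * (gU g (base w) * pd ju (flow th' h) (ext2 g w)) =
    pd it (gU g) (base w) + gU g (base w) * pd ju (flow th f) w - pd it (gX g) (base w) * pd ju G w.
  exact: (collect_u (pull3_u gw za')
    (D _ _ _ _ _ _ (hasD_base_u Tta) (hasD_base_u Uta) (hasD_base_u Ua) (hasD_base_u Xta) (hasD_fib_u w))).
exact: (commutation_algebra T0 X0 U0 erefl (nbhs_singleton nE) (esym (pull3_t gw ha))
  (esym (pull3_x gw ha)) (esym (pull3_u gw ha)) Gt (nbhs_singleton nflow) Dx Du Gu).
Unshelve. all: by end_near. Qed.

End Point.
End GaugeDE0Transform.

Section LocalForms.
Variable R : realType.
Implicit Types g : gauge R.

Definition local2 (F : ptrans R (2 + 1)) p g :=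
  gauge_at g (base p) /\ \forall q \near p, fwd F q = ext2 g q.

Definition local3 (F : ptrans R (2 + 1 + 1)) p g :=
  gauge_at g (base (base p)) /\ \forall q \near p, fwd F q = ext3 g q.

Lemma gauge_eq_Z g1 g2 z : gauge_eq g1 g2 z -> \forall y \near z, gZ g1 y = gZ g2 y.
Proof. by apply: filterS => y [e1 e2 _]; rewrite /gZ e1 e2. Qed.

(** The action gives the new coefficients as functions of the old point; the inverse gauge turns
    them into functions of the new one. *)
Lemma gauge_coeffs g z th : gauge_at g z -> admissible th z ->
  exists2 th', admissible th' (gZ g z) & \forall y \near z, gauge_rel g th th' y.
Proof.
move=> gz [Aa Ba Ca A0]; have [g' [gz' zz /gauge_eq_Z nZ _]] := gauge_inverse gz.
have [Ta Xa Ua _ [T0 X0 U0]] := gz.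
have Tta := analytic_pd it Ta; have Xta := analytic_pd it Xa; have Uta := analytic_pd it Ua.
have Xxa := analytic_pd ix Xa; have Uxa := analytic_pd ix Ua.
have Xxxa := analytic_pd ix Xxa; have Uxxa := analytic_pd ix Uxa.
have Tia := analytic_inv Tta T0; have Uia := analytic_inv Ua U0.
have ca (c : R) : analytic_at (fun=> c) z by exact: analytic_cst.
pose Ac y := (pd it (gT g) y)^-1 * (pd ix (gX g) y ^+ 2 * cA th y).
pose Bc y := (pd it (gT g) y)^-1 * (pd ix (gX g) y *
  (cB th y - 2 * pd ix (gU g) y * (gU g y)^-1 * cA th y) - pd it (gX g) y + cA th y * pd ix (pd ix (gX g)) y).
pose Cc y := (pd it (gT g) y)^-1 * (cC th y + pd it (gU g) y * (gU g y)^-1 +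
  cA th y * (2 * pd ix (gU g) y ^+ 2 * ((gU g y)^-1) ^+ 2 - pd ix (pd ix (gU g)) y * (gU g y)^-1) -
  cB th y * pd ix (gU g) y * (gU g y)^-1).
have Aca : analytic_at Ac z.
  by apply: (analytic_mul Tia); apply: analytic_mul Aa; exact: analytic_exp.
have Bca : analytic_at Bc z.
  apply: (analytic_mul Tia); apply: analytic_add (analytic_mul Aa Xxxa).
  apply: analytic_sub Xta; apply: (analytic_mul Xxa); apply: (analytic_sub Ba).
  by apply: analytic_mul Aa; apply: analytic_mul Uia; apply: analytic_mul Uxa.
have Cca : analytic_at Cc z.
  apply: (analytic_mul Tia); apply: analytic_sub.
    apply: analytic_add; first by apply: (analytic_add Ca); exact: analytic_mul.
    apply: (analytic_mul Aa); apply: analytic_sub; last exact: analytic_mul.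
    apply: analytic_mul; last exact: analytic_exp.
    by apply: (analytic_mul (ca 2)); exact: analytic_exp.
  by apply: analytic_mul Uia; exact: analytic_mul.
have comp h : analytic_at h z -> analytic_at (fun y => h (gZ g' y)) (gZ g z).
  by move=> ha; apply: (@analytic_comp _ _ _ h (gZ g') _ _ (gZ_analytic gz')); rewrite zz.
exists (Coeffs (fun y => Ac (gZ g' y)) (fun y => Bc (gZ g' y)) (fun y => Cc (gZ g' y))).
  split; [exact: comp|exact: comp|exact: comp|].
  by rewrite /= zz /Ac mulf_neq0 ?invr_neq0// mulf_neq0// expf_neq0.
have ng := gauge_near gz.
near=> y.
have [_ _ _ _ [Ty0 _ Uy0]] : gauge_at g y by near: y.
have Zy : gZ g' (gZ g y) = y.
  have : gZ (gcomp g' g) y = gZ (gid R) y by near: y.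
  by rewrite gid_Z.
move: Ty0 Uy0; split; rewrite /= Zy /Ac /Bc /Cc mulrA divff// mul1r //.
by field.
Unshelve. all: by end_near. Qed.

Lemma graph_near n (P : 'rV[R]_(n + 1) -> Prop) (q : 'rV[R]_(n + 1)) (f : 'rV[R]_n -> R) :
  analytic_at f (base q) -> f (base q) = fib q -> (\forall p \near q, P p) ->
  \forall z \near base q, P (pt z (f z)).
Proof.
move=> fa fq nP; have an : analytic_map_at (fun z => pt z (f z)) (base q).
  by apply: analytic_pt => //; exact: analytic_map_id.
by apply: (@near_pullback _ _ _ P _ _ an); rewrite fq pt_base_fib.
Qed.

(** Nonzero values of u are singled out because C is multiplied by u in L and cannot be recovered
    over u = 0. Such values exist arbitrarily close to any point. *)
Lemma fiber_near n (P : 'rV[R]_(n + 1) -> Prop) (q : 'rV[R]_(n + 1)) : (\forall p \near q, P p) ->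
  \forall z \near base q, exists2 u, u != 0 & P (pt z u).
Proof.
move=> /near_exists_ball[e e0 eP].
have [u u0 qu] : exists2 u, u != 0 & `|fib q - u| < e.
  have [q0|q0] := eqVneq (fib q) 0; last by exists (fib q); rewrite ?subrr ?normr0.
  exists (e / 2); first by rewrite gt_eqF ?divr_gt0.
  by rewrite q0 sub0r normrN gtr0_norm ?divr_gt0// ltr_pdivrMr// mulr_natr mulr2n ltrDr.
have nb : \forall z \near base q, ball (base q) e z by exact: nbhsx_ballx.
apply: (@filterS _ (nbhs (base q)) _ (ball (base q) e)) nb => z; rewrite -ball_normE/= => qz.
exists u => //; apply: eP; rewrite -ball_normE/= -{1}(pt_base_fib q) -ptB.
have m : Num.max `|base q - z| `|fib q - u| < e by rewrite gt_max qz qu.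
by apply: le_lt_trans m; apply: pt_le; rewrite le_max lexx ?orbT.
Qed.

Lemma maps_L F q g th th' : local2 F q g -> gauge_rel g th th' (base q) ->
  maps_equation F (eqL th) (eqL th') q.
Proof.
move=> [gq Fg] rel f h fa ha fq nh.
have Fq := nbhs_singleton Fg; have bE : base (fwd F q) = gZ g (base q) by rewrite Fq base_pt.
rewrite bE; apply: (L_transform gq rel fa); first by rewrite -bE.
have nF := graph_near fa fq Fg.
near=> z.
have Fz : fwd F (pt z (f z)) = ext2 g (pt z (f z)) by near: z.
have : fib (fwd F (pt z (f z))) = h (base (fwd F (pt z (f z)))) by near: z.
by rewrite Fz /ext2 !base_pt !fib_pt => ->.
Unshelve. all: by end_near. Qed.

Lemma maps_DE0 F q g th th' : local3 F q g -> (\forall z \near base (base q), gauge_rel g th th' z) ->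
  admissible th (base (base q)) -> admissible th' (gZ g (base (base q))) ->
  maps_equation F (eqDE0 th) (eqDE0 th') q.
Proof.
move=> [gq Fg] rel ad ad' f h fa ha fq nh.
have Fq := nbhs_singleton Fg; have bE : base (fwd F q) = ext2 g (base q) by rewrite Fq base_pt.
rewrite bE; apply: (DE0_transform gq rel ad ad' fa); first by rewrite -bE.
have nF := graph_near fa fq Fg.
have ng : \forall v \near base q, gauge_at g (base v) := near_pullback (analytic_map_base (base q)) (gauge_near gq).
near=> v.
have Fv : fwd F (pt v (f v)) = ext3 g (pt v (f v)) by near: v.
have [_ _ _ _ [_ X0 _]] : gauge_at g (base v) by near: v.
have : fib (fwd F (pt v (f v))) = h (base (fwd F (pt v (f v)))) by near: v.
rewrite Fv /ext3 !base_pt !fib_pt => <-; rewrite /gH.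
by field.
Unshelve. all: by end_near. Qed.

End LocalForms.

(** * Recovery of the coefficients from the equations *)

Section Determination.
Variable R : realType.
Implicit Types g : gauge R.

Lemma quadratic_pd n (z : 'rV[R]_n) y om k a i : pd i (quadratic z y om k a) z = om 0 i.
Proof. by apply: (etrans (quadratic_D _ _ _ _ _ _)); rewrite dotC dot_delta. Qed.

Lemma quadratic_pd2 n (z : 'rV[R]_n) y om k a i j :
  pd i (pd j (quadratic z y om k a)) z = 2 * k * a 0 j * a 0 i.
Proof. by apply: (etrans (quadratic_D2 _ _ _ _ _ _ _)); rewrite dotC dot_delta dotC dot_delta. Qed.

Lemma rhs_unique (P1 P2 : R -> Prop) (s1 s2 : R) :
  (forall t, P1 t <-> t = s1) -> (forall t, P2 t <-> t = s2) -> (forall t, P1 t <-> P2 t) -> s1 = s2.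
Proof. by move=> e1 e2 e; apply/e2/e/e1. Qed.

Lemma L_unique (th1 th2 : coeffs R) z y : y != 0 ->
  (forall h, analytic_at h z -> h z = y -> (eqL th1 h z <-> eqL th2 h z)) ->
  [/\ cA th1 z = cA th2 z, cB th1 z = cB th2 z & cC th1 z = cC th2 z].
Proof.
move=> y0 e.
have S k s : cA th1 z * (2 * k) + cB th1 z * s + cC th1 z * y =
             cA th2 z * (2 * k) + cB th2 z * s + cC th2 z * y.
  pose h t := quadratic z y (point2 t s) k (delta_mx 0 ix).
  have E th t : eqL th (h t) z <-> t = cA th z * (2 * k) + cB th z * s + cC th z * y.
    rewrite /eqL quadratic_pd quadratic_pd (quadratic_pd2 z y (point2 t s) k (delta_mx 0 ix) ix ix).
    by rewrite /h quadraticE point2_t point2_x delta2E eqxx !mulr1.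
  apply: (rhs_unique (E th1) (E th2)) => t.
  by apply: e; [exact: quadratic_analytic|exact: quadraticE].
have := S 0 0; rewrite !mulr0 !add0r => /(mulIf y0) eC.
have := S 0 1; rewrite !mulr0 !add0r !mulr1 eC => /addIr eB.
have := S 1 0; rewrite !mulr0 !addr0 eC => /addIr; rewrite mulr1.
have two0 : (2 : R) != 0 by rewrite pnatr_eq0.
by move=> /(mulIf two0).
Qed.

(** The coefficient of k gives A. The slope in x only gives A_x + B and the slope in u only y A_x -
    u C, so B and C follow once the A_x are known to agree. *)
Lemma DE0_unique_algebra (A A' Ax Ax' B B' Bx Bx' C C' Cx Cx' y u : R) :
  (forall k ox ou, A * (2 * k) + Ax * (ox + y * ou) + (Bx * y + B * ox) + C * (y - u * ou) + Cx * u =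
     A' * (2 * k) + Ax' * (ox + y * ou) + (Bx' * y + B' * ox) + C' * (y - u * ou) + Cx' * u) ->
  A = A' /\ (Ax = Ax' -> u != 0 -> B = B' /\ C = C').
Proof.
move=> S; have := S 0 0 0; have := S 1 0 0; have := S 0 1 0; have := S 0 0 1.
rewrite !mulr0 !mulr1 !addr0 !add0r !subr0 => e3 e2 e1 e0.
split; first by lra.
move=> eA u0; subst Ax'; split; first by lra.
by apply: (mulIf u0); lra.
Qed.

Lemma DE0_unique (th1 th2 : coeffs R) w y : analytic_at (cB th1) (base w) -> analytic_at (cB th2) (base w) ->
  (forall h, analytic_at h w -> h w = y -> (eqDE0 th1 h w <-> eqDE0 th2 h w)) ->
  cA th1 (base w) = cA th2 (base w) /\
  (pd ix (cA th1) (base w) = pd ix (cA th2) (base w) -> fib w != 0 ->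
    cB th1 (base w) = cB th2 (base w) /\ cC th1 (base w) = cC th2 (base w)).
Proof.
move=> Ba1 Ba2 e.
pose S th k ox ou := cA th (base w) * (2 * k) + pd ix (cA th) (base w) * (ox + y * ou) +
  (pd ix (cB th) (base w) * y + cB th (base w) * ox) + cC th (base w) * (y - fib w * ou) +
  pd ix (cC th) (base w) * fib w.
suff H k ox ou : S th1 k ox ou = S th2 k ox ou by exact: (DE0_unique_algebra H).
pose h t := quadratic w y (\row_i (if i == jt then t else if i == jx then ox else ou)) k (delta_mx 0 jx).
have E th t : analytic_at (cB th) (base w) -> eqDE0 th (h t) w <-> t = S th k ox ou.
  move=> Ba; rewrite /eqDE0 (base_analytic_B Ba (quadratic_analytic _ _ _ _ _ _)).
  rewrite (quadratic_pd w y _ k _ jt) (quadratic_pd w y _ k _ jx) (quadratic_pd w y _ k _ ju).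
  rewrite (quadratic_pd2 w y _ k _ jx jx) (quadratic_pd2 w y _ k _ jx ju) (quadratic_pd2 w y _ k _ ju ju).
  rewrite /h quadraticE !delta3E eqxx !mxE.
  have -> : (ju == jx) = false by [].
  have -> : (jx == jt) = false by [].
  have -> : (ju == jt) = false by [].
  by rewrite !eqxx !mulr0 !mul0r !mulr0 !addr0 !mulr1.
apply: (rhs_unique (fun t => E th1 t Ba1) (fun t => E th2 t Ba2)) => t.
by apply: e; [exact: quadratic_analytic|exact: quadraticE].
Qed.

End Determination.

Section MapsRel.
Variable R : realType.
Implicit Types g : gauge R.

Lemma local2_near F q g : local2 F q g -> \forall p \near q, local2 F p g.
Proof.
move=> [gq Fg]; have n1 := near_pullback (analytic_map_base q) (gauge_near gq).
have n2 := near_join Fg.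
by near=> p; split; near: p.
Unshelve. all: by end_near. Qed.

Lemma base_near n (P : 'rV[R]_n -> Prop) (q : 'rV[R]_(n + 1)) : (\forall z \near base q, P z) ->
  \forall p \near q, P (base p).
Proof. exact: near_pullback (analytic_map_base q). Qed.

Lemma local3_near F q g : local3 F q g -> \forall p \near q, local3 F p g.
Proof.
move=> [gq Fg]; have n1 := base_near (base_near (gauge_near gq)).
have n2 := near_join Fg.
by near=> p; split; near: p.
Unshelve. all: by end_near. Qed.

Lemma gauge_rel_eq g th th1 th2 z : cA th1 (gZ g z) = cA th2 (gZ g z) ->
  cB th1 (gZ g z) = cB th2 (gZ g z) -> cC th1 (gZ g z) = cC th2 (gZ g z) ->
  gauge_rel g th th1 z -> gauge_rel g th th2 z.
Proof. by rewrite /gauge_rel => -> -> ->. Qed.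

Lemma local2_fwd F q g : local2 F q g -> base (fwd F q) = gZ g (base q).
Proof. by move=> [_ /nbhs_singleton ->]; rewrite base_pt. Qed.

Lemma local3_fwd F q g : local3 F q g -> base (fwd F q) = ext2 g (base q).
Proof. by move=> [_ /nbhs_singleton ->]; rewrite base_pt. Qed.

(** Every h with the right value at the image point is reached: the graph of f = (h o Z) / U is sent
    to that of h. The equations th' and th'' can thus be compared on arbitrary jets. *)
Lemma maps_L_onto F q g th th' (h : 'rV[R]_2 -> R) : local2 F q g ->
  maps_equation F (eqL th) (eqL th') q ->
  analytic_at h (gZ g (base q)) -> h (gZ g (base q)) = gU g (base q) * fib q ->
  let f y := h (gZ g y) / gU g y in (eqL th f (base q) <-> eqL th' h (gZ g (base q))).
Proof.
move=> lF FE ha hq f; have [gq Fg] := lF; have [_ _ Ua _ [_ _ U0]] := gq.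
have bE := local2_fwd lF.
have fa : analytic_at f (base q).
  apply: analytic_mul; last exact: analytic_inv.
  exact: (@analytic_comp _ _ _ h (gZ g) (base q) ha (gZ_analytic gq)).
have fq : f (base q) = fib q by rewrite /f hq mulrC mulKf.
rewrite -bE; apply: (FE f h fa _ fq); first by rewrite bE.
have nF := graph_near fa fq Fg; have ng := gauge_near gq.
near=> z => /=.
have Fz : fwd F (pt z (f z)) = ext2 g (pt z (f z)) by near: z.
have [_ _ _ _ [_ _ Uz0]] : gauge_at g z by near: z.
by rewrite Fz /ext2 !base_pt !fib_pt /f mulrC divfK.
Unshelve. all: by end_near. Qed.

Lemma maps_DE0_onto F q g th th' (h : 'rV[R]_(2 + 1) -> R) : local3 F q g ->
  maps_equation F (eqDE0 th) (eqDE0 th') q ->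
  analytic_at h (ext2 g (base q)) -> h (ext2 g (base q)) = gH g (base q) (fib q) ->
  let f v := (h (ext2 g v) * pd ix (gX g) (base v) - pd ix (gU g) (base v) * fib v) / gU g (base v) in
  (eqDE0 th f (base q) <-> eqDE0 th' h (ext2 g (base q))).
Proof.
move=> lF FE ha hq f; have [gq Fg] := lF; have [_ Xa Ua _ [_ X0 U0]] := gq.
have bE := local3_fwd lF.
have bc (k : 'rV[R]_2 -> R) : analytic_at k (base (base q)) -> analytic_at (fun v : 'rV[R]_(2 + 1) => k (base v)) (base q).
  by move=> ka; exact: (@analytic_comp _ _ _ k (@base R 2) (base q) ka (analytic_map_base _)).
have fa : analytic_at f (base q).
  apply: analytic_mul; last by apply: analytic_inv => //; exact: bc.
  apply: analytic_sub.
    apply: analytic_mul; last by apply: bc; exact: analytic_pd.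
    exact: (@analytic_comp _ _ _ h (ext2 g) (base q) ha (ext2_analytic gq)).
  by apply: analytic_mul (analytic_fib _); apply: bc; exact: analytic_pd.
have fq : f (base q) = fib q.
  by rewrite /f hq /gH; field; rewrite X0 U0.
rewrite -bE; apply: (FE f h fa _ fq); first by rewrite bE.
have nF := graph_near fa fq Fg; have ng := base_near (gauge_near gq).
near=> v => /=.
have Fv : fwd F (pt v (f v)) = ext3 g (pt v (f v)) by near: v.
have [_ _ _ _ [_ Xv0 Uv0]] : gauge_at g (base v) by near: v.
rewrite Fv /ext3 !base_pt !fib_pt /gH /f.
by field; rewrite Xv0 Uv0.
Unshelve. all: by end_near. Qed.

(** [gauge_coeffs] provides coefficients th'' satisfying the rules, so that F maps the equation of
    th to that of th'' as well. The equations of th' and th'' then hold for the same jets over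
    points with nonzero u, and their coefficients coincide. *)
Lemma L_maps_rel F q g th th' : local2 F q g -> admissible th (base q) ->
  (\forall p \near q, maps_equation F (eqL th) (eqL th') p) <->
  (\forall z \near base q, gauge_rel g th th' z).
Proof.
move=> lF ad; have nl := local2_near lF; split=> [nm|nr].
  have [th'' _ nr] := gauge_coeffs lF.1 ad.
  have nr' := base_near nr.
  have nP : \forall p \near q, [/\ local2 F p g, maps_equation F (eqL th) (eqL th') p
      & maps_equation F (eqL th) (eqL th'') p].
    near=> p; have lFp : local2 F p g by near: p.
    by split; [exact: lFp|near: p|apply: (maps_L lFp); near: p].
  have nz := fiber_near nP.
  near=> z.
  have [u u0 [lFz m1 m2]] : exists2 u, u != 0 & [/\ local2 F (pt z u) g, maps_equation F (eqL th) (eqL th') (pt z u)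
      & maps_equation F (eqL th) (eqL th'') (pt z u)] by near: z.
  have rz : gauge_rel g th th'' z by near: z.
  have [_ _ _ _ [_ _ U0]] := lFz.1; rewrite base_pt in U0.
  have [] := @L_unique _ th' th'' (gZ g z) (gU g z * u) (mulf_neq0 U0 u0).
    move=> h ha hz.
    have := maps_L_onto (h := h) lFz m1; have := maps_L_onto (h := h) lFz m2.
    by rewrite base_pt fib_pt => /(_ ha hz) <- /(_ ha hz) <-.
  by move=> eA eB eC; apply: gauge_rel_eq rz.
have nr' := base_near nr.
near=> p; apply: (@maps_L _ _ _ g); near: p; exact: nl || exact: nr'.
Unshelve. all: by end_near. Qed.

(** As for L, th' is compared with the th'' of [gauge_coeffs], but in two rounds: A is identified on
    a whole neighborhood, hence so is A_x, and only then B and C. *)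
Lemma DE0_maps_rel F q g th th' : local3 F q g -> admissible th (base (base q)) ->
  admissible th' (gZ g (base (base q))) ->
  (\forall p \near q, maps_equation F (eqDE0 th) (eqDE0 th') p) <->
  (\forall z \near base (base q), gauge_rel g th th' z).
Proof.
move=> lF ad ad'; have nl := local3_near lF.
have gq := lF.1.
have adn := admissible_near ad.
have adn' : \forall z \near base (base q), admissible th' (gZ g z) := near_pullback (gZ_analytic gq) (admissible_near ad').
have nm2 th2 : admissible th2 (gZ g (base (base q))) -> (\forall z \near base (base q), gauge_rel g th th2 z) ->
    \forall p \near q, maps_equation F (eqDE0 th) (eqDE0 th2) p.
  move=> ad2 nr; have adn2 := near_pullback (gZ_analytic gq) (admissible_near ad2).
  have n1 := base_near (base_near adn); have n2 := base_near (base_near adn2).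
  have n3 := base_near (base_near (near_join nr)).
  by near=> p; apply: (@maps_DE0 _ _ _ g); near: p.
split=> [nm|]; last exact: nm2.
have [th'' ad'' nr] := gauge_coeffs gq ad.
have adn'' : \forall z \near base (base q), admissible th'' (gZ g z) := near_pullback (gZ_analytic gq) (admissible_near ad'').
have nm'' := nm2 th'' ad'' nr.
have nP : \forall p \near q, [/\ local3 F p g, maps_equation F (eqDE0 th) (eqDE0 th') p
      & maps_equation F (eqDE0 th) (eqDE0 th'') p].
  by near=> p; split; near: p.
have nw : \forall w \near base q, exists eta, [/\ local3 F (pt w eta) g,
   maps_equation F (eqDE0 th) (eqDE0 th') (pt w eta)
   & maps_equation F (eqDE0 th) (eqDE0 th'') (pt w eta)].
  have nw := fiber_near nP; near=> w.
  have [eta _ H] : exists2 eta, eta != 0 & [/\ local3 F (pt w eta) g,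
   maps_equation F (eqDE0 th) (eqDE0 th') (pt w eta)
   & maps_equation F (eqDE0 th) (eqDE0 th'') (pt w eta)] by near: w.
  by exists eta.
have nz := fiber_near nw.
have U z : (exists2 u, u != 0 & exists eta, [/\ local3 F (pt (pt z u) eta) g,
   maps_equation F (eqDE0 th) (eqDE0 th') (pt (pt z u) eta)
   & maps_equation F (eqDE0 th) (eqDE0 th'') (pt (pt z u) eta)]) ->
   admissible th' (gZ g z) -> admissible th'' (gZ g z) -> cA th' (gZ g z) = cA th'' (gZ g z) /\
   (pd ix (cA th') (gZ g z) = pd ix (cA th'') (gZ g z) ->
    cB th' (gZ g z) = cB th'' (gZ g z) /\ cC th' (gZ g z) = cC th'' (gZ g z)).
  move=> [u u0 [eta [lFz m1 m2]]] adz adz'.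
  have [_ Bz _ _] := adz; have [_ Bz' _ _] := adz'.
  have [_ _ _ _ [_ _ U0]] := lFz.1; rewrite !base_pt in U0.
  have bE : base (ext2 g (pt z u)) = gZ g z by rewrite !base_pt.
  have := @DE0_unique _ th' th'' (ext2 g (pt z u)) (gH g (pt z u) eta).
  rewrite bE; have -> : fib (ext2 g (pt z u)) = gU g z * u by rewrite fib_pt base_pt fib_pt.
  case=> // [h ha hz|e1 e2].
    have := maps_DE0_onto (h := h) lFz m1; have := maps_DE0_onto (h := h) lFz m2.
    by rewrite base_pt fib_pt => /(_ ha hz) <- /(_ ha hz) <-.
  by split=> // eA; apply: e2 => //; exact: mulf_neq0.
have nA : \forall z \near base (base q), cA th' (gZ g z) = cA th'' (gZ g z).
  by near=> z; have [] := U z; [near: z|near: z|near: z|].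
have nA' := near_join nA; have ng := gauge_near gq.
near=> z.
have gz : gauge_at g z by near: z.
have az : admissible th' (gZ g z) by near: z.
have az' : admissible th'' (gZ g z) by near: z.
have [eA eBC] : cA th' (gZ g z) = cA th'' (gZ g z) /\
   (pd ix (cA th') (gZ g z) = pd ix (cA th'') (gZ g z) ->
    cB th' (gZ g z) = cB th'' (gZ g z) /\ cC th' (gZ g z) = cC th'' (gZ g z)).
  by apply: U => //; near: z.
have [Aa _ _ _] := az; have [Aa' _ _ _] := az'.
have [_ _ _ _ [_ X0 _]] := gz.
have eAz : \forall z' \near z, cA th' (gZ g z') = cA th'' (gZ g z') by near: z.
have eAx := etrans (etrans (esym (pull_x gz Aa)) (near_eq_derive _ eAz)) (pull_x gz Aa').
have [eB eC] := eBC (mulfI X0 eAx).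
apply: (gauge_rel_eq (esym eA) (esym eB) (esym eC)).
by near: z.
Unshelve. all: by end_near. Qed.

End MapsRel.

(** * Local triples (T, X, U) of the elements of both groups *)

Section LocalFormExistence.
Variable R : realType.

Lemma pt_eq2 (q : 'rV[R]_(2 + 1)) a b c : q 0 jt = a -> q 0 jx = b -> q 0 ju = c -> q = pt (point2 a b) c.
Proof.
move=> <- <- <-; rewrite -[LHS]pt_base_fib fibE; congr pt.
by apply/rowP => k; rewrite baseE; have [->|->] := I2P k; rewrite ?point2_t ?point2_x.
Qed.

(** T, X and U are read on the slice where u keeps its value at p, with U = V_u. None of them
    depends on u, and V = u V_u gives the last component. *)
Theorem L_local_form (F : ptrans R (2 + 1)) p : Gequiv F -> dom F p -> exists g, local2 F p g.
Proof.
move=> GF Fp; have [e e0 H] := L_structure GF Fp; have [PF _] := GF.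
pose u0 := fib p.
have an k q : ball p e q -> analytic_at (coordF F k) q.
  by move=> /H[Fq _ _ _ _]; exact: coordF_analytic.
have an2 k z : ball (base p) e z -> analytic_at (coordF F k) (pt z u0).
  by move=> /ball_pt; exact: an.
have bp : ball (base p) e (base p) by exact: ballxx.
have sl k i z : ball (base p) e z -> pd i (fun z' => coordF F k (pt z' u0)) z = pd (lshift 1 i) (coordF F k) (pt z u0).
  by move=> pz; apply: pd_slice; exact: an2.
pose g := Gauge (fun z => coordF F jt (pt z u0)) (fun z => coordF F jx (pt z u0))
  (fun z => pd ju (coordF F ju) (pt z u0)).
have gp : gauge_at g (base p).
  have [_ _ [T0 X0] U0 _] := H _ (ball_pt bp).
  split.
  - exact: (@analytic_slice _ _ _ (base p) u0 (an2 jt _ bp)).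
  - exact: (@analytic_slice _ _ _ (base p) u0 (an2 jx _ bp)).
  - exact: (@analytic_slice _ _ _ (base p) u0 (analytic_pd ju (an2 ju _ bp))).
  - apply: ball_nbhs bp _ => z pz; apply: (etrans (sl jt ix z pz)).
    by have [_ []] := H _ (ball_pt pz).
  split; last exact: U0.
  - by apply/eqP => E; move/eqP: (etrans (esym (sl jt it _ bp)) E); rewrite (negbTE T0).
  - by apply/eqP => E; move/eqP: (etrans (esym (sl jx ix _ bp)) E); rewrite (negbTE X0).
exists g; split=> //.
apply: (@ball_nbhs _ _ _ p e p (ballxx _ e0)) => q pq.
have [_ _ _ _ [Vq _]] := H q pq.
have pb := ball_pt (ball_base pq); have bE : base q = base (pt (base q) u0) by rewrite base_pt.
apply: pt_eq2.
- by apply: (pd0_fiber (an jt) _ pq pb bE) => w /H[_ []].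
- by apply: (pd0_fiber (an jx) _ pq pb bE) => w /H[_ []].
apply: (etrans Vq); rewrite mulrC; congr (_ * _).
apply: (pd0_fiber _ _ pq pb bE) => w pw; first by apply: analytic_pd; exact: an.
by have [_ _ _ _ []] := H w pw.
Unshelve. all: by end_near. Qed.

Lemma I4P (k : 'I_(2 + 1 + 1)) : [\/ k = kt, k = kx, k = ku | k = ke].
Proof.
case: (split_ordP k) => j ->; last by rewrite ord1; constructor 4.
by have [->|->|->] := I3P j; [constructor 1|constructor 2|constructor 3].
Qed.

Lemma pt_eq3 (q : 'rV[R]_(2 + 1 + 1)) a b c d : q 0 kt = a -> q 0 kx = b -> q 0 ku = c -> q 0 ke = d ->
  q = pt (pt (point2 a b) c) d.
Proof.
move=> qt qx qu <-; rewrite -[LHS]pt_base_fib fibE; congr pt.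
by apply: pt_eq2; rewrite baseE.
Qed.

(** The triple is read on the slice where u and eta keep their values at p, with U = V_u. The
    contact condition H X_x = V_x + eta V_u, in which V_x = u U_x, then yields the formula for
    eta~. *)
Theorem DE0_local_form (F : ptrans R (2 + 1 + 1)) p : Gequiv0 F -> dom F p -> exists g, local3 F p g.
Proof.
move=> GF Fp; have [e e0 H] := DE0_structure GF Fp; have [PF _] := GF.
pose T := coordF F kt; pose X := coordF F kx; pose V := coordF F ku.
pose Vu := pd ku V.
pose s (z : 'rV[R]_2) := pt (pt z (fib (base p))) (fib p).
have an k q : ball p e q -> analytic_at (coordF F k) q.
  by move=> /H[Fq _ _ _ _]; exact: coordF_analytic.
have bp : ball (base (base p)) e (base (base p)) by exact: ballxx.
have bs z : ball (base (base p)) e z -> ball p e (s z).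
  by move=> pz; exact: ball_pt (ball_pt pz).
have slA f z : analytic_at f (s z) -> analytic_at (fun z' => f (s z')) z.
  move=> fa; apply: (@analytic_slice _ _ (fun w => f (pt w (fib p))) z (fib (base p))).
  exact: (@analytic_slice _ _ f _ (fib p)).
have sl f i z : analytic_at f (s z) -> pd i (fun z' => f (s z')) z = pd (lshift 1 (lshift 1 i)) f (s z).
  move=> fa; apply: (etrans (@pd_slice _ _ (fun w => f (pt w (fib p))) z (fib (base p)) i _)).
    exact: (@analytic_slice _ _ f _ (fib p)).
  exact: pd_slice.
have const f : (forall q, ball p e q -> analytic_at f q) -> (forall q, ball p e q -> pd ku f q = 0) ->
    (forall q, ball p e q -> pd ke f q = 0) -> forall q, ball p e q -> f q = f (s (base (base q))).
  move=> fa fu fe q pq.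
  apply: (@pd0_const _ _ f p e (fun i => (i == ku) || (i == ke)) fa _ q _ pq).
  - by move=> w i pw /orP[] /eqP ->; [exact: fu|exact: fe].
  - by apply: bs; apply: ball_base; exact: ball_base.
  move=> i; have [->|->|->|->] := I4P i => // _.
  - by rewrite /kt /s ptl /jt ptl !baseE.
  - by rewrite /kx /s ptl /jx ptl !baseE.
have Xu q : ball p e q -> pd ku X q = 0 by move=> /H[_ _ []].
have Xe q : ball p e q -> pd ke X q = 0 by move=> /H[_ _ []].
have Ve q : ball p e q -> pd ke V q = 0 by move=> /H[_ _ []].
have Vuu q : ball p e q -> pd ku Vu q = 0 by move=> /H[_ _ _ _ []].
have Vue q : ball p e q -> pd ke Vu q = 0 by exact: (@fiber_pd _ _ V p e ku (an ku) Ve).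
have com f i : (forall q, ball p e q -> analytic_at f q) -> (forall q, ball p e q -> pd ku f q = 0) ->
    forall q, ball p e q -> pd ku (pd i f) q = 0.
  move=> fa fu q pq; apply: (etrans (deriveC_pd ku i (fa q pq))).
  by apply: pd_near0; exact: ball_nbhs pq fu.
have Vua q : ball p e q -> analytic_at Vu q by move=> pq; apply: analytic_pd; exact: an.
pose g := Gauge (fun z => T (s z)) (fun z => X (s z)) (fun z => Vu (s z)).
have gp : gauge_at g (base (base p)).
  have [_ _ _ [T0 X0 U0] _] := H _ (bs _ bp).
  split.
  - exact: (slA _ _ (an kt _ (bs _ bp))).
  - exact: (slA _ _ (an kx _ (bs _ bp))).
  - exact: (slA _ _ (Vua _ (bs _ bp))).
  - apply: ball_nbhs bp _ => z pz; apply: (etrans (sl _ ix z (an kt _ (bs _ pz)))).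
    by have [_ []] := H _ (bs _ pz).
  split; last exact: U0.
  - by apply/eqP => E; move/eqP: (etrans (esym (sl _ it _ (an kt _ (bs _ bp)))) E); rewrite (negbTE T0).
  - by apply/eqP => E; move/eqP: (etrans (esym (sl _ ix _ (an kx _ (bs _ bp)))) E); rewrite (negbTE X0).
exists g; split=> //.
apply: (@ball_nbhs _ _ _ p e p (ballxx _ e0)) => q pq.
have [_ [_ Tu Te] _ [_ X0 _] [HX _ Vq]] := H q pq.
have VE w : ball p e w -> fib (base w) * Vu w = V w by move=> /H[_ _ _ _ []].
have UE := const Vu Vua Vuu Vue q pq.
have Vx : pd kx V q = fib (base q) * pd kx Vu q.
  have hf : hasD (delta_mx 0 kx) (fun w : 'rV[R]_(2 + 1 + 1) => fib (base w)) q 0.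
    apply: hasD_eq (hasD_base _ (analytic_fib (base q))) _.
    rewrite [delta_mx 0 kx]delta_lshift base_pt.
    by have [_] := hasD_fib_x (base q).
  have [_ D] := hasD_near (ball_nbhs pq VE) (hasD_mul hf (hasD_derive (delta_mx 0 kx) (Vua q pq))).
  by apply: (etrans D); rewrite mul0r add0r.
have VxE : pd kx Vu q = pd ix (gU g) (base (base q)).
  have pb := ball_base (ball_base pq).
  apply: (etrans (const (pd kx Vu) _ (com Vu kx Vua Vuu) (@fiber_pd _ _ Vu p e kx Vua Vue) q pq)).
    by move=> w pw; apply: analytic_pd; exact: Vua.
  by apply: esym; exact: (sl Vu ix _ (Vua _ (bs _ pb))).
have XxE : pd kx X q = pd ix (gX g) (base (base q)).
  have pb := ball_base (ball_base pq).
  apply: (etrans (const (pd kx X) _ (com X kx (an kx) Xu) (@fiber_pd _ _ X p e kx (an kx) Xe) q pq)).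
    by move=> w pw; apply: analytic_pd; exact: an.
  by apply: esym; exact: (sl X ix _ (an kx _ (bs _ pb))).
apply: pt_eq3.
- by apply: (const T (an kt) _ _ q pq) => w /H[_ []].
- exact: (const X (an kx) Xu Xe q pq).
- by apply: (etrans (esym (VE q pq))); rewrite mulrC UE.
rewrite /gH -XxE -VxE /=; rewrite -[Vu (s _)]UE.
have := HX; rewrite -/X -/V -/Vu Vx => HX'.
have -> : fwd F q 0 ke = coordF F ke q * pd kx X q / pd kx X q by rewrite mulfK.
rewrite HX'; move: X0; rewrite -/X.
generalize (pd kx X q) (pd kx Vu q) (Vu q) (fib q) (fib (base q)) => a b c d u a0.
by field.
Unshelve. all: by end_near. Qed.

End LocalFormExistence.

(** * Pseudogroups and canonical extension *)

Section Pseudogroups.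
Variable R : realType.

(** Replaces the definition by equations with a local normal form; the group axioms and the
    properties of the extension are then checked on triples, without any differential equation. *)
Lemma Gequiv_localP (F : ptrans R (2 + 1)) :
  Gequiv F <-> point_transformation F /\ forall p, dom F p -> exists g, local2 F p g.
Proof.
split=> [GF|[PF loc]]; first by have [PF _] := GF; split=> // p; exact: L_local_form.
split=> // p th Fp ad; have [g lF] := loc p Fp; have [gp _] := lF.
have [th' ad' nr] := gauge_coeffs gp ad.
by exists th'; [rewrite (local2_fwd lF)|apply/(L_maps_rel _ lF ad)].
Qed.

Lemma Gequiv0_localP (F : ptrans R (2 + 1 + 1)) :
  Gequiv0 F <-> point_transformation F /\ forall p, dom F p -> exists g, local3 F p g.
Proof.
split=> [GF|[PF loc]]; first by have [PF _] := GF; split=> // p; exact: DE0_local_form.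
split=> // p th Fp ad; have [g lF] := loc p Fp; have [gp _] := lF.
have [th' ad' nr] := gauge_coeffs gp ad.
exists th'; first by rewrite (local3_fwd lF) base_pt.
by apply/(DE0_maps_rel lF ad).
Qed.

Lemma point_transformation_id m (D : set 'rV[R]_m) : open D -> point_transformation (pt_id D).
Proof. by move=> Do; split=> // p _; exact: analytic_map_id. Qed.

Lemma open_preimage m n (D : set 'rV[R]_m) (E : set 'rV[R]_n) (f : 'rV[R]_m -> 'rV[R]_n) :
  open D -> open E -> (forall p, D p -> analytic_map_at f p) -> open (D `&` f @^-1` E).
Proof.
move=> Do Eo fa; rewrite openE => p [Dp Ep].
have nD : \forall q \near p, D q by apply: open_nbhs_nbhs.
have nE : \forall q \near p, E (f q).
  by apply: (near_pullback (fa p Dp)); apply: open_nbhs_nbhs.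
by near=> q; split; near: q.
Unshelve. all: by end_near. Qed.

Lemma point_transformation_comp m (F1 F2 : ptrans R m) : point_transformation F1 ->
  point_transformation F2 -> point_transformation (pt_comp F2 F1).
Proof.
move=> [[od1 oc1] k1 k1' a1 a1'] [[od2 oc2] k2 k2' a2 a2']; split=> /=.
- by split; exact: open_preimage.
- move=> p [d1 d2]; have [c2 e2] := k2 _ d2; have [c1 e1] := k1 _ d1.
  by rewrite /preimage/= e2.
- move=> p [d1 d2]; have [c2 e2] := k1' _ d2; have [c1 e1] := k2' _ d1.
  by rewrite /preimage/= e2.
- by move=> p [d1 d2]; apply: (@analytic_map_comp _ _ _ _ (fwd F2) (fwd F1)); [exact: a2|exact: a1].
by move=> p [d1 d2]; apply: (@analytic_map_comp _ _ _ _ (bwd F1) (bwd F2)); [exact: a1'|exact: a2'].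
Qed.

(** Both groups are given by a condition on germs; the axioms reduce to the stability of this
    condition under identities, composition and inversion. *)
Lemma pseudogroup_local m (G : set (ptrans R m)) (loc : ptrans R m -> 'rV[R]_m -> Prop) :
  (forall F, G F <-> point_transformation F /\ forall p, dom F p -> loc F p) ->
  (forall F F' p, germ_eq p F F' -> loc F' p -> loc F p) ->
  (forall D p, D p -> loc (pt_id D) p) ->
  (forall F1 F2 p, point_transformation F1 -> dom F1 p -> loc F1 p -> loc F2 (fwd F1 p) ->
    loc (pt_comp F2 F1) p) ->
  (forall F p, point_transformation F -> dom F p -> loc F p -> loc (pt_inv F) (fwd F p)) ->
  pseudogroup G.
Proof.
move=> GP germ lid lcomp linv; split.
- by move=> F /GP[].
- by move=> D Do; apply/GP; split; [exact: point_transformation_id|exact: lid].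
- move=> F1 F2 /GP[P1 l1] /GP[P2 l2]; apply/GP; split; first exact: point_transformation_comp.
  by move=> p [d1 d2]; apply: lcomp => //; [exact: l1|exact: l2].
- move=> F /GP[PF lF]; apply/GP; split; first exact: point_transformation_inv.
  move=> p cp; have [_ _ k _ _] := PF; have [dp e] := k p cp.
  by rewrite -e; apply: linv => //; exact: lF.
move=> F PF H; apply/GP; split=> // p dp.
have [F' /GP[_ l'] g] := H p dp; apply: (germ _ F') => //.
by have [_ d' _] := g; exact: l'.
Qed.

Lemma local2_comp (F1 F2 : ptrans R (2 + 1)) p g1 g2 : point_transformation F1 -> dom F1 p ->
  local2 F1 p g1 -> local2 F2 (fwd F1 p) g2 -> local2 (pt_comp F2 F1) p (gcomp g2 g1).
Proof.
move=> PF1 d1 l1 [G2 E2]; have [G1 E1] := l1; rewrite (local2_fwd l1) in G2.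
split; first exact: gcomp_at.
have n2 : \forall q \near p, fwd F2 (fwd F1 q) = ext2 g2 (fwd F1 q) := fwd_cvg PF1 d1 E2.
near=> q => /=; have -> : fwd F2 (fwd F1 q) = ext2 g2 (fwd F1 q) by near: q.
rewrite gcomp_ext2; congr (ext2 g2 _); near: q; exact: E1.
Unshelve. all: by end_near. Qed.

Lemma local3_comp (F1 F2 : ptrans R (2 + 1 + 1)) p g1 g2 : point_transformation F1 -> dom F1 p ->
  local3 F1 p g1 -> local3 F2 (fwd F1 p) g2 -> local3 (pt_comp F2 F1) p (gcomp g2 g1).
Proof.
move=> PF1 d1 l1 [G2 E2]; have [G1 E1] := l1; rewrite (local3_fwd l1) base_pt in G2.
split; first exact: gcomp_at.
have n2 : \forall q \near p, fwd F2 (fwd F1 q) = ext3 g2 (fwd F1 q) := fwd_cvg PF1 d1 E2.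
have n1 := base_near (base_near (gauge_near G1)).
have n3 := base_near (base_near (near_pullback (gZ_analytic G1) (gauge_near G2))).
near=> q => /=; have -> : fwd F2 (fwd F1 q) = ext3 g2 (fwd F1 q) by near: q.
rewrite gcomp_ext3; [|near: q; exact: n1|near: q; exact: n3].
congr (ext3 g2 _); near: q; exact: E1.
Unshelve. all: by end_near. Qed.

Lemma ext2_cancel (g g' : gauge R) p : gauge_eq (gcomp g' g) (gid R) (base p) ->
  \forall q \near p, ext2 g' (ext2 g q) = q.
Proof.
move=> /gauge_eq_ext2 /base_near n; near=> q; rewrite -gcomp_ext2 -{1}(pt_base_fib q).
have -> : forall u, ext2 (gcomp g' g) (pt (base q) u) = ext2 (gid R) (pt (base q) u) by near: q.
by rewrite gid_ext2 pt_base_fib.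
Unshelve. all: by end_near. Qed.

Lemma ext3_cancel (g g' : gauge R) p : gauge_at g (base (base p)) -> gauge_at g' (gZ g (base (base p))) ->
  gauge_eq (gcomp g' g) (gid R) (base (base p)) ->
  \forall q \near p, ext3 g' (ext3 g q) = q.
Proof.
move=> gp gp' /gauge_eq_ext3 /base_near /base_near n.
have n1 := base_near (base_near (gauge_near gp)).
have n3 := base_near (base_near (near_pullback (gZ_analytic gp) (gauge_near gp'))).
near=> q; rewrite -gcomp_ext3; [|near: q; exact: n1|near: q; exact: n3].
rewrite -{1}(pt_base_fib q) -{1}(pt_base_fib (base q)).
have -> : forall u eta, ext3 (gcomp g' g) (pt (pt (base (base q)) u) eta) =
  ext3 (gid R) (pt (pt (base (base q)) u) eta) by near: q.
by rewrite gid_ext3 !pt_base_fib.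
Unshelve. all: by end_near. Qed.

Lemma inverse_near m (F : ptrans R m) p (E E' : 'rV[R]_m -> 'rV[R]_m) :
  point_transformation F -> dom F p -> (\forall q \near p, fwd F q = E q) ->
  (\forall q \near p, E' (E q) = q) -> \forall q \near fwd F p, bwd F q = E' q.
Proof.
move=> PF dp nE nE'; have PI := point_transformation_inv PF.
have [_ kp _ _ _] := PF; have [cp pE] := kp p dp.
have c := fwd_cvg PI (q := fwd F p) cp; rewrite /= pE in c.
have n1 := c _ nE; have n2 := c _ nE'.
have n3 := dom_near PI (q := fwd F p) cp.
near=> q.
have cq : cod F q by near: q.
have [_ _ k _ _] := PF; have [_ e] := k q cq.
have e1 : fwd F (bwd F q) = E (bwd F q) by near: q.
have e2 : E' (E (bwd F q)) = bwd F q by near: q.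
by rewrite -[LHS]e2 -e1 e.
Unshelve. all: by end_near. Qed.

Lemma local2_inv (F : ptrans R (2 + 1)) p g : point_transformation F -> dom F p -> local2 F p g ->
  exists2 g', gauge_eq (gcomp g' g) (gid R) (base p) & local2 (pt_inv F) (fwd F p) g'.
Proof.
move=> PF dp lF; have [gp Fg] := lF; have [g' [gz _ e _]] := gauge_inverse gp.
exists g'; first exact: e.
split; first by rewrite (local2_fwd lF).
exact: inverse_near PF dp Fg (ext2_cancel e).
Qed.

Lemma local3_inv (F : ptrans R (2 + 1 + 1)) p g : point_transformation F -> dom F p -> local3 F p g ->
  exists2 g', gauge_eq (gcomp g' g) (gid R) (base (base p)) & local3 (pt_inv F) (fwd F p) g'.
Proof.
move=> PF dp lF; have [gp Fg] := lF; have [g' [gz _ e _]] := gauge_inverse gp.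
exists g'; first exact: e.
split; first by rewrite (local3_fwd lF) base_pt.
exact: inverse_near PF dp Fg (ext3_cancel gp gz e).
Qed.

Theorem Gequiv_pseudogroup : pseudogroup (@Gequiv R).
Proof.
apply: (pseudogroup_local Gequiv_localP).
- move=> F F' p [_ _ n] [g [gp n']]; exists g; split=> //.
  by near=> q; transitivity (fwd F' q); near: q.
- by move=> D p Dp; exists (gid R); split; [exact: gid_at|near=> q; rewrite gid_ext2].
- by move=> F1 F2 p P1 d1 [g1 l1] [g2 l2]; exists (gcomp g2 g1); exact: local2_comp.
by move=> F p PF dp [g l]; have [g' _ l'] := local2_inv PF dp l; exists g'.
Unshelve. all: by end_near. Qed.

Theorem Gequiv0_pseudogroup : pseudogroup (@Gequiv0 R).
Proof.
apply: (pseudogroup_local Gequiv0_localP).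
- move=> F F' p [_ _ n] [g [gp n']]; exists g; split=> //.
  by near=> q; transitivity (fwd F' q); near: q.
- by move=> D p Dp; exists (gid R); split; [exact: gid_at|near=> q; rewrite gid_ext3].
- by move=> F1 F2 p P1 d1 [g1 l1] [g2 l2]; exists (gcomp g2 g1); exact: local3_comp.
by move=> F p PF dp [g l]; have [g' _ l'] := local3_inv PF dp l; exists g'.
Unshelve. all: by end_near. Qed.

End Pseudogroups.

Section CanonicalExtension.
Variable R : realType.
Implicit Type F : ptrans R (2 + 1).

(* For f = (T(t), X(t, x), U(t, x) u), the formula for eta~ is written without
   splitting off U: the derivatives of U u are U and U_x u. *)
Definition lift_map (f : 'rV[R]_(2 + 1) -> 'rV[R]_(2 + 1)) (p : 'rV[R]_(2 + 1 + 1)) : 'rV[R]_(2 + 1 + 1) :=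
  let q := base p in
  pt (f q) ((pd ju (fun w => f w 0 ju) q * fib p + pd jx (fun w => f w 0 ju) q) /
            pd jx (fun w => f w 0 jx) q).

Definition lift_trans (F : ptrans R (2 + 1)) : ptrans R (2 + 1 + 1) :=
  PTrans (@base R (2 + 1) @^-1` dom F) (@base R (2 + 1) @^-1` cod F) (lift_map (fwd F)) (lift_map (bwd F)).

Lemma lift_mapE F q g eta : local2 F q g -> lift_map (fwd F) (pt q eta) = ext3 g (pt q eta).
Proof.
move=> [gq Fg]; rewrite /lift_map /ext3 base_pt fib_pt (nbhs_singleton Fg); congr pt.
have [_ Xa Ua _ [_ X0 _]] := gq.
have nU : \forall w \near q, gU g (base w) * fib w = fwd F w 0 ju.
  near=> w; have Fw : fwd F w = ext2 g w by near: w.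
  by rewrite Fw; exact: esym (ptr _ _).
have nX : \forall w \near q, gX g (base w) = fwd F w 0 jx.
  near=> w; have Fw : fwd F w = ext2 g w by near: w.
  by rewrite Fw; apply: esym; apply: etrans (ptl _ _ _) (point2_x _ _).
have [_ Du] := hasD_near nU (hasD_mul (hasD_base_u Ua) (hasD_fib_u q)).
have [_ Dx] := hasD_near nU (hasD_mul (hasD_base_x Ua) (hasD_fib_x q)).
have [_ DX] := hasD_near nX (hasD_base_x Xa).
have alg (a b c u U Ux Xx : R) : Xx != 0 -> a = 0 * u + U * 1 -> b = Ux * u + U * 0 -> c = Xx ->
  (a * eta + b) / c = U / Xx * eta + Ux / Xx * u.
  by move=> Xx0 -> -> ->; field.
exact: (alg _ _ _ _ _ _ _ X0 Du Dx DX).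
Unshelve. all: by end_near. Qed.

Lemma lift_near F p g : local2 F p g -> \forall q \near p, forall eta, lift_map (fwd F) (pt q eta) = ext3 g (pt q eta).
Proof. by move=> /local2_near; apply: filterS => q lq eta; exact: lift_mapE. Qed.

Lemma pd_time (T : R -> R) (z : 'rV[R]_2) i :
  pd i (fun y : 'rV[R]_2 => T (y 0 it)) z = if i == it then derive1 T (z 0 it) else 0.
Proof.
have [->|->] := I2P i; last first.
  have -> : (ix == it) = false by [].
  rewrite /pd /derive; apply: cvg_lim => //; apply: cvg_near_cst; near=> h => /=.
  by rewrite !mxE /= mulr0 add0r subrr scaler0.
have E : (fun h : R => h^-1 *: (((fun y : 'rV[R]_2 => T (y 0 it)) \o shift z) (h *: delta_mx 0 it) - T (z 0 it))) =
    (fun h : R => h^-1 *: ((T \o shift (z 0 it)) (h *: 1) - T (z 0 it))).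
  by apply/funext => h /=; rewrite !mxE /=.
by rewrite eqxx derive1E /pd /derive E.
Unshelve. all: by end_near. Qed.

Lemma canonical_gauge F (F0 : ptrans R (2 + 1 + 1)) p : canonical_extension F F0 -> dom F p ->
  exists2 g, local2 F p g & \forall q \near p, forall eta, fwd F0 (pt q eta) = ext3 g (pt q eta).
Proof.
move=> [_ ce] Fp; have [T [X [U [Ta Xa Ua n]]]] := ce p Fp.
pose g := Gauge (fun z : 'rV[R]_2 => T (z 0 it)) X U.
exists g; first split.
- split=> //; first by near=> z; rewrite /= pd_time.
  have [h _ _] := nbhs_singleton n; move: h; rewrite !mulf_eq0 !negb_or => /andP[/andP[h1 h2] h3].
  by split=> //; rewrite /= pd_time.
- by apply: filterS n => q [].
apply: filterS n => q [_ e1 e2] eta; rewrite e2 e1 /ext3 base_pt fib_pt.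
by rewrite /ext2 /gH.
Unshelve. all: by end_near. Qed.

Lemma gauge_canonical F (F0 : ptrans R (2 + 1 + 1)) : dom F0 = @base R (2 + 1) @^-1` dom F ->
  (forall p, dom F p -> exists2 g, local2 F p g &
     \forall q \near p, forall eta, fwd F0 (pt q eta) = ext3 g (pt q eta)) -> canonical_extension F F0.
Proof.
move=> dE H; split=> // p Fp; have [g [gp Fg] F0g] := H p Fp.
(* [canonical_extension] asks for a function of one real variable: x is frozen at its value at p,
   which does not change T near p. *)
pose T t := gT g (point2 t (base p 0 ix)).
have [e e0 gc] := gauge_const gp.
have nb : \forall z \near base p, ball (base p) e z by exact: nbhsx_ballx.
have an2 : analytic_map_at (fun y : 'rV[R]_2 => point2 (y 0 it) (base p 0 ix)) (base p).
  by apply: analytic_point2; [exact: analytic_coord|exact: analytic_cst].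
have nb3 : \forall y \near base p, ball (base p) e (point2 ((y : 'rV[R]_2) 0 it) (base p 0 ix)).
  by apply: (@near_pullback _ _ _ (ball (base p) e) _ _ an2); rewrite point2E.
have nT : \forall z \near base p, gT g z = T ((z : 'rV[R]_2) 0 it).
  by near=> z; apply: gc; [near: z|near: z|rewrite point2_t].
have [Ta Xa Ua _ _] := gp.
exists T, (gX g), (gU g); split=> //; first exact: analytic_ext nT Ta.
have ng := base_near (gauge_near gp); have nT' := base_near (near_join nT); have nT0 := base_near nT.
near=> q.
have [_ _ _ _ [T0 X0 U0]] : gauge_at g (base q) by near: q.
have nTq : \forall z \near base q, gT g z = T ((z : 'rV[R]_2) 0 it) by near: q.
have Tq : gT g (base q) = T (base q 0 it) by near: q.
have D := near_eq_derive (delta_mx 0 it) nTq.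
have Fq : fwd F q = ext2 g q by near: q.
split.
- rewrite !mulf_neq0//; have := pd_time T (base q) it; rewrite eqxx => <-.
  by apply/eqP => E; move/eqP: (etrans D E); rewrite (negbTE T0).
- by rewrite Fq /ext2 /gZ Tq.
move=> eta; have -> : forall eta, fwd F0 (pt q eta) = ext3 g (pt q eta) by near: q.
by rewrite /ext3 base_pt fib_pt -Fq.
Unshelve. all: by end_near. Qed.

(** For F in the group, the extension is given by a formula in the derivatives of F itself, free of
    any local choice of T, X and U. Uniqueness and compatibility with the operations follow from
    it. *)
Lemma canonicalP F (F0 : ptrans R (2 + 1 + 1)) : Gequiv F -> canonical_extension F F0 <->
  dom F0 = @base R (2 + 1) @^-1` dom F /\ forall q, dom F0 q -> fwd F0 q = lift_map (fwd F) q.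
Proof.
move=> /Gequiv_localP[PF loc]; split=> [ce|[dE F0E]].
  have [dE _] := ce; split=> // q; rewrite dE => dq.
  have [g lF /nbhs_singleton F0g] := canonical_gauge ce dq.
  by rewrite -[q]pt_base_fib F0g (lift_mapE _ lF).
apply: gauge_canonical => // p dp; have [g lF] := loc p dp; exists g => //.
have nl := local2_near lF; have nd := dom_near PF dp.
near=> q => eta; have lq : local2 F q g by near: q.
rewrite F0E; first exact: lift_mapE.
by rewrite dE /preimage /= base_pt; near: q.
Unshelve. all: by end_near. Qed.

Lemma ext3_analytic (g : gauge R) (p : 'rV[R]_(2 + 1 + 1)) : gauge_at g (base (base p)) ->
  analytic_map_at (ext3 g) p.
Proof.
move=> gp; have [_ Xa Ua _ [_ X0 _]] := gp; apply: analytic_pt.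
  by apply: (@analytic_map_comp _ _ _ _ (ext2 g) (@base R (2 + 1))); [exact: ext2_analytic|exact: analytic_map_base].
have bc (k : 'rV[R]_2 -> R) : analytic_at k (base (base p)) -> analytic_at (fun v : 'rV[R]_(2 + 1 + 1) => k (base (base v))) p.
  move=> ka; apply: (@analytic_comp _ _ _ k (fun v : 'rV[R]_(2 + 1 + 1) => base (base v)) p ka).
  by apply: (@analytic_map_comp _ _ _ _ (@base R 2) (@base R (2 + 1))); exact: analytic_map_base.
have Xi := analytic_inv (analytic_pd ix Xa) X0.
apply: analytic_add.
  by apply: analytic_mul (analytic_fib _); apply: (bc (fun z => gU g z / pd ix (gX g) z)); exact: analytic_mul.
apply: analytic_mul; last first.
  exact: (@analytic_comp _ _ _ (@fib R 2) (@base R (2 + 1)) p (analytic_fib _) (analytic_map_base _)).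
apply: (bc (fun z => pd ix (gU g) z / pd ix (gX g) z)); apply: analytic_mul => //; exact: analytic_pd.
Qed.

Lemma lift_local3 F p g : local2 F (base p) g -> local3 (lift_trans F) p g.
Proof.
move=> lF; split; first exact: lF.1.
have n := base_near (lift_near lF).
near=> q => /=; rewrite -[q]pt_base_fib.
by have -> : forall eta, lift_map (fwd F) (pt (base q) eta) = ext3 g (pt (base q) eta) by near: q.
Unshelve. all: by end_near. Qed.

Lemma base_lift F p : base (lift_map (fwd F) p) = fwd F (base p) :> 'rV[R]_(2 + 1).
Proof. by rewrite base_pt. Qed.

Lemma lift_cancel F : Gequiv F -> forall p, dom F (base p) ->
  lift_map (bwd F) (lift_map (fwd F) p) = p.
Proof.
move=> /Gequiv_localP[PF loc] p dp; have [g lF] := loc _ dp.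
have [g' e lI] := local2_inv PF dp lF.
have E1 : lift_map (fwd F) p = ext3 g p by rewrite -[p]pt_base_fib (lift_mapE _ lF).
have E2 eta := lift_mapE eta lI; rewrite /= in E2.
have [eta e3] : exists eta, lift_map (fwd F) p = pt (fwd F (base p)) eta by eexists.
have -> : lift_map (bwd F) (lift_map (fwd F) p) = ext3 g' (ext3 g p) by rewrite e3 E2 -e3 E1.
have gz' : gauge_at g' (gZ g (base (base p))) by rewrite -(local2_fwd lF); exact: lI.1.
exact: nbhs_singleton (ext3_cancel lF.1 gz' e).
Qed.

Lemma lift_transformation F : Gequiv F -> point_transformation (lift_trans F).
Proof.
move=> GF; have [_ _ _ Ginv _] := Gequiv_pseudogroup R.
have GI := Ginv F GF; have [PF loc] := (Gequiv_localP F).1 GF.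
have [PI locI] := (Gequiv_localP _).1 GI.
have [[od oc] k k' _ _] := PF.
have an (F' : ptrans R (2 + 1)) p g : local2 F' (base p) g -> analytic_map_at (lift_map (fwd F')) p.
  move=> lF; have [_ n] := lift_local3 lF.
  apply: (@analytic_map_near _ _ _ (ext3 g)); last exact: ext3_analytic lF.1.
  by near=> q; apply: esym; near: q.
have ob (D : set 'rV[R]_(2 + 1)) : open D -> open (@base R (2 + 1) @^-1` D).
  move=> Do; have := @open_preimage R _ _ setT D (@base R (2 + 1)) openT Do.
  by rewrite setTI; apply=> p _; exact: analytic_map_base.
split=> /=.
- by split; exact: ob.
- by move=> p dp; split; [rewrite /preimage/= base_lift; have [] := k _ dp|exact: lift_cancel].
- move=> p cp; split; last exact: (lift_cancel GI).
  by rewrite /preimage/= (base_lift (pt_inv F)); have [] := k' _ cp.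
- by move=> p dp; have [g lF] := loc _ dp; exact: an lF.
by move=> p cp; have [g lF] := locI _ cp; exact: (an (pt_inv F) p g lF).
Unshelve. all: by end_near. Qed.

Lemma lift_Gequiv0 F : Gequiv F -> Gequiv0 (lift_trans F).
Proof.
move=> GF; apply/Gequiv0_localP; split; first exact: lift_transformation.
move=> p dp; have [_ loc] := (Gequiv_localP F).1 GF; have [g lF] := loc _ dp.
by exists g; exact: lift_local3.
Qed.

End CanonicalExtension.

(** * The canonical extension as an isomorphism *)

Section Isomorphism.
Variable R : realType.
Implicit Type F : ptrans R (2 + 1).

Lemma lift_comp F1 F2 q : Gequiv F1 -> Gequiv F2 -> dom F1 (base q) -> dom F2 (fwd F1 (base q)) ->
  lift_map (fwd F2) (lift_map (fwd F1) q) = lift_map (fwd F2 \o fwd F1) q.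
Proof.
move=> /Gequiv_localP[PF1 l1] /Gequiv_localP[PF2 l2] d1 d2.
have [g1 lF1] := l1 _ d1; have [g2 lF2] := l2 _ d2.
have lF := local2_comp PF1 d1 lF1 lF2.
have gz : gauge_at g2 (gZ g1 (base (base q))) by rewrite -(local2_fwd lF1); exact: lF2.1.
have E1 : lift_map (fwd F1) q = ext3 g1 q by rewrite -[q]pt_base_fib (lift_mapE _ lF1).
have E2 eta := lift_mapE eta lF2.
have E : lift_map (fwd F2 \o fwd F1) q = ext3 (gcomp g2 g1) q.
  by rewrite -[q]pt_base_fib; exact: (lift_mapE _ lF).
have [eta e3] : exists eta, lift_map (fwd F1) q = pt (fwd F1 (base q)) eta by eexists.
by rewrite E (gcomp_ext3 lF1.1 gz) e3 E2 -e3 E1.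
Qed.

Lemma lift_map_id (q : 'rV[R]_(2 + 1 + 1)) : lift_map (fwd (pt_id setT)) q = q.
Proof.
have lF : local2 (pt_id setT) (base q) (gid R).
  by split; [exact: gid_at|near=> w; rewrite gid_ext2].
by rewrite -[q in lift_map _ q]pt_base_fib (lift_mapE _ lF) pt_base_fib gid_ext3.
Unshelve. all: by end_near. Qed.

Lemma lift_map_near (f f' : 'rV[R]_(2 + 1) -> 'rV[R]_(2 + 1)) (q : 'rV[R]_(2 + 1 + 1)) :
  (\forall w \near base q, f w = f' w) -> \forall p \near q, lift_map f p = lift_map f' p.
Proof.
move=> n; have n1 := base_near (near_join n); have n0 := base_near n.
near=> p; have e : f (base p) = f' (base p) by near: p.
have np : \forall w \near base p, f w = f' w by near: p.
have ec k : \forall w \near base p, f w 0 k = f' w 0 k by apply: filterS np => w ->.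
have ed i k : pd i (fun w => f w 0 k) (base p) = pd i (fun w => f' w 0 k) (base p).
  exact: near_eq_derive (ec k).
by rewrite /lift_map e !ed.
Unshelve. all: by end_near. Qed.

Lemma slice_near n (P : 'rV[R]_n -> Prop) (q : 'rV[R]_(n + 1)) :
  (\forall p \near q, P (base p)) -> \forall w \near base q, P w.
Proof.
move=> nP; have an : analytic_map_at (fun w : 'rV[R]_n => pt w (fib q)) (base q).
  by apply: analytic_pt; [exact: analytic_map_id|exact: analytic_cst].
have := @near_pullback _ _ _ (fun p => P (base p)) _ _ an.
by rewrite pt_base_fib => /(_ nP); apply: filterS => w; rewrite base_pt.
Qed.

(** Every local triple is realized by an element of the group: its domain and codomain are cut out
    of the interiors of the sets on which the gauge and its inverse are valid and cancel each
    other. *)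
Lemma gauge_transformation (g : gauge R) (w : 'rV[R]_(2 + 1)) : gauge_at g (base w) ->
  exists F, [/\ Gequiv F, dom F w & fwd F = ext2 g].
Proof.
move=> gw; have [g' [gz' _ e e']] := gauge_inverse gw.
pose P0 q := gauge_at g (base q) /\ ext2 g' (ext2 g q) = q.
pose P1 q := gauge_at g' (base q) /\ ext2 g (ext2 g' q) = q.
have n0 : \forall q \near w, P0 q.
  have n1 := base_near (gauge_near gw); have n2 := ext2_cancel e.
  by near=> q; split; near: q.
have bE : base (ext2 g w) = gZ g (base w) by rewrite base_pt.
have n1 : \forall q \near ext2 g w, P1 q.
  have n1 : \forall q \near ext2 g w, gauge_at g' (base q) by apply: base_near; rewrite bE; exact: gauge_near.
  have n2 : \forall q \near ext2 g w, ext2 g (ext2 g' q) = q by apply: ext2_cancel; rewrite bE.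
  by near=> q; split; near: q.
pose B0 := [set q | P0 q]^°; pose B1 := [set q | P1 q]^°.
have B0P q : B0 q -> P0 q by exact: interior_subset.
have B1P q : B1 q -> P1 q by exact: interior_subset.
pose F := PTrans (B0 `&` ext2 g @^-1` B1) (B1 `&` ext2 g' @^-1` B0) (ext2 g) (ext2 g').
exists F; split=> //.
apply/Gequiv_localP; split.
  split=> /=.
  - split; apply: open_preimage; try exact: open_interior.
      by move=> p /B0P[gp _]; exact: ext2_analytic.
    by move=> p /B1P[gp _]; exact: ext2_analytic.
  - by move=> p [/[dup] Bp /B0P[_ E] B1p]; rewrite /preimage/= E.
  - by move=> p [/[dup] Bp /B1P[_ E] B0p]; rewrite /preimage/= E.
  - by move=> p [/B0P[gp _] _]; exact: ext2_analytic.
  - by move=> p [/B1P[gp _] _]; exact: ext2_analytic.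
by move=> p [/B0P[gp _] _]; exists g; split=> //; near=> q.
Unshelve. all: by end_near. Qed.

Lemma canonical_dom F (F0 : ptrans R (2 + 1 + 1)) q : canonical_extension F F0 ->
  dom F0 q <-> dom F (base q).
Proof. by move=> [-> _]. Qed.

(** The lift involves first derivatives of F, hence depends on the germ of F and not only on its
    value; conversely, the base component of the lift is F. *)
Lemma canonical_germ F F' (F0 F0' : ptrans R (2 + 1 + 1)) q :
  Gequiv F -> Gequiv F' -> Gequiv0 F0 -> Gequiv0 F0' ->
  canonical_extension F F0 -> canonical_extension F' F0' ->
  germ_eq (base q) F F' <-> germ_eq q F0 F0'.
Proof.
move=> GF GF' [PF0 _] [PF0' _] ce ce'.
have [dE F0E] := (canonicalP F0 GF).1 ce; have [dE' F0E'] := (canonicalP F0' GF').1 ce'.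
split=> -[d d' n].
  have d0 : dom F0 q by rewrite dE.
  have d0' : dom F0' q by rewrite dE'.
  split=> //; have n1 := lift_map_near n; have n2 := dom_near PF0 d0; have n3 := dom_near PF0' d0'.
  near=> p; rewrite F0E; last by near: p.
  by rewrite F0E'; near: p.
have n2 := dom_near PF0 d; have n3 := dom_near PF0' d'.
split; [by rewrite dE in d|by rewrite dE' in d'|].
apply: slice_near; near=> p.
have dp : dom F0 p by near: p.
have dp' : dom F0' p by near: p.
rewrite -base_lift -(base_lift F') -(F0E _ dp) -(F0E' _ dp'); congr base.
by near: p.
Unshelve. all: by end_near. Qed.

(** [canonical_extension] constrains only the domain and the forward map. That cod F0 is the
    cylinder over cod F, and that its backward map is the lift of bwd F, follows because F0 agrees
    with [lift_trans F] on their common domain and both are invertible. *)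
Lemma canonical_inv F (F0 : ptrans R (2 + 1 + 1)) : Gequiv F -> Gequiv0 F0 ->
  canonical_extension F F0 -> canonical_extension (pt_inv F) (pt_inv F0).
Proof.
move=> GF [PF0 _] ce; have [_ _ _ Ginv _] := Gequiv_pseudogroup R.
have [dE F0E] := (canonicalP F0 GF).1 ce.
have [_ k k' _ _] := lift_transformation GF.
have [_ k0 k0' _ _] := PF0.
have cE q : cod F0 q <-> cod F (base q).
  split=> [cq|cq].
    have [d0 e] := k0' q cq; have d1 := d0; rewrite dE in d1.
    by have [c1 _] := k _ d1; rewrite -e (F0E _ d0).
  have [d1 e] := k' q cq; have d0 : dom F0 (lift_map (bwd F) q) by rewrite dE.
  have [c0 _] := k0 _ d0; have e0 : fwd F0 (lift_map (bwd F) q) = q := etrans (F0E _ d0) e.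
  by rewrite e0 in c0.
apply/canonicalP; first exact: Ginv.
split=> /=; first by apply/seteqP; split=> q /cE.
move=> q cq; have [d1 e] := k' q ((cE q).1 cq).
have d0 : dom F0 (lift_map (bwd F) q) by rewrite dE.
have [_ b0] := k0 _ d0; have e0 : fwd F0 (lift_map (bwd F) q) = q := etrans (F0E _ d0) e.
by rewrite e0 in b0.
Qed.

Lemma canonical_comp F1 F2 (F01 F02 : ptrans R (2 + 1 + 1)) : Gequiv F1 -> Gequiv F2 ->
  canonical_extension F1 F01 -> canonical_extension F2 F02 ->
  canonical_extension (pt_comp F2 F1) (pt_comp F02 F01).
Proof.
move=> G1 G2 ce1 ce2; have [_ _ Gcomp _ _] := Gequiv_pseudogroup R.
have [dE1 E1] := (canonicalP F01 G1).1 ce1; have [dE2 E2] := (canonicalP F02 G2).1 ce2.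
apply/canonicalP; first exact: Gcomp.
split=> /=.
  apply/seteqP; split=> q [].
    move=> d1; rewrite /preimage/= (E1 _ d1) dE2 /preimage/= base_lift => d2.
    by split=> //; rewrite dE1 in d1.
  move=> d1 d2; have d01 : dom F01 q by rewrite dE1.
  by split=> //; rewrite /preimage/= (E1 _ d01) dE2 /preimage/= base_lift.
move=> q [d1 d2]; rewrite /preimage/= in d2; rewrite (E2 _ d2) (E1 _ d1) lift_comp//.
  by rewrite dE1 in d1.
by move: d2; rewrite (E1 _ d1) dE2 /preimage/= base_lift.
Qed.

Theorem canonical_isomorphism : isomorphism_by_extension (@Gequiv R) (@Gequiv0 R) (@canonical_extension R).
Proof.
have [_ Gid _ _ _] := Gequiv_pseudogroup R.
split; split.
- move=> F GF; exists (lift_trans F); first exact: lift_Gequiv0.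
  exact/canonicalP.
- move=> F F0 F0' GF _ _ /(canonicalP _ GF)[dE E] /(canonicalP _ GF)[dE' E'].
  split; first by rewrite dE dE'.
  by move=> p d; rewrite E// E'// dE' -dE.
- move=> F F0 GF _ /(canonicalP _ GF)[dE E]; split=> // q d.
  by rewrite E// base_lift.
- by move=> F F' F0 F0' GF GF' G0 G0' ce ce' q; exact: canonical_germ.
(* Surjectivity on germs: the triple of F0 at q also defines an element F of the first group, whose
   lift has the germ of F0. *)
- move=> F0 q /Gequiv0_localP[PF0 loc] d; have [g [gq F0g]] := loc q d.
  have [F [GF dF FE]] := gauge_transformation gq.
  exists F, (lift_trans F); split=> //; [exact: lift_Gequiv0|exact/canonicalP|].
  have lF : local2 F (base q) g by split=> //; near=> w; rewrite FE.
  have [_ n] := lift_local3 lF.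
  by split=> //; near=> p; transitivity (ext3 g p); [near: p|apply: esym; near: p].
- move=> D Do; apply/canonicalP; first exact: Gid.
  by split=> // q _; rewrite lift_map_id.
- by move=> F1 F2 F01 F02 G1 G2 _ _; exact: canonical_comp.
by move=> F F0 GF G0; exact: canonical_inv.
Unshelve. all: by end_near. Qed.

(** Both conditions amount to [gauge_rel] near the given point of the (t, x)-plane, for the triple
    shared by F and F0. *)
Theorem canonical_same_action F (F0 : ptrans R (2 + 1 + 1)) :
  canonical_extension F F0 -> same_induced_action F F0.
Proof.
move=> ce q th th' d ad ad'.
have [g lF n] := canonical_gauge ce ((canonical_dom q ce).1 d).
have l3 : local3 F0 q g.
  split; first exact: lF.1.
  have nb := base_near n; near=> p; rewrite -[p]pt_base_fib.
  by have -> : forall eta, fwd F0 (pt (base p) eta) = ext3 g (pt (base p) eta) by near: p.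
have ad2 : admissible th' (gZ g (base (base q))).
  by rewrite (local3_fwd l3) base_pt in ad'.
exact: iff_trans (L_maps_rel th' lF ad) (iff_sym (DE0_maps_rel l3 ad ad2)).
Unshelve. all: by end_near. Qed.

End Isomorphism.

Theorem corollary11 (R : realType) :
  [/\ pseudogroup (@Gequiv R),
      pseudogroup (@Gequiv0 R),
      isomorphism_by_extension (@Gequiv R) (@Gequiv0 R) (@canonical_extension R)
    & forall (F : ptrans R (2 + 1)) (F0 : ptrans R (2 + 1 + 1)),
        Gequiv F -> Gequiv0 F0 -> canonical_extension F F0 ->
        same_induced_action F F0].
Proof.
split; [exact: Gequiv_pseudogroup|exact: Gequiv0_pseudogroup|exact: canonical_isomorphism|].
by move=> F F0 _ _; exact: canonical_same_action.
Qed.
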